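(* Let $k>0$, $R>0$, $M>0$, $a_{\max}>0$ and a small $\epsilon>0$ be as in the context, let $\mathcal B'=\{(\theta,a):-\pi/2-\epsilon<\theta<\epsilon,\ -a_{\max}-\epsilon<a<a_{\max}+\epsilon\}$, and for $m=(\theta,a)\in\mathcal B'$ let $A_m:H^{-1/2}((-M,M))\to L^2(S_R)$ be the operator $$(A_m\psi)(x)=\int_{-M}^{M}\Phi(x,y(t))\,\psi(t)\,dt,\qquad x\in S_R,$$ where $y(t)=t\tau+a n$, $\tau=(\cos\theta,\sin\theta)$, $n=(-\sin\theta,\cos\theta)$, and $\Phi(x,y)=\frac{i}{4}\mathcal H^1_0(k|x-y|)$. Then: (1) For all $\psi,\phi\in H^{-1/2}((-M,M))$ and all $m,m'\in\mathcal B'$, if $\psi\ne0$ and $A_m\psi=A_{m'}\phi$, then $m=m'$ and $\psi=\phi$. (2) For every $m\in\mathcal B'$, every unit vector $q\in\mathbb R^2$ and all $\psi,\phi\in H^{-1/2}((-M,M))$, if $\partial_qA_m\psi=A_m\phi$, then $\psi=\phi=0$.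
   Context: $\mathcal H^1_0$ is the Hankel function of the first kind of order $0$, so $\Phi$ is the outgoing free-space Green function of the Helmholtz operator $\Delta+k^2$ in $\mathbb R^2$, with constant wavenumber $k>0$. $S_R$ is the circle of radius $R$ centered at the origin. $\partial_qA_m$ is the derivative of $m\mapsto A_m$ at $m=(\theta,a)$ in the direction $q$. Function spaces are complex. $H^{-1/2}((-M,M))$ is the space of densities on the crack segment, i.e. the dual of $H^{1/2}((-M,M))$ (equivalently, elements of $H^{-1/2}(\mathbb R)$ supported in $[-M,M]$); the integral defining $A_m$ is the corresponding duality pairing. The constants $R,M,a_{\max}$ are such that the distance from the line segment $\{t\tau+an:-M\le t\le M\}$ to $S_R$ is bounded below by a positive constant, uniformly in $(\theta,a)$; $\epsilon>0$ is small enough that this holds for all $(\theta,a)\in\mathcal B'$ and that the range of $\theta$ in $\mathcal B'$ has length less than $\pi$. *)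

(* Defs.v *)
From HB Require Import structures.
From mathcomp Require Import all_boot all_order all_algebra.
From mathcomp Require Import all_classical all_reals all_analysis.
From mathcomp Require Import complex.
From mathcomp Require Import measurable_realfun ring lra.
Set Implicit Arguments.
Unset Strict Implicit.
Unset Printing Implicit Defensive.
Import Order.TTheory GRing.Theory Num.Theory.
Import numFieldNormedType.Exports.
Import ComplexField.Normc.

Local Open Scope classical_set_scope.
Local Open Scope ring_scope.

Section special_functions.
Context {R : realType}.
Implicit Type x : R.

Definition euler_gamma : R :=
  limn (fun n => series harmonic n - ln n%:R).

Definition bessel_J0 x : R :=
  limn (series (fun n => (-1) ^+ n * (x / 2) ^+ n.*2 / n`!%:R ^+ 2)).

(* [series harmonic n] is the harmonic number 1 + 1/2 + ... + 1/n. *)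
Definition bessel_Y0 x : R :=
  2 / pi * ((ln (x / 2) + euler_gamma) * bessel_J0 x
    + limn (series (fun n => (-1) ^+ n.+1 * series harmonic n
                             * (x / 2) ^+ n.*2 / n`!%:R ^+ 2))).

Definition hankel1_0 x : R[i] := (bessel_J0 x +i* bessel_Y0 x)%C.

End special_functions.

Section plane.
Context {R : realType}.
Implicit Types (x y m : R * R) (t theta a k r : R).

(* The norm of the normed module R * R is the sup norm, whence this one. *)
Definition enorm2 x : R := Num.sqrt (x.1 ^+ 2 + x.2 ^+ 2).

Definition Phi k x y : R[i] := (0 +i* 4^-1)%C * hankel1_0 (k * enorm2 (x - y)).

Definition tau theta : R * R := (cos theta, sin theta).
Definition nvec theta : R * R := (- sin theta, cos theta).

Definition crack m t : R * R := t *: tau m.1 + m.2 *: nvec m.1.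

Definition circle r : set (R * R) := [set x | enorm2 x = r].

Definition Bprime (amax eps : R) : set (R * R) :=
  [set m | - (pi / 2) - eps < m.1 < eps /\ - amax - eps < m.2 < amax + eps].

End plane.

Section complex_L2.
Context d (T : measurableType d) {R : realType}.
Variables (mu : {measure set T -> \bar R}) (D : set T).
Implicit Types f g : T -> R[i].

Definition cmeasurable f :=
  measurable_fun D (fun x => complex.Re (f x)) /\
  measurable_fun D (fun x => complex.Im (f x)).

Definition L2norm f : \bar R :=
  ((\int[mu]_(x in D) (normc (f x) ^+ 2)%:E) `^ 2^-1)%E.

Definition inL2 f := cmeasurable f /\ (L2norm f < +oo)%E.

Definition eqL2 f g := {ae mu, forall x, D x -> f x = g x}.

End complex_L2.

Section complex_L2_theory.
Context d (T : measurableType d) {R : realType}.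
Variables (mu : {measure set T -> \bar R}) (D : set T).
Hypothesis mD : measurable D.
Implicit Types f g : T -> R[i].

Lemma sqr_normcE (z : R[i]) :
  normc z ^+ 2 = complex.Re z ^+ 2 + complex.Im z ^+ 2.
Proof. by case: z => a b /=; rewrite sqr_sqrtr// addr_ge0 ?sqr_ge0. Qed.

Lemma normc_ge0 (z : R[i]) : 0 <= normc z.
Proof. by case: z => a b; exact: sqrtr_ge0. Qed.

Lemma L2norm_lty f :
  (L2norm mu D f < +oo)%E = (\int[mu]_(x in D) (normc (f x) ^+ 2)%:E < +oo)%E.
Proof.
apply/idP/idP.
- by move=> h; apply: (lty_poweRy _ h); rewrite invr_neq0.
- by move=> h; apply: poweR_lty.
Qed.

Lemma measurable_sqr_normc f : cmeasurable D f ->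
  measurable_fun D (fun x => normc (f x) ^+ 2).
Proof.
move=> [mr mi].
under eq_fun do rewrite sqr_normcE.
by apply: measurable_funD; exact: measurable_funX.
Qed.

Lemma cmeasurable_lin (c : R[i]) f g : cmeasurable D f -> cmeasurable D g ->
  cmeasurable D (fun x => c * f x + g x).
Proof.
move=> [fr fi] [gr gi]; split.
- rewrite (_ : (fun _ => _) = (fun x => complex.Re c * complex.Re (f x)
     - complex.Im c * complex.Im (f x) + complex.Re (g x))).
    apply: measurable_funD => //; apply: measurable_funB;
    by apply: measurable_funM.
  by apply/funext => x; case: c (f x) (g x) => [? ?] [? ?] [? ?].
- rewrite (_ : (fun _ => _) = (fun x => complex.Re c * complex.Im (f x)
     + complex.Im c * complex.Re (f x) + complex.Im (g x))).
    apply: measurable_funD => //; apply: measurable_funD;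
    by apply: measurable_funM.
  apply/funext => x; case: c (f x) (g x) => [? ?] [? ?] [? ?] //=.
Qed.

Lemma inL2_lin (c : R[i]) f g : inL2 mu D f -> inL2 mu D g ->
  inL2 mu D (fun x => c * f x + g x).
Proof.
move=> [mf lf] [mg lg]; split; first exact: cmeasurable_lin.
have mfg := measurable_sqr_normc (cmeasurable_lin c mf mg).
move: lf lg; rewrite !L2norm_lty => lf lg.
pose F x : \bar R := (2 * normc c ^+ 2 * normc (f x) ^+ 2 + 2 * normc (g x) ^+ 2)%:E.
have mf2 := measurable_sqr_normc mf; have mg2 := measurable_sqr_normc mg.
apply: (@le_lt_trans _ _ (\int[mu]_(x in D) F x)%E).
  apply: ge0_le_integral => //.
  - by move=> x _; rewrite lee_fin sqr_ge0.
  - by apply/measurable_EFinP.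
  - by apply/measurable_EFinP/measurable_funD; apply: measurable_funM.
  - move=> x _; rewrite lee_fin.
    have h : normc (c * f x + g x) <= normc c * normc (f x) + normc (g x).
      by rewrite -normcM le_normcD.
    apply: (@le_trans _ _ ((normc c * normc (f x) + normc (g x)) ^+ 2)).
      by rewrite ler_sqr// nnegrE ?addr_ge0 ?mulr_ge0 ?normc_ge0.
    by have := sqr_ge0 (normc c * normc (f x) - normc (g x)); nra.
rewrite /F; under eq_integral do rewrite EFinD.
rewrite ge0_integralD//.
- under eq_integral do rewrite EFinM.
  rewrite ge0_integralZl//; first last.
  + by rewrite lee_fin mulr_ge0// sqr_ge0.
  + by move=> x _; rewrite lee_fin sqr_ge0.
  + by apply/measurable_EFinP.
  under [X in (_ + X)%E]eq_integral do rewrite EFinM.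
  rewrite ge0_integralZl//; first last.
  + by move=> x _; rewrite lee_fin sqr_ge0.
  + by apply/measurable_EFinP.
  apply: lte_add_pinfty; apply: lte_mul_pinfty => //;
  by rewrite lee_fin ?mulr_ge0 ?normc_ge0 ?ler0n.
- by move=> x _; rewrite lee_fin ?mulr_ge0 ?normc_ge0 ?ler0n.
- by apply/measurable_EFinP; apply: measurable_funM.
- by move=> x _; rewrite lee_fin ?mulr_ge0 ?normc_ge0 ?ler0n.
- by apply/measurable_EFinP; apply: measurable_funM.
Qed.

Lemma inL2_0 : inL2 mu D (fun=> 0).
Proof.
split; first by split; exact: measurable_cst.
rewrite L2norm_lty; under eq_integral do rewrite normc0 expr0n.
by rewrite integral0.
Qed.

End complex_L2_theory.

Section Hhalf.
Context {R : realType} (M : R).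

Let leb := @lebesgue_measure R.
Let I : set (measurableTypeR R) := [set t | - M < t < M].

(* The L^2 norm over I * I of this difference quotient is the
   Gagliardo-Slobodeckij seminorm of f; the diagonal is a null set. *)
Definition slobodeckij (f : R -> R[i]) (p : measurableTypeR R * measurableTypeR R)
  : R[i] := (f p.1 - f p.2) / (p.1 - p.2)%:C%C.

(* f stands for its restriction to ]-M, M[: its values elsewhere are ignored. *)
Definition in_Hhalf (f : R -> R[i]) :=
  inL2 leb I f /\ inL2 (leb \x leb)%E (I `*` I) (slobodeckij f).

Definition Hhalf_pred : {pred R -> R[i]} := mem [set f | in_Hhalf f].

Lemma in_Hhalf0 : in_Hhalf (fun=> 0).
Proof.
split; first exact: inL2_0.
rewrite (_ : slobodeckij _ = fun=> 0); first exact: inL2_0.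
by apply/funext => p; rewrite /slobodeckij subr0 mul0r.
Qed.

Lemma measurable_I : measurable I.
Proof.
have -> : I = `]- M, M[%classic.
  by apply/seteqP; split => t; rewrite /I /= in_itv.
exact: measurable_itv.
Qed.

Lemma Hhalf_submod_closed : submod_closed Hhalf_pred.
Proof.
split; first by apply/mem_set; exact: in_Hhalf0.
move=> c f g /set_mem[f1 f2] /set_mem[g1 g2]; apply/mem_set; split.
  exact: (inL2_lin measurable_I c f1 g1).
rewrite (_ : slobodeckij _ = fun p => c * slobodeckij f p + slobodeckij g p).
  apply: inL2_lin => //; apply: measurableX; exact: measurable_I.
apply/funext => p; rewrite /slobodeckij mulrA -mulrDl; congr (_ / _).
rewrite -[LHS]/(c * f p.1 + g p.1 - (c * f p.2 + g p.2)).
by rewrite opprD addrACA mulrBr.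
Qed.

HB.instance Definition _ := GRing.isSubmodClosed.Build _ _ Hhalf_pred
  Hhalf_submod_closed.

Record Hhalf := MkHhalf { Hhalf_val :> R -> R[i]; _ : Hhalf_val \in Hhalf_pred }.

HB.instance Definition _ := [isSub for Hhalf_val].
HB.instance Definition _ := [Choice of Hhalf by <:].
HB.instance Definition _ := [SubChoice_isSubLmodule of Hhalf by <:].

Definition Hhalf_norm (f : Hhalf) : \bar R :=
  ((L2norm leb I f ^+ 2
    + L2norm (leb \x leb)%E (I `*` I) (slobodeckij f) ^+ 2) `^ 2^-1)%E.

Lemma Hhalf_norm_fin_num f : Hhalf_norm f \is a fin_num.
Proof.
case: f => f fP; have [[_ f1] [_ f2]] := set_mem fP.
rewrite ge0_fin_numE ?poweR_ge0//; apply: poweR_lty; rewrite /=.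
by apply: lte_add_pinfty; apply: lte_mul_pinfty;
  rewrite ?ge0_fin_numE ?poweR_ge0.
Qed.

End Hhalf.

Section Hmhalf.
Context {R : realType} (M : R).

Definition Hmhalf_pred : {pred Hhalf M -> R[i]} :=
  mem [set psi : Hhalf M -> R[i] | linear_for *%R psi /\
    exists C : R, forall f, ((normc (psi f))%:E <= C%:E * Hhalf_norm f)%E].

Lemma Hmhalf_submod_closed : submod_closed Hmhalf_pred.
Proof.
split.
  apply/mem_set; split; first by move=> a f g; rewrite /= mulr0 addr0.
  by exists 0 => f; rewrite mul0e lee_fin [leLHS]normc0.
move=> c psi phi /set_mem[lpsi [C1 hC1]] /set_mem[lphi [C2 hC2]].
apply/mem_set; split.
  move=> a f g.
  rewrite -[LHS]/(c * psi (a *: f + g) + phi (a *: f + g)).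
  rewrite -[RHS]/(a * (c * psi f + phi f) + (c * psi g + phi g)).
  by rewrite lpsi lphi !mulrDr addrACA mulrCA.
exists (normc c * C1 + C2) => f.
have h : normc (c * psi f + phi f) <= normc c * normc (psi f) + normc (phi f).
  by rewrite -normcM le_normcD.
move: (hC1 f) (hC2 f); rewrite -(fineK (Hhalf_norm_fin_num f)) -!EFinM !lee_fin.
move=> h1 h2; apply: (le_trans h); rewrite mulrDl -mulrA lerD//.
by rewrite ler_wpM2l ?normc_ge0.
Qed.

HB.instance Definition _ := GRing.isSubmodClosed.Build _ _ Hmhalf_pred
  Hmhalf_submod_closed.

(* The dual space of Hhalf M, with the bilinear duality pairing: a density
   psi in L^2 acts by f |-> \int_(-M)^M f t * psi t dt. *)
Record Hmhalf := MkHmhalf {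
  Hmhalf_val :> Hhalf M -> R[i] ; _ : Hmhalf_val \in Hmhalf_pred }.

HB.instance Definition _ := [isSub for Hmhalf_val].
HB.instance Definition _ := [Choice of Hmhalf by <:].
HB.instance Definition _ := [SubChoice_isSubLmodule of Hmhalf by <:].

Definition Hmhalf_norm (psi : Hmhalf) : \bar R :=
  ereal_sup [set (normc (psi f))%:E | f in [set f | (Hhalf_norm f <= 1)%E]].

End Hmhalf.

Section single_layer.
Context {R : realType}.
Variables (k r M : R).
Implicit Types (m q : R * R) (psi : Hmhalf M).

(* For x on the circle, off the crack, the kernel t |-> Phi k x (crack m t) is
   smooth on [-M, M] and thus lies in Hhalf M; insubd returns 0 if it did not. *)
Definition single_layer m psi : R * R -> R[i] :=
  fun x => psi (insubd 0 (fun t => Phi k x (crack m t))).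

(* L^2(S_r) is defined by pulling functions back along the arclength
   parametrization of the circle. *)
Definition arc (s : R) : R * R := (r * cos (s / r), r * sin (s / r)).

Let leb := @lebesgue_measure R.
Let J : set (measurableTypeR R) := [set s | 0 <= s < 2 * pi * r].

Definition circle_inL2 (g : R * R -> R[i]) := inL2 leb J (g \o arc).
Definition circle_L2norm (g : R * R -> R[i]) := L2norm leb J (g \o arc).
Definition circle_eqL2 (g h : R * R -> R[i]) := eqL2 leb J (g \o arc) (h \o arc).

Definition diff_quotient (A : R * R -> Hmhalf M -> R * R -> R[i]) m q (h : R) psi
    : R * R -> R[i] :=
  fun x => (h^-1)%:C%C * (A (m + h *: q) psi x - A m psi x).

(* B is the limit, in the norm of bounded operators from Hmhalf M to L^2(S_r),
   of the difference quotients of A at m in the direction q.  Each B psi is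
   thereby determined up to equality almost everywhere on the circle, and
   dir_derivative picks a representative. *)
Definition is_dir_derivative (A : R * R -> Hmhalf M -> R * R -> R[i]) m q
    (B : Hmhalf M -> R * R -> R[i]) :=
  (forall psi, circle_inL2 (B psi)) /\
  forall e : R, 0 < e -> \forall h \near 0^', forall psi,
    (circle_L2norm (diff_quotient A m q h psi \- B psi)%R
     <= e%:E * Hmhalf_norm psi)%E.

Definition dir_derivative (A : R * R -> Hmhalf M -> R * R -> R[i]) m q :
    Hmhalf M -> R * R -> R[i] :=
  xget (fun _ _ => 0) [set B | is_dir_derivative A m q B].

End single_layer.

Arguments single_layer {R} k {M} m psi _.

(* Main.v *)
(* Both equations are tested against the modes cos (n s / r), sin (n s / r) on the
   circle.  By Graf's addition formula for J_0 and Y_0, the n-th coefficient of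
   the Green function with source v inside the circle is a constant times the
   regular mode J_n(k |v|) e^(i n arg v); the constants of J_0 and Y_0 do not both
   vanish, because the Wronskian of J_n and Y_n does not.
   Hence the two densities, viewed as functionals on real functions, agree on the
   restrictions of all regular modes to the two cracks, and, summing these modes,
   on the restrictions of e^(s x) e^(i eta y), eta^2 = s^2 + k^2, in any rotated frame.
   - If the cracks are not parallel and their lines meet at the parameters t0, t0',
     a bound on the growth in s of the Laplace transform of a density controls the
     convex hull of its support; passing from one crack to the other multiplies the
     radius of the support around t0, t0' by the cosine of the angle, so iterating
     reduces both supports to a point, which has zero H^(1/2)-capacity.
   - If they are parallel, comparing the cosine and sine waves kills the Laplace
     transforms; if they coincide, the Laplace transforms are equal.
   - For the derivative, the same sums give that the Laplace transform of
     (q1 t + q2) psi vanishes, and then that of phi.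
   Lipschitz functions are dense in H^(1/2), which turns this into psi = phi = 0. *)

From HB Require Import structures.
Require Import Defs.
From mathcomp Require Import all_boot all_order all_algebra.
From mathcomp Require Import all_classical all_reals all_analysis.
From mathcomp Require Import complex measurable_realfun ring lra.
Set Implicit Arguments.
Unset Strict Implicit.
Unset Printing Implicit Defensive.
Import Order.TTheory GRing.Theory Num.Theory.
Import numFieldNormedType.Exports.
Import ComplexField.Normc.
Local Open Scope classical_set_scope.
Local Open Scope ring_scope.

(** A density is split into two functionals on real functions, [Lre] and [Lim]. The kernel i / 4
    times (J_0 + i Y_0) couples them, so each Fourier coefficient gives a 2 by 2 linear system.
    Kernels are functions of the squared distance; Graf's formula is then proved for J_0 and Y_0 at
    once, from total derivatives over the circle and differential equations along rays. No
    holomorphic extension or Paley-Wiener theorem enters: supports are bounded from real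
    exponentials alone, by testing with an approximate hinge that is an entire series in e^(l t).
    Since H^(1/2) contains no step functions, localization is done by composing with Lipschitz
    clamps. The notion [lipfun] suits this: it is stable under reflection and under multiplication
    by Lipschitz functions, and it only asks of a series that its partial sums be uniformly
    Lipschitz and converge pointwise. In the second claim [dir_derivative] is a choice, equal to 0
    by default, so differentiability in operator norm has to be proved before the equation carries
    any information. *)

Local Notation cRe := complex.Re.
Local Notation cIm := complex.Im.

Notation der f x l := (is_derive (x : _) 1 (f : _ -> _) l).

(** * Derivatives and integrals *)

Section derivative_rules.
Context {R : realType}.
Implicit Types (f g : R -> R) (x a b : R).

Lemma der_eq f x a b : der f x a -> a = b -> der f x b.
Proof. by move=> h <-. Qed.

Lemma der_ext f g x a : f =1 g -> der g x a -> der f x a.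
Proof. by move=> /funext ->. Qed.

Lemma der_cst c x : der (fun=> c : R) x 0.
Proof. exact: is_derive_cst. Qed.

Lemma der_id x : der (fun y : R => y) x 1.
Proof. exact: is_derive_id. Qed.

Lemma derD f g x a b : der f x a -> der g x b -> der (fun y => f y + g y) x (a + b).
Proof. by move=> hf hg; exact: is_deriveD. Qed.

Lemma derN f x a : der f x a -> der (fun y => - f y) x (- a).
Proof. by move=> hf; exact: is_deriveN. Qed.

Lemma derM f g x a b : der f x a -> der g x b ->
  der (fun y => f y * g y) x (a * g x + f x * b).
Proof.
move=> hf hg; apply: der_eq (is_deriveM hf hg) _.
by rewrite addrC -[_ *: a]/(g x * a) -[_ *: b]/(f x * b) (mulrC _ a).
Qed.

Lemma derX f n x a : der f x a ->
  der (fun y => f y ^+ n) x (n%:R * f x ^+ n.-1 * a).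
Proof.
move=> hf; apply: der_ext (is_deriveX n hf) => y.
by elim: n => [|n ih]; rewrite ?expr0// !exprS ih.
Qed.

Lemma derV f x a : f x != 0 -> der f x a -> der (fun y => (f y)^-1) x (- (f x) ^- 2 * a).
Proof. by move=> f0 hf; exact: is_deriveV. Qed.

Lemma der_comp f g x a b : der f (g x) a -> der g x b ->
  der (fun y => f (g y)) x (a * b).
Proof. by move=> hf hg; exact: (is_derive1_comp hf hg). Qed.

Lemma der_cos f x a : der f x a -> der (fun y => cos (f y)) x (- sin (f x) * a).
Proof. by move=> hf; apply: (@der_comp cos); exact: is_derive_cos. Qed.

Lemma der_sin f x a : der f x a -> der (fun y => sin (f y)) x (cos (f x) * a).
Proof. by move=> hf; apply: (@der_comp sin); exact: is_derive_sin. Qed.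

Lemma der_expR f x a : der f x a -> der (fun y => expR (f y)) x (expR (f x) * a).
Proof. by move=> hf; apply: (@der_comp expR); exact: is_derive_expR. Qed.

Lemma der_ln f x a : 0 < f x -> der f x a -> der (fun y => ln (f y)) x ((f x)^-1 * a).
Proof. by move=> f0 hf; exact: (@der_comp (@ln R) f x _ _ (is_derive1_ln f0) hf). Qed.

Lemma der_sum (I : Type) (s : seq I) (P : pred I) (F : I -> R -> R) (dF : I -> R) x :
  (forall i, der (F i) x (dF i)) ->
  der (fun y => \sum_(i <- s | P i) F i y) x (\sum_(i <- s | P i) dF i).
Proof.
move=> h; elim: s => [|i s ih].
  rewrite big_nil; apply: der_ext (der_cst 0 x) => y; exact: big_nil.
rewrite big_cons; case: ifP => Pi.
  by apply: der_ext (derD (h i) ih) => y; rewrite big_cons Pi.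
by apply: der_ext ih => y; rewrite big_cons Pi.
Qed.

Lemma der_continuous f x a : der f x a -> {for x, continuous f}.
Proof.
by move=> hf; apply: differentiable_continuous; apply/derivable1_diffP.
Qed.

Lemma der_derivable f x a : der f x a -> derivable f x 1.
Proof. by case. Qed.

Lemma der_val f x a : der f x a -> 'D_1 f x = a.
Proof. by case. Qed.

Lemma der_near f g x a : (\near x, f x = g x) -> der f x a -> der g x a.
Proof. by move=> h hf; exact: near_eq_is_derive h hf. Qed.

Lemma der_unique f x a b : der f x a -> der f x b -> a = b.
Proof. by move=> [_ <-] [_ <-]. Qed.

(** [Num.min] and [Num.max] make the estimate usable without knowing the order of a and b. *)
Lemma mvt_le f (df : R -> R) C a b :
  (forall x, Num.min a b <= x <= Num.max a b -> der f x (df x)) ->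
  (forall x, Num.min a b <= x <= Num.max a b -> `|df x| <= C) ->
  `|f b - f a| <= C * `|b - a|.
Proof.
wlog ab : a b / a <= b.
  move=> H hd hC; have [ab|/ltW ab] := leP a b; first exact: H.
  by rewrite distrC [`|b - a|]distrC; apply: H => //; rewrite minC maxC.
rewrite min_l// max_r// => hd hC.
have [||c cab ->] := @MVT_segment _ f df a b ab.
- by move=> x; rewrite in_itv/= => /andP[/ltW xa /ltW xb]; apply: hd; rewrite xa xb.
- apply: continuous_in_subspaceT => x; rewrite inE/= in_itv/= => xab.
  exact: (der_continuous (hd x xab)).
- by rewrite normrM ler_wpM2r//; apply: hC; move: cab; rewrite in_itv.
Qed.

Lemma der_ge0_le f (df : R -> R) a b : a <= b ->
  (forall x, a <= x <= b -> {for x, continuous f}) ->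
  (forall x, a < x < b -> der f x (df x)) ->
  (forall x, a < x < b -> 0 <= df x) -> f a <= f b.
Proof.
move=> ab hc hd h0; have := ab; rewrite le_eqVlt => /predU1P[->//|ltab].
have hd' x : x \in `]a, b[ -> is_derive x 1 f (df x).
  by rewrite in_itv/=; exact: hd.
have cf : {within `[a, b], continuous f}.
  apply: continuous_in_subspaceT => x; rewrite inE/= in_itv/= => xab.
  exact: hc.
have [c cab e] := MVT ltab hd' cf.
by rewrite -subr_ge0 e mulr_ge0 ?subr_ge0// h0//; move: cab; rewrite in_itv.
Qed.

End derivative_rules.

(** The last cases catch eta-reduced functions such as [cos] or [-%R], which the patterns with an
    explicit argument miss. [der] leaves the value of the derivative as an equation for [ring] or
    [field]. *)
Ltac der1 := match goal with
  | |- is_derive _ _ (fun y => y) _ => eapply der_id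
  | |- is_derive _ _ (fun y => ?c) _ => eapply der_cst
  | |- is_derive _ _ (fun y => @?f y + @?g y) _ => eapply derD
  | |- is_derive _ _ (fun y => - @?f y) _ => eapply derN
  | |- is_derive _ _ (fun y => @?f y * @?g y) _ => eapply derM
  | |- is_derive _ _ (fun y => @?f y ^+ _) _ => eapply derX
  | |- is_derive _ _ (fun y => cos (@?f y)) _ => eapply der_cos
  | |- is_derive _ _ (fun y => sin (@?f y)) _ => eapply der_sin
  | |- is_derive _ _ (fun y => expR (@?f y)) _ => eapply der_expR
  | |- is_derive _ _ (fun y => (@?f y)^-1) _ => eapply derV
  | |- is_derive _ _ (fun y => ln (@?f y)) _ => eapply der_ln
  | |- is_derive _ _ -%R _ => eapply (derN (der_id _))
  | |- is_derive _ _ ( *%R ?c) _ => eapply (derM (der_cst c _) (der_id _))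
  | |- is_derive _ _ ( +%R ?c) _ => eapply (derD (der_cst c _) (der_id _))
  | |- is_derive _ _ (@ln _) _ => eapply is_derive1_ln
  | |- is_derive _ _ cos _ => eapply (der_cos (der_id _))
  | |- is_derive _ _ sin _ => eapply (der_sin (der_id _))
  | |- is_derive _ _ expR _ => eapply (der_expR (der_id _))
  end.
Ltac der_auto := repeat der1.
Ltac der := eapply der_eq; [der_auto|rewrite /=].

Section integrals.
Context {R : realType}.
Implicit Types (f g : R -> R) (x a b : R).
Let mu := @lebesgue_measure R.

Definition rint a b f : R := \int[mu]_(x in `[a, b]) f x.

Lemma cont_integrable a b f : (forall x, {for x, continuous f}) ->
  mu.-integrable `[a, b] (EFin \o f).
Proof.
move=> cf; apply: continuous_compact_integrable; first exact: segment_compact.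
by apply: continuous_subspaceT.
Qed.

Lemma rint_der a b f df : a < b -> (forall x, der f x (df x)) ->
  (forall x, {for x, continuous df}) -> rint a b df = f b - f a.
Proof.
move=> ab hf cdf; rewrite /rint /Rintegral (@continuous_FTC2 _ df f) => //.
- exact: continuous_subspaceT.
- split.
  + by move=> x _; exact: der_derivable (hf x).
  + by apply: cvg_at_right_filter; exact: (der_continuous (hf a)).
  + by apply: cvg_at_left_filter; exact: (der_continuous (hf b)).
- by move=> x _; rewrite derive1E; exact: der_val (hf x).
Qed.

Lemma rintD a b f g : (forall x, {for x, continuous f}) ->
  (forall x, {for x, continuous g}) ->
  rint a b (fun x => f x + g x) = rint a b f + rint a b g.
Proof. by move=> cf cg; apply: RintegralD => //; exact: cont_integrable. Qed.

Lemma rintZ a b c f : (forall x, {for x, continuous f}) ->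
  rint a b (fun x => c * f x) = c * rint a b f.
Proof. by move=> cf; apply: RintegralZl => //; exact: cont_integrable. Qed.

Lemma rint_cst a b c : a <= b -> rint a b (fun=> c) = c * (b - a).
Proof.
move=> ab; rewrite /rint Rintegral_cst//= lebesgue_measure_itv/= lte_fin.
have [ltab//|ba] := ltP a b.
by rewrite (@le_anti _ _ a b) ?ab//= subrr.
Qed.

Lemma eq_rint a b f g : (forall x, a <= x <= b -> f x = g x) ->
  rint a b f = rint a b g.
Proof. by move=> h; apply: eq_Rintegral => x; rewrite inE/= in_itv/=; exact: h. Qed.

Lemma rint_le a b f C : a <= b -> (forall x, {for x, continuous f}) ->
  (forall x, a <= x <= b -> `|f x| <= C) -> `|rint a b f| <= C * (b - a).
Proof.
move=> ab cf h; rewrite -rint_cst//.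
apply: (le_trans (le_normr_Rintegral _ _)) => //; first exact: cont_integrable.
apply: le_Rintegral => //.
- apply: cont_integrable => x; apply: cvg_norm; exact: cf.
- by apply: cont_integrable => x; exact: cvg_cst.
Qed.

Lemma der_rint (K dK : R -> R -> R) a b x0 e C : 0 < e ->
  (forall x, `|x - x0| < e -> forall y, {for y, continuous (K x)}) ->
  (forall x y, `|x - x0| < e -> der (fun x => K x y) x (dK x y)) ->
  (forall x y, `|x - x0| < e -> a <= y <= b -> `|dK x y| <= C) ->
  der (fun x => rint a b (K x)) x0 (rint a b (dK x0)).
Proof.
move=> e0 cK hK hC.
(* The dominating constant has to be nonnegative, whereas [C] may be negative when the interval is
   empty. *)
have C0 : 0 <= Num.max C 0 by rewrite le_max lexx orbT.
have ballE x : `](x0 - e), (x0 + e)[%classic x -> `|x - x0| < e.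
  by rewrite /= in_itv/= -ltr_distl.
have Ix0 : `](x0 - e), (x0 + e)[%classic x0.
  by rewrite /= in_itv/= -ltr_distl subrr normr0.
have p1 x y : `|x - x0| < e -> partial1of2 K x y = dK x y.
  by move=> h; rewrite partial1of2E; exact: der_val (hK x y h).
have intK x : `](x0 - e), (x0 + e)[%classic x -> mu.-integrable `[a, b] (EFin \o K x).
  by move=> /ballE xe; apply: cont_integrable; exact: cK.
have dK1 x y : `](x0 - e), (x0 + e)[%classic x -> `[a, b]%classic y -> derivable (K ^~ y) x 1.
  by move=> /ballE xe _; exact: der_derivable (hK x y xe).
have iC : mu.-integrable `[a, b] (EFin \o (fun=> Num.max C 0)).
  by apply: cont_integrable => x; exact: cvg_cst.
have hb x y : `](x0 - e), (x0 + e)[%classic x -> `[a, b]%classic y ->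
    `|partial1of2 K x y| <= Num.max C 0.
  by move=> /ballE xe; rewrite /= in_itv/= => yab; rewrite p1// le_max hC.
have mab : measurable (`[a, b]%classic : set (measurableTypeR R)) by [].
apply: DeriveDef.
  exact: (derivable_under_integral mab Ix0 intK dK1 (fun=> C0) iC hb).
rewrite -derive1E (differentiation_under_integral mab Ix0 intK dK1 (fun=> C0) iC hb).
by apply: eq_Rintegral => y _; rewrite p1// subrr normr0.
Qed.

Lemma der_rint_bound f a x : a < x -> (forall x, {for x, continuous f}) ->
  der (fun y => rint a y f) x (f x).
Proof.
move=> ax cf.
have lt : x < x + 1 by rewrite ltrDl.
have [d e] := continuous_FTC1_closed lt (cont_integrable a (x + 1) cf) ax (cf x).
by split; [exact: d|rewrite -derive1E; exact: e].
Qed.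

End integrals.

Lemma factE_neq0 (R : realType) n : n`!%:R != 0 :> R.
Proof. by rewrite pnatr_eq0 -lt0n fact_gt0. Qed.

Ltac nz := rewrite -?natrD ?nat1r ?natr1 ?factE_neq0 ?pnatr_eq0.

Ltac nzt := repeat (apply/andP; split); first [assumption | apply: lt0r_neq0; assumption].

(** * Bessel functions *)

Section entire_series.
Context {R : realType}.
Implicit Types (c d : R^nat) (x C : R).

(** Domination by the exponential series is stronger than an infinite radius of convergence, but it
    is kept by termwise differentiation with the same constant and bounds the sum by C e^|x|. *)
Definition coef_le C c := forall j, `|c j| <= C / j`!%:R.
Definition entire c := exists C, coef_le C c.
Definition psum c x : R := limn (pseries c x).

Lemma coef_le_ge0 C c : coef_le C c -> 0 <= C.
Proof. by move=> /(_ 0%N); rewrite fact0 divr1; exact: le_trans. Qed.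

Lemma psum_cvg_norm c x : entire c -> cvgn [normed series (fun i => c i * x ^+ i)].
Proof.
move=> [C hC]; have C0 := coef_le_ge0 hC.
apply: (@series_le_cvg _ _ (fun j => C * exp_coeff `|x| j)).
- by move=> n; exact: normr_ge0.
- by move=> n; rewrite mulr_ge0// exp_coeff_ge0.
- move=> n; rewrite /exp_coeff/= normrM normrX mulrCA [leRHS]mulrC.
  by apply: ler_wpM2r; rewrite ?exprn_ge0//; exact: hC.
- by apply: is_cvg_seriesZ; exact: is_cvg_series_exp_coeff.
Qed.

Lemma psum_cvg c x : entire c -> cvgn (pseries c x).
Proof. by move=> /(@psum_cvg_norm _ x)/normed_cvg. Qed.

Lemma psum_le C c x : coef_le C c -> `|psum c x| <= C * expR `|x|.
Proof.
move=> hC; have C0 := coef_le_ge0 hC; have ec : entire c by exists C.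
rewrite /psum -lim_norm; last exact: psum_cvg.
apply: limr_le; first by apply: is_cvg_norm; exact: psum_cvg.
near=> n; rewrite /= /pseries seriesEord/=.
apply: (le_trans (ler_norm_sum _ _ _)).
apply: (@le_trans _ _ (C * series (exp_coeff `|x|) n)).
  rewrite seriesEord/= mulr_sumr; apply: ler_sum => i _.
  rewrite /exp_coeff/= normrM normrX mulrCA [leRHS]mulrC.
  by apply: ler_wpM2r; rewrite ?exprn_ge0//; exact: hC.
apply: ler_wpM2l => //; rewrite /expR.
apply: nondecreasing_cvgn_le; last exact: is_cvg_series_exp_coeff.
by apply: nondecreasing_series => i _ _; exact: exp_coeff_ge0.
Unshelve. all: by end_near. Qed.

Lemma entire_diffs c : entire c -> entire (pseries_diffs c).
Proof.
move=> [C hC]; exists C => j; rewrite /pseries_diffs normrM normr_nat.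
apply: (le_trans (ler_wpM2l _ (hC j.+1))) => //.
rewrite le_eqVlt; apply/orP; left; apply/eqP; rewrite factS natrM.
by field; nz.
Qed.

Lemma psum_der c x : entire c -> der (psum c) x (psum (pseries_diffs c) x).
Proof.
move=> ec; have ec1 := entire_diffs ec; have ec2 := entire_diffs ec1.
apply: (@pseries_snd_diffs _ c (`|x| + 1)); try exact: psum_cvg.
by rewrite (@ger0_norm _ (_ + _)) ?ltrDl// addr_ge0.
Qed.

Lemma entireD c d : entire c -> entire d -> entire (fun j => c j + d j).
Proof.
move=> [C hC] [D hD]; exists (C + D) => j.
by rewrite mulrDl (le_trans (ler_normD _ _))// lerD.
Qed.

Lemma entireZ a c : entire c -> entire (fun j => a * c j).
Proof.
by move=> [C hC]; exists (`|a| * C) => j; rewrite normrM -mulrA ler_wpM2l.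
Qed.

Lemma psumD c d x : entire c -> entire d ->
  psum (fun j => c j + d j) x = psum c x + psum d x.
Proof.
move=> ec ed; rewrite /psum -limD; [|exact: psum_cvg..].
congr (limn _); apply/funext => n; rewrite /pseries /series/= fctE -big_split/=.
by apply: eq_bigr => i _; rewrite mulrDl.
Qed.

Lemma psumZ a c x : entire c -> psum (fun j => a * c j) x = a * psum c x.
Proof.
move=> ec; apply/cvg_lim => //.
rewrite (_ : pseries _ _ = fun n => a * pseries c x n).
  by apply: cvgMr; exact: psum_cvg.
apply/funext => n; rewrite /pseries /series/= mulr_sumr.
by apply: eq_bigr => i _; rewrite mulrA.
Qed.

Lemma psum_shift c x : entire c ->
  psum c x = c 0%N + x * psum (fun j => c j.+1) x.
Proof.
move=> ec; apply/cvg_lim => //; rewrite -cvg_shiftS.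
rewrite (_ : (fun n => _) = fun n => c 0%N + x * pseries (fun j => c j.+1) x n).
  apply: cvgD; first exact: cvg_cst.
  apply: cvgMr; apply: psum_cvg.
  move: ec => [C hC]; exists C => j; apply: (le_trans (hC _)).
  rewrite ler_wpM2l ?(coef_le_ge0 hC)// lef_pV2 ?posrE ?ltr0n ?fact_gt0//.
  by rewrite ler_nat factS leq_pmull.
apply/funext => n; rewrite /pseries /series/= big_nat_recl// expr0 mulr1.
congr (_ + _); rewrite mulr_sumr.
by apply: eq_bigr => i _; rewrite exprS mulrCA.
Qed.

Lemma psum0 c : entire c -> psum c 0 = c 0%N.
Proof. by move=> ec; rewrite psum_shift// mul0r addr0. Qed.

End entire_series.

Section clifford.
Context {R : realType}.
Implicit Types (x : R) (n : nat).

(* The Bessel-Clifford functions: J_n(z) = (z / 2)^n * clif n (- (z / 2)^2). *)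
Definition clif_coef n : R^nat := fun j => (j`!%:R * (n + j)`!%:R)^-1.
Definition clif n x : R := psum (clif_coef n) x.

Lemma clif_coef_le n : coef_le (n`!%:R^-1) (clif_coef n).
Proof.
move=> j; rewrite /clif_coef ger0_norm ?invr_ge0 ?mulr_ge0// invfM mulrC.
rewrite ler_wpM2r ?invr_ge0// lef_pV2 ?posrE ?ltr0n ?fact_gt0//.
by rewrite ler_nat leq_fact// leq_addr.
Qed.

Lemma clif_entire n : entire (clif_coef n).
Proof. by exists (n`!%:R^-1); exact: clif_coef_le. Qed.

Lemma clif_le n x : `|clif n x| <= expR `|x| / n`!%:R.
Proof. by rewrite mulrC; apply: psum_le; exact: clif_coef_le. Qed.

Lemma clif_der n x : der (clif n) x (clif n.+1 x).
Proof.
apply: (der_eq (psum_der _ (clif_entire n))); congr psum.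
apply/funext => j; rewrite /pseries_diffs /clif_coef addnS addSn factS natrM.
by field; nz.
Qed.

(** The three-term recurrence of the Bessel functions in this normalization. Together with
    [clif_der] it is the differential equation x g'' + (n + 1) g' = g for g = [clif n]. *)
Lemma clif_rec n x : n.+1%:R * clif n.+1 x + x * clif n.+2 x = clif n x.
Proof.
have e2 : entire (fun j => j%:R * clif_coef n.+1 j).
  exists (1 : R) => j; rewrite /clif_coef ger0_norm ?mulr_ge0 ?invr_ge0 ?mulr_ge0//.
  rewrite mul1r invfM mulrCA ler_piMr ?invr_ge0//.
  rewrite ler_pdivrMr ?ltr0n ?fact_gt0// mul1r ler_nat addSn factS.
  by rewrite (leq_trans (leq_addl n j))// (leq_trans (leqnSn _))// leq_pmulr// fact_gt0.
have -> : x * clif n.+2 x = psum (fun j => j%:R * clif_coef n.+1 j) x.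
  rewrite [RHS]psum_shift// mul0r add0r; congr (_ * psum _ _).
  apply/funext => j; rewrite /clif_coef addnS !addSn [j.+1`!]factS natrM.
  by field; nz.
rewrite /clif -psumZ; last exact: clif_entire.
rewrite -psumD//; last by apply: entireZ; exact: clif_entire.
congr psum; apply/funext => j; rewrite -mulrDl -natrD /clif_coef addSn factS natrM.
by field; nz.
Qed.

Lemma clif0 n : clif n 0 = n`!%:R^-1.
Proof. by rewrite /clif psum0 ?/clif_coef ?fact0 ?mul1r ?addn0//; exact: clif_entire. Qed.

(** The part of the series of Y_0 without logarithm, in the variable - (z / 2)^2 and up to sign. *)
Definition harm_coef : R^nat := fun j => series harmonic j / j`!%:R ^+ 2.
Definition harm x := psum harm_coef x.
Definition harm1 x := psum (pseries_diffs harm_coef) x.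
Definition harm2 x := psum (pseries_diffs (pseries_diffs harm_coef)) x.

Lemma fact_gek n : n%:R <= n`!%:R :> R.
Proof. by rewrite ler_nat; case: n => // n; rewrite factS leq_pmulr// fact_gt0. Qed.

Lemma harmonic_ge0 n : 0 <= series (@harmonic R) n.
Proof. by rewrite /series/= sumr_ge0// => i _; rewrite /harmonic/= invr_ge0. Qed.

Lemma harmonic_le n : series (@harmonic R) n <= n%:R.
Proof.
rewrite /series/= -[leRHS](_ : \sum_(0 <= i < n) 1 = _); last first.
  by rewrite sumr_const_nat subn0.
by apply: ler_sum => i _; rewrite /harmonic/= invf_le1 ?ltr0n// ler1n.
Qed.

Lemma harm_entire : entire harm_coef.
Proof.
exists 1 => j; rewrite /harm_coef mul1r expr2 invfM mulrA.
rewrite ger0_norm ?mulr_ge0 ?invr_ge0 ?harmonic_ge0// ler_piMl ?invr_ge0//.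
rewrite ler_pdivrMr ?ltr0n ?fact_gt0// mul1r.
exact: (le_trans (harmonic_le j) (fact_gek j)).
Qed.

Lemma harm_der x : der harm x (harm1 x).
Proof. exact: (psum_der _ harm_entire). Qed.

Lemma harm1_der x : der harm1 x (harm2 x).
Proof. exact: (psum_der _ (entire_diffs harm_entire)). Qed.

(** With D the derivative, the operator x D^2 + D - 1 annihilates [clif 0] and sends (ln x / 2)
    [clif 0] to [clif 1]. As [harm] has the same image, the logarithmic and the regular part of
    [besY0] combine to a solution. *)
Lemma harm_ode x : x * harm2 x + harm1 x - harm x = clif 1 x.
Proof.
have ek := harm_entire; have ek1 := entire_diffs ek; have ek2 := entire_diffs ek1.
have e2 : entire (fun j => j%:R * pseries_diffs harm_coef j).
  exists 1 => j; rewrite /pseries_diffs /harm_coef factS natrM exprMn.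
  have -> : j%:R * (j.+1%:R * (series (@harmonic R) j.+1 / (j.+1%:R ^+ 2 * j`!%:R ^+ 2)))
      = (j%:R / j`!%:R) * (series harmonic j.+1 / j.+1%:R) / j`!%:R.
    by field; nz.
  have h0 := harmonic_ge0 j.+1.
  rewrite ger0_norm ?mulr_ge0 ?invr_ge0//.
  rewrite ler_wpM2r ?invr_ge0// mulr_ile1 ?mulr_ge0 ?invr_ge0//.
    by rewrite ler_pdivrMr ?ltr0n ?fact_gt0// mul1r fact_gek.
  by rewrite ler_pdivrMr ?ltr0n// mul1r harmonic_le.
have -> : x * harm2 x = psum (fun j => j%:R * pseries_diffs harm_coef j) x.
  rewrite [RHS]psum_shift// mul0r add0r; congr (_ * psum _ _).
rewrite /harm1 -psumD// (_ : harm x = - psum (fun j => -1 * harm_coef j) x); last first.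
  by rewrite psumZ// mulN1r opprK.
rewrite opprK -psumD; [|exact: entireD|exact: entireZ].
congr psum; apply/funext => j; rewrite /pseries_diffs /harm_coef /clif_coef.
rewrite seriesSr/= /harmonic/= add1n factS natrM.
by field; nz.
Qed.

End clifford.

Section hankel.
Context {R : realType}.
Variable k : R.
Hypothesis k_gt0 : 0 < k.
Implicit Types (s x : R) (n : nat).

(** The recursion solves the equation of [bessel_tower] for its term of highest index; that each
    function is the derivative of the preceding one is then proved in [bseq_tower]. *)
Fixpoint bseq (F0 F1 : R -> R) n s {struct n} : R :=
  match n with
  | 0 => F0 s
  | m.+1 => match m with
    | 0 => F1 s
    | p.+1 => - (4 * m%:R * bseq F0 F1 m s + k ^+ 2 * bseq F0 F1 p s) / (4 * s)
    end
  end.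

(** The argument is a squared distance. If Z is J or Y and F_0(s) = Z_0(k sqrt s), then the n-th
    derivative is F_n(s) = (- k / 2)^n s^(- n / 2) Z_n(k sqrt s), and the equation is the recurrence
    Z_n + Z_(n+2) = 2 (n + 1) / (k sqrt s) Z_(n+1). *)
Definition bessel_tower (F : nat -> R -> R) := forall n s, 0 < s ->
  der (F n) s (F n.+1 s) /\
  4 * s * F n.+2 s + 4 * n.+1%:R * F n.+1 s + k ^+ 2 * F n s = 0.

Lemma bseqSS F0 F1 n s : bseq F0 F1 n.+2 s =
  - (4 * n.+1%:R * bseq F0 F1 n.+1 s + k ^+ 2 * bseq F0 F1 n s) / (4 * s).
Proof. by []. Qed.

Lemma bseq_tower F0 F1 F2 :
  (forall s, 0 < s -> der F0 s (F1 s)) ->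
  (forall s, 0 < s -> der F1 s (F2 s)) ->
  (forall s, 0 < s -> 4 * s * F2 s + 4 * F1 s + k ^+ 2 * F0 s = 0) ->
  bessel_tower (bseq F0 F1).
Proof.
move=> h0 h1 h2.
have ode n s : 0 < s -> 4 * s * bseq F0 F1 n.+2 s + 4 * n.+1%:R * bseq F0 F1 n.+1 s
    + k ^+ 2 * bseq F0 F1 n s = 0.
  by move=> s0; rewrite bseqSS; field; nzt.
move=> n s s0; split; last exact: ode.
suff: der (bseq F0 F1 n) s (bseq F0 F1 n.+1 s) /\
    der (bseq F0 F1 n.+1) s (bseq F0 F1 n.+2 s) by case.
elim: n => [|n [ih1 ih2]].
  split; first exact: h0.
  apply: (der_eq (h1 s s0)); rewrite /= mulr1.
  apply: (@mulfI _ (4 * s)); first by rewrite mulf_neq0 ?gt_eqF.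
  rewrite [RHS]mulrC divfK ?mulf_neq0 ?gt_eqF//.
  by have := h2 s s0; lra.
split; first exact: ih2.
apply: (@der_ext _ _ (fun s => - (4 * n.+1%:R * bseq F0 F1 n.+1 s
   + k ^+ 2 * bseq F0 F1 n s) * (4 * s)^-1)); first by move=> y; rewrite bseqSS.
eapply der_eq.
  der_auto; [exact: ih2|exact: ih1|by rewrite mulf_neq0 ?gt_eqF].
rewrite (bseqSS F0 F1 n.+1 s) (bseqSS F0 F1 n s).
move: (bseq F0 F1 n.+1 s) (bseq F0 F1 n s) => b1 b0.
by field; nzt.
Qed.

Let q := (k / 2) ^+ 2.
Let X s := - (q * s).
Let q_gt0 : 0 < q. Proof. by rewrite exprn_gt0// divr_gt0. Qed.

Definition besJ0 s := clif 0 (X s).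
Definition besJ1 s := - (q * clif 1 (X s)).
Definition besY0 s := 2 / pi *
  ((ln s / 2 + (ln (k / 2) + euler_gamma)) * clif 0 (X s) - harm (X s)).
Definition besY1 s := 2 / pi * (clif 0 (X s) / (2 * s)
  - q * (ln s / 2 + (ln (k / 2) + euler_gamma)) * clif 1 (X s) + q * harm1 (X s)).
Definition besJ := bseq besJ0 besJ1.
Definition besY := bseq besY0 besY1.

Let dX s : der X s (- q).
Proof. by rewrite /X; der; ring. Qed.

Let dclif n s : der (fun s => clif n (X s)) s (- (q * clif n.+1 (X s))).
Proof. by apply: der_eq (der_comp (clif_der _ _) (dX s)) _; ring. Qed.

Lemma besJ_tower : bessel_tower besJ.
Proof.
refine (@bseq_tower besJ0 besJ1 (fun s => q ^+ 2 * clif 2 (X s)) _ _ _).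
- by move=> s _; exact: dclif.
- move=> s _; rewrite /besJ1; eapply der_eq.
    by der_auto; exact: dclif.
  by rewrite /=; ring.
- move=> s _; rewrite /besJ0 /besJ1 -/(X s); have := clif_rec 0 (X s).
  move: (clif 0 (X s)) (clif 1 (X s)) (clif 2 (X s)) => g0 g1 g2 <-.
  by rewrite /X /q mul1r /=; field.
Qed.

Let dlog s : 0 < s -> der (fun s => ln s / 2 + (ln (k / 2) + euler_gamma)) s (1 / (2 * s)).
Proof.
move=> s0; eapply der_eq.
  by der_auto.
by rewrite /=; field; nzt.
Qed.

Lemma besY_tower : bessel_tower besY.
Proof.
have pi0 : pi != 0 :> R by rewrite gt_eqF// pi_gt0.
refine (@bseq_tower besY0 besY1 (fun s => 2 / pi * (- (q * clif 1 (X s) / s) - clif 0 (X s) / (2 * s ^+ 2)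
   + q ^+ 2 * (ln s / 2 + (ln (k / 2) + euler_gamma)) * clif 2 (X s) - q ^+ 2 * harm2 (X s))) _ _ _).
- move=> s s0; rewrite /besY0; eapply der_eq.
    eapply derM; first exact: der_cst.
    eapply derD.
      by eapply derM; [exact: dlog|exact: dclif].
    by eapply derN; exact: der_comp (harm_der _) (dX s).
  by rewrite /besY1 /=; move: pi pi0 => p p0; field; nzt.
- move=> s s0; rewrite /besY1; eapply der_eq.
    eapply derM; first exact: der_cst.
    eapply derD; [eapply derD|].
    + eapply derM; first exact: dclif.
      eapply derV; first by rewrite mulf_neq0 ?gt_eqF.
      by der_auto.
    + eapply derN; eapply derM; last exact: dclif.
      by eapply derM; [exact: der_cst|exact: dlog].
    + eapply derM; first exact: der_cst.
      exact: der_comp (harm1_der _) (dX s).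
  by rewrite /=; move: pi pi0 => p p0; field; nzt.
- move=> s s0; rewrite /besY0 /besY1 -/(X s).
  have h := harm_ode (X s).
  have -> : harm (X s) = X s * harm2 (X s) + harm1 (X s) - clif 1 (X s).
    by rewrite -h; ring.
  have := clif_rec 0 (X s); set l := ln s / 2 + _.
  move: (harm1 (X s)) (harm2 (X s)) => h1 h2.
  move: (clif 0 (X s)) (clif 1 (X s)) (clif 2 (X s)) => g0 g1 g2 <-.
  rewrite mul1r /= /X /q.
  by rewrite /=; move: pi pi0 => p p0; field; nzt.
Qed.

Lemma wronskian_lim s : 0 < s -> s * (besJ0 s * besY1 s - besJ1 s * besY0 s) = pi^-1.
Proof.
have pi0 : pi != 0 :> R by rewrite gt_eqF// pi_gt0.
(* The left-hand side once its logarithms have cancelled. Unlike that expression, [E] is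
   differentiable at 0 too, so its constant value can be read off there. *)
pose E s := 2 / pi * (clif 0 (X s) ^+ 2 / 2
   + s * q * (harm1 (X s) * clif 0 (X s) - clif 1 (X s) * harm (X s))).
have EE s' : 0 < s' -> s' * (besJ0 s' * besY1 s' - besJ1 s' * besY0 s') = E s'.
  move=> s0; rewrite /besJ0 /besJ1 /besY0 /besY1 /E.
  by rewrite /=; move: pi pi0 => p p0; field; nzt.
pose dE s := 2 / pi * (- (q * clif 0 (X s) * clif 1 (X s))
   + q * (harm1 (X s) * clif 0 (X s) - clif 1 (X s) * harm (X s))
   - s * q * q * (harm2 (X s) * clif 0 (X s) - clif 2 (X s) * harm (X s))).
have dE' s' : der E s' (dE s').
  rewrite /E; eapply der_eq.
    eapply derM; first exact: der_cst.
    eapply derD.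
      by eapply derM; [eapply derX; exact: dclif|exact: der_cst].
    eapply derM; first by der_auto.
    eapply derD; [|eapply derN]; eapply derM.
    - exact: der_comp (harm1_der _) (dX s').
    - exact: dclif.
    - exact: dclif.
    - exact: der_comp (harm_der _) (dX s').
  by rewrite /dE/=; move: pi pi0 => p p0; field; nzt.
have dE0 s' : dE s' = 0.
  rewrite /dE; have h := harm_ode (X s').
  have -> : harm1 (X s') = clif 1 (X s') + harm (X s') - X s' * harm2 (X s').
    by rewrite -h; ring.
  have := clif_rec 0 (X s'); move: (harm (X s')) (harm2 (X s')) => h0 h2.
  move: (clif 0 (X s')) (clif 1 (X s')) (clif 2 (X s')) => g0 g1 g2 <-.
  rewrite mul1r /= /X.
  by move: pi pi0 => p p0; field; nzt.
move=> s0; rewrite EE//.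
have cE s' : {for s', continuous E} by exact: der_continuous (dE' s').
have E0 : E 0 = pi^-1.
  by rewrite /E /X mulr0 oppr0 !mul0r addr0 clif0 fact0 invr1 expr1n; move: pi pi0 => p p0; field; nzt.
have cN x : {for x, continuous (fun x => - E x)} by apply: continuousN; exact: cE.
have dN x : der (fun x => - E x) x (- dE x) by eapply derN; exact: dE'.
have s1 := ltW s0.
have le1 := @der_ge0_le _ E dE 0 s s1 (fun x _ => cE x) (fun x _ => dE' x).
have le2 := @der_ge0_le _ (fun x => - E x) (fun x => - dE x) 0 s s1 (fun x _ => cN x)
   (fun x _ => dN x).
rewrite -E0; apply/eqP; rewrite eq_le -lerN2 le2 ?le1// => x _.
  by rewrite dE0.
by rewrite dE0 oppr0.
Qed.

(** The equation of the tower multiplies the Wronskian of consecutive functions by k^2 / (4 s) from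
    one n to the next, so it vanishes for no n. *)
Lemma bessel_tower_neq0 n s : 0 < s -> (besJ n s != 0) || (besY n s != 0).
Proof.
move=> s0; suff: besJ n s * besY n.+1 s - besJ n.+1 s * besY n s != 0.
  by apply: contra_neqT; rewrite negb_or !negbK => /andP[/eqP -> /eqP ->]; ring.
elim: n => [|n ih].
  have := wronskian_lim s0; rewrite /besJ /besY/=; set w := _ - _ => e.
  apply/eqP => w0; move: e; rewrite w0 mulr0 => /esym/eqP.
  by rewrite invr_eq0 gt_eqF// pi_gt0.
have [_ hJ] := besJ_tower n s0; have [_ hY] := besY_tower n s0.
have -> : besJ n.+1 s * besY n.+2 s - besJ n.+2 s * besY n.+1 s =
    k ^+ 2 / (4 * s) * (besJ n s * besY n.+1 s - besJ n.+1 s * besY n s).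
  apply: (@mulfI _ (4 * s)); first by rewrite mulf_neq0 ?gt_eqF.
  rewrite [RHS]mulrA [4 * s * (_ / _)]mulrC divfK ?mulf_neq0 ?gt_eqF//.
  have -> : 4 * s * (besJ n.+1 s * besY n.+2 s - besJ n.+2 s * besY n.+1 s) =
     besJ n.+1 s * (4 * s * besY n.+2 s) - (4 * s * besJ n.+2 s) * besY n.+1 s by ring.
  have -> : 4 * s * besY n.+2 s = - (4 * n.+1%:R * besY n.+1 s) - k ^+ 2 * besY n s.
    by rewrite -[LHS]subr0 -hY; ring.
  have -> : 4 * s * besJ n.+2 s = - (4 * n.+1%:R * besJ n.+1 s) - k ^+ 2 * besJ n s.
    by rewrite -[LHS]subr0 -hJ; ring.
  ring.
by rewrite mulf_neq0// mulf_neq0// ?invr_eq0 ?expf_neq0 ?mulf_neq0// gt_eqF.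
Qed.

Lemma hankelE s : 0 < s ->
  hankel1_0 (k * Num.sqrt s) = (besJ 0 s +i* besY 0 s)%C.
Proof.
move=> s0; rewrite /hankel1_0 /bessel_Y0 /besJ /besY/= /besJ0 /besY0.
have pw n : (k * Num.sqrt s / 2) ^+ n.*2 = q ^+ n * s ^+ n.
  rewrite -muln2 mulnC exprM -exprMn; congr (_ ^+ _).
  by rewrite mulrAC exprMn sqr_sqrtr ?ltW.
have -> : bessel_J0 (k * Num.sqrt s) = clif 0 (X s).
  rewrite /bessel_J0 /clif /psum /pseries; congr (limn (series _)); apply/funext => n.
  by rewrite pw /clif_coef/= add0n -expr2 /X [in RHS]exprNn [(q * s) ^+ n]exprMn; ring.
congr (_ +i* _)%C; congr (_ * (_ * _ + _)).
  have -> : ln (k * Num.sqrt s / 2) = ln (k / 2) + ln (Num.sqrt s).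
    by rewrite mulrAC; apply: lnM; rewrite posrE ?divr_gt0 ?sqrtr_gt0.
  have : ln (Num.sqrt s ^+ 2) = ln s by rewrite sqr_sqrtr ?ltW.
  rewrite lnXn ?sqrtr_gt0// => <-; rewrite mulr2n mulrDl -splitr addrA.
  by congr (_ + _); rewrite addrC.
rewrite /harm /psum -[RHS]mulN1r -[RHS](psumZ _ _ harm_entire) /psum /pseries.
congr (limn (series _)); apply/funext => n.
rewrite /= pw /harm_coef /X [in RHS]exprNn [(q * s) ^+ n]exprMn exprS. by ring.
Qed.

End hankel.

(** * Continuity at a point and integrals depending on a parameter *)

Definition cnt {R : realType} {T : topologicalType} (f : T -> R) (p : T) :=
  f x @[x --> p] --> f p.

Section joint_continuity.
Context {R : realType} {T : topologicalType}.
Implicit Types (f g : T -> R) (p : T).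

Lemma cnt_cst (c : R) p : cnt (fun=> c) p. Proof. exact: cvg_cst. Qed.
Lemma cntD f g p : cnt f p -> cnt g p -> cnt (fun x => f x + g x) p.
Proof. exact: cvgD. Qed.
Lemma cntN f p : cnt f p -> cnt (fun x => - f x) p.
Proof. exact: cvgN. Qed.
Lemma cntM f g p : cnt f p -> cnt g p -> cnt (fun x => f x * g x) p.
Proof. exact: cvgM. Qed.
Lemma cnt_comp (h : R -> R) f p : cnt h (f p) -> cnt f p -> cnt (fun x => h (f x)) p.
Proof. by move=> ch cf; exact: (cvg_comp f h cf ch). Qed.
Lemma cntX f n p : cnt f p -> cnt (fun x => f x ^+ n) p.
Proof.
move=> cf; elim: n => [|n ih]; first exact: cvg_cst.
by rewrite /cnt; under eq_fun do rewrite exprS; rewrite exprS; exact: cntM.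
Qed.
Lemma cnt_cos f p : cnt f p -> cnt (fun x => cos (f x)) p.
Proof. by apply: cnt_comp; exact: continuous_cos. Qed.
Lemma cnt_sin f p : cnt f p -> cnt (fun x => sin (f x)) p.
Proof. by apply: cnt_comp; exact: continuous_sin. Qed.
Lemma cnt_expR f p : cnt f p -> cnt (fun x => expR (f x)) p.
Proof. by apply: cnt_comp; exact: continuous_expR. Qed.

End joint_continuity.

Section joint_continuity_R.
Context {R : realType}.
Lemma cnt_id (x : R) : cnt (fun y : R => y) x. Proof. exact: cvg_id. Qed.
Lemma cnt_fst (p : R * R) : cnt (fun q => q.1) p. Proof. exact: cvg_fst. Qed.
Lemma cnt_snd (p : R * R) : cnt (fun q => q.2) p. Proof. exact: cvg_snd. Qed.
Lemma cnt_der (f : R -> R) (x a : R) : der f x a -> cnt f x.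
Proof. exact: der_continuous. Qed.
Lemma cnt_pairl (f : R -> R -> R) (x y : R) : cnt (fun p : R * R => f p.1 p.2) (x, y) ->
  cnt (f x) y.
Proof.
move=> h; have h2 : (x, z) @[z --> y] --> (x, y).
  exact: (@cvg_pair R R R (nbhs y) (nbhs x) (nbhs y) _ _ _ (fun=> x) id (cvg_cst x) cvg_id).
exact: (cvg_comp (fun z => (x, z)) (fun p : R * R => f p.1 p.2) h2 h).
Qed.
End joint_continuity_R.

Ltac cnt1 := match goal with
  | |- @cnt ?R ?T (fun y => y) _ => eapply cnt_id
  | |- cnt id _ => eapply cnt_id
  | |- @cnt ?R ?T (fun y => y.1) _ => eapply cnt_fst
  | |- @cnt ?R ?T (fun y => y.2) _ => eapply cnt_snd
  | |- cnt fst _ => eapply cnt_fst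
  | |- cnt snd _ => eapply cnt_snd
  | |- @cnt ?R ?T (fun y => ?c) ?p => exact (@cnt_cst R T c p)
  | |- @cnt ?R ?T (fun y => @?f y + @?g y) ?p => refine (@cntD R T f g p _ _)
  | |- @cnt ?R ?T (fun y => - @?f y) ?p => refine (@cntN R T f p _)
  | |- @cnt ?R ?T (fun y => @?f y * @?g y) ?p => refine (@cntM R T f g p _ _)
  | |- @cnt ?R ?T (fun y => @?f y ^+ ?n) ?p => refine (@cntX R T f n p _)
  | |- @cnt ?R ?T (fun y => cos (@?f y)) ?p => refine (@cnt_cos R T f p _)
  | |- @cnt ?R ?T (fun y => sin (@?f y)) ?p => refine (@cnt_sin R T f p _)
  | |- @cnt ?R ?T (fun y => expR (@?f y)) ?p => refine (@cnt_expR R T f p _)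
  | |- cnt -%R _ => eapply (cntN (cnt_id _))
  | |- cnt ( *%R ?c) _ => eapply (cntM (cnt_cst c _) (cnt_id _))
  | |- cnt ( +%R ?c) _ => eapply (cntD (cnt_cst c _) (cnt_id _))
  | |- cnt cos _ => eapply (cnt_cos (cnt_id _))
  | |- cnt sin _ => eapply (cnt_sin (cnt_id _))
  | |- cnt expR _ => eapply (cnt_expR (cnt_id _))
  end.
Ltac cnt_auto := repeat (cnt1; cbv beta).

Section integral_parameter.
Context {R : realType}.
Implicit Types (a b e x y C : R).

Lemma compact_bound (f : R -> R) a b : (forall x, a <= x <= b -> cnt f x) ->
  exists C, forall x, a <= x <= b -> `|f x| <= C.
Proof.
move=> cf; have [ab|ba] := leP a b; last first.
  by exists 0 => x /andP[ax xb]; move: (le_lt_trans (le_trans ax xb) ba); rewrite ltxx.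
have cf' : {within `[a, b], continuous (fun x => `|f x|)}.
  apply: continuous_in_subspaceT => x; rewrite inE/= in_itv/= => xab.
  by apply: cvg_norm; exact: cf.
have [c _ h] := EVT_max ab cf'.
by exists `|f c| => x xab; apply: h; rewrite in_itv.
Qed.

Lemma compact2_bound (K : R -> R -> R) a b c d :
  (forall x y, a <= x <= b -> c <= y <= d -> cnt (fun p => K p.1 p.2) (x, y)) ->
  exists C, forall x y, a <= x <= b -> c <= y <= d -> `|K x y| <= C.
Proof.
move=> cK.
pose A : set (R * R) := `[a, b]%classic `*` `[c, d]%classic.
have cA : compact A by apply: compact_setX; exact: segment_compact.
have cKA : compact ((fun p => K p.1 p.2) @` A).
  apply: continuous_compact => //; apply: continuous_in_subspaceT => -[x y].
  rewrite inE => -[/=]; rewrite !in_itv/= => xab ycd; exact: cK.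
have [C [_ hC]] := compact_bounded cKA.
exists (C + 1) => x y xab ycd; apply: (hC (C + 1)); first by rewrite ltrDl.
by exists (x, y) => //; split; rewrite /= in_itv.
Qed.

(** Joint continuity of [dK] on a compact rectangle supplies the dominating constant of
    [der_rint]. *)
Lemma der_rint_joint (K dK : R -> R -> R) a b x0 e : 0 < e ->
  (forall x y, `|x - x0| <= e -> cnt (fun p => K p.1 p.2) (x, y)) ->
  (forall x y, `|x - x0| <= e -> cnt (fun p => dK p.1 p.2) (x, y)) ->
  (forall x y, `|x - x0| <= e -> der (fun x => K x y) x (dK x y)) ->
  der (fun x => rint a b (K x)) x0 (rint a b (dK x0)).
Proof.
move=> e0 cK cdK hK.
have [|C hC] := @compact2_bound dK (x0 - e) (x0 + e) a b.
  by move=> x y xe yab; apply: cdK; rewrite ler_distl.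
refine (@der_rint R K dK a b x0 e C e0 _ _ _).
- by move=> x xe y; exact: (cnt_pairl (cK x y (ltW xe))).
- by move=> x y xe; exact: (hK x y (ltW xe)).
- by move=> x y xe yab; apply: hC => //; rewrite -ler_distl ltW.
Qed.

(** Applied with b a period: an identity between integrals over the circle reduces to exhibiting a
    periodic antiderivative of the combined integrand. *)
Lemma rint_total (f df : R -> R) b : 0 < b -> (forall x, der f x (df x)) ->
  (forall x, cnt df x) -> f b = f 0 -> rint 0 b df = 0.
Proof. by move=> b0 hf cdf e; rewrite (rint_der b0 hf cdf) e subrr. Qed.

Lemma cst_of_der0 (f : R -> R) a b : a <= b ->
  (forall x, a <= x <= b -> der f x 0) -> f b = f a.
Proof.
move=> ab h; apply/eqP; rewrite -subr_eq0 -normr_le0.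
rewrite -(mul0r `|b - a|); apply: (@mvt_le _ f (fun=> 0)).
  by move=> x; rewrite min_l// max_r//; exact: h.
by move=> x _; rewrite normr0.
Qed.

End integral_parameter.

(** * Fourier coefficients of the Green function on the circle *)

Section modes.
Context {R : realType}.
Variables (k r : R).
Hypotheses (k_gt0 : 0 < k) (r_gt0 : 0 < r).
Variable F : nat -> R -> R.
Hypothesis hF : bessel_tower k F.
Implicit Types (b x s v : R) (n : nat).

Let T := 2 * pi * r.
Let T_gt0 : 0 < T. Proof. by rewrite !mulr_gt0// pi_gt0. Qed.

(** With w the unit vector of angle s / r, [cw] is v . w, [cw'] is its derivative in the angle, and
    [dist2] is |b w - v|^2. *)
Definition cw v1 v2 s := v1 * cos (s / r) + v2 * sin (s / r).
Definition cw' v1 v2 s := v2 * cos (s / r) - v1 * sin (s / r).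
Definition dist2 b v1 v2 s := b ^+ 2 + (v1 ^+ 2 + v2 ^+ 2) - 2 * b * cw v1 v2 s.
(** The observation radius [b] is kept apart from [r], which only fixes the parametrization of
    angles, because the induction on n differentiates in [b]. *)
Definition emode (tr : R -> R) n b v1 v2 :=
  rint 0 T (fun s => F 0 (dist2 b v1 v2 s) * tr (n%:R * (s / r))).

Lemma cos2Dsin2' x : sin x ^+ 2 = 1 - cos x ^+ 2.
Proof. by rewrite sin2cos2. Qed.

Lemma dist2_gt0 b v1 v2 s : v1 ^+ 2 + v2 ^+ 2 < b ^+ 2 -> 0 < dist2 b v1 v2 s.
Proof.
move=> vb; have e := cos2Dsin2' (s / r).
have -> : dist2 b v1 v2 s = (b * cos (s / r) - v1) ^+ 2 + (b * sin (s / r) - v2) ^+ 2.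
  by rewrite /dist2 /cw; ring: e.
rewrite lt_neqAle addr_ge0 ?sqr_ge0// andbT eq_sym paddr_eq0 ?sqr_ge0// !sqrf_eq0 !subr_eq0.
apply/negP => /andP[/eqP e1 /eqP e2]; move: vb; rewrite -e1 -e2.
by rewrite (_ : _ + _ = b ^+ 2) ?ltxx//; ring: e.
Qed.

Lemma cos_period n : cos (n%:R * (T / r)) = 1 /\ sin (n%:R * (T / r)) = 0.
Proof.
have -> : T / r = pi *+ 2 by rewrite /T mulfK ?gt_eqF// mulr_natl.
elim: n => [|n [ihc ihs]]; first by rewrite mul0r cos0 sin0.
by rewrite -natr1 mulrDl mul1r (cosD (n%:R * _)) (sinD (n%:R * _)) ihc ihs cos2pi sin2pi; split; ring.
Qed.

Lemma dist2_period b v1 v2 : dist2 b v1 v2 T = dist2 b v1 v2 0.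
Proof.
have [ec es] := cos_period 1; rewrite mul1r in ec es.
by rewrite /dist2 /cw ec es mul0r cos0 sin0.
Qed.

Lemma tower_cnt n s : 0 < s -> cnt (F n) s.
Proof. by move=> s0; apply: cnt_der; exact: (hF n s0).1. Qed.

Lemma tower_der n (f : R -> R) (x a : R) : 0 < f x -> der f x a ->
  der (fun y => F n (f y)) x (F n.+1 (f x) * a).
Proof. by move=> f0 df; apply: der_comp df; exact: (hF n f0).1. Qed.

Lemma cw_der v1 v2 s : der (cw v1 v2) s (cw' v1 v2 s / r).
Proof. by rewrite /cw /cw'; der; ring. Qed.

Lemma dist2_ders b v1 v2 s : der (dist2 b v1 v2) s (- 2 * b * cw' v1 v2 s / r).
Proof.
rewrite /dist2; eapply der_eq.
  der_auto; exact: cw_der.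
by rewrite /=; ring.
Qed.

Lemma dist2_scale b x v1 v2 s :
  dist2 b (x * v1) (x * v2) s = b ^+ 2 + x ^+ 2 * (v1 ^+ 2 + v2 ^+ 2) - 2 * b * x * cw v1 v2 s.
Proof. by rewrite /dist2 /cw; ring. Qed.

Lemma emode_derb (tr : R -> R) n b v1 v2 : (forall s, cnt tr s) -> 0 < b ->
  v1 ^+ 2 + v2 ^+ 2 < b ^+ 2 ->
  der (fun b => emode tr n b v1 v2) b
    (rint 0 T (fun s => F 1 (dist2 b v1 v2 s) * (2 * b - 2 * cw v1 v2 s)
       * tr (n%:R * (s / r)))).
Proof.
move=> ctr b0 vb.
have : \forall y \near b, v1 ^+ 2 + v2 ^+ 2 < y ^+ 2.
  have cX : cnt (fun y : R => y ^+ 2) b by cnt_auto.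
  by have /cvgr_gt := cX; apply.
move=> /nbhs_ballP[e /= e0 he].
pose e1 := e / 2; have e10 : 0 < e1 by rewrite divr_gt0.
have pos x s : `|x - b| <= e1 -> 0 < dist2 x v1 v2 s.
  move=> xe; apply: dist2_gt0; apply: he; rewrite /ball/= distrC.
  by apply: (le_lt_trans xe); rewrite ltr_pdivrMr// ltr_pMr// ltr1n.
rewrite /emode.
apply: (@der_rint_joint R (fun b s => F 0 (dist2 b v1 v2 s) * tr (n%:R * (s / r)))
  (fun b s => F 1 (dist2 b v1 v2 s) * (2 * b - 2 * cw v1 v2 s) * tr (n%:R * (s / r)))
  0 T b e1 e10).
- move=> x y xe; eapply cntM; last by eapply (cnt_comp (ctr _)); cnt_auto.
  eapply (@cnt_comp _ _ (F 0)); first by apply: tower_cnt; exact: pos.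
  by rewrite /dist2 /cw; cnt_auto.
- move=> x y xe; eapply cntM; last by eapply (cnt_comp (ctr _)); cnt_auto.
  eapply cntM; last by rewrite /cw; cnt_auto.
  eapply (@cnt_comp _ _ (F 1)); first by apply: tower_cnt; exact: pos.
  by rewrite /dist2 /cw; cnt_auto.
- move=> x y xe; eapply der_eq.
    eapply derM; last exact: der_cst.
    eapply tower_der; first exact: pos.
    rewrite /dist2; der_auto.
  by rewrite /=; ring.
Qed.

Lemma ray_near b x v1 v2 : x ^+ 2 * (v1 ^+ 2 + v2 ^+ 2) < b ^+ 2 ->
  exists2 e, 0 < e & forall y s, `|y - x| <= e -> 0 < dist2 b (y * v1) (y * v2) s.
Proof.
move=> vb; have : \forall y \near x, y ^+ 2 * (v1 ^+ 2 + v2 ^+ 2) < b ^+ 2.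
  have cX : cnt (fun y : R => y ^+ 2 * (v1 ^+ 2 + v2 ^+ 2)) x by cnt_auto.
  by have /cvgr_lt := cX; apply.
move=> /nbhs_ballP[e /= e0 he].
exists (e / 2); first by rewrite divr_gt0.
move=> y s ye; apply: dist2_gt0.
rewrite !exprMn -mulrDr; apply: he; rewrite /ball/= distrC.
by apply: (le_lt_trans ye); rewrite ltr_pdivrMr// ltr_pMr// ltr1n.
Qed.

Lemma emode_derx (tr : R -> R) n b x v1 v2 : (forall s, cnt tr s) ->
  x ^+ 2 * (v1 ^+ 2 + v2 ^+ 2) < b ^+ 2 ->
  der (fun x => emode tr n b (x * v1) (x * v2)) x
    (rint 0 T (fun s => F 1 (dist2 b (x * v1) (x * v2) s)
       * (2 * x * (v1 ^+ 2 + v2 ^+ 2) - 2 * b * cw v1 v2 s) * tr (n%:R * (s / r)))).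
Proof.
move=> ctr /ray_near[e e0 pos].
rewrite /emode.
apply: (@der_rint_joint R (fun x s => F 0 (dist2 b (x * v1) (x * v2) s) * tr (n%:R * (s / r)))
  (fun x s => F 1 (dist2 b (x * v1) (x * v2) s)
       * (2 * x * (v1 ^+ 2 + v2 ^+ 2) - 2 * b * cw v1 v2 s) * tr (n%:R * (s / r)))
  0 T x e e0).
- move=> z y xe; eapply cntM; last by eapply (cnt_comp (ctr _)); cnt_auto.
  eapply (@cnt_comp _ _ (F 0)); first by apply: tower_cnt; exact: pos.
  by rewrite /dist2 /cw; cnt_auto.
- move=> z y xe; eapply cntM; last by eapply (cnt_comp (ctr _)); cnt_auto.
  eapply cntM; last by rewrite /cw; cnt_auto.
  eapply (@cnt_comp _ _ (F 1)); first by apply: tower_cnt; exact: pos.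
  by rewrite /dist2 /cw; cnt_auto.
- move=> z y xe; eapply der_eq.
    eapply derM; last exact: der_cst.
    eapply tower_der; first exact: pos.
    rewrite /dist2 /cw; der_auto.
  by rewrite /= /cw; ring.
Qed.

Lemma emode_derx2 b x v1 v2 :
  x ^+ 2 * (v1 ^+ 2 + v2 ^+ 2) < b ^+ 2 ->
  der (fun x => rint 0 T (fun s => F 1 (dist2 b (x * v1) (x * v2) s)
       * (2 * x * (v1 ^+ 2 + v2 ^+ 2) - 2 * b * cw v1 v2 s))) x
    (rint 0 T (fun s => F 2 (dist2 b (x * v1) (x * v2) s)
       * (2 * x * (v1 ^+ 2 + v2 ^+ 2) - 2 * b * cw v1 v2 s) ^+ 2
       + F 1 (dist2 b (x * v1) (x * v2) s) * (2 * (v1 ^+ 2 + v2 ^+ 2)))).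
Proof.
move=> /ray_near[e e0 pos].
apply: (@der_rint_joint R (fun x s => F 1 (dist2 b (x * v1) (x * v2) s)
       * (2 * x * (v1 ^+ 2 + v2 ^+ 2) - 2 * b * cw v1 v2 s))
  (fun x s => F 2 (dist2 b (x * v1) (x * v2) s)
       * (2 * x * (v1 ^+ 2 + v2 ^+ 2) - 2 * b * cw v1 v2 s) ^+ 2
       + F 1 (dist2 b (x * v1) (x * v2) s) * (2 * (v1 ^+ 2 + v2 ^+ 2)))
  0 T x e e0).
- move=> z y xe; eapply cntM; last by rewrite /cw; cnt_auto.
  eapply (@cnt_comp _ _ (F 1)); first by apply: tower_cnt; exact: pos.
  by rewrite /dist2 /cw; cnt_auto.
- move=> z y xe; eapply cntD.
    eapply cntM; last by rewrite /cw; cnt_auto.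
    eapply (@cnt_comp _ _ (F 2)); first by apply: tower_cnt; exact: pos.
    by rewrite /dist2 /cw; cnt_auto.
  eapply cntM; last by cnt_auto.
  eapply (@cnt_comp _ _ (F 1)); first by apply: tower_cnt; exact: pos.
  by rewrite /dist2 /cw; cnt_auto.
- move=> z y xe; eapply der_eq.
    eapply derM; last by rewrite /cw; der_auto.
    eapply tower_der; first exact: pos.
    rewrite /dist2 /cw; der_auto.
  by rewrite /= /cw; ring.
Qed.

Lemma cnt_dist2 n b v1 v2 s : v1 ^+ 2 + v2 ^+ 2 < b ^+ 2 ->
  cnt (fun s => F n (dist2 b v1 v2 s)) s.
Proof.
move=> vb; eapply (@cnt_comp _ _ (F n)); first by apply: tower_cnt; exact: dist2_gt0.
by rewrite /dist2 /cw; cnt_auto.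
Qed.

(** Merges a linear combination of integrals into a single one; for a literal list the hypothesis
    computes to a conjunction of continuity statements. *)
Lemma rint_comb (c : seq (R * (R -> R))) :
  foldr (fun p P => (forall x, cnt p.2 x) /\ P) True c ->
  \sum_(p <- c) p.1 * rint 0 T p.2 = rint 0 T (fun s => \sum_(p <- c) p.1 * p.2 s)
  /\ (forall x, cnt (fun s => \sum_(p <- c) p.1 * p.2 s) x).
Proof.
elim: c => [|p c ih] /=.
  move=> _; rewrite big_nil; split.
    by under eq_rint do rewrite big_nil; rewrite rint_cst ?mul0r// ltW.
  by move=> x; rewrite /cnt; under eq_fun do rewrite big_nil; rewrite big_nil; exact: cvg_cst.
move=> [cp /ih [e cc]]; have cp' x : cnt (fun s => p.1 * p.2 s) x.
  by eapply cntM; [exact: cnt_cst|exact: cp].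
split; last first.
  move=> x; rewrite /cnt; under eq_fun do rewrite big_cons; rewrite big_cons.
  exact: (cntD (cp' x) (cc x)).
rewrite big_cons e -rintZ// -rintD//.
by apply: eq_rint => s _; rewrite big_cons.
Qed.

Definition zre n v1 v2 : R := complex.Re ((v1 +i* v2)%C ^+ n).
Definition zim n v1 v2 : R := complex.Im ((v1 +i* v2)%C ^+ n).
(** For v = |v| e^(i phi), [modec] and [modes] are J_n(k |v|) times cos (n phi) and sin (n phi), and
    the amplitude [amp n b] is T Z_n(k b), where Z is the Bessel function behind F. *)
Definition modec n v1 v2 := (k / 2) ^+ n * zre n v1 v2
  * clif n (- ((k / 2) ^+ 2 * (v1 ^+ 2 + v2 ^+ 2))).
Definition modes n v1 v2 := (k / 2) ^+ n * zim n v1 v2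
  * clif n (- ((k / 2) ^+ 2 * (v1 ^+ 2 + v2 ^+ 2))).
Definition amp n b := T * b ^+ n * (- 2 / k) ^+ n * F n (b ^+ 2).

Lemma zreS n v1 v2 : zre n.+1 v1 v2 = v1 * zre n v1 v2 - v2 * zim n v1 v2.
Proof. by rewrite /zre /zim exprS; case: (_ ^+ n). Qed.

Lemma zimS n v1 v2 : zim n.+1 v1 v2 = v1 * zim n v1 v2 + v2 * zre n v1 v2.
Proof. by rewrite /zre /zim exprS; case: (_ ^+ n). Qed.

Lemma zscale n x v1 v2 : zre n (x * v1) (x * v2) = x ^+ n * zre n v1 v2 /\
  zim n (x * v1) (x * v2) = x ^+ n * zim n v1 v2.
Proof.
elim: n => [|n [ih1 ih2]]; first by rewrite /zre /zim !expr0 /= mulr0 mulr1.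
by rewrite !zreS !zimS ih1 ih2 exprS; split; ring.
Qed.

Lemma ray_lt b x v1 v2 : v1 ^+ 2 + v2 ^+ 2 < b ^+ 2 -> 0 <= x <= 1 ->
  x ^+ 2 * (v1 ^+ 2 + v2 ^+ 2) < b ^+ 2.
Proof.
move=> vb /andP[x0 x1]; apply: le_lt_trans vb.
by rewrite ler_piMl ?addr_ge0 ?sqr_ge0// expr_le1.
Qed.

Lemma ray_lt' b x v1 v2 : v1 ^+ 2 + v2 ^+ 2 < b ^+ 2 -> 0 <= x <= 1 ->
  (x * v1) ^+ 2 + (x * v2) ^+ 2 < b ^+ 2.
Proof. by move=> vb x01; rewrite !exprMn -mulrDr ray_lt. Qed.

(** Helmholtz' equation in polar coordinates, averaged over the angle: only the radial part
    survives. The factor x clears the singular coefficient 1 / x. *)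
Lemma emode0_ode b x v1 v2 : 0 < b -> v1 ^+ 2 + v2 ^+ 2 < b ^+ 2 -> 0 <= x <= 1 ->
  x * rint 0 T (fun s => F 2 (dist2 b (x * v1) (x * v2) s)
       * (2 * x * (v1 ^+ 2 + v2 ^+ 2) - 2 * b * cw v1 v2 s) ^+ 2
       + F 1 (dist2 b (x * v1) (x * v2) s) * (2 * (v1 ^+ 2 + v2 ^+ 2)))
  + rint 0 T (fun s => F 1 (dist2 b (x * v1) (x * v2) s)
       * (2 * x * (v1 ^+ 2 + v2 ^+ 2) - 2 * b * cw v1 v2 s))
  + k ^+ 2 * (v1 ^+ 2 + v2 ^+ 2) * x
    * rint 0 T (fun s => F 0 (dist2 b (x * v1) (x * v2) s)) = 0.
Proof.
move=> b0 vb x01; have vb' := ray_lt' vb x01.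
set G2 := fun s => F 2 _ * _ + _; set G1 := fun s => F 1 _ * _; set G0 := fun s => F 0 _.
have c0 s : cnt G0 s by exact: cnt_dist2.
have c1 s : cnt G1 s.
  by eapply cntM; [exact: cnt_dist2|rewrite /cw; cnt_auto].
have c2 s : cnt G2 s.
  eapply cntD; (eapply cntM; first exact: cnt_dist2); last by cnt_auto.
  by rewrite /cw; cnt_auto.
have [|e cc] := @rint_comb [:: (x, G2); (1, G1); (k ^+ 2 * (v1 ^+ 2 + v2 ^+ 2) * x, G0)].
  by [].
move: e; rewrite !big_cons big_nil /= mul1r addr0 addrA => ->.
(* This is - r^2 / x times the derivative of the kernel in s, so its own derivative is the angular
   part of the Laplacian, with its sign changed and multiplied by x. *)
pose H s := r * (2 * b * F 1 (dist2 b (x * v1) (x * v2) s) * cw' v1 v2 s).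
have HT : H T = H 0.
  have [ec es] := cos_period 1; rewrite mul1r in ec es.
  by rewrite /H dist2_period /cw' ec es mul0r cos0 sin0.
refine (rint_total T_gt0 _ cc HT) => s.
rewrite /H; eapply der_eq.
  eapply derM; first exact: der_cst.
  eapply derM.
    eapply derM; first exact: der_cst.
    eapply tower_der; [exact: dist2_gt0|exact: dist2_ders].
  by rewrite /cw'; der_auto.
rewrite !big_cons big_nil /= /G2 /G1 /G0.
have pos := dist2_gt0 s vb'; have [_ ode] := hF 0 pos.
have := cos2Dsin2' (s / r); move: ode (dist2_scale b x v1 v2 s).
rewrite /cw /cw'; set S := dist2 b (x * v1) (x * v2) s.
set f0 := F 0 S; set f1 := F 1 S; set f2 := F 2 S => ode eS eq.
have -> : k ^+ 2 * (v1 ^+ 2 + v2 ^+ 2) * x * f0 = (v1 ^+ 2 + v2 ^+ 2) * x * (k ^+ 2 * f0) by ring.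
have -> : k ^+ 2 * f0 = - (4 * S * f2) - 4 * f1.
  by move: ode => /eqP; rewrite addrC addr_eq0 => /eqP ->; ring.
rewrite eS; clearbody f0 f1 f2; move: eq; set co := cos _; set si := sin _ => eq.
clearbody co si.
by field: eq; rewrite gt_eqF.
Qed.

Lemma emode0 b v1 v2 : 0 < b -> v1 ^+ 2 + v2 ^+ 2 < b ^+ 2 ->
  emode cos 0 b v1 v2 = amp 0 b * modec 0 v1 v2.
Proof.
move=> b0 vb; set V := v1 ^+ 2 + v2 ^+ 2 in vb *.
pose f x := emode cos 0 b (x * v1) (x * v2).
pose f1 x := rint 0 T (fun s => F 1 (dist2 b (x * v1) (x * v2) s)
       * (2 * x * (v1 ^+ 2 + v2 ^+ 2) - 2 * b * cw v1 v2 s)).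
pose f2 x := rint 0 T (fun s => F 2 (dist2 b (x * v1) (x * v2) s)
       * (2 * x * (v1 ^+ 2 + v2 ^+ 2) - 2 * b * cw v1 v2 s) ^+ 2
       + F 1 (dist2 b (x * v1) (x * v2) s) * (2 * (v1 ^+ 2 + v2 ^+ 2))).
pose q := (k / 2) ^+ 2 * V.
pose A := T * F 0 (b ^+ 2).
pose X (x : R) := - (q * x ^+ 2).
pose g x := A * clif 0 (X x).
pose g1 x := A * (clif 1 (X x) * (- (2 * q * x))).
pose g2 x := A * (clif 2 (X x) * (2 * q * x) ^+ 2 - clif 1 (X x) * (2 * q)).
have dX x : der X x (- (2 * q * x)) by rewrite /X; der; ring.
have df x : 0 <= x <= 1 -> der f x (f1 x).
  move=> x01; apply: (der_eq (emode_derx 0 (@continuous_cos R) (ray_lt vb x01))).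
  by apply: eq_rint => s _; rewrite mul0r cos0 mulr1.
have df1 x : 0 <= x <= 1 -> der f1 x (f2 x).
  by move=> x01; exact: (emode_derx2 (ray_lt vb x01)).
have dg x : der g x (g1 x).
  rewrite /g /g1; eapply der_eq.
    eapply derM; first exact: der_cst.
    by eapply der_comp; [exact: clif_der|exact: dX].
  by rewrite /=; ring.
have dg1 x : der g1 x (g2 x).
  rewrite /g1 /g2; eapply der_eq.
    eapply derM; first exact: der_cst.
    eapply derM; last by der_auto.
    by eapply der_comp; [exact: clif_der|exact: dX].
  by rewrite /=; ring.
have fE x : f x = rint 0 T (fun s => F 0 (dist2 b (x * v1) (x * v2) s)).
  by apply: eq_rint => s _; rewrite mul0r cos0 mulr1.
have odef x : 0 <= x <= 1 -> x * f2 x + f1 x + k ^+ 2 * V * x * f x = 0.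
  by move=> x01; rewrite fE; exact: emode0_ode.
have odeg x : x * g2 x + g1 x + k ^+ 2 * V * x * g x = 0.
  rewrite /g2 /g1 /g; have := clif_rec 0 (X x); rewrite mul1r => <-.
  by rewrite /X /q; field.
pose d x := f x - g x; pose d1 x := f1 x - g1 x; pose d2 x := f2 x - g2 x.
have dd x : 0 <= x <= 1 -> der d x (d1 x).
  by move=> x01; eapply derD; [exact: df|eapply derN; exact: dg].
have dd1 x : 0 <= x <= 1 -> der d1 x (d2 x).
  by move=> x01; eapply derD; [exact: df1|eapply derN; exact: dg1].
have oded x : 0 <= x <= 1 -> x * d2 x + d1 x + k ^+ 2 * V * x * d x = 0.
  move=> x01; have e1 := odef x x01; have e2 := odeg x.
  have -> : x * d2 x + d1 x + k ^+ 2 * V * x * d x =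
    (x * f2 x + f1 x + k ^+ 2 * V * x * f x) - (x * g2 x + g1 x + k ^+ 2 * V * x * g x).
    by rewrite /d /d1 /d2; ring.
  by rewrite e1 e2 subr0.
have i01 : 0 <= (0 : R) <= 1 by rewrite lexx ler01.
have d00 : d 0 = 0.
  rewrite /d fE /g /X expr0n mulr0 oppr0 clif0 fact0 invr1 mulr1.
  rewrite (@eq_rint _ _ _ _ (fun=> F 0 (b ^+ 2))); last first.
    by move=> s _; rewrite dist2_scale expr0n !mul0r addr0 mulr0 mul0r subr0.
  by rewrite rint_cst ?ltW// subr0 mulrC subrr.
(* At the singular point x = 0 the equation itself forces d' = 0, which gives the second initial
   condition. *)
have d10 : d1 0 = 0.
  by have := oded 0 i01; rewrite mul0r add0r mulr0 mul0r addr0.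
(* An energy whose derivative is - 2 d1^2 / x for x > 0. It starts at 0, hence stays nonpositive,
   and this forces d1 = 0. *)
pose E x := d1 x ^+ 2 + k ^+ 2 * V * d x ^+ 2.
pose dE x := 2 * d1 x * d2 x + k ^+ 2 * V * (2 * d x * d1 x).
have hE x : 0 <= x <= 1 -> der E x (dE x).
  move=> x01; rewrite /E /dE; eapply der_eq.
    eapply derD; first by eapply derX; exact: dd1.
    eapply derM; first exact: der_cst.
    by eapply derX; exact: dd.
  by rewrite /= expr1; ring.
have E0 : E 0 = 0 by rewrite /E d10 d00 expr0n mulr0 addr0.
have V0 : 0 <= V by rewrite addr_ge0 ?sqr_ge0.
have Ele x : 0 <= x <= 1 -> E x <= 0.
  move=> /andP[x0 x1]; rewrite -oppr_ge0 -(oppr0) -E0.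
  have h y : 0 <= y <= x -> 0 <= y <= 1.
    by move=> /andP[-> yx]; rewrite (le_trans yx).
  have h' y : 0 < y < x -> 0 <= y <= 1.
    by move=> /andP[/ltW y0 /ltW yx]; apply: h; rewrite y0.
  have := @der_ge0_le R (fun x => - E x) (fun x => - dE x) 0 x x0; apply.
  - by move=> y y01; apply: continuousN; exact: (cnt_der (hE y (h y y01))).
  - by move=> y y01; eapply derN; exact: (hE y (h' y y01)).
  - move=> y y01; have := oded y (h' y y01).
    move: y01 => /andP[y0 _].
    have -> : - dE y = (2 * d1 y * (- (y * d2 y) - k ^+ 2 * V * y * d y)) / y.
      by rewrite /dE; field; rewrite gt_eqF.
    move=> /eqP; rewrite addrAC addr_eq0 => /eqP e.
    have -> : - (y * d2 y) - k ^+ 2 * V * y * d y = d1 y by rewrite -opprD e opprK.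
    by rewrite mulr_ge0 ?invr_ge0 ?(ltW y0)// -mulrA -expr2 mulr_ge0// sqr_ge0.
have d1_0 x : 0 <= x <= 1 -> d1 x = 0.
  move=> x01; apply/eqP; rewrite -sqrf_eq0 eq_le sqr_ge0 andbT.
  by apply: le_trans (Ele x x01); rewrite /E lerDl mulr_ge0 ?sqr_ge0// mulr_ge0// sqr_ge0.
have d1E : d 1 = d 0.
  apply: cst_of_der0 => // x x01; apply: der_eq (dd x x01) _; exact: d1_0.
have := d1E; rewrite d00 /d /f /g !mul1r => /eqP; rewrite subr_eq0 => /eqP ->.
by rewrite /A /amp /modec /X /q /zre !expr0 expr1n !mulr1 !mul1r.
Qed.

Definition emode_dx (tr : R -> R) n b x v1 v2 :=
  rint 0 T (fun s => F 1 (dist2 b (x * v1) (x * v2) s)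
    * (2 * x * (v1 ^+ 2 + v2 ^+ 2) - 2 * b * cw v1 v2 s) * tr (n%:R * (s / r))).
Definition emode_db (tr : R -> R) n b v1 v2 :=
  rint 0 T (fun s => F 1 (dist2 b v1 v2 s) * (2 * b - 2 * cw v1 v2 s)
    * tr (n%:R * (s / r))).

(** A ladder relation: x d/dx + n + 1 takes the regular mode of order n + 1 back to order n
    ([mode_euler]), while n / b - d/db raises the order of the amplitude ([amp_der]). The difference
    of the two sides is the integral of the derivative of the periodic function [H] below. *)
Lemma emode_rec_cos n b x v1 v2 : 0 < b -> v1 ^+ 2 + v2 ^+ 2 < b ^+ 2 -> 0 <= x <= 1 ->
  x * emode_dx cos n.+1 b x v1 v2 + n.+1%:R * emode cos n.+1 b (x * v1) (x * v2) =
  x * v1 * (n%:R / b * emode cos n b (x * v1) (x * v2) - emode_db cos n b (x * v1) (x * v2))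
  - x * v2 * (n%:R / b * emode sin n b (x * v1) (x * v2) - emode_db sin n b (x * v1) (x * v2)).
Proof.
move=> b0 vb x01; have vb' := ray_lt' vb x01.
rewrite /emode_dx /emode_db /emode.
set G1 := fun s => F 1 _ * _ * cos _; set G2 := fun s => F 0 _ * cos (n.+1%:R * _).
set G3 := fun s => F 1 _ * _ * cos _; set G4 := fun s => F 0 _ * cos (n%:R * _).
set G5 := fun s => F 1 _ * _ * sin _; set G6 := fun s => F 0 _ * sin (n%:R * _).
have c1 s : cnt G1 s.
  by eapply cntM; [eapply cntM; [exact: cnt_dist2|rewrite /cw; cnt_auto]|cnt_auto].
have c2 s : cnt G2 s by eapply cntM; [exact: cnt_dist2|cnt_auto].
have c3 s : cnt G3 s.
  by eapply cntM; [eapply cntM; [exact: cnt_dist2|rewrite /cw; cnt_auto]|cnt_auto].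
have c4 s : cnt G4 s by eapply cntM; [exact: cnt_dist2|cnt_auto].
have c5 s : cnt G5 s.
  by eapply cntM; [eapply cntM; [exact: cnt_dist2|rewrite /cw; cnt_auto]|cnt_auto].
have c6 s : cnt G6 s by eapply cntM; [exact: cnt_dist2|cnt_auto].
apply/eqP; rewrite -subr_eq0; apply/eqP.
have [|e cc] := @rint_comb [:: (x, G1); (n.+1%:R, G2); (x * v1, G3); (- (x * v1 * (n%:R / b)), G4); (- (x * v2), G5); (x * v2 * (n%:R / b), G6)].
  by [].
rewrite [LHS](_ : _ = \sum_(p <- [:: (x, G1); (n.+1%:R, G2); (x * v1, G3); (- (x * v1 * (n%:R / b)), G4); (- (x * v2), G5); (x * v2 * (n%:R / b), G6)])
    p.1 * rint 0 T p.2); last by rewrite !big_cons big_nil /=; ring.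
rewrite e.
pose H s := r * (F 0 (dist2 b (x * v1) (x * v2) s) * (sin (n.+1%:R * (s / r)) - x / b * (v1 * sin (n%:R * (s / r)) + v2 * cos (n%:R * (s / r))))).
have HT : H T = H 0.
  have [ec es] := cos_period n; have [ec' es'] := cos_period n.+1.
  by rewrite /H dist2_period ?ec ?es ?ec' ?es' !mul0r !mulr0 ?cos0 ?sin0 ?mulr0.
refine (rint_total T_gt0 _ cc HT) => s.
rewrite /H; eapply der_eq.
  eapply derM; first exact: der_cst.
  eapply derM.
    eapply tower_der; [exact: dist2_gt0|exact: dist2_ders].
  by der_auto.
rewrite !big_cons big_nil /= /G1 /G2 /G3 /G4 /G5 /G6.
have := cos2Dsin2' (s / r).
rewrite -natr1 mulrDl mul1r cosD sinD.
rewrite /cw /cw'; set S := dist2 b (x * v1) (x * v2) s.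
set f0 := F 0 S; set f1 := F 1 S.
set co := cos (s / r); set si := sin (s / r).
set cn := cos (n%:R * _); set sn := sin (n%:R * _) => eq.
clearbody f0 f1 co si cn sn.
by field: eq; rewrite !gt_eqF.
Qed.

Lemma emode_rec_sin n b x v1 v2 : 0 < b -> v1 ^+ 2 + v2 ^+ 2 < b ^+ 2 -> 0 <= x <= 1 ->
  x * emode_dx sin n.+1 b x v1 v2 + n.+1%:R * emode sin n.+1 b (x * v1) (x * v2) =
  x * v2 * (n%:R / b * emode cos n b (x * v1) (x * v2) - emode_db cos n b (x * v1) (x * v2))
  + x * v1 * (n%:R / b * emode sin n b (x * v1) (x * v2) - emode_db sin n b (x * v1) (x * v2)).
Proof.
move=> b0 vb x01; have vb' := ray_lt' vb x01.
rewrite /emode_dx /emode_db /emode.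
set G1 := fun s => F 1 _ * _ * sin _; set G2 := fun s => F 0 _ * sin (n.+1%:R * _).
set G3 := fun s => F 1 _ * _ * cos _; set G4 := fun s => F 0 _ * cos (n%:R * _).
set G5 := fun s => F 1 _ * _ * sin _; set G6 := fun s => F 0 _ * sin (n%:R * _).
have c1 s : cnt G1 s.
  by eapply cntM; [eapply cntM; [exact: cnt_dist2|rewrite /cw; cnt_auto]|cnt_auto].
have c2 s : cnt G2 s by eapply cntM; [exact: cnt_dist2|cnt_auto].
have c3 s : cnt G3 s.
  by eapply cntM; [eapply cntM; [exact: cnt_dist2|rewrite /cw; cnt_auto]|cnt_auto].
have c4 s : cnt G4 s by eapply cntM; [exact: cnt_dist2|cnt_auto].
have c5 s : cnt G5 s.
  by eapply cntM; [eapply cntM; [exact: cnt_dist2|rewrite /cw; cnt_auto]|cnt_auto].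
have c6 s : cnt G6 s by eapply cntM; [exact: cnt_dist2|cnt_auto].
apply/eqP; rewrite -subr_eq0; apply/eqP.
have [|e cc] := @rint_comb [:: (x, G1); (n.+1%:R, G2); (x * v2, G3); (- (x * v2 * (n%:R / b)), G4); (x * v1, G5); (- (x * v1 * (n%:R / b)), G6)].
  by [].
rewrite [LHS](_ : _ = \sum_(p <- [:: (x, G1); (n.+1%:R, G2); (x * v2, G3); (- (x * v2 * (n%:R / b)), G4); (x * v1, G5); (- (x * v1 * (n%:R / b)), G6)])
    p.1 * rint 0 T p.2); last by rewrite !big_cons big_nil /=; ring.
rewrite e.
pose H s := r * (F 0 (dist2 b (x * v1) (x * v2) s) * (- cos (n.+1%:R * (s / r)) + x / b * (v1 * cos (n%:R * (s / r)) - v2 * sin (n%:R * (s / r))))).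
have HT : H T = H 0.
  have [ec es] := cos_period n; have [ec' es'] := cos_period n.+1.
  by rewrite /H dist2_period ?ec ?es ?ec' ?es' !mul0r !mulr0 ?cos0 ?sin0 ?mulr0.
refine (rint_total T_gt0 _ cc HT) => s.
rewrite /H; eapply der_eq.
  eapply derM; first exact: der_cst.
  eapply derM.
    eapply tower_der; [exact: dist2_gt0|exact: dist2_ders].
  by der_auto.
rewrite !big_cons big_nil /= /G1 /G2 /G3 /G4 /G5 /G6.
have := cos2Dsin2' (s / r).
rewrite -natr1 mulrDl mul1r cosD sinD.
rewrite /cw /cw'; set S := dist2 b (x * v1) (x * v2) s.
set f0 := F 0 S; set f1 := F 1 S.
set co := cos (s / r); set si := sin (s / r).
set cn := cos (n%:R * _); set sn := sin (n%:R * _) => eq.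
clearbody f0 f1 co si cn sn.
by field: eq; rewrite !gt_eqF.
Qed.

(* The last hypothesis says that x ^ n.+1 * (f x - g x) has zero derivative. *)
Lemma euler_uniq n (f g f1 g1 : R -> R) :
  (forall x, 0 <= x <= 1 -> der f x (f1 x)) ->
  (forall x, 0 <= x <= 1 -> der g x (g1 x)) ->
  (forall x, 0 <= x <= 1 -> x * f1 x + n.+1%:R * f x = x * g1 x + n.+1%:R * g x) ->
  f 1 = g 1.
Proof.
move=> df dg e; pose d x := x ^+ n.+1 * (f x - g x).
have dd x : 0 <= x <= 1 -> der d x 0.
  move=> x01; rewrite /d; eapply der_eq.
    eapply derM; first by der_auto.
    by eapply derD; [exact: df|eapply derN; exact: dg].
  have := e x x01; rewrite /= exprS => /eqP; rewrite -subr_eq0 => /eqP eq.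
  rewrite [LHS](_ : _ = x ^+ n * (x * f1 x + n.+1%:R * f x - (x * g1 x + n.+1%:R * g x))).
    by rewrite eq mulr0.
  by ring.
have := cst_of_der0 ler01 dd.
by rewrite /d expr1n mul1r expr0n/= mul0r => /eqP; rewrite subr_eq0 => /eqP.
Qed.

Lemma amp_der n b : 0 < b -> der (amp n) b (n%:R / b * amp n b - k * amp n.+1 b).
Proof.
move=> b0; rewrite /amp; eapply der_eq.
  eapply derM; first by der_auto.
  eapply tower_der; last by der_auto.
  by rewrite exprn_gt0.
rewrite /= !exprS expr0; case: n => [|n] /=; first by field; nzt.
by rewrite exprS; field; nzt.
Qed.

Lemma mode_euler n x v1 v2 (z : R) :
  let X x := - ((k / 2) ^+ 2 * ((x * v1) ^+ 2 + (x * v2) ^+ 2)) in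
  let g x := (k / 2) ^+ n.+1 * (x ^+ n.+1 * z) * clif n.+1 (X x) in
  exists2 g1, der g x g1 &
   x * g1 + n.+1%:R * g x = k * (k / 2) ^+ n * (x ^+ n.+1 * z) * clif n (X x).
Proof.
move=> X g; have dX : der X x (- ((k / 2) ^+ 2 * (2 * x * (v1 ^+ 2 + v2 ^+ 2)))).
  by rewrite /X; der; ring.
eexists.
  rewrite /g; eapply derM; first by der_auto.
  by eapply der_comp; [exact: clif_der|exact: dX].
rewrite /= /g -(clif_rec n (X x)) [X in X * clif n.+2 _]/X.
by rewrite !exprS; field.
Qed.

Lemma emode_step (tr : R -> R) n b v1 v2 z : (forall s, cnt tr s) ->
  v1 ^+ 2 + v2 ^+ 2 < b ^+ 2 ->
  (forall x, 0 <= x <= 1 -> x * emode_dx tr n.+1 b x v1 v2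
     + n.+1%:R * emode tr n.+1 b (x * v1) (x * v2) =
   amp n.+1 b * (k * (k / 2) ^+ n * (x ^+ n.+1 * z)
     * clif n (- ((k / 2) ^+ 2 * ((x * v1) ^+ 2 + (x * v2) ^+ 2))))) ->
  emode tr n.+1 b v1 v2 = amp n.+1 b * ((k / 2) ^+ n.+1 * z
     * clif n.+1 (- ((k / 2) ^+ 2 * (v1 ^+ 2 + v2 ^+ 2)))).
Proof.
move=> ctr vb hrec.
pose X x := - ((k / 2) ^+ 2 * ((x * v1) ^+ 2 + (x * v2) ^+ 2)).
pose g x := (k / 2) ^+ n.+1 * (x ^+ n.+1 * z) * clif n.+1 (X x).
have /choice[g1 hg] : forall x, exists g1 : R, der g x g1 /\
    x * g1 + n.+1%:R * g x = k * (k / 2) ^+ n * (x ^+ n.+1 * z) * clif n (X x).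
  by move=> x; have [g1 h1 h2] := mode_euler n x v1 v2 z; exists g1.
have df x : 0 <= x <= 1 -> der (fun x => emode tr n.+1 b (x * v1) (x * v2)) x
    (emode_dx tr n.+1 b x v1 v2).
  by move=> x01; exact: (emode_derx n.+1 ctr (ray_lt vb x01)).
have dg x : 0 <= x <= 1 -> der (fun x => amp n.+1 b * g x) x (amp n.+1 b * g1 x).
  move=> _; eapply der_eq; first by eapply derM; [exact: der_cst|exact: (hg x).1].
  by rewrite mul0r add0r.
have e x : 0 <= x <= 1 ->
    x * emode_dx tr n.+1 b x v1 v2 + n.+1%:R * emode tr n.+1 b (x * v1) (x * v2) =
    x * (amp n.+1 b * g1 x) + n.+1%:R * (amp n.+1 b * g x).
  by move=> x01; rewrite hrec// -(hg x).2; ring.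
by have := euler_uniq df dg e; rewrite /g /X !mul1r expr1n mul1r.
Qed.

(** Induction on n, for all b and v at once: the step differentiates the formula of order n in b, so
    it must hold on a neighbourhood of b. *)
Lemma emode_mode n b v1 v2 : 0 < b -> v1 ^+ 2 + v2 ^+ 2 < b ^+ 2 ->
  emode cos n b v1 v2 = amp n b * modec n v1 v2 /\
  emode sin n b v1 v2 = amp n b * modes n v1 v2.
Proof.
elim: n b v1 v2 => [|n ih] b v1 v2 b0 vb.
  split; first exact: emode0.
  rewrite /modes /zim expr0 /= !(mulr0, mul0r) /emode.
  rewrite (@eq_rint _ _ _ _ (fun=> 0)) ?rint_cst ?mul0r// ?ltW// => s _.
  by rewrite mul0r sin0 mulr0.
have dbc w1 w2 : w1 ^+ 2 + w2 ^+ 2 < b ^+ 2 ->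
    emode_db cos n b w1 w2 = (n%:R / b * amp n b - k * amp n.+1 b) * modec n w1 w2 /\
    emode_db sin n b w1 w2 = (n%:R / b * amp n b - k * amp n.+1 b) * modes n w1 w2.
  move=> wb.
  have nr : \forall y \near b, 0 < y /\ w1 ^+ 2 + w2 ^+ 2 < y ^+ 2.
    have cX : cnt (fun y : R => y ^+ 2) b by cnt_auto.
    by apply: filterI; [exact: lt_nbhsr|have /cvgr_gt := cX; apply].
  split.
    apply: der_unique (emode_derb n (@continuous_cos R) b0 wb) _.
    have : der (fun b => amp n b * modec n w1 w2) b
        ((n%:R / b * amp n b - k * amp n.+1 b) * modec n w1 w2).
      eapply der_eq; first by eapply derM; [exact: amp_der|exact: der_cst].
      by rewrite mulr0 addr0.
    apply: der_near; near=> y; have [y0 wy] : 0 < y /\ w1 ^+ 2 + w2 ^+ 2 < y ^+ 2.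
      by near: y.
    by have [-> _] := ih y w1 w2 y0 wy.
  apply: der_unique (emode_derb n (@continuous_sin R) b0 wb) _.
  have : der (fun b => amp n b * modes n w1 w2) b
      ((n%:R / b * amp n b - k * amp n.+1 b) * modes n w1 w2).
    eapply der_eq; first by eapply derM; [exact: amp_der|exact: der_cst].
    by rewrite mulr0 addr0.
  apply: der_near; near=> y; have [y0 wy] : 0 < y /\ w1 ^+ 2 + w2 ^+ 2 < y ^+ 2.
    by near: y.
  by have [_ ->] := ih y w1 w2 y0 wy.
split.
- rewrite (@emode_step cos n b v1 v2 (zre n.+1 v1 v2)) ?/modec ?mulrA//.
    exact: continuous_cos.
  move=> x x01; rewrite emode_rec_cos//.
  have vb' := ray_lt' vb x01.
  have [-> ->] := ih b (x * v1) (x * v2) b0 vb'; have [-> ->] := dbc _ _ vb'.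
  rewrite /modec /modes (zscale n x v1 v2).1 (zscale n x v1 v2).2 zreS [x ^+ n.+1]exprS.
  by ring.
- rewrite (@emode_step sin n b v1 v2 (zim n.+1 v1 v2)) ?/modes ?mulrA//.
    exact: continuous_sin.
  move=> x x01; rewrite emode_rec_sin//.
  have vb' := ray_lt' vb x01.
  have [-> ->] := ih b (x * v1) (x * v2) b0 vb'; have [-> ->] := dbc _ _ vb'.
  rewrite /modec /modes (zscale n x v1 v2).1 (zscale n x v1 v2).2 zimS [x ^+ n.+1]exprS.
  by ring.
Unshelve. all: by end_near.
Qed.

End modes.

(** * Plane waves as sums of modes *)

Section complex_curves.
Context {R : realType}.
Implicit Types (z w : R[i]) (f g : R -> R[i]) (h : R).

Lemma ReM z w : cRe (z * w) = cRe z * cRe w - cIm z * cIm w.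
Proof. by case: z w => [? ?] [? ?]. Qed.
Lemma ImM z w : cIm (z * w) = cRe z * cIm w + cIm z * cRe w.
Proof. by case: z w => [? ?] [? ?]. Qed.
Lemma ReD z w : cRe (z + w) = cRe z + cRe w. Proof. by case: z w => [? ?] [? ?]. Qed.
Lemma ImD z w : cIm (z + w) = cIm z + cIm w. Proof. by case: z w => [? ?] [? ?]. Qed.
Lemma ReN z : cRe (- z) = - cRe z. Proof. by case: z. Qed.
Lemma ImN z : cIm (- z) = - cIm z. Proof. by case: z. Qed.
Lemma complex_ext z w : cRe z = cRe w -> cIm z = cIm w -> z = w.
Proof. by case: z w => [? ?] [? ?] /= -> ->. Qed.

Lemma normc_Re z : `|cRe z| <= normc z.
Proof.
case: z => x y /=; rewrite -sqrtr_sqr ler_wsqrtr//.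
by rewrite lerDl sqr_ge0.
Qed.

Lemma normc_Im z : `|cIm z| <= normc z.
Proof.
case: z => x y /=; rewrite -sqrtr_sqr ler_wsqrtr//.
by rewrite lerDr sqr_ge0.
Qed.

Lemma normc_real (x : R) : normc (x%:C)%C = `|x|.
Proof. by rewrite /= expr0n addr0 sqrtr_sqr. Qed.

Lemma normcX z n : normc (z ^+ n) = normc z ^+ n.
Proof. by elim: n => [|n ih]; rewrite ?expr0 ?normc1// !exprS normcM ih. Qed.

Lemma normc_sum (I : Type) (s : seq I) (F : I -> R[i]) :
  normc (\sum_(i <- s) F i) <= \sum_(i <- s) normc (F i).
Proof.
elim: s => [|i s ih]; first by rewrite !big_nil normc0.
by rewrite !big_cons (le_trans (le_normcD _ _))// lerD2l.
Qed.

(** Differentiability of curves in the complex plane is taken componentwise, so that the real rules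
    and the real mean value inequality apply. *)
Definition cder f h z := der (fun y => cRe (f y)) h (cRe z) /\
  der (fun y => cIm (f y)) h (cIm z).

Lemma cder_eq f h z w : cder f h z -> z = w -> cder f h w.
Proof. by move=> ? <-. Qed.

Lemma cder_ext f g h z : f =1 g -> cder g h z -> cder f h z.
Proof. by move=> /funext ->. Qed.

Lemma cder_cst z h : cder (fun=> z) h 0.
Proof. by split; exact: der_cst. Qed.

Lemma cder_real (f : R -> R) h a : der f h a -> cder (fun y => (f y)%:C%C) h (a%:C)%C.
Proof. by move=> df; split => //; exact: der_cst. Qed.

Lemma cderD f g h z w : cder f h z -> cder g h w -> cder (fun y => f y + g y) h (z + w).
Proof.
move=> [f1 f2] [g1 g2]; rewrite /cder ReD ImD.
by split; [exact: (der_ext (fun y => ReD _ _) (derD f1 g1))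
          |exact: (der_ext (fun y => ImD _ _) (derD f2 g2))].
Qed.

Lemma cderM f g h z w : cder f h z -> cder g h w ->
  cder (fun y => f y * g y) h (z * g h + f h * w).
Proof.
move=> [f1 f2] [g1 g2]; rewrite /cder ReD ImD !ReM !ImM; split.
  apply: der_eq (der_ext (fun y => ReM _ _) (derD (derM f1 g1) (derN (derM f2 g2)))) _.
  by rewrite /=; ring.
apply: der_eq (der_ext (fun y => ImM _ _) (derD (derM f1 g2) (derM f2 g1))) _.
by rewrite /=; ring.
Qed.

Lemma cderX f h z n : cder f h z -> cder (fun y => f y ^+ n.+1) h (n.+1%:R * f h ^+ n * z).
Proof.
move=> df; elim: n => [|n ih].
  by apply: cder_eq df _; rewrite expr0 !mul1r.
apply: (@cder_ext _ (fun y => f y * f y ^+ n.+1)) => [y|]; first by rewrite exprS.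
apply: cder_eq (cderM df ih) _; rewrite -[in RHS]natr1 !exprS; ring.
Qed.

Definition cexp z : R[i] := ((expR (cRe z) * cos (cIm z)) +i* (expR (cRe z) * sin (cIm z)))%C.

Lemma cexpD z w : cexp (z + w) = cexp z * cexp w.
Proof.
apply: complex_ext; rewrite ?ReM ?ImM /cexp/= ReD ImD expRD ?cosD ?sinD; ring.
Qed.

Lemma cexp0 : cexp 0 = 1.
Proof. by apply: complex_ext; rewrite /cexp/= expR0 ?cos0 ?sin0 mul1r. Qed.

Lemma normc_cexp z : normc (cexp z) = expR (cRe z).
Proof.
rewrite /cexp/= !exprMn -mulrDr cos2Dsin2 mulr1 sqrtr_sqr ger0_norm// expR_ge0.
Qed.

Lemma cder_cexp f h z : cder f h z -> cder (fun y => cexp (f y)) h (z * cexp (f h)).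
Proof.
move=> [f1 f2]; split.
  rewrite ReM /=; eapply der_eq.
    by eapply derM; [eapply der_expR; exact: f1|eapply der_cos; exact: f2].
  by rewrite /=; ring.
rewrite ImM /=; eapply der_eq.
  by eapply derM; [eapply der_expR; exact: f1|eapply der_sin; exact: f2].
by rewrite /=; ring.
Qed.

Lemma cmvt f df C a b : a <= b -> (forall y, a <= y <= b -> cder f y (df y)) ->
  (forall y, a <= y <= b -> normc (df y) <= C) ->
  `|cRe (f b) - cRe (f a)| <= C * (b - a) /\ `|cIm (f b) - cIm (f a)| <= C * (b - a).
Proof.
move=> ab hd hC; have -> : b - a = `|b - a| by rewrite ger0_norm ?subr_ge0.
split.
  apply: (@mvt_le _ (fun y => cRe (f y)) (fun y => cRe (df y))).
    by move=> y; rewrite min_l// max_r// => /hd[].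
  by move=> y; rewrite min_l// max_r// => /hC; apply: le_trans; exact: normc_Re.
apply: (@mvt_le _ (fun y => cIm (f y)) (fun y => cIm (df y))).
  by move=> y; rewrite min_l// max_r// => /hd[].
by move=> y; rewrite min_l// max_r// => /hC; apply: le_trans; exact: normc_Im.
Qed.

End complex_curves.

Section bessel_series.
Context {R : realType}.
Implicit Types (a b z : R[i]) (x A : R) (n N : nat).

(* With a = (k/2) lambda zeta and b = - (k/2) conj zeta / lambda these are
   lambda^n times the n-th and lambda^(-n) times the (-n)-th cylindrical wave. *)
Definition wav n a x : R[i] := a ^+ n * (clif n x)%:C%C.
Definition wavsum N a b x : R[i] := \sum_(n < N) (wav n a x + wav n.+1 b x).

Lemma realCM x y : (x * y)%:C%C = x%:C%C * y%:C%C :> R[i].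
Proof. by apply: complex_ext => /=; ring. Qed.
Lemma realCD x y : (x + y)%:C%C = x%:C%C + y%:C%C :> R[i].
Proof. by apply: complex_ext => /=; ring. Qed.
Lemma realCn n : (n%:R)%:C%C = n%:R :> R[i].
Proof. by elim: n => // n ih; rewrite -!natr1 realCD ih. Qed.

Lemma cder_wav0 (a b : R -> R[i]) (X : R -> R) (h : R) a' b' (X' : R) :
  der X h X' -> (X')%:C%C = a' * b h + a h * b' ->
  cder (fun y => wav 0 (a y) (X y)) h (a' * wav 1 (b h) (X h) + b' * wav 1 (a h) (X h)).
Proof.
move=> dX eX; apply: (@cder_ext _ _ (fun y => (clif 0 (X y))%:C%C)).
  by move=> y; rewrite /wav expr0 mul1r.
apply: cder_eq; first by apply: cder_real; apply: der_comp dX; exact: clif_der.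
by rewrite realCM eX /wav !expr1; ring.
Qed.

(** By [clif_rec] and a b = X, the product rule becomes a shift of orders: a' lowers the order by
    one and b' raises it by one. *)
Lemma cder_wavS n (a b : R -> R[i]) (X : R -> R) (h : R) a' b' (X' : R) :
  cder a h a' -> der X h X' -> (X')%:C%C = a' * b h + a h * b' ->
  a h * b h = (X h)%:C%C ->
  cder (fun y => wav n.+1 (a y) (X y)) h
    (a' * wav n (a h) (X h) + b' * wav n.+2 (a h) (X h)).
Proof.
move=> da dX eX eab; rewrite /wav; apply: cder_eq.
  apply: cderM; first by apply: cderX; exact: da.
  by apply: cder_real; apply: der_comp dX; exact: clif_der.
rewrite realCM eX -(clif_rec n (X h)) realCD !realCM realCn -eab !exprS; ring.
Qed.

(** As differentiation shifts orders, the sum over positive and negative orders reproduces itself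
    with factor a' + b', up to the four terms at the ends of the range. *)
Lemma cder_wavsum N (a b : R -> R[i]) (X : R -> R) (h : R) a' b' (X' : R) :
  cder a h a' -> cder b h b' -> der X h X' -> (X')%:C%C = a' * b h + a h * b' ->
  a h * b h = (X h)%:C%C ->
  cder (fun y => wavsum N.+1 (a y) (b y) (X y)) h
    ((a' + b') * wavsum N.+1 (a h) (b h) (X h)
     + a' * (wav N.+2 (b h) (X h) - wav N (a h) (X h))
     + b' * (wav N.+1 (a h) (X h) - wav N.+1 (b h) (X h))).
Proof.
move=> da db dX eX eab.
have eX' : (X')%:C%C = b' * a h + b h * a' by rewrite eX; ring.
have eba : b h * a h = (X h)%:C%C by rewrite mulrC.
have dP n := @cder_wavS n a b X h a' b' X' da dX eX eab.
have dQ n := @cder_wavS n b a X h b' a' X' db dX eX' eba.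
have e0 : wav 0 (b h) (X h) = wav 0 (a h) (X h) by rewrite /wav !expr0.
elim: N => [|N ih].
  apply: (@cder_ext _ _ (fun y => wav 0 (a y) (X y) + wav 1 (b y) (X y))).
    by move=> y; rewrite /wavsum big_ord1.
  apply: cder_eq; first by apply: cderD; [exact: (cder_wav0 dX eX)|exact: dQ].
  by rewrite /wavsum big_ord1 e0; ring.
apply: (@cder_ext _ _ (fun y => wavsum N.+1 (a y) (b y) (X y)
    + (wav N.+1 (a y) (X y) + wav N.+2 (b y) (X y)))).
  by move=> y; rewrite /wavsum big_ord_recr.
apply: cder_eq; first by apply: cderD; [exact: ih|apply: cderD; [exact: dP|exact: dQ]].
rewrite /wavsum [in RHS]big_ord_recr /=; ring.
Qed.

Definition wavB A := expR (A ^+ 2) * expR A.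

Lemma wav_le n a x A : normc a <= A -> `|x| <= A ^+ 2 ->
  normc (wav n a x) <= expR (A ^+ 2) * (A ^+ n / n`!%:R).
Proof.
move=> aA xA; rewrite /wav normcM normcX normc_real mulrCA.
have A0 : 0 <= A by apply: le_trans aA; exact: normc_ge0.
apply: ler_pM; rewrite ?exprn_ge0 ?normc_ge0//.
  by rewrite lerXn2r ?nnegrE ?normc_ge0.
apply: (le_trans (clif_le _ _)).
by rewrite ler_wpM2r ?invr_ge0// ler_expR.
Qed.

Lemma expterm_le n A : 0 <= A -> A ^+ n / n`!%:R <= expR A.
Proof.
move=> A0; case: n => [|n]; first by rewrite expr0 fact0 divr1 (le_trans _ (expR_ge1Dx A))// lerDl.
by apply: le_trans (expR_ge1Dxn n A0); rewrite lerDr.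
Qed.

Lemma wav_leB n a x A : normc a <= A -> `|x| <= A ^+ 2 -> normc (wav n a x) <= wavB A.
Proof.
move=> aA xA; have A0 : 0 <= A by apply: le_trans aA; exact: normc_ge0.
apply: (le_trans (wav_le n aA xA)); rewrite ler_wpM2l ?expR_ge0//.
exact: expterm_le.
Qed.

Lemma expsum_le N A : 0 <= A -> \sum_(n < N) A ^+ n / n`!%:R <= expR A.
Proof.
move=> A0; have -> : \sum_(n < N) A ^+ n / n`!%:R = series (exp_coeff A) N.
  by rewrite /series/= big_mkord.
apply: nondecreasing_cvgn_le; last exact: is_cvg_series_exp_coeff.
by apply: nondecreasing_series => i _ _; exact: exp_coeff_ge0.
Qed.

Lemma wavsum_le N a b x A : normc a <= A -> normc b <= A -> `|x| <= A ^+ 2 ->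
  normc (wavsum N a b x) <= 2 * wavB A.
Proof.
move=> aA bA xA; have A0 : 0 <= A by apply: le_trans aA; exact: normc_ge0.
apply: (le_trans (normc_sum _ _)).
apply: (@le_trans _ _ (\sum_(n < N) (expR (A ^+ 2) * (A ^+ n / n`!%:R)
   + expR (A ^+ 2) * (A ^+ n.+1 / n.+1`!%:R)))).
  by apply: ler_sum => n _; rewrite (le_trans (le_normcD _ _))// lerD// wav_le.
rewrite big_split/= -!mulr_sumr /wavB -mulrDr mulrCA ler_wpM2l ?expR_ge0//.
rewrite mulr_natl mulr2n lerD ?expsum_le//.
apply: le_trans (expsum_le N.+1 A0).
by rewrite [leRHS]big_ord_recl lerDr divr_ge0 ?exprn_ge0.
Qed.

(** The generating function of the Bessel functions with an explicit remainder. Along (t a, t b, t^2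
    x) the sum times e^(- t (a + b)) is 1 at t = 0, and only the end terms contribute to its
    derivative; no double series is rearranged. *)
Lemma wavsum_err N a b x A : normc a <= A -> normc b <= A -> a * b = x%:C%C ->
  let e := 4 * A * expR (2 * A) * (expR (A ^+ 2) * (A ^+ N / N`!%:R * (1 + A) ^+ 2)) in
  let D := wavsum N.+1 a b x * cexp (- (a + b)) - 1 in
  `|cRe D| <= e /\ `|cIm D| <= e.
Proof.
move=> aA bA eab e; have A0 : 0 <= A by apply: le_trans aA; exact: normc_ge0.
pose c (z : R[i]) (t : R) : R[i] := t%:C%C * z.
pose X (t : R) := t ^+ 2 * x.
have dc z t : cder (c z) t z.
  apply: cder_eq; first by apply: cderM; [apply: cder_real; exact: der_id|exact: cder_cst].
  by rewrite (_ : (1%:C)%C = 1) // mul1r mulr0 addr0.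
have dX (t : R) : der X t (2 * t * x) by rewrite /X; der; ring.
have eX t : (2 * t * x)%:C%C = a * c b t + c a t * b.
  by rewrite !realCM -eab realCn /c; ring.
have eabt t : c a t * c b t = (X t)%:C%C.
  by rewrite /X !realCM -eab /c; ring.
pose T t := wavsum N.+1 (c a t) (c b t) (X t).
pose bd t := a * (wav N.+2 (c b t) (X t) - wav N (c a t) (X t))
     + b * (wav N.+1 (c a t) (X t) - wav N.+1 (c b t) (X t)).
pose Ex t := cexp (- (c (a + b) t)).
pose D t := T t * Ex t.
have dD t : cder D t (bd t * Ex t).
  apply: cder_eq.
    apply: cderM; first exact: (cder_wavsum N (dc a t) (dc b t) (dX t) (eX t) (eabt t)).
    apply: cder_cexp; apply: (@cder_ext _ _ (fun t => (-1) * c (a + b) t)).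
      by move=> y; rewrite mulN1r.
    by apply: cderM; [exact: cder_cst|exact: dc].
  by rewrite /bd /T /Ex; ring.
have cA z t : 0 <= t <= 1 -> normc z <= A -> normc (c z t) <= A.
  move=> /andP[t0 t1] zA; rewrite /c normcM normc_real ger0_norm//.
  by apply: le_trans zA; rewrite ler_piMl// normc_ge0.
have XA t : 0 <= t <= 1 -> `|X t| <= A ^+ 2.
  move=> t01; rewrite -normc_real -eabt normcM expr2.
  by rewrite ler_pM ?normc_ge0// cA.
(* The factor (1 + A)^2 absorbs the orders N + 1 and N + 2 of the end terms. *)
have pw m : (m <= 2)%N -> A ^+ (N + m) / (N + m)`!%:R <= A ^+ N / N`!%:R * (1 + A) ^+ 2.
  move=> m2; rewrite exprD mulrAC; apply: ler_pM.
  - by rewrite mulr_ge0 ?exprn_ge0 ?invr_ge0.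
  - exact: exprn_ge0.
  - rewrite ler_wpM2l ?exprn_ge0// lef_pV2 ?posrE ?ltr0n ?fact_gt0//.
    by rewrite ler_nat leq_fact// leq_addr.
  - apply: (@le_trans _ _ ((1 + A) ^+ m)).
      by rewrite lerXn2r ?nnegrE ?addr_ge0// lerDr.
    by rewrite ler_weXn2l// lerDl.
set B := A ^+ N / N`!%:R * (1 + A) ^+ 2 in e pw *.
have wA z t m : 0 <= t <= 1 -> normc z <= A -> (m <= 2)%N ->
    normc (wav (N + m) (c z t) (X t)) <= expR (A ^+ 2) * B.
  move=> t01 zA m2; apply: (le_trans (wav_le _ (cA z t t01 zA) (XA t t01))).
  by rewrite ler_wpM2l ?expR_ge0// pw.
have hbd t : 0 <= t <= 1 -> normc (bd t * Ex t) <= e.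
  move=> t01; rewrite normcM.
  have h1 : normc (bd t) <= 4 * A * (expR (A ^+ 2) * B).
    have := wA a t 0 t01 aA isT; have := wA b t 2 t01 bA isT.
    have := wA a t 1 t01 aA isT; have := wA b t 1 t01 bA isT.
    rewrite addn0 addn1 addn2; set K := expR _ * B => h1 h2 h3 h4.
    rewrite /bd; apply: (le_trans (le_normcD _ _)); rewrite !normcM.
    have s1 : normc (wav N.+2 (c b t) (X t) - wav N (c a t) (X t)) <= K + K.
      by rewrite (le_trans (le_normcD _ _))// normcN lerD.
    have s2 : normc (wav N.+1 (c a t) (X t) - wav N.+1 (c b t) (X t)) <= K + K.
      by rewrite (le_trans (le_normcD _ _))// normcN lerD.
    have -> : 4 * A * K = A * (K + K) + A * (K + K) by ring.
    by rewrite lerD// ler_pM// normc_ge0.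
  have h2 : normc (Ex t) <= expR (2 * A).
    rewrite /Ex normc_cexp ler_expR; apply: (le_trans (ler_norm _)).
    apply: (le_trans (normc_Re _)); rewrite normcN.
    have /andP[t0 t1] := t01; rewrite /c normcM normc_real ger0_norm//.
    apply: (@le_trans _ _ (normc (a + b))); first by rewrite ler_piMl// normc_ge0.
    by rewrite (le_trans (le_normcD _ _))// mulr_natl mulr2n lerD.
  rewrite /e; have -> : 4 * A * expR (2 * A) * (expR (A ^+ 2) * B)
     = 4 * A * (expR (A ^+ 2) * B) * expR (2 * A) by ring.
  by rewrite ler_pM// normc_ge0.
have D0 : D 0 = 1.
  rewrite /D /T /Ex /X /c !mul0r oppr0 cexp0 mulr1 expr0n mul0r /wavsum.
  rewrite big_ord_recl /= big1 ?addr0; last first.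
    by move=> i _; rewrite /wav /= !expr0n/= !mul0r addr0.
  by rewrite /wav expr0 expr1 mul0r addr0 mul1r clif0 fact0 invr1.
have D1 : D 1 = wavsum N.+1 a b x * cexp (- (a + b)).
  by rewrite /D /T /Ex /X /c !mul1r expr1n mul1r.
have [h1 h2] := cmvt ler01 (fun y _ => dD y) hbd.
move: h1 h2; rewrite D0 D1 subr0 mulr1 => h1 h2.
by rewrite /= ReD ImD ReN ImN.
Qed.

Lemma wavsum_cvg a b x : a * b = x%:C%C ->
  (cRe (wavsum N.+1 a b x) @[N --> \oo] --> cRe (cexp (a + b))) /\
  (cIm (wavsum N.+1 a b x) @[N --> \oo] --> cIm (cexp (a + b))).
Proof.
move=> eab; pose A := normc a + normc b.
have aA : normc a <= A by rewrite lerDl normc_ge0.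
have bA : normc b <= A by rewrite lerDr normc_ge0.
have h N := wavsum_err N aA bA eab.
pose K := 4 * A * expR (2 * A) * expR (A ^+ 2) * (1 + A) ^+ 2.
pose u N := K * exp_coeff A N.
have u0 : u N @[N --> \oo] --> 0.
  rewrite -(mulr0 K); apply: cvgMr; apply: cvg_series_cvg_0.
  exact: is_cvg_series_exp_coeff.
pose D N := wavsum N.+1 a b x * cexp (- (a + b)) - 1.
have hu N : `|cRe (D N)| <= u N /\ `|cIm (D N)| <= u N.
  have [h1 h2] := h N.
  suff -> : u N = 4 * A * expR (2 * A) * (expR (A ^+ 2) * (A ^+ N / N`!%:R * (1 + A) ^+ 2)) by [].
  by rewrite /u /K /exp_coeff/=; ring.
have D1 : cRe (D N) @[N --> \oo] --> 0.
  apply/cvgr0Pnorm_le => e e0; have /cvgr0Pnorm_le/(_ e e0) := u0.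
  apply: filterS => N; apply: le_trans; apply: le_trans (hu N).1 _; exact: ler_norm.
have D2 : cIm (D N) @[N --> \oo] --> 0.
  apply/cvgr0Pnorm_le => e e0; have /cvgr0Pnorm_le/(_ e e0) := u0.
  apply: filterS => N; apply: le_trans; apply: le_trans (hu N).2 _; exact: ler_norm.
have eT N : wavsum N.+1 a b x = (1 + D N) * cexp (a + b).
  by rewrite /D addrC subrK -mulrA -cexpD addNr cexp0 mulr1.
set p := cRe (cexp (a + b)); set q := cIm (cexp (a + b)).
have c1 : (1 + cRe (D N)) @[N --> \oo] --> (1 + 0 : R).
  by apply: cvgD; [exact: cvg_cst|exact: D1].
split.
  have -> : (fun N => cRe (wavsum N.+1 a b x)) =
      (fun N => (1 + cRe (D N)) * p - cIm (D N) * q).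
    by apply/funext => N; rewrite eT ReM ReD ImD add0r.
  have ep : p = (1 + 0) * p - 0 * q by ring.
  rewrite {2}ep.
  by apply: cvgB; apply: cvgM => //; exact: cvg_cst.
have -> : (fun N => cIm (wavsum N.+1 a b x)) =
    (fun N => (1 + cRe (D N)) * q + cIm (D N) * p).
  by apply/funext => N; rewrite eT ImM ReD ImD add0r.
have eq : q = (1 + 0) * q + 0 * p by ring.
rewrite {2}eq.
by apply: cvgD; apply: cvgM => //; exact: cvg_cst.
Qed.

Lemma wav_cvg0 a x A : normc a <= A -> `|x| <= A ^+ 2 ->
  (normc (wav N a x) @[N --> \oo] --> 0).
Proof.
move=> aA xA; apply/cvgr0Pnorm_le => e e0.
have u0 : expR (A ^+ 2) * exp_coeff A N @[N --> \oo] --> 0.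
  rewrite -(mulr0 (expR (A ^+ 2))); apply: cvgMr; apply: cvg_series_cvg_0.
  exact: is_cvg_series_exp_coeff.
have /cvgr0Pnorm_le/(_ e e0) := u0; apply: filterS => N; apply: le_trans.
rewrite ger0_norm ?normc_ge0//; apply: le_trans (ler_norm _).
by apply: le_trans (wav_le _ aA xA) _; rewrite /exp_coeff.
Qed.

End bessel_series.

(** * Functionals on Lipschitz functions and their Laplace transforms *)

Section lipschitz_functionals.
Context {R : realType}.
Variable M : R.
Implicit Types (f g : R -> R) (s t C : R) (L : (R -> R) -> R).

(** One constant bounds both the values and the slopes, and only the open interval counts, as
    densities do not see the rest. *)
Definition lipC C f := (forall t, - M < t < M -> `|f t| <= C) /\
  (forall s t, - M < s < M -> - M < t < M -> `|f s - f t| <= C * `|s - t|).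
Definition lip f := exists C, lipC C f.

(* Continuity along bounded sequences of Lipschitz functions that converge
   pointwise; this is what is left of a bounded functional on H^(1/2). *)
Definition lipfun L :=
  (forall a f g, lip f -> lip g -> L (fun t => a * f t + g t) = a * L f + L g) /\
  (forall C (F : nat -> R -> R) f, (forall n, lipC C (F n)) ->
    (forall t, - M < t < M -> F n t @[n --> \oo] --> f t) ->
    L (F n) @[n --> \oo] --> L f).

Lemma lipC_le C D f : C <= D -> lipC C f -> lipC D f.
Proof.
move=> CD [h1 h2]; split=> [t tM|s t sM tM]; first exact: (le_trans (h1 t tM)).
by apply: (le_trans (h2 s t sM tM)); rewrite ler_wpM2r.
Qed.

Lemma lipC_cst c : lipC `|c| (fun=> c).
Proof. by split=> // s t _ _; rewrite subrr normr0 mulr_ge0. Qed.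

Lemma lipCD C D f g : lipC C f -> lipC D g -> lipC (C + D) (fun t => f t + g t).
Proof.
move=> [f1 f2] [g1 g2]; split=> [t tM|s t sM tM].
  by rewrite (le_trans (ler_normD _ _))// lerD// ?f1 ?g1.
rewrite opprD addrACA (le_trans (ler_normD _ _))// mulrDl.
by rewrite lerD ?f2 ?g2.
Qed.

Lemma lipCZ C a f : lipC C f -> lipC (`|a| * C) (fun t => a * f t).
Proof.
move=> [f1 f2]; split=> [t tM|s t sM tM]; first by rewrite normrM ler_wpM2l ?f1.
by rewrite -mulrBr normrM -mulrA ler_wpM2l ?f2.
Qed.

Lemma lipCM C D f g : lipC C f -> lipC D g -> lipC (2 * C * D) (fun t => f t * g t).
Proof.
move=> [f1 f2] [g1 g2]; split=> [t tM|s t sM tM].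
  have h1 := f1 t tM; have h2 := g1 t tM.
  have C0 := le_trans (normr_ge0 _) h1; have D0 := le_trans (normr_ge0 _) h2.
  rewrite normrM; apply: (@le_trans _ _ (C * D)); first by rewrite ler_pM.
  by rewrite -mulrA ler_peMl ?mulr_ge0// ler1n.
have h1 := f1 t tM; have h2 := g1 s sM.
have C0 := le_trans (normr_ge0 _) h1; have D0 := le_trans (normr_ge0 _) h2.
have -> : f s * g s - f t * g t = (f s - f t) * g s + f t * (g s - g t) by ring.
have -> : 2 * C * D * `|s - t| = (C * `|s - t|) * D + C * (D * `|s - t|) by ring.
rewrite (le_trans (ler_normD _ _))// !normrM lerD// ler_pM ?f2 ?g2//.
Qed.

Lemma lipD f g : lip f -> lip g -> lip (fun t => f t + g t).
Proof. by move=> [C hf] [D hg]; exists (C + D); exact: lipCD. Qed.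
Lemma lipZ a f : lip f -> lip (fun t => a * f t).
Proof. by move=> [C hf]; exists (`|a| * C); exact: lipCZ. Qed.
Lemma lipM f g : lip f -> lip g -> lip (fun t => f t * g t).
Proof. by move=> [C hf] [D hg]; exists (2 * C * D); exact: lipCM. Qed.
Lemma lip_cst c : lip (fun=> c).
Proof. by exists `|c|; exact: lipC_cst. Qed.

Lemma lip_sum (I : Type) (s : seq I) (F : I -> R -> R) : (forall i, lip (F i)) ->
  lip (fun t => \sum_(i <- s) F i t).
Proof.
move=> hF; elim: s => [|i s ih].
  by rewrite (_ : (fun _ => _) = fun=> 0); [exact: lip_cst|apply/funext => t; rewrite big_nil].
rewrite (_ : (fun _ => _) = fun t => F i t + \sum_(i <- s) F i t); first exact: lipD.
by apply/funext => t; rewrite big_cons.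
Qed.

Lemma lipC_der C f df : (forall t, - M < t < M -> der f t (df t)) ->
  (forall t, - M < t < M -> `|f t| <= C) -> (forall t, - M < t < M -> `|df t| <= C) ->
  lipC C f.
Proof.
move=> hd h1 h2; split=> // s t /andP[s1 s2] /andP[t1 t2].
have bt x : Num.min t s <= x <= Num.max t s -> - M < x < M.
  by move=> /andP[]; rewrite ge_min le_max => /orP[] ? /orP[] ?; apply/andP; split; lra.
by apply: (@mvt_le _ f df) => x /bt; [exact: hd|exact: h2].
Qed.

Lemma lipC_ext C f g : (forall t, - M < t < M -> f t = g t) -> lipC C f -> lipC C g.
Proof.
move=> e [h1 h2]; split=> [t tM|s t sM tM]; first by rewrite -e// h1.
by rewrite -!e// h2.
Qed.

Section functional.
Variable L : (R -> R) -> R.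
Hypothesis hL : lipfun L.

(** The constant sequence f also converges to g on the open interval, so continuity gives the
    equality. *)
Lemma lipfun_ext f g : lip f -> (forall t, - M < t < M -> f t = g t) -> L f = L g.
Proof.
move=> [C hf] e; have := hL.2 C (fun=> f) g (fun=> hf).
move=> H; have {}H : L f @[n --> \oo] --> L g.
  by apply: H => t tM; rewrite e//; exact: cvg_cst.
by apply: (cvg_unique _ _ H) => //; exact: cvg_cst.
Qed.

Lemma lipfun0 : L (fun=> 0) = 0.
Proof.
have := hL.1 (-1) (fun=> 0) (fun=> 0) (lip_cst 0) (lip_cst 0).
have -> : (fun _ : R => -1 * 0 + 0) = (fun=> 0 : R) by apply/funext => t; ring.
by move=> ->; ring.
Qed.

Lemma lipfunD f g : lip f -> lip g -> L (fun t => f t + g t) = L f + L g.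
Proof.
move=> hf hg; have := hL.1 1 f g hf hg; rewrite mul1r => <-.
by congr L; apply/funext => t; rewrite mul1r.
Qed.

Lemma lipfunZ a f : lip f -> L (fun t => a * f t) = a * L f.
Proof.
move=> hf; have := hL.1 a f (fun=> 0) hf (lip_cst 0); rewrite lipfun0 addr0 => <-.
by congr L; apply/funext => t; rewrite addr0.
Qed.

Lemma lipfunB f g : lip f -> lip g -> L (fun t => f t - g t) = L f - L g.
Proof.
move=> hf hg; have -> : (fun t => f t - g t) = (fun t => f t + -1 * g t).
  by apply/funext => t; rewrite mulN1r.
by rewrite lipfunD ?lipfunZ ?mulN1r//; exact: lipZ.
Qed.

Lemma lipfun_sum (I : Type) (s : seq I) (F : I -> R -> R) : (forall i, lip (F i)) ->
  L (fun t => \sum_(i <- s) F i t) = \sum_(i <- s) L (F i).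
Proof.
move=> hF; elim: s => [|i s ih].
  rewrite big_nil -[RHS]lipfun0; congr L; apply/funext => t; exact: big_nil.
rewrite big_cons -ih -lipfunD//; last exact: lip_sum.
by congr L; apply/funext => t; rewrite big_cons.
Qed.

(** Otherwise there are functions F_n of constant 1 with |L F_n| > n + 1; the functions F_n / (n +
    1) then tend to 0 with constants at most 1, which contradicts sequential continuity. *)
Lemma lipfun_bound : exists2 B, 0 <= B & forall C f, lipC C f -> 0 <= C -> `|L f| <= B * C.
Proof.
apply: contrapT => hn.
have {}hn n : exists f, lipC 1 f /\ n%:R + 1 < `|L f|.
  apply: contrapT => h; apply: hn; exists (n%:R + 1); first by rewrite addr_ge0.
  move=> C f hf C0; have [e|Cn0] := eqVneq C 0.
    have : L f = 0.
      rewrite -lipfun0; apply: lipfun_ext; first by exists C.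
      move=> t tM; apply/eqP; rewrite -normr_le0; apply: le_trans (hf.1 t tM) _.
      by rewrite e.
    by move=> ->; rewrite normr0 mulr_ge0// addr_ge0.
  rewrite leNgt; apply/negP => lt; apply: h; exists (fun t => C^-1 * f t); split.
    have := lipCZ C^-1 hf; rewrite ger0_norm ?invr_ge0// mulVf//.
  rewrite lipfunZ; last by exists C.
  rewrite normrM ger0_norm ?invr_ge0// mulrC ltr_pdivlMr//.
  by rewrite lt_neqAle eq_sym Cn0.
have /choice[F hF] := hn.
have h1 n : lipC 1 (fun t => n.+1%:R^-1 * F n t).
  have := lipCZ n.+1%:R^-1 (hF n).1; apply: lipC_le.
  by rewrite mulr1 ger0_norm ?invr_ge0// invf_le1// ler1n.
have := hL.2 1 (fun n t => n.+1%:R^-1 * F n t) (fun=> 0) h1.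
move=> H; have {}H : L (fun t => n.+1%:R^-1 * F n t) @[n --> \oo] --> L (fun=> 0).
  apply: H => t tM; apply/cvgr0Pnorm_le => e e0.
  have := @cvg_harmonic R; move=> /cvgr0Pnorm_le/(_ e e0).
  apply: filterS => n; rewrite /harmonic /= ger0_norm ?invr_ge0// => ne.
  rewrite normrM ger0_norm ?invr_ge0// (le_trans _ ne)// ler_piMr ?invr_ge0//.
  exact: (hF n).1.1.
move: H; rewrite lipfun0 => /cvgr0Pnorm_lt/(_ 1 ltr01)[N _ /(_ N (leqnn _))] /=.
rewrite lipfunZ; last by exists 1; exact: (hF N).1.
rewrite normrM ger0_norm ?invr_ge0// mulrC ltr_pdivrMr// mul1r.
have := (hF N).2; rewrite natr1 => h2 h3; move: (lt_trans h2 h3).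
by rewrite ltxx.
Qed.

End functional.

Lemma lipfunMl L p : lipfun L -> lip p -> lipfun (fun f => L (fun t => p t * f t)).
Proof.
move=> hL hp; split=> [a f g hf hg|C F f hF cF].
  rewrite -(hL.1 a); [|exact: lipM..].
  by congr L; apply/funext => t; ring.
have [D hD] := hp; apply: (hL.2 (2 * D * C)) => [n|t tM]; first exact: lipCM.
by apply: cvgMr; exact: cF.
Qed.

Lemma lipfunB_fun L L' : lipfun L -> lipfun L' -> lipfun (fun f => L f - L' f).
Proof.
move=> hL hL'; split=> [a f g hf hg|C F f hF cF].
  by rewrite hL.1// hL'.1//; ring.
by apply: cvgB; [apply: hL.2 hF cF|apply: hL'.2 hF cF].
Qed.

(* Restriction to the compact segment |t| <= M - 1/(n+1) makes f globally
   Lipschitz without changing its constant. *)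
Lemma lip_approx L f C : 0 < M -> lipfun L -> lipC C f ->
  (forall g, (forall s t, `|g s - g t| <= C * `|s - t|) -> (forall t, `|g t| <= C) -> L g = 0) ->
  L f = 0.
Proof.
move=> M0 hL hf h.
pose m n := M * (1 - n.+2%:R^-1).
have m0 n : 0 < m n.
  by rewrite mulr_gt0// subr_gt0 invf_lt1// ltr1n.
have mM n : m n < M by rewrite gtr_pMr// gtrBl invr_gt0.
pose cl n t := Num.max (- m n) (Num.min t (m n)).
have clM n t : - M < cl n t < M.
  have := m0 n; have := mM n; rewrite /cl; case: (leP t (m n)) => h1; case: (leP (- m n) _) => h2 *;
  apply/andP; split; lra.
have hmin c s t : s <= t -> Num.min s c <= Num.min t c /\ Num.min t c - Num.min s c <= t - s.
  by move=> st; case: (leP t c) => h1; case: (leP s c) => h2; split; lra.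
have hmax c s t : s <= t -> Num.max c s <= Num.max c t /\ Num.max c t - Num.max c s <= t - s.
  by move=> st; case: (leP c t) => h1; case: (leP c s) => h2; split; lra.
have clL n s t : `|cl n s - cl n t| <= `|s - t|.
  wlog st : s t / s <= t.
    move=> H; have [st|/ltW st] := leP s t; first exact: H.
    by rewrite distrC [leRHS]distrC; exact: H.
  have [a1 a2] := hmin (m n) _ _ st; have [b1 b2] := hmax (- m n) _ _ a1.
  rewrite distrC [leRHS]distrC !ger0_norm ?subr_ge0//.
  exact: le_trans b2 a2.
have : L (fun t => f (cl n t)) @[n --> \oo] --> L f.
  apply: (hL.2 C) => [n|t /andP[t1 t2]].
    split=> [t _|s t _ _]; first exact: hf.1.
    apply: (le_trans (hf.2 _ _ (clM n s) (clM n t))).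
    rewrite ler_wpM2l ?clL//; apply: le_trans (hf.1 0 _) => //.
    by rewrite oppr_lt0 M0.
  have e0 : 0 < 1 - `|t| / M.
    by rewrite subr_gt0 ltr_pdivrMr// mul1r ltr_norml t1 t2.
  have := @cvg_harmonic R; move=> /cvgr0Pnorm_lt/(_ _ e0) ev.
  apply: (@cvg_trans _ ((fun=> f t) n @[n --> \oo])); last exact: cvg_cst.
  apply: near_eq_cvg; apply: filterS ev => n; rewrite /harmonic/= ger0_norm ?invr_ge0// => hn.
  congr f; have : `|t| <= m n.
    rewrite -ler_pdivrMl// mulrC lerBrDr -lerBrDl (le_trans _ (ltW hn))//.
    by rewrite lef_pV2 ?posrE ?ltr0n// ler_nat.
  rewrite ler_norml => /andP[a1 a2]; rewrite /cl min_l// max_r//.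
have -> : (fun n => L (fun t => f (cl n t))) = fun=> 0.
  apply/funext => n; apply: h => [s t|t]; last exact: hf.1.
  apply: (le_trans (hf.2 _ _ (clM n s) (clM n t))).
  rewrite ler_wpM2l ?clL//; apply: le_trans (hf.1 0 _) => //.
  by rewrite oppr_lt0 M0.
by move=> H; apply: (cvg_unique _ H) => //; exact: cvg_cst.
Qed.

End lipschitz_functionals.

(** * From the growth of the Laplace transform to the support *)

Section exponential_integral.
Context {R : realType}.
Implicit Types (x l v : R) (n j : nat).

Definition ein_coef : R^nat := fun j =>
  if j is i.+1 then (-1) ^+ i / (i.+1%:R * i.+1`!%:R) else 0.
(* ein x = \int_0^x (1 - exp (- u)) / u du *)
Definition ein x : R := psum ein_coef x.

Lemma ein_coef_le j : `|ein_coef j| * j%:R <= j`!%:R^-1.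
Proof.
case: j => [|i] /=; first by rewrite mulr0 invr_ge0.
rewrite normrM normrX normrN1 expr1n mul1r normfV ger0_norm ?mulr_ge0//.
by rewrite invfM mulrAC mulVf ?pnatr_eq0// mul1r.
Qed.

Lemma ein_entire : entire ein_coef.
Proof.
exists 1 => -[|i] /=; first by rewrite normr0 divr_ge0.
rewrite mul1r; apply: le_trans (ein_coef_le i.+1).
by rewrite ler_peMr// ler1n.
Qed.

Let ein1 x : R := psum (pseries_diffs ein_coef) x.

Lemma ein1E x : x * ein1 x = 1 - expR (- x).
Proof.
have -> : expR (- x) = psum (fun j => (-1) ^+ j / j`!%:R) x.
  rewrite /expR /psum /pseries; congr (limn (series _)); apply/funext => j.
  by rewrite /exp_coeff/= -[in LHS]mulN1r exprMn; ring.
rewrite psum_shift; last first.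
  by exists 1 => j; rewrite normrM normrX normrN1 expr1n mul1r normfV ger0_norm// div1r.
rewrite expr0 fact0 divr1 /ein1.
have -> : psum (fun j => (-1) ^+ j.+1 / j.+1`!%:R) x =
    - psum (pseries_diffs ein_coef) x.
  have -> : (fun j : nat => (-1) ^+ j.+1 / j.+1`!%:R) =
      (fun j => -1 * pseries_diffs ein_coef j) :> (nat -> R).
    apply/funext => j; rewrite /pseries_diffs /ein_coef exprS.
    by field; nz.
  by rewrite psumZ ?mulN1r//; exact: entire_diffs ein_entire.
ring.
Qed.

(** A smooth approximation of max v 0 that is an everywhere convergent power series in e^(l v),
    unlike ln (1 + e^(l v)) / l. A functional controlled on exponentials can therefore be evaluated
    on it term by term. *)
Definition softplus l v := l^-1 * ein (expR (l * v)).

Lemma softplus_der l v : 0 < l -> der (softplus l) v (1 - expR (- expR (l * v))).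
Proof.
move=> l0; rewrite /softplus; eapply der_eq.
  eapply derM; first exact: der_cst.
  eapply der_comp; first exact: (psum_der _ ein_entire).
  by der_auto.
rewrite /= -ein1E /ein1; field; nzt.
Qed.

Lemma ein0 : ein 0 = 0. Proof. by rewrite /ein (psum0 ein_entire). Qed.

Lemma ein_ge0 x : 0 <= x -> 0 <= ein x.
Proof.
move=> x0; rewrite -ein0.
apply: (@der_ge0_le _ ein ein1) => // y.
- by move=> _; apply: der_continuous; exact: (psum_der _ ein_entire).
- by move=> _; exact: (psum_der _ ein_entire).
move=> /andP[y0 _]; rewrite -(pmulr_rge0 _ y0) ein1E subr_ge0.
by rewrite -[leRHS]expR0 ler_expR oppr_le0 ltW.
Qed.

Lemma softplus_cvg l v : 0 < l ->
  `|softplus l v - Num.max v 0| <= (ein 1 + 1) / l.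
Proof.
move=> l0; have e1 : 0 <= ein 1 by exact: ein_ge0.
have sc y : {for y, continuous (softplus l)} by exact: der_continuous (softplus_der y l0).
have s0 : softplus l 0 = ein 1 / l by rewrite /softplus mulr0 expR0 mulrC.
have B1 : (ein 1 + 1) / l = ein 1 / l + 1 / l by rewrite mulrDl.
have li0 : 0 < l^-1 by rewrite invr_gt0.
have e1l : 0 <= ein 1 / l by rewrite mulr_ge0// ltW.
have [v0|v0] := leP v 0.
  rewrite subr0 ger0_norm; last first.
    by rewrite mulr_ge0 ?(ltW li0)// ein_ge0// expR_ge0.
  apply: (@le_trans _ _ (softplus l 0)); last by rewrite s0 B1 lerDl mulr_ge0// ltW.
  have := @der_ge0_le _ (softplus l) (fun y => 1 - expR (- expR (l * y))) v 0 v0; apply.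
  - by move=> y _; exact: sc.
  - by move=> y _; exact: softplus_der.
  - by move=> y _; rewrite subr_ge0 -[leRHS]expR0 ler_expR oppr_le0 expR_ge0.
(* For v > 0 both bounds come from the derivative e^(- e^(l y)) of y - softplus, which lies between
   0 and e^(- l y). *)
have d1 (y : R) : der (fun y => y - softplus l y) y (expR (- expR (l * y))).
  eapply der_eq; first by eapply derD; [exact: der_id|eapply derN; exact: softplus_der].
  by ring.
have d2 (y : R) : der (fun y => softplus l y - y - expR (- (l * y)) / l) y
    (expR (- (l * y)) - expR (- expR (l * y))).
  eapply der_eq.
    eapply derD.
      by eapply derD; [exact: softplus_der|eapply derN; exact: der_id].
    by der_auto.
  by rewrite /=; field; nzt.
have h1 : 0 - softplus l 0 <= v - softplus l v.
  have := @der_ge0_le _ _ _ 0 v (ltW v0) (fun y _ => der_continuous (d1 y)) (fun y _ => d1 y).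
  by apply => y _; exact: expR_ge0.
have h2 : softplus l 0 - 0 - expR (- (l * 0)) / l <= softplus l v - v - expR (- (l * v)) / l.
  have := @der_ge0_le _ _ _ 0 v (ltW v0) (fun y _ => der_continuous (d2 y)) (fun y _ => d2 y).
  apply => y _; rewrite subr_ge0 ler_expR lerN2.
  by apply: le_trans (expR_ge1Dx _); rewrite lerDr.
have h3 : 0 <= expR (- (l * v)) / l by rewrite mulr_ge0 ?expR_ge0// ltW.
move: h1 h2; rewrite mulr0 oppr0 expR0 s0 ler_norml B1 => h1 h2.
apply/andP; split; lra.
Qed.

End exponential_integral.

Lemma cvg_norm_le (R : realType) (u : R^nat) (l B : R) : u @ \oo --> l ->
  (forall n, `|u n| <= B) -> `|l| <= B.
Proof.
move=> cu hB; have cN : (fun n => `|u n|) @ \oo --> `|l| by exact: cvg_norm.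
rewrite -(cvg_lim _ cN)//; apply: limr_le; first by apply/cvg_ex; eexists; exact: cN.
exact: nearW.
Qed.

Section laplace.
Context {R : realType}.
Variables (M : R) (L : (R -> R) -> R).
Hypotheses (M_gt0 : 0 < M) (hL : lipfun M L).
Variables (t0 C D : R).
Hypothesis L_exp : forall s, 0 < s ->
  `|L (fun t => expR (s * (t - t0)))| <= C * (1 + s) * expR (s * D).
Implicit Types (s t l : R) (n N : nat).

Let C_ge0 : 0 <= C.
Proof.
have := L_exp ltr01 => /(le_trans (normr_ge0 _)).
by rewrite pmulr_lge0 ?expR_gt0// pmulr_lge0.
Qed.

Lemma lip_exp a b : lip M (fun t => expR (a * (t - b))).
Proof.
pose E := expR (`|a| * (M + `|b|)).
have hE t : - M < t < M -> expR (a * (t - b)) <= E.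
  move=> tM; rewrite ler_expR (le_trans (ler_norm _))// normrM ler_wpM2l//.
  rewrite (le_trans (ler_normB _ _))// lerD2r ltW//.
  by rewrite ltr_norml.
exists (`|a| * E + E); apply: (@lipC_der _ _ _ _ (fun t => expR (a * (t - b)) * a)).
- by move=> t _; der; ring.
- move=> t tM; rewrite ger0_norm ?expR_ge0//; apply: le_trans (hE t tM) _.
  by rewrite lerDr mulr_ge0 ?expR_ge0.
- move=> t tM; rewrite normrM ger0_norm ?expR_ge0// mulrC.
  apply: (@le_trans _ _ (`|a| * E)); first by rewrite ler_wpM2l// hE.
  by rewrite lerDl expR_ge0.
Qed.

(** The hypothesis on L is applied with exponent j l to the j-th term of the series. The absence of
    a constant term is essential: every remaining term carries a factor at most e^(- l (s - t0 -
    D)). *)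
Lemma laplace_softplus s l : 1 <= l -> t0 + D < s ->
  `|L (fun t => softplus l (t - s))| <= 2 * C * expR 1 * expR (- (l * (s - t0 - D))).
Proof.
move=> l1 sD; have l0 : 0 < l by exact: lt_le_trans l1.
pose y t := expR (l * (t - s)).
pose S N t := \sum_(j < N) (l^-1 * ein_coef j * expR (- (j%:R * l * (s - t0))))
    * expR (j%:R * l * (t - t0)).
have SE N t : S N t = l^-1 * \sum_(j < N) ein_coef j * y t ^+ j.
  rewrite /S mulr_sumr; apply: eq_bigr => j _.
  rewrite -!mulrA; congr (_ * (_ * _)); rewrite -expRD /y -expRM_natl; congr expR.
  by ring.
pose Y := expR (l * (M + `|s|)).
have yY t : - M < t < M -> 0 <= y t <= Y.
  move=> /andP[_ tM]; rewrite /y expR_ge0 ler_expR ler_pM2l//=.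
  by have := ler_norm (- s); rewrite normrN; lra.
have csum N t (c : nat -> R) : - M < t < M -> (forall j, `|c j| <= j`!%:R^-1) ->
    `|\sum_(j < N) c j * y t ^+ j| <= expR Y.
  move=> tM hc; have /andP[y0 y1] := yY t tM.
  apply: (le_trans (ler_norm_sum _ _ _)).
  apply: (@le_trans _ _ (\sum_(j < N) Y ^+ j / j`!%:R)); last first.
    by apply: expsum_le; exact: expR_ge0.
  apply: ler_sum => j _; rewrite normrM normrX (ger0_norm y0) mulrC.
  by rewrite ler_pM ?exprn_ge0// lerXn2r ?nnegrE// expR_ge0.
have hc j : `|ein_coef j| <= (j`!%:R : R)^-1.
  case: j => [|j]; first by rewrite normr0 invr_ge0.
  by apply: le_trans (ein_coef_le j.+1); rewrite ler_peMr// ler1n.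
(* Continuity of L needs a constant independent of N; for the derivative this rests on j |c_j| <= 1
   / j!, where c_j is the j-th coefficient of [ein]. *)
have lipS N : lipC M (expR Y) (S N).
  pose dS t := \sum_(j < N) (ein_coef j * j%:R) * y t ^+ j.
  apply: (@lipC_der _ _ _ _ dS).
  - move=> t _; rewrite /S /dS; eapply der_eq.
      eapply der_sum => j; eapply derM; first exact: der_cst.
      by eapply der_expR; der_auto.
    apply: eq_bigr => j _; rewrite /= /y -expRM_natl.
    have -> : expR (j%:R * l * (t - t0)) = expR (j%:R * l * (s - t0)) * expR (j%:R * (l * (t - s))).
      by rewrite -expRD; congr expR; ring.
    rewrite expRN; set E := expR (_ * (s - t0)); have E0 : E != 0 by rewrite gt_eqF ?expR_gt0.
    by field; rewrite E0 gt_eqF.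
  - move=> t tM; rewrite SE normrM ger0_norm ?invr_ge0 ?(ltW l0)//.
    by rewrite (le_trans _ (csum N t _ tM hc))// ler_piMl// invf_le1.
  - move=> t tM; apply: (csum N t (fun j => ein_coef j * j%:R) tM) => j.
    by rewrite normrM normr_nat ein_coef_le.
have cS t : S N t @[N --> \oo] --> softplus l (t - s).
  have -> : (fun N => S N t) = (fun N => l^-1 * pseries ein_coef (y t) N).
    by apply/funext => N; rewrite SE /pseries /series/= big_mkord.
  rewrite /softplus -/(y t) /ein /psum; apply: cvgMr.
  by apply: psum_cvg; exact: ein_entire.
have cLS := hL.2 (expR Y) S _ lipS (fun t _ => cS t).
set B := 2 * C * expR 1 * _.
have LS N : `|L (S N)| <= B.
  rewrite /S (lipfun_sum hL); last by move=> j; apply: lipZ; exact: lip_exp.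
  apply: (le_trans (ler_norm_sum _ _ _)).
  (* The 2 bounds (1 + j l) / (j l), because j l >= 1, and the sum of the 1 / j! will give the
     factor e. *)
  apply: (@le_trans _ _ (\sum_(j < N) (2 * C * expR (- (l * (s - t0 - D)))) * (1 ^+ j / j`!%:R))).
    apply: ler_sum => j _; rewrite (lipfunZ hL); last exact: lip_exp.
    case: j => -[|j] jN /=.
      by rewrite mulr0 !mul0r normr0 !mulr_ge0 ?expR_ge0.
    set x := j.+1%:R; have x1 : 1 <= x by rewrite /x ler1n.
    have x0 : 0 < x by exact: lt_le_trans x1.
    have xl0 : 0 < x * l by rewrite mulr_gt0.
    rewrite normrM; apply: (le_trans (ler_wpM2l _ (L_exp xl0))) => //.
    rewrite !normrM normfV (ger0_norm (ltW l0)) (ger0_norm (expR_ge0 _)).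
    rewrite expr1n mul1r.
    have -> : `|(-1) ^+ j| * `|(x * j.+1`!%:R)^-1| = x^-1 / j.+1`!%:R.
      by rewrite normrX normrN1 expr1n mul1r ger0_norm ?invr_ge0 ?mulr_ge0// ?ltW// invfM.
    have -> : l^-1 * (x^-1 / j.+1`!%:R) * expR (- (x * l * (s - t0)))
        * (C * (1 + x * l) * expR (x * l * D)) =
        C * ((1 + x * l) / (x * l)) * expR (- (x * (l * (s - t0 - D)))) / j.+1`!%:R.
      have -> : expR (- (x * (l * (s - t0 - D)))) = expR (- (x * l * (s - t0))) * expR (x * l * D).
        by rewrite -expRD; congr expR; ring.
      by field; rewrite factE_neq0 !gt_eqF.
    rewrite ler_wpM2r ?invr_ge0//; apply: ler_pM.
    - by rewrite mulr_ge0// mulr_ge0 ?invr_ge0 ?addr_ge0// ltW.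
    - exact: expR_ge0.
    - have h : 1 <= x * l by rewrite -[leLHS]mulr1 ler_pM.
      by rewrite [2 * C]mulrC ler_wpM2l// ler_pdivrMr//; lra.
    - rewrite ler_expR lerN2 ler_peMl// mulr_ge0 ?(ltW l0)//.
      by rewrite -addrA -opprD subr_ge0 ltW.
  rewrite -mulr_sumr /B [leRHS]mulrAC ler_wpM2l ?expsum_le//.
  by rewrite !mulr_ge0 ?expR_ge0.
exact: cvg_norm_le cLS LS.
Qed.

(** As l grows, [softplus l] tends to the hinge with bounded Lipschitz constants, while the bound of
    [laplace_softplus] tends to 0. *)
Lemma laplace_hinge s : t0 + D < s -> L (fun t => Num.max (t - s) 0) = 0.
Proof.
move=> sD; pose K := M + `|s| + ein 1 + 1.
have e1 := @ein_ge0 R 1 ler01.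
have hmx t : - M < t < M -> `|Num.max (t - s) 0| <= M + `|s|.
  move=> tM; have : `|t - s| <= M + `|s|.
    by rewrite (le_trans (ler_normB _ _))// lerD2r ltW// ltr_norml.
  by case: (leP (t - s) 0) => // _ _; rewrite normr0 addr_ge0// ltW.
have lipS n : lipC M K (fun t => softplus n.+1%:R (t - s)).
  have n0 : 0 < n.+1%:R :> R by rewrite ltr0n.
  apply: (@lipC_der _ _ _ _ (fun t => 1 - expR (- expR (n.+1%:R * (t - s))))).
  - move=> t _; eapply der_eq.
      by eapply (@der_comp _ (softplus n.+1%:R)); [exact: softplus_der|der_auto].
    by rewrite /=; ring.
  - move=> t tM; have h := softplus_cvg (t - s) n0.
    rewrite -[softplus _ _](subrK (Num.max (t - s) 0)) (le_trans (ler_normD _ _))//.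
    rewrite addrC /K -addrA lerD ?hmx// (le_trans h)//.
    by rewrite ler_pdivrMr// ler_peMr ?addr_ge0// ler1n.
  - move=> t tM; rewrite ger0_norm; last first.
      by rewrite subr_ge0 -[leRHS]expR0 ler_expR oppr_le0 expR_ge0.
    apply: (@le_trans _ _ 1); first by rewrite lerBlDr lerDl expR_ge0.
    by rewrite /K lerDr !addr_ge0// ltW.
have cS t : - M < t < M -> softplus n.+1%:R (t - s) @[n --> \oo] --> Num.max (t - s) 0.
  move=> _; apply/cvgrPdist_le => e e0.
  have u0 : (ein 1 + 1) * harmonic n @[n --> \oo] --> (0 : R).
    by rewrite -(mulr0 (ein 1 + 1)); apply: cvgMr; exact: cvg_harmonic.
  have /cvgr0Pnorm_le/(_ e e0) := u0; apply: filterS => n; apply: le_trans.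
  rewrite distrC; apply: le_trans (ler_norm _).
  by apply: softplus_cvg; rewrite ltr0n.
have cL := hL.2 K _ _ lipS cS.
have d0 : 0 < s - t0 - D by rewrite -addrA -opprD subr_gt0.
have L0 : L (fun t => softplus n.+1%:R (t - s)) @[n --> \oo] --> 0.
  apply/cvgr0Pnorm_le => e e0.
  pose B := 2 * C * expR 1 * (s - t0 - D)^-1.
  have u0 : B * harmonic n @[n --> \oo] --> (0 : R).
    by rewrite -(mulr0 B); apply: cvgMr; exact: cvg_harmonic.
  have /cvgr0Pnorm_le/(_ e e0) := u0; apply: filterS => n; apply: le_trans.
  apply: le_trans (ler_norm _); apply: (le_trans (laplace_softplus _ sD)).
    by rewrite ler1n.
  rewrite /B -[leRHS]mulrA ler_wpM2l ?mulr_ge0 ?expR_ge0// /harmonic/= expRN -invfM.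
  have pos : 0 < n.+1%:R * (s - t0 - D) by rewrite mulr_gt0// ltr0n.
  rewrite lef_pV2 ?posrE ?expR_gt0//; last by rewrite mulrC.
  by rewrite mulrC; apply: le_trans (expR_ge1Dx _); rewrite lerDr.
exact: (cvg_unique _ cL L0).
Qed.

End laplace.

Definition glip {R : realType} (K : R) (f : R -> R) := forall s t, `|f s - f t| <= K * `|s - t|.

Section vanishing.
Context {R : realType}.
Implicit Types (f g : R -> R) (a s t K M C D : R) (L : (R -> R) -> R).

Let h (u : R) := Num.max u 0.
Let hmono u v : u <= v -> 0 <= h v - h u /\ h v - h u <= v - u.
Proof. by move=> uv; rewrite /h; case: (leP u 0) => ?; case: (leP v 0) => ?; split; lra. Qed.
Let hmono2 d u v : 0 <= d -> u <= v -> 0 <= (h v - h (v - d)) - (h u - h (u - d)).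
Proof.
move=> d0 uv; rewrite /h; case: (leP u 0) => ?; case: (leP v 0) => ?;
 case: (leP (u - d) 0) => ?; case: (leP (v - d) 0) => ?; lra.
Qed.

Lemma glip_mono K f : (forall s t, s <= t -> `|f t - f s| <= K * (t - s)) -> glip K f.
Proof.
move=> hf s t; have [st|/ltW ts] := leP s t.
  by rewrite distrC [`|s - t|]distrC (@ger0_norm _ (t - s)) ?subr_ge0// hf.
by rewrite (@ger0_norm _ (s - t)) ?subr_ge0// hf.
Qed.

Lemma glip_ge0 K f : glip K f -> 0 <= K.
Proof.
by move=> /(_ 1 0); rewrite subr0 normr1 mulr1; apply: le_trans.
Qed.

Lemma glip_lipC M K f : 0 < M -> glip K f -> lipC M (K * M + `|f 0| + K) f.
Proof.
move=> M0 hf; have K0 := glip_ge0 hf; split=> [t tM|s t _ _].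
  rewrite -[f t](subrK (f 0)) (le_trans (ler_normD _ _))//.
  rewrite -addrA lerD//; last by rewrite lerDl.
  by rewrite (le_trans (hf _ _))// subr0 ler_wpM2l// ltW// ltr_norml.
apply: (le_trans (hf s t)); rewrite ler_wpM2r// lerDr.
by rewrite addr_ge0// mulr_ge0// ltW.
Qed.

Lemma glip_lip M K f : 0 < M -> glip K f -> lip M f.
Proof. by move=> M0 hf; eexists; exact: glip_lipC M0 hf. Qed.

Lemma glipD K K' f g : glip K f -> glip K' g -> glip (K + K') (fun t => f t + g t).
Proof.
move=> hf hg s t; rewrite opprD addrACA (le_trans (ler_normD _ _))// mulrDl.
by rewrite lerD.
Qed.

Lemma glipN K f : glip K f -> glip K (fun t => - f t).
Proof. by move=> hf s t; rewrite -opprD normrN. Qed.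

Lemma glip_hinge s : glip 1 (fun t => h (t - s)).
Proof.
move=> x y; rewrite mul1r; wlog xy : x y / x <= y.
  by move=> H; have [xy|/ltW yx] := leP x y; [exact: H|rewrite distrC [leRHS]distrC; exact: H].
have xy' : x - s <= y - s by rewrite lerD2r.
have [h0 h1] := hmono xy'; rewrite distrC [leRHS]distrC (ger0_norm h0) ger0_norm ?subr_ge0//.
by apply: le_trans h1 _; rewrite opprB addrA subrK.
Qed.

(* The piecewise linear interpolants of f are sums of hinges. *)
Lemma hinge_vanish M L (a a' : R) : 0 < M -> lipfun M L -> a < a' ->
  (forall s, a < s -> L (fun t => h (t - s)) = 0) ->
  forall K f, glip K f -> (forall t, t <= a' -> f t = 0) -> L f = 0.
Proof.
move=> M0 hL aa' L0 K f hf f0; have K0 := glip_ge0 hf.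
have lh s : lip M (fun t => h (t - s)) by exact: (glip_lip M0 (@glip_hinge s)).
pose d n : R := n.+1%:R^-1.
have d0 n : 0 < d n by rewrite invr_gt0.
(* Starting the nodes at a' > a makes every hinge used one of those that L annihilates. *)
pose x n (i : nat) := a' + i%:R * d n.
have ax n i : a < x n i.
  by rewrite (lt_le_trans aa')// lerDl mulr_ge0// ltW.
have xS n i : x n i.+1 = x n i + d n by rewrite /x -natr1 mulrDl mul1r addrA.
pose ramp n i t := (d n)^-1 * (h (t - x n i) - h (t - x n i.+1)).
(* Enough nodes of step 1 / (n + 1) for the last one to pass M. *)
pose m n := ((Num.truncn `|(M - a')%R|).+1 * n.+1)%N.
have xm n : M <= x n (m n).
  rewrite /x /m natrM -mulrA mulfV ?pnatr_eq0// mulr1 -lerBlDl ltW//.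
  by apply: le_lt_trans (ler_norm _) _; exact: truncnS_gt.
pose p n t := \sum_(i < m n) (f (x n i.+1) - f (x n i)) * ramp n i t.
have lr n i : lip M (ramp n i).
  apply: lipZ; apply: lipD; first exact: lh.
  rewrite (_ : (fun _ => _) = fun t => -1 * h (t - x n i.+1)); last first.
    by apply/funext => t; rewrite mulN1r.
  exact: lipZ.
have Lr n i : L (ramp n i) = 0.
  rewrite /ramp (lipfunZ hL); last first.
    apply: lipD; first exact: lh.
    rewrite (_ : (fun _ => _) = fun t => -1 * h (t - x n i.+1)); last first.
      by apply/funext => t; rewrite mulN1r.
    exact: lipZ.
  by rewrite (lipfunB hL)// !L0// subrr mulr0.
have Lp n : L (p n) = 0.
  rewrite /p (lipfun_sum hL); last by move=> i; exact: lipZ.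
  by rewrite big1// => i _; rewrite (lipfunZ hL)// Lr mulr0.
(* The increments of the ramps are nonnegative and their weighted sum telescopes to at most t - s,
   so the interpolants keep the constant of f. *)
have glp n : glip K (p n).
  apply: glip_mono => s t st; rewrite /p -sumrB.
  apply: (le_trans (ler_norm_sum _ _ _)).
  pose T i := (h (t - x n i) - h (s - x n i)).
  apply: (@le_trans _ _ (\sum_(i < m n) K * (T i - T i.+1))).
    apply: ler_sum => i _; rewrite -mulrBr normrM.
    have -> : ramp n i t - ramp n i s = (d n)^-1 * (T i - T i.+1).
      by rewrite /ramp /T; ring.
    have T0 : 0 <= T i - T i.+1.
      rewrite /T xS; have st' : s - x n i <= t - x n i by rewrite lerD2r.
      have := hmono2 (ltW (d0 n)) st'; rewrite !opprD !addrA => H.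
      by lra.
    rewrite (@normrM _ (d n)^-1) (ger0_norm T0) (@ger0_norm _ (d n)^-1) ?invr_ge0 ?(ltW (d0 n))// mulrA.
    rewrite ler_wpM2r// ler_pdivrMr//; apply: (le_trans (hf _ _)).
    by rewrite xS addrAC subrr add0r ger0_norm// ltW.
  rewrite -mulr_sumr ler_wpM2l// -(big_mkord xpredT (fun i => T i - T i.+1)).
  rewrite (_ : \sum_(0 <= i < m n) (T i - T i.+1) = T 0%N - T (m n)); last first.
    rewrite -[RHS]opprB -(telescope_sumr T (leq0n _)) -sumrN.
    by apply: eq_bigr => i _; rewrite opprB.
  have st0 i : s - x n i <= t - x n i by rewrite lerD2r.
  have [_ e1] := hmono (st0 0%N); have [e2 _] := hmono (st0 (m n)).
  by rewrite lerBlDr; move: e1 e2; rewrite -/(T 0%N) -/(T (m n)) => e1 e2; lra.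
have p0 n t : t <= a' -> p n t = 0.
  move=> ta; rewrite /p big1// => i _.
  have xa j : t - x n j <= 0.
    by rewrite subr_le0 (le_trans ta)// lerDl mulr_ge0// ltW.
  by rewrite /ramp /h !max_r// subrr !mulr0.
have cp t : - M < t < M -> p n t @[n --> \oo] --> f t.
  move=> /andP[_ tM]; have [ta|at'] := leP t a'.
    by rewrite f0//; under eq_fun do rewrite p0//; exact: cvg_cst.
  apply/cvgrPdist_le => e e0.
  have u0 : 2 * K * harmonic n @[n --> \oo] --> (0 : R).
    by rewrite -(mulr0 (2 * K)); apply: cvgMr; exact: cvg_harmonic.
  have /cvgr0Pnorm_le/(_ e e0) := u0; apply: filterS => n; apply: le_trans.
  apply: le_trans (ler_norm _).
  pose j := Num.truncn ((t - a') / d n).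
  have td0 : 0 <= (t - a') / d n by rewrite mulr_ge0 ?invr_ge0 ?subr_ge0 ?ltW.
  have /andP[j1 j2] := truncn_itv td0; rewrite -/j in j1 j2.
  have xj1 : x n j <= t.
    by rewrite /x -lerBrDl -ler_pdivlMr.
  have xj2 : t < x n j + d n.
    rewrite -xS /x -ltrBlDl -ltr_pdivrMr//.
  have jm : (j <= m n)%N.
    rewrite leqNgt; apply/negP => mj.
    have : x n (m n) <= x n j by rewrite lerD2l ler_wpM2r ?(ltW (d0 n))// ler_nat ltnW.
    by move=> /(le_trans (xm n)) /le_trans/(_ xj1); rewrite leNgt tM.
  have pj : p n (x n j) = f (x n j).
    rewrite /p -(big_mkord xpredT (fun i => (f (x n i.+1) - f (x n i)) * ramp n i (x n j))).
    rewrite (big_cat_nat (leq0n j) jm)//= [X in _ + X]big_nat_cond [X in _ + X]big1 ?addr0; last first.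
      move=> i /andP[/andP[ji _] _].
      have ex i' : (j <= i')%N -> x n j - x n i' <= 0.
        by move=> h'; rewrite subr_le0 lerD2l ler_wpM2r ?(ltW (d0 n))// ler_nat.
      by rewrite /ramp /h !max_r ?ex// ?subrr ?mulr0// (leq_trans ji).
    have fx0 : f (x n 0%N) = 0 by apply: f0; rewrite /x mul0r addr0.
    rewrite -[RHS]subr0 -[X in _ = _ - X]fx0.
    rewrite -(telescope_sumr (fun i => f (x n i)) (leq0n j)).
    rewrite big_nat_cond [RHS]big_nat_cond; apply: eq_bigr => i /andP[/andP[_ ij] _].
    have ex i' : (i' <= j)%N -> 0 <= x n j - x n i'.
      by move=> h'; rewrite subr_ge0 lerD2l ler_wpM2r ?(ltW (d0 n))// ler_nat.
    rewrite /ramp /h !max_l ?ex// 1?ltnW// xS.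
    have -> : x n j - x n i - (x n j - (x n i + d n)) = d n by ring.
    by rewrite mulVf ?mulr1// gt_eqF.
  rewrite -[f t](subrK (f (x n j))) -addrA -[in X in _ + X]pj (le_trans (ler_normD _ _))//.
  have -> : 2 * K * harmonic n = K * d n + K * d n by rewrite /harmonic/= -/(d n); ring.
  have td : `|t - x n j| <= d n by rewrite ger0_norm ?subr_ge0// lerBlDl ltW.
  rewrite lerD//; first by rewrite (le_trans (hf _ _))// ler_wpM2l.
  by rewrite (le_trans (glp n _ _))// distrC ler_wpM2l.
have lipp n : lipC M (K * M + K * (M + `|a'|) + K) (p n).
  apply: lipC_le (glip_lipC M0 (glp n)); rewrite lerD2r lerD2l.
  have [a0|a0] := leP 0 a'; first by rewrite p0// normr0 mulr_ge0// addr_ge0// ltW.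
  have ep := p0 n a' (lexx _); rewrite -[p n 0]subr0 -[X in _ - X]ep (le_trans (glp n _ _))//.
  by rewrite sub0r normrN ler_wpM2l// lerDr ltW.
have := hL.2 _ p f lipp cp; under eq_fun do rewrite Lp.
by move=> H; apply: (cvg_unique _ H) => //; exact: cvg_cst.
Qed.

Lemma laplace_right M L (t0 : R) C D a : 0 < M -> lipfun M L ->
  (forall s, 0 < s -> `|L (fun t => expR (s * (t - t0)))| <= C * (1 + s) * expR (s * D)) ->
  t0 + D < a -> forall K f, glip K f -> (forall t, t <= a -> f t = 0) -> L f = 0.
Proof.
move=> M0 hL he Da; apply: (hinge_vanish M0 hL Da) => s.
exact: (laplace_hinge M0 hL he).
Qed.

Lemma lipfun_opp M L : lipfun M L -> lipfun M (fun f => L (fun t => f (- t))).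
Proof.
move=> hL; have IN t : - M < t < M -> - M < - t < M.
  by move=> /andP[t1 t2]; apply/andP; split; lra.
have lN C f : lipC M C f -> lipC M C (fun t => f (- t)).
  move=> [h1 h2]; split=> [t tM|s t sM tM]; first by rewrite h1// IN.
  by rewrite (le_trans (h2 _ _ (IN _ sM) (IN _ tM)))// -opprD normrN.
split=> [b f g [C hf] [D hg]|C F f hF cF].
  by apply: hL.1; [exists C; exact: lN|exists D; exact: lN].
by apply: (hL.2 C) => [n|t tM]; [exact: lN|exact: cF (IN _ tM)].
Qed.

(** Since f t0 = 0, f is the sum of its parts to the right and to the left of t0. The right part
    falls under [laplace_right], and so does the left one after reflection. *)
Lemma laplace_two_sided M L (t0 : R) C D (D' : R) : 0 < M -> lipfun M L ->
  (forall s, `|L (fun t => expR (s * (t - t0)))| <= C * (1 + `|s|) * expR (`|s| * D)) ->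
  D < D' -> 0 <= D' -> forall K f, glip K f -> (forall t, `|t - t0| <= D' -> f t = 0) -> L f = 0.
Proof.
move=> M0 hL he DD' D'0 K f hf f0; have K0 := glip_ge0 hf.
have e1 s : 0 < s -> `|L (fun t => expR (s * (t - t0)))| <= C * (1 + s) * expR (s * D).
  by move=> s0; have := he s; rewrite (gtr0_norm s0).
have hL' := lipfun_opp hL.
have e2 s : 0 < s -> `|L (fun t => expR (s * (- t - - t0)))| <= C * (1 + s) * expR (s * D).
  move=> s0; have := he (- s); rewrite normrN (gtr0_norm s0).
  by congr (`|L _| <= _); apply/funext => t; congr expR; ring.
pose f1 t := f (Num.max t t0); pose f2 t := f (Num.min t t0).
have g1 : glip K f1.
  move=> s t; rewrite (le_trans (hf _ _))// ler_wpM2l//.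
  wlog st : s t / s <= t.
    by move=> H; have [xy|/ltW yx] := leP s t; [exact: H|rewrite distrC [leRHS]distrC; exact: H].
  rewrite distrC [leRHS]distrC ger0_norm ?ger0_norm; case: (leP s t0); case: (leP t t0); lra.
have g2 : glip K (fun t => f2 (- t)).
  move=> s t; rewrite (le_trans (hf _ _))// ler_wpM2l//.
  wlog st : s t / s <= t.
    by move=> H; have [xy|/ltW yx] := leP s t; [exact: H|rewrite distrC [leRHS]distrC; exact: H].
  rewrite [leRHS]distrC ger0_norm ?ger0_norm; case: (leP (- s) t0); case: (leP (- t) t0); lra.
have L1 : L f1 = 0.
  apply: (laplace_right M0 hL e1 (a := t0 + D')) g1 _; first by rewrite ltrD2l.
  move=> t tD; apply: f0; case: (leP t t0) => tt; first by rewrite subrr normr0.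
  by rewrite gtr0_norm ?subr_gt0// lerBlDl.
have L2 : L f2 = 0.
  have -> : f2 = fun t => f2 (- - t) by apply/funext => t; rewrite opprK.
  apply: (laplace_right M0 hL' e2 (a := - t0 + D')) g2 _; first by rewrite ltrD2l.
  move=> t tD; apply: f0; case: (leP (- t) t0) => tt; last by rewrite subrr normr0.
  by rewrite ler0_norm ?subr_le0//; lra.
have ft0 : f t0 = 0 by apply: f0; rewrite subrr normr0.
have -> : f = fun t => f1 t + f2 t.
  apply/funext => t; rewrite /f1 /f2; case: (leP t t0) => _; rewrite ft0 ?add0r ?addr0//.
rewrite (lipfunD hL) ?L1 ?L2 ?addr0//; first exact: glip_lip M0 g1.
suff : glip K f2 by exact: glip_lip M0.
by move=> s t; have := g2 (- s) (- t); rewrite !opprK => H; rewrite (le_trans H)// addrC distrC.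
Qed.

End vanishing.

Section clamp.
Context {R : realType}.
Implicit Types (D u v s t b C : R).

(** The projection onto [- D, D]. Composing with it is how functions are cut off while remaining
    Lipschitz. *)
Definition clamp D u : R := Num.max (- D) (Num.min u D).

Lemma clamp_le D u : 0 <= D -> `|clamp D u| <= D.
Proof.
by move=> D0; rewrite /clamp ler_norml; by rewrite le_max lexx ge_max ge_min lexx orbT /= andbT; lra.
Qed.

Lemma clamp_id D u : `|u| <= D -> clamp D u = u.
Proof. by rewrite ler_norml /clamp => /andP[h1 h2]; rewrite min_l// max_r. Qed.

Lemma clamp_mono D u v : 0 <= D -> u <= v ->
  clamp D u <= clamp D v /\ clamp D v - clamp D u <= v - u.
Proof.
move=> D0 uv; rewrite /clamp.
have hmin : Num.min u D <= Num.min v D /\ Num.min v D - Num.min u D <= v - u.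
  by case: (leP u D) => h1; case: (leP v D) => h2; split; lra.
move: hmin; move: (Num.min u D) (Num.min v D) => x y [xy yx].
by case: (leP (- D) x) => h1; case: (leP (- D) y) => h2; split; lra.
Qed.

Lemma glip_clamp (g dg : R -> R) D b C : 0 <= D -> 0 <= C -> (forall u, der g u (dg u)) ->
  (forall u, `|u| <= D -> `|dg u| <= C) -> glip C (fun t => g (clamp D (t - b))).
Proof.
move=> D0 C0 hg hC; apply: glip_mono => s t st.
have sb : s - b <= t - b by rewrite lerD2r.
have [h1 h2] := clamp_mono D0 sb.
apply: (@le_trans _ _ (C * `|clamp D (t - b) - clamp D (s - b)|)); last first.
  by rewrite ler_wpM2l// ger0_norm ?subr_ge0//; apply: le_trans h2 _; rewrite opprB addrA subrK.
have := @mvt_le _ g dg C _ _ (fun u _ => hg u); apply => u.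
rewrite min_l// max_r// => /andP[u1 u2]; apply: hC.
have := clamp_le (s - b) D0; have := clamp_le (t - b) D0.
by rewrite !ler_norml => /andP[a1 a2] /andP[a3 a4]; apply/andP; split; lra.
Qed.

End clamp.

(** * Differentiating a functional along a parameter *)

Section sequential_derivative.
Context {R : realType}.
Implicit Types (f : R -> R) (x l : R).

Let quotientE f x (y : R) : y^-1 *: ((f \o shift x) (y *: 1) - f x) = (f (x + y) - f x) / y.
Proof.
by rewrite /= -[_ *: _]/(_ * _) -[y *: 1]/(y * 1) mulr1 addrC [y + x]addrC mulrC addrC.
Qed.

Lemma der_seq f x l :
  (forall u : R^nat, (forall n, u n != 0) -> u @ \oo --> 0 ->
    (f (x + u n) - f x) / u n @[n --> \oo] --> l) ->
  der f x l.
Proof.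
move=> h.
have cd : (fun y => y^-1 *: ((f \o shift x) (y *: 1) - f x)) @ 0^' --> l.
  by apply/cvgr_dnbhsP => u [u0 cu]; under eq_fun do rewrite quotientE; exact: h.
apply: DeriveDef; first by apply/cvg_ex; exists l.
exact: cvg_lim cd.
Qed.

Lemma der_quotient f x l (u : R^nat) : der f x l -> (forall n, u n != 0) -> u @ \oo --> 0 ->
  (f (x + u n) - f x) / u n @[n --> \oo] --> l.
Proof.
move=> [df dl] u0 cu.
have cd : (fun y => y^-1 *: ((f \o shift x) (y *: 1) - f x)) @ 0^' --> l.
  by rewrite -dl; exact: df.
have /cvgr_dnbhsP/(_ u (conj u0 cu)) := cd.
by under eq_fun do rewrite quotientE.
Qed.

(** By the mean value inequality in h, the difference quotients of F are Lipschitz in t with the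
    constant of [dF], so sequential continuity of L applies to them. *)
Lemma der_lipfun (M : R) (L : (R -> R) -> R) (F dF : R -> R -> R) (h0 e C : R) :
  lipfun M L -> 0 < e ->
  (forall h t, `|h - h0| <= e -> - M < t < M -> der (fun h => F h t) h (dF h t)) ->
  (forall h, `|h - h0| <= e -> lipC M C (dF h)) ->
  (forall h, lip M (F h)) ->
  der (fun h => L (F h)) h0 (L (dF h0)).
Proof.
move=> hL e0 hF hC hl; apply: der_seq => u u0 cu.
have h0e : `|h0 - h0| <= e by rewrite subrr normr0 ltW.
(* For the finitely many n with u n too large the quotient is replaced by its limit, so that the
   constant C holds for all n. *)
pose Q n t := if `|u n| <= e then (F (h0 + u n) t - F h0 t) / u n else dF h0 t.
have inter n h : `|u n| <= e -> Num.min h0 (h0 + u n) <= h <= Num.max h0 (h0 + u n) -> `|h - h0| <= e.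
  rewrite !ler_norml => /andP[u1 u2].
  by case: (leP h0 (h0 + u n)) => h1 /andP[h2 h3]; apply/andP; split; lra.
have lQ n : lipC M C (Q n).
  rewrite /Q; case: (boolP (`|u n| <= e)) => [un|_]; last exact: hC.
  have un0 : 0 < `|u n| by rewrite normr_gt0.
  split=> [t tM|s t sM tM].
    rewrite normrM normfV ler_pdivrMr//.
    have := @mvt_le _ (fun h => F h t) (fun h => dF h t) C h0 (h0 + u n).
    rewrite [h0 + u n - h0]addrC addKr; apply=> h /(inter n h un) hh; first exact: hF.
    exact: (hC h hh).1.
  rewrite -mulrBl normrM normfV ler_pdivrMr//.
  have := @mvt_le _ (fun h => F h s - F h t) (fun h => dF h s - dF h t) (C * `|s - t|) h0 (h0 + u n).
  rewrite [h0 + u n - h0]addrC addKr => H.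
  have -> : F (h0 + u n) s - F h0 s - (F (h0 + u n) t - F h0 t) =
    F (h0 + u n) s - F (h0 + u n) t - (F h0 s - F h0 t) by ring.
  apply: H => h /(inter n h un) hh; last exact: (hC h hh).2.
  by eapply derD; [exact: hF|eapply derN; exact: hF].
have ev : \forall n \near \oo, `|u n| <= e by exact: (cvgr0_norm_le _ cu).
have cQ t : - M < t < M -> Q n t @[n --> \oo] --> dF h0 t.
  move=> tM; have := der_quotient (hF h0 t h0e tM) u0 cu.
  apply: cvg_trans; apply: near_eq_cvg; apply: filterS ev => n un.
  by rewrite /Q un.
have := hL.2 C Q _ lQ cQ; apply: cvg_trans; apply: near_eq_cvg; apply: filterS ev => n un.
rewrite /Q un.
have -> : (fun t => (F (h0 + u n) t - F h0 t) / u n) = fun t => (u n)^-1 * (F (h0 + u n) t - F h0 t).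
  by apply/funext => t; rewrite mulrC.
rewrite (lipfunZ hL) ?(lipfunB hL) 1?mulrC//.
rewrite (_ : (fun _ => _) = fun t => F (h0 + u n) t + -1 * F h0 t); last first.
  by apply/funext => t; rewrite mulN1r.
by apply: lipD => //; exact: lipZ.
Qed.

End sequential_derivative.

(** * Supports of functionals *)

Section supports.
Context {R : realType}.
Variable M : R.
Hypothesis M_gt0 : 0 < M.
Implicit Types (L : (R -> R) -> R) (f g : R -> R) (K C D b s t e : R).

(** A way to say that the support of L, as a distribution, lies in [b - D, b + D]. *)
Definition kills L b D := forall K f, glip K f -> (forall t, `|t - b| <= D -> f t = 0) -> L f = 0.

Lemma kills_start L b D : lipfun M L -> M + `|b| <= D -> kills L b D.
Proof.
move=> hL MD K f hf f0; rewrite -(lipfun0 hL); apply: (lipfun_ext hL).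
  exact: glip_lip M_gt0 hf.
move=> t tM; apply: f0; apply: le_trans MD; rewrite (le_trans (ler_normB _ _))// lerD2r.
by rewrite ltW// ltr_norml.
Qed.

(** Clamping at radius D alters g only off the support of L, so only the size of g and g' on
    [- D, D] matters. A preliminary clamp at the larger radius [E], harmless on the crack, makes g
    globally Lipschitz. *)
Lemma kills_bound L b D : lipfun M L -> kills L b D -> 0 <= D ->
  exists2 B, 0 <= B & forall (g dg : R -> R) C, (forall u : R, der g u (dg u)) -> (forall u : R, cnt dg u) ->
    (forall u, `|u| <= D -> `|g u| <= C) -> (forall u, `|u| <= D -> `|dg u| <= C) ->
    `|L (fun t => g (t - b))| <= B * C.
Proof.
move=> hL hk D0; have [B B0 hB] := lipfun_bound hL; exists B => // g dg C hg cdg h1 h2.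
pose E := M + `|b| + D.
have E0 : 0 <= E by rewrite !addr_ge0// ltW.
have DE : D <= E by rewrite /E lerDr addr_ge0// ltW.
have C0 : 0 <= C by apply: le_trans (h1 0 _); rewrite ?normr0.
have [C' hC'] := @compact_bound R dg (- E) E (fun u _ => cdg u).
have hE : glip (Num.max 0 C') (fun t => g (clamp E (t - b))).
  apply: (glip_clamp _ E0 _ hg); first by rewrite le_max lexx.
  by move=> u; rewrite ler_norml => /hC' h; rewrite le_max h orbT.
have hD : glip C (fun t => g (clamp D (t - b))) by exact: (glip_clamp _ D0 C0 hg).
have -> : L (fun t => g (t - b)) = L (fun t => g (clamp E (t - b))).
  apply/esym/(lipfun_ext hL); first exact: glip_lip M_gt0 hE.
  move=> t tM; rewrite clamp_id// (le_trans (ler_normB _ _))// /E.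
  by rewrite -[leLHS]addr0 lerD// lerD2r ltW// ltr_norml.
have -> : L (fun t => g (clamp E (t - b))) = L (fun t => g (clamp D (t - b))).
  apply/eqP; rewrite -subr_eq0 -(lipfunB hL); [|exact: glip_lip M_gt0 hE|exact: glip_lip M_gt0 hD].
  apply/eqP; apply: (hk _ _ (glipD hE (glipN hD))) => t tD.
  by rewrite !clamp_id ?subrr// (le_trans tD).
apply: hB => //; split=> [t _|s t _ _]; first by apply: h1; exact: clamp_le.
exact: hD.
Qed.

(** The component [sn] of the second direction enters only through a bounded cosine, so on the
    support of L' the wave grows no faster than e^(|s| |c| D): the Laplace transform of L around b
    grows as if its support had radius |c| D. *)
Lemma kills_step L L' b b' D D' (c sn : R) (k : R) : lipfun M L -> lipfun M L' ->
  c ^+ 2 + sn ^+ 2 = 1 -> 0 <= k ->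
  (forall s, L (fun t => expR (s * (t - b))) =
     L' (fun t => expR (s * (c * (t - b'))) * cos (Num.sqrt (s ^+ 2 + k ^+ 2) * (sn * (t - b'))))) ->
  kills L' b' D -> 0 <= D -> `|c| * D < D' -> kills L b D'.
Proof.
move=> hL hL' csn k0 he hk D0 cD; have [B B0 hB] := kills_bound hL' hk D0.
have D'0 : 0 <= D' by apply: le_trans (ltW cD); rewrite mulr_ge0.
have c1 : `|c| <= 1.
  by rewrite -(ler_pXn2r (_ : 0 < 2)%N) ?nnegrE// expr1n real_normK ?num_real//; nra.
have s1 : `|sn| <= 1.
  by rewrite -(ler_pXn2r (_ : 0 < 2)%N) ?nnegrE// expr1n real_normK ?num_real//; nra.
(* Besides the exponential, the derivative of the wave has the factor |s| + eta <= 2 |s| + k, which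
   is at most (2 + k) (1 + |s|). *)
apply: (laplace_two_sided (C := B * (2 + k)) M_gt0 hL _ cD D'0) => s; rewrite he.
set eta := Num.sqrt _.
have eta0 : 0 <= eta by exact: sqrtr_ge0.
have etaS : eta <= `|s| + k.
  rewrite -(ler_pXn2r (_ : 0 < 2)%N) ?nnegrE ?addr_ge0//.
  rewrite /eta sqr_sqrtr ?addr_ge0 ?sqr_ge0// sqrrD real_normK ?num_real//.
  have : 0 <= `|s| * k by rewrite mulr_ge0.
  by move=> ?; lra.
pose g u := expR (s * (c * u)) * cos (eta * (sn * u)).
pose dg u := expR (s * (c * u)) * (s * c) * cos (eta * (sn * u))
   - expR (s * (c * u)) * sin (eta * (sn * u)) * (eta * sn).
have E u : `|u| <= D -> expR (s * (c * u)) <= expR (`|s| * (`|c| * D)).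
  move=> uD; rewrite ler_expR (le_trans (ler_norm _))// !normrM.
  by rewrite !ler_wpM2l.
have cosb x : `|cos x| <= 1 :> R by rewrite ler_norml cos_geN1 cos_le1.
have sinb x : `|sin x| <= 1 :> R by rewrite ler_norml sin_geN1 sin_le1.
rewrite -!mulrA; apply: (hB g dg).
- by move=> u; rewrite /g /dg; eapply der_eq; [der_auto|rewrite /=; ring].
- by move=> u; rewrite /dg; cnt_auto.
- move=> u uD; rewrite normrM ger0_norm ?expR_ge0// -[leLHS]mulr1.
  have := E u uD; set x := expR _; set y := expR _ => xy.
  have x0 : 0 <= x by exact: expR_ge0.
  apply: (@le_trans _ _ y); first by rewrite mulr1 -[leRHS]mulr1 ler_pM.
  rewrite mulrA ler_peMl ?expR_ge0//.
  by have : 0 <= `|s| by []; nra.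
- move=> u uD; have := E u uD; rewrite /dg; set x := expR _; set y := expR _ => xy.
  have x0 : 0 <= x by exact: expR_ge0.
  have y0 : 0 <= y by exact: expR_ge0.
  rewrite (le_trans (ler_normB _ _))// !normrM (ger0_norm x0) (ger0_norm eta0).
  have a1 : `|s| * `|c| * `|cos (eta * (sn * u))| <= `|s|.
    by rewrite -mulrA ler_piMr// mulr_ile1.
  have a2 : `|sin (eta * (sn * u))| * (eta * `|sn|) <= `|s| + k.
    rewrite mulrCA; apply: le_trans etaS; rewrite ler_piMr// mulr_ile1//.
  apply: (@le_trans _ _ (x * (`|s| + (`|s| + k)))).
    by rewrite mulrDr lerD// -!mulrA ler_wpM2l// mulrA.
  apply: (@le_trans _ _ (y * (`|s| + (`|s| + k)))).
    by rewrite ler_wpM2r// !addr_ge0.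
  rewrite mulrC mulrA ler_wpM2r//.
  by have : 0 <= `|s| by []; nra.
Qed.

Lemma two_cracks L L' b b' (c sn : R) (k : R) : lipfun M L -> lipfun M L' ->
  c ^+ 2 + sn ^+ 2 = 1 -> sn != 0 -> 0 <= k ->
  (forall s, L (fun t => expR (s * (t - b))) =
     L' (fun t => expR (s * (c * (t - b'))) * cos (Num.sqrt (s ^+ 2 + k ^+ 2) * (sn * (t - b'))))) ->
  (forall s, L' (fun t => expR (s * (t - b'))) =
     L (fun t => expR (s * (c * (t - b))) * cos (Num.sqrt (s ^+ 2 + k ^+ 2) * (sn * (t - b))))) ->
  forall e, 0 < e -> kills L b e.
Proof.
move=> hL hL' csn sn0 k0 h1 h2 e e0.
have c1 : `|c| < 1.
  rewrite -(ltr_pXn2r (_ : 0 < 2)%N) ?nnegrE// expr1n real_normK ?num_real//.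
  by have : 0 < sn ^+ 2 by [rewrite exprn_even_gt0]; lra.
(* A ratio strictly between |c| and 1, because [kills_step] only reaches radii strictly larger than
   |c| times the old one. *)
pose rho := (1 + `|c|) / 2; pose D0 := M + `|b| + `|b'|.
have rho0 : 0 < rho by rewrite /rho divr_gt0// ltr_pwDl.
have rho1 : rho < 1 by rewrite /rho; lra.
have cr : `|c| < rho by rewrite /rho; lra.
have D00 : 0 < D0 by rewrite /D0 -addrA ltr_pwDl// addr_ge0.
have kn n : kills L b (rho ^+ n * D0) /\ kills L' b' (rho ^+ n * D0).
  elim: n => [|n [ih1 ih2]].
    rewrite expr0 mul1r; split; apply: kills_start => //; first by rewrite lerDl.
    by rewrite /D0 addrAC lerDl.
  have Dn0 : 0 < rho ^+ n * D0 by rewrite mulr_gt0// exprn_gt0.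
  have Dn : `|c| * (rho ^+ n * D0) < rho ^+ n.+1 * D0.
    by rewrite exprS -mulrA ltr_pM2r.
  by split; [apply: (kills_step hL hL' csn k0 h1 ih2)|apply: (kills_step hL' hL csn k0 h2 ih1)] => //;
    exact: ltW.
have r1 : `|rho| < 1 by rewrite ger0_norm ?(ltW rho0).
have : D0 * rho ^+ n @[n --> \oo] --> (0 : R).
  by rewrite -(mulr0 D0); apply: cvgMr; exact: cvg_expr r1.
move=> /cvgr0Pnorm_le/(_ _ e0)[N _ /(_ N (leqnn N))] /=.
rewrite ger0_norm; last by rewrite mulr_ge0 ?exprn_ge0// ltW.
rewrite mulrC => Ne K f hf f0; apply: ((kn N).1 K f hf) => t tN.
by apply: f0; exact: le_trans Ne.
Qed.

(** The Laplace bound holds with C = 0, so L annihilates every Lipschitz function that vanishes up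
    to [a], a point to the left of the crack. Subtracting a constant brings g into this class, and
    the constants are handled by a ramp. *)
Lemma exp_kills L : lipfun M L -> (forall s, 0 < s -> L (fun t => expR (s * t)) = 0) ->
  forall f, lip M f -> L f = 0.
Proof.
move=> hL he f [C hf]; apply: (lip_approx M_gt0 hL hf) => g hg _.
have {}hg : glip C g by [].
pose a := - M - 1.
have r := @laplace_right R M L 0 0 (a - 1) a M_gt0 hL.
have {}r K h : glip K h -> (forall t, t <= a -> h t = 0) -> L h = 0.
  apply: r; last by rewrite add0r ltrBlDr ltrDl.
  by move=> s s0; under eq_fun do rewrite subr0; rewrite he// normr0 !mul0r.
have mx s t (x : R) : s <= t -> Num.max s x <= Num.max t x /\ Num.max t x - Num.max s x <= t - s.
  by move=> st; case: (leP t x) => h1; case: (leP s x) => h2; split; lra.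
have mn s t (x : R) : s <= t -> Num.min s x <= Num.min t x /\ Num.min t x - Num.min s x <= t - s.
  by move=> st; case: (leP t x) => h1; case: (leP s x) => h2; split; lra.
have g1 : glip C (fun t => g (Num.max t a) - g a).
  apply: glip_mono => s t st; rewrite opprB addrA subrK (le_trans (hg _ _))// ler_wpM2l ?(glip_ge0 hg)//.
  by have [h1 h2] := mx s t a st; rewrite ger0_norm ?subr_ge0.
have h0 : glip 1 (fun t => Num.min (Num.max t a - a) 1).
  apply: glip_mono => s t st; rewrite mul1r.
  have [h1 h2] := mx s t a st; have h1' : Num.max s a - a <= Num.max t a - a by rewrite lerD2r.
  have [h3 h4] := mn _ _ 1 h1'; rewrite ger0_norm ?subr_ge0//.
  lra.
(* The ramp of [h0] vanishes up to a and equals 1 on ]- M, M[, since a = - M - 1. *)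
have L1 : L (fun=> 1) = 0.
  rewrite -(r _ _ h0); last by move=> t ta; rewrite max_r// subrr min_l.
  apply/esym/(lipfun_ext hL); first exact: glip_lip M_gt0 h0.
  by move=> t /andP[tM _]; rewrite /a max_l ?min_r//; lra.
have Lg : L (fun t => g (Num.max t a) - g a) = 0.
  by apply: (r _ _ g1) => t ta; rewrite max_r// subrr.
have -> : L g = L (fun t => g a * 1 + (g (Num.max t a) - g a)).
  apply: (lipfun_ext hL); first exact: glip_lip M_gt0 hg.
  by move=> t /andP[tM _]; rewrite max_l /a; [ring|lra].
by rewrite (hL.1 (g a) (fun=> 1)) ?Lg ?L1 ?mulr0 ?addr0//; [exact: lip_cst|exact: glip_lip M_gt0 g1].
Qed.

(* A point has zero H^(1/2)-capacity, i.e. a bounded functional does not charge it. *)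
Definition diffuse L := forall b, exists G : nat -> R -> R,
  [/\ forall n, exists K, glip K (G n), forall n, G n b = 1 & L (G n) @[n --> \oo] --> 0].

Lemma kills_point L b : lipfun M L -> (forall e, 0 < e -> kills L b e) ->
  forall K f, glip K f -> f b = 0 -> L f = 0.
Proof.
move=> hL hk K f hf fb; have K0 := glip_ge0 hf.
(* Soft thresholding: it annihilates the values of size at most e, moves no value by more than e and
   does not increase Lipschitz constants. As f b = 0, the thresholded f vanishes near b. *)
pose th e (x : R) := x - clamp e x.
have thL e : 0 <= e -> glip 1 (th e).
  move=> e0; apply: glip_mono => s t st; rewrite /th mul1r.
  by have [h1 h2] := clamp_mono e0 st; rewrite ger0_norm; lra.
pose u n := (K + 1) * harmonic n.
have u0 n : 0 <= u n by rewrite mulr_ge0 ?addr_ge0 ?invr_ge0.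
have thf n : glip K (fun t => th (u n) (f t)).
  move=> s t; apply: le_trans (hf s t); have := thL _ (u0 n) (f s) (f t).
  by rewrite mul1r.
have L0 n : L (fun t => th (u n) (f t)) = 0.
  apply: (hk (harmonic n) _ K) => //; first by rewrite invr_gt0.
  move=> t tn; rewrite /th clamp_id ?subrr// -[f t]subr0 -fb (le_trans (hf _ _))//.
  by rewrite /u ler_pM// lerDl.
have [C0 hC0] : exists C0, forall n, lipC M C0 (fun t => th (u n) (f t)).
  exists (K * M + `|f 0| + K) => n; apply: lipC_le (glip_lipC M_gt0 (thf n)).
  rewrite lerD2r lerD2l; have := thL _ (u0 n) (f 0) 0.
  by rewrite mul1r subr0 /th [clamp _ 0]clamp_id ?normr0// !subr0.
have cf t : - M < t < M -> th (u n) (f t) @[n --> \oo] --> f t.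
  move=> _; apply/cvgrPdist_le => e e0.
  have : u n @[n --> \oo] --> (0 : R).
    by rewrite -(mulr0 (K + 1)); apply: cvgMr; exact: cvg_harmonic.
  move=> /cvgr0Pnorm_le/(_ e e0); apply: filterS => n; apply: le_trans.
  rewrite /th opprB addrC subrK (le_trans (clamp_le _ (u0 n)))//.
  exact: ler_norm.
have := hL.2 _ _ _ hC0 cf; under eq_fun do rewrite L0.
by move=> H; apply: (cvg_unique _ H) => //; exact: cvg_cst.
Qed.

(** By [kills_point], L is a multiple of the evaluation at b; the functions [G n], with value 1 at b
    and L (G n) tending to 0, make that multiple 0. *)
Lemma diffuse_kills L b : lipfun M L -> diffuse L -> (forall e, 0 < e -> kills L b e) ->
  forall f, lip M f -> L f = 0.
Proof.
move=> hL hd hk; have kp := kills_point hL hk.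
have glip_cst (c : R) : glip 0 (fun=> c) by move=> s t; rewrite subrr normr0 mul0r.
have LE K f : glip K f -> L f = f b * L (fun=> 1).
  move=> hf; have := kp _ _ (glipD hf (glipN (glip_cst (f b)))) (subrr _).
  rewrite (lipfunB hL); [|exact: glip_lip M_gt0 hf|exact: lip_cst].
  move=> /eqP; rewrite subr_eq0 => /eqP ->.
  by rewrite -(lipfunZ hL); [congr L; apply/funext => t; rewrite mulr1|exact: lip_cst].
have L1 : L (fun=> 1) = 0.
  have [G [gG Gb cG]] := hd b.
  have LG n : L (G n) = L (fun=> 1) by have [K /LE ->] := gG n; rewrite Gb mul1r.
  move: cG; under eq_fun do rewrite LG; move=> H.
  by apply: (cvg_unique _ _ H) => //; exact: cvg_cst.
by move=> f [C hf]; apply: (lip_approx M_gt0 hL hf) => g /LE -> _; rewrite L1 mulr0.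
Qed.

(** The functional f |-> L ((q1 t + q2) f) vanishes by [exp_kills]. Away from its zero b the affine
    factor can be divided out, so L is carried by the point b, which a diffuse functional does not
    charge. *)
Lemma affine_exp_kills L (q1 q2 : R) : lipfun M L -> diffuse L -> (q1 != 0) || (q2 != 0) ->
  (forall s, 0 < s -> L (fun t => (q1 * t + q2) * expR (s * t)) = 0) ->
  forall f, lip M f -> L f = 0.
Proof.
move=> hL hd q0 he.
have lid : lip M (fun t => t : R).
  exists (M + 1); split=> [t tM|s t _ _]; first by rewrite ler_wpDr// ltW// ltr_norml.
  by rewrite ler_peMl// lerDr ltW.
have lq : lip M (fun t => q1 * t + q2) by apply: lipD; [exact: lipZ|exact: lip_cst].
have kq := exp_kills (lipfunMl hL lq) he.
have [q10|q10] := eqVneq q1 0.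
  move=> f hf; have := kq _ hf; rewrite q10 in q0 *.
  under eq_fun do rewrite mul0r add0r; rewrite (lipfunZ hL)// => /eqP.
  by move: q0; rewrite eqxx/= mulf_eq0 => /negPf-> /= /eqP.
pose b := - q2 / q1; apply: (diffuse_kills (b := b)) => // e e0 K f hf f0.
have K0 := glip_ge0 hf.
have fb : f b = 0 by apply: f0; rewrite subrr normr0 ltW.
have inv (w : R -> R) : (forall t, e <= `|w t|) -> glip 1 w -> lip M (fun t => (w t)^-1).
  move=> we wl; have w0 t : 0 < `|w t| by exact: lt_le_trans (we t).
  have w0' t : w t != 0 by rewrite -normr_gt0.
  exists (e^-1 + e^-1 ^+ 2); split=> [t _|s t _ _].
    by rewrite normfV (@le_trans _ _ e^-1) ?lerDl ?sqr_ge0// lef_pV2 ?posrE.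
  have -> : (w s)^-1 - (w t)^-1 = (w t - w s) * ((w s)^-1 * (w t)^-1).
    by field; rewrite !w0'.
  rewrite !normrM !normfV distrC mulrC; apply: ler_pM => //.
  - apply: (@le_trans _ _ (e^-1 ^+ 2)); last by rewrite lerDr invr_ge0 ltW.
    by rewrite expr2 ler_pM ?invr_ge0// lef_pV2 ?posrE.
  - by have := wl s t; rewrite mul1r.
(* Replacements of t - b on the two sides of b that stay at distance e from 0, so that their
   inverses are Lipschitz. *)
pose w1 t := Num.max (t - b) e; pose w2 t := Num.min (t - b) (- e).
pose f1 t := f (Num.max t b); pose f2 t := f (Num.min t b).
have mx s t (x : R) : s <= t -> Num.max s x <= Num.max t x /\ Num.max t x - Num.max s x <= t - s.
  by move=> st; case: (leP t x) => h1; case: (leP s x) => h2; split; lra.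
have mn s t (x : R) : s <= t -> Num.min s x <= Num.min t x /\ Num.min t x - Num.min s x <= t - s.
  by move=> st; case: (leP t x) => h1; case: (leP s x) => h2; split; lra.
have sb s t : s <= t -> s - b <= t - b by rewrite lerD2r.
have lw1 : lip M (fun t => (w1 t)^-1).
  apply: inv => [t|]; first by rewrite ger0_norm /w1 ?le_max ?lexx ?orbT// (ltW e0) orbT.
  apply: glip_mono => s t st; rewrite mul1r; have [h1 h2] := mx _ _ e (sb _ _ st).
  by rewrite ger0_norm ?subr_ge0//; apply: le_trans h2 _; rewrite opprB addrA subrK.
have lw2 : lip M (fun t => (w2 t)^-1).
  apply: inv => [t|].
    rewrite ler0_norm /w2; first by rewrite lerNr ge_min lexx orbT.
    by rewrite ge_min oppr_le0 (ltW e0) orbT.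
  apply: glip_mono => s t st; rewrite mul1r; have [h1 h2] := mn _ _ (- e) (sb _ _ st).
  by rewrite ger0_norm ?subr_ge0//; apply: le_trans h2 _; rewrite opprB addrA subrK.
have lf1 : lip M f1.
  apply: (glip_lip M_gt0 (K := K)); apply: glip_mono => s t st.
  rewrite (le_trans (hf _ _))// ler_wpM2l//.
  by have [h1 h2] := mx _ _ b st; rewrite ger0_norm ?subr_ge0.
have lf2 : lip M f2.
  apply: (glip_lip M_gt0 (K := K)); apply: glip_mono => s t st.
  rewrite (le_trans (hf _ _))// ler_wpM2l//.
  by have [h1 h2] := mn _ _ b st; rewrite ger0_norm ?subr_ge0.
have := kq (fun t => q1^-1 * (f1 t * (w1 t)^-1 + f2 t * (w2 t)^-1)).
move=> <-; last by apply: lipZ; apply: lipD; exact: lipM.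
congr L; apply/funext => t; rewrite /f1 /f2 /w1 /w2.
have -> : q1 * t + q2 = q1 * (t - b) by rewrite /b; field.
have [te|te] := leP `|t - b| e.
  rewrite (f0 t te) [f (Num.max t b)]f0 ?[f (Num.min t b)]f0 ?mul0r ?addr0 ?mulr0//.
    by case: (leP t b) => // _; rewrite subrr normr0 ltW.
  by case: (leP t b) => // _; rewrite subrr normr0 ltW.
have [tb|tb] := leP t b.
  have tb' : t - b <= 0 by rewrite subr_le0.
  move: te; rewrite ler0_norm// => te; rewrite fb mul0r add0r min_l; last by lra.
  by field; rewrite q10/= ltr0_neq0//; lra.
have tb' : 0 < t - b by rewrite subr_gt0.
move: te; rewrite gtr0_norm// => te; rewrite fb mul0r addr0 max_l ?ltW//.
by field; rewrite q10/= gt_eqF.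
Qed.

(** Eliminating L' leaves sin (eta (a - a')) L(e^(s t)) = 0 with eta = sqrt (s^2 + k^2). If the
    second factor were nonzero at some s0 > 0, the sine would vanish near s0, although its
    derivative in s is nonzero wherever it vanishes. *)
Lemma parallel_kills L L' (a a' k : R) : lipfun M L -> lipfun M L' -> a != a' -> 
  (forall s, cos (Num.sqrt (s ^+ 2 + k ^+ 2) * a) * L (fun t => expR (s * t)) =
             cos (Num.sqrt (s ^+ 2 + k ^+ 2) * a') * L' (fun t => expR (s * t))) ->
  (forall s, sin (Num.sqrt (s ^+ 2 + k ^+ 2) * a) * L (fun t => expR (s * t)) =
             sin (Num.sqrt (s ^+ 2 + k ^+ 2) * a') * L' (fun t => expR (s * t))) ->
  forall f, lip M f -> L f = 0.
Proof.
move=> hL hL' aa' h1 h2; apply: exp_kills => // s0 s00.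
pose P s := L (fun t => expR (s * t)).
pose S s := sin (Num.sqrt (s ^+ 2 + k ^+ 2) * (a - a')).
have SP s : S s * P s = 0.
  have e1 := h1 s; have e2 := h2 s; rewrite /S mulrBr sinB.
  by move: e1 e2; rewrite -/(P s); set c := cos _; set c' := cos _; set x := sin _; set x' := sin _;
    set Q := L' _ => e1 e2; ring: e1 e2.
apply: contrapT => /eqP P0.
have dP : der P s0 (L (fun t => t * expR (s0 * t))).
  pose A := `|s0| + 1; pose E := expR (A * M).
  have A0 : 0 <= A by rewrite addr_ge0.
  have lE (a0 : R) : lip M (fun t => expR (a0 * t)).
    by have := lip_exp M a0 0; under eq_fun do rewrite subr0.
  apply: (der_lipfun hL (e := 1) (C := E * (M + 1 + A * M)) (F := fun s t => expR (s * t)) (dF := fun s t => t * expR (s * t))) => //.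
    by move=> s t _ _; eapply der_eq; [der_auto|rewrite /=; ring].
  move=> s ss.
  have sA : `|s| <= A by rewrite -[s](subrK s0) addrC (le_trans (ler_normD _ _))// lerD2l.
  have hE t : - M < t < M -> expR (s * t) <= E.
    move=> tM; rewrite ler_expR (le_trans (ler_norm _))// normrM ler_pM//.
    by rewrite ltW// ltr_norml.
  have tn t : - M < t < M -> `|t| <= M by move=> tM; rewrite ltW// ltr_norml.
  apply: (@lipC_der _ _ _ _ (fun t => expR (s * t) * (1 + s * t))).
  - by move=> t _; eapply der_eq; [der_auto|rewrite /=; ring].
  - move=> t tM; rewrite normrM mulrC ger0_norm ?expR_ge0// ler_pM ?expR_ge0 ?hE//.
    by rewrite -addrA (le_trans (tn t tM))// lerDl addr_ge0// mulr_ge0// ltW.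
  - move=> t tM; rewrite normrM ger0_norm ?expR_ge0// ler_pM ?expR_ge0 ?hE//.
    rewrite (le_trans (ler_normD _ _))// normr1 normrM lerD//.
      by rewrite lerDr ltW.
    by rewrite ler_pM// tn.
have S0 : \forall s \near s0, S s = 0.
  have := der_continuous dP => /cvgr_neq0/(_ P0); apply: filterS => s Ps.
  by have /eqP := SP s; rewrite mulf_eq0 (negPf Ps) orbF => /eqP.
pose eta := Num.sqrt (s0 ^+ 2 + k ^+ 2).
have q0 : 0 < s0 ^+ 2 + k ^+ 2 by rewrite ltr_pwDl ?sqr_ge0// exprn_gt0.
have eta0 : 0 < eta by rewrite sqrtr_gt0.
have dS : der S s0 (cos (eta * (a - a')) * ((2 * eta)^-1 * (2 * s0) * (a - a'))).
  rewrite /S; eapply der_eq.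
    eapply der_sin; eapply derM; last exact: der_cst.
    by eapply (@der_comp _ Num.sqrt); [exact: is_derive1_sqrt|der_auto].
  by rewrite /= -/eta; ring.
have dS0 : der S s0 0.
  by apply: der_near (der_cst 0 s0); apply: filterS S0 => s ->.
have := der_unique dS dS0 => /eqP; rewrite mulf_eq0.
rewrite !mulf_eq0 invr_eq0 mulf_eq0 subr_eq0 (negPf aa') (gt_eqF s00) (gt_eqF eta0) pnatr_eq0 /= !orbF.
have := nbhs_singleton S0; rewrite /S -/eta => sin0 /eqP cos0.
have := cos2Dsin2 (eta * (a - a')); rewrite sin0 cos0 expr0n/= addr0 => /eqP.
by rewrite eq_sym oner_eq0.
Qed.

End supports.

(** * Functionals on H^(1/2) *)

Section square_integral.
Context d (T : measurableType d) (R : realType).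
Variables (mu : {measure set T -> \bar R}) (D : set T).
Hypothesis mD : measurable D.
Implicit Types F G : T -> R.

Definition isq F : \bar R := (\int[mu]_(x in D) ((F x) ^+ 2)%:E)%E.

Lemma msq F : measurable_fun D F -> measurable_fun D (fun x => (F x ^+ 2)%:E).
Proof. by move=> mF; apply/measurable_EFinP; exact: measurable_funX. Qed.

Lemma isq_ge0 F : (0 <= isq F)%E.
Proof. by apply: integral_ge0 => x _; rewrite lee_fin sqr_ge0. Qed.

Lemma isq_le F G : measurable_fun D F -> measurable_fun D G ->
  (forall x, D x -> `|F x| <= `|G x|) -> (isq F <= isq G)%E.
Proof.
move=> mF mG h; apply: ge0_le_integral => //.
- by move=> x _; rewrite lee_fin sqr_ge0.
- exact: msq.
- exact: msq.
- move=> x Dx; rewrite lee_fin -(real_normK (num_real (F x))) -(real_normK (num_real (G x))).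
  by rewrite lerXn2r ?nnegrE// h.
Qed.

Lemma isqZ (a : R) F : measurable_fun D F -> isq (fun x => a * F x) = ((a ^+ 2)%:E * isq F)%E.
Proof.
move=> mF; rewrite /isq; under eq_integral do rewrite exprMn EFinM.
rewrite ge0_integralZl//; [exact: msq| |by rewrite lee_fin sqr_ge0].
by move=> x _; rewrite lee_fin sqr_ge0.
Qed.

Lemma isq_parallelogram F G : measurable_fun D F -> measurable_fun D G ->
  (isq (fun x => F x - G x)%R + isq (fun x => F x + G x)%R = 2%:E * (isq F + isq G))%E.
Proof.
move=> mF mG.
have s0 H (x : T) : D x -> (0 <= ((H x) ^+ 2 : R)%:E)%E by move=> _; rewrite lee_fin sqr_ge0.
have mB : measurable_fun D (fun x => ((F x - G x) ^+ 2)%:E).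
  by apply: (@msq (fun x => F x - G x)); exact: measurable_funB.
have mS : measurable_fun D (fun x => ((F x + G x) ^+ 2)%:E).
  by apply: (@msq (fun x => F x + G x)); exact: measurable_funD.
rewrite /isq -ge0_integralD//; [|exact: (s0 (fun x => F x - G x))|exact: (s0 (fun x => F x + G x))].
rewrite -[X in _ = (_ * X)%E]ge0_integralD//; [|exact: s0|exact: msq|exact: s0|exact: msq].
rewrite -ge0_integralZl//; last first.
- by move=> x _; rewrite -EFinD lee_fin addr_ge0// sqr_ge0.
- by apply: emeasurable_funD; exact: msq.
by apply: eq_integral => x _; rewrite -!EFinD -EFinM; congr EFin; ring.
Qed.

Lemma isqD_le F G : measurable_fun D F -> measurable_fun D G ->
  (isq (fun x => F x + G x)%R <= 2%:E * (isq F + isq G))%E.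
Proof. by move=> mF mG; rewrite -isq_parallelogram// leeDr// isq_ge0. Qed.

(* Fatou's lemma applied to (F_n + F)^2, together with the parallelogram identity. *)
Lemma isq_cvg (Fn : nat -> T -> R) F : (forall n, measurable_fun D (Fn n)) -> measurable_fun D F ->
  {ae mu, forall x, D x -> Fn n x @[n --> \oo] --> F x} ->
  (forall n, (isq (Fn n) <= isq F)%E) -> (isq F < +oo)%E ->
  forall e : R, 0 < e -> \forall n \near \oo, (isq (fun x => Fn n x - F x)%R <= e%:E)%E.
Proof.
move=> mFn mF [N [mN N0 hN]] le fin e e0.
have mDN : measurable (D `\` N) by exact: measurableD.
pose a n := isq (fun x => Fn n x + F x)%R.
have mS n : measurable_fun D (fun x => ((Fn n x + F x) ^+ 2)%:E).
  by apply: (@msq (fun x => Fn n x + F x)); exact: measurable_funD.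
have fF : isq F \is a fin_num by rewrite ge0_fin_numE// isq_ge0.
pose A : R := 4 * fine (isq F).
have hf : (A%:E <= limn_einf a)%E.
  have := @fatou d T R mu (D `\` N) mDN (fun n x => ((Fn n x + F x) ^+ 2)%:E).
  have -> : (fun n => \int[mu]_(x in D `\` N) ((Fn n x + F x) ^+ 2)%:E)%E = a.
    apply/funext => n; rewrite /a /isq [RHS](ge0_negligible_integral mN mD)//.
    by move=> x _; rewrite lee_fin sqr_ge0.
  move=> H; apply: le_trans; last first.
    apply: H => [n|n x _]; first by apply: measurable_funS (mS n) => // x [].
    by rewrite lee_fin sqr_ge0.
  rewrite le_eqVlt; apply/orP; left; apply/eqP.
  transitivity (\int[mu]_(x in D `\` N) (4%:E * (F x ^+ 2)%:E))%E.
    rewrite ge0_integralZl//; last first.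
    - by move=> x _; rewrite lee_fin sqr_ge0.
    - by apply: measurable_funS (msq mF) => // x [].
    rewrite -(ge0_negligible_integral mN mD)//; last first.
    - by move=> x _; rewrite lee_fin sqr_ge0.
    - exact: msq.
    by rewrite -/(isq F) -(fineK fF) -EFinM.
  apply: eq_integral => x /set_mem[Dx Nx].
  have cx : Fn n x @[n --> \oo] --> F x.
    by apply: contrapT => h; apply: Nx; apply: hN => /= /(_ Dx).
  have cx2 : ((Fn n x + F x) ^+ 2)%:E @[n --> \oo] --> (4 * F x ^+ 2)%:E.
    apply/cvg_EFin; first exact: nearW.
    have -> : 4 * F x ^+ 2 = (F x + F x) * (F x + F x) by ring.
    under eq_fun do rewrite /= expr2.
    by apply: cvgM; apply: cvgD => //; exact: cvg_cst.
  by rewrite -EFinM (cvg_limn_einf_sup cx2).1.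
have fa n : a n \is a fin_num.
  rewrite ge0_fin_numE ?isq_ge0//; apply: (le_lt_trans (isqD_le (mFn n) mF)).
  rewrite -(fineK fF) lte_mul_pinfty// lte_add_pinfty//; last by rewrite ltry.
  by apply: (le_lt_trans (le n)).
have ev : \forall n \near \oo, ((A - e)%:E <= a n)%E.
  have H : ((A - e)%:E < limn_einf a)%E by apply: lt_le_trans hf; rewrite lte_fin ltrBlDr ltrDl.
  have e1 := cvg_lim (@ereal_hausdorff R) (@cvg_einfs_sup R a).
  rewrite limn_einf_lim e1 in H.
  have [_ [m _ <-] hm] := ereal_sup_gt H.
  exists m => // n /= mn; apply: (le_trans (ltW hm)).
  by apply: ereal_inf_lbound; exists n.
apply: filterS ev => n an; have := isq_parallelogram (mFn n) mF.
move=> pe; have fp : isq (fun x => Fn n x - F x) \is a fin_num.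
  rewrite ge0_fin_numE ?isq_ge0//; apply: (@le_lt_trans _ _ (2%:E * (isq (Fn n) + isq F))%E).
    by rewrite -pe leeDl// isq_ge0.
  rewrite -(fineK fF) lte_mul_pinfty// lte_add_pinfty//; last by rewrite ltry.
  by apply: (le_lt_trans (le n)).
have fFn : isq (Fn n) \is a fin_num.
  by rewrite ge0_fin_numE ?isq_ge0//; exact: le_lt_trans (le n) fin.
move: pe an (le n); rewrite -/(a n) -(fineK fp) -(fineK (fa n)) -(fineK fFn) -(fineK fF) -!EFinD -!EFinM.
by move=> [pe]; rewrite !lee_fin /A => h1 h2; lra.
Qed.

End square_integral.

Section measurability.
Context {R : realType}.
Lemma measurable_inv_fun : measurable_fun [set: R] (fun x : R => x^-1).
Proof.
have -> : [set: R] = [set~ 0] `|` [set 0] by rewrite setUC setUv.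
apply/measurable_funU => //; first exact: measurableC.
split; last exact: measurable_fun_set1.
have o0 : open ([set~ 0] : set R).
  by apply: closed_openC; apply: accessible_closed_set1; apply: hausdorff_accessible; exact: Rhausdorff.
apply: open_continuous_measurable_fun; first exact: o0.
by move=> x /set_mem /eqP x0; exact: inv_continuous.
Qed.
End measurability.

Lemma isq_bounded_cvg_ae d (T : measurableType d) (R : realType) (mu : {measure set T -> \bar R})
    (D : set T) (K : R) (Fn : nat -> T -> R) : measurable D -> (mu D < +oo)%E ->
  (forall n, measurable_fun D (Fn n)) -> (forall n x, D x -> `|Fn n x| <= K) ->
  {ae mu, forall x, D x -> Fn n x @[n --> \oo] --> 0} ->
  forall e : R, 0 < e -> \forall n \near \oo, (isq mu D (Fn n) <= e%:E)%E.
Proof.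
move=> mD fD mF hK cF e e0.
have [|||||_ _ cv] := @dominated_convergence _ T R mu D mD (fun n x => ((Fn n x) ^+ 2)%:E) (fun=> 0%E) (fun=> (K ^+ 2)%:E).
- by move=> n; exact: msq.
- exact: measurable_cst.
- apply: filterS cF => x cx Dx; apply/cvg_EFin; first exact: nearW.
  have h : Fn n x * Fn n x @[n --> \oo] --> (0 * 0 : R) by apply: cvgM; exact: cx.
  rewrite mulr0 in h.
  have -> : fine \o (fun n => (Fn n x ^+ 2)%:E) = (fun n => Fn n x * Fn n x).
    by apply/funext => n; rewrite /= expr2.
  exact: h.
- apply/integrableP; split; first exact: measurable_cst.
  by rewrite integral_cst// lte_mul_pinfty//= lee_fin.
- apply: aeW => x n Dx; rewrite gee0_abs ?lee_fin ?sqr_ge0//.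
  by rewrite -real_normK ?num_real// lerXn2r ?nnegrE// ?(le_trans _ (hK n x Dx))// hK.
move: cv; rewrite integral0 => /fine_cvgP[fF cv].
have /cvgr0Pnorm_le/(_ e e0) := cv; apply: filterS2 fF => n f1 f2.
have f1' : isq mu D (Fn n) \is a fin_num by exact: f1.
by rewrite -(fineK f1') lee_fin; exact: le_trans (ler_norm _) f2.
Qed.

Lemma isq_bounded_cvg d (T : measurableType d) (R : realType) (mu : {measure set T -> \bar R})
    (D : set T) (K : R) (Fn : nat -> T -> R) : measurable D -> (mu D < +oo)%E ->
  (forall n, measurable_fun D (Fn n)) -> (forall n x, D x -> `|Fn n x| <= K) ->
  (forall x, D x -> Fn n x @[n --> \oo] --> 0) ->
  forall e : R, 0 < e -> \forall n \near \oo, (isq mu D (Fn n) <= e%:E)%E.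
Proof. by move=> mD fD mF hK cF; apply: (isq_bounded_cvg_ae mD fD mF hK); exact: aeW. Qed.

Section half_space.
Context {R : realType}.
Variable M : R.
Hypothesis M_gt0 : 0 < M.
Implicit Types (f g : R -> R) (a C e : R).

Local Notation leb := (@lebesgue_measure R).
Local Notation I := ([set t : measurableTypeR R | - M < t < M]).
Local Notation leb2 := (leb \x leb)%E.

(** On the diagonal the quotient is 0, by the convention on the inverse of 0. *)
Definition rs f (p : measurableTypeR R * measurableTypeR R) : R := (f p.1 - f p.2) / (p.1 - p.2).
Definition hn2 f := (isq leb I f + isq leb2 (I `*` I) (rs f))%E.
Definition hin f := measurable_fun I f /\ (hn2 f < +oo)%E.

Lemma measurable_II : measurable (I `*` I).
Proof. by apply: measurableX; exact: measurable_I. Qed.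

Lemma leb_I : leb I = (2 * M)%:E.
Proof.
have -> : I = `]- M, M[%classic by apply/seteqP; split => t; rewrite /= in_itv.
have MM : - M < M by move: M_gt0 => ?; lra.
rewrite lebesgue_measure_itv /= lte_fin MM.
by rewrite -EFinD; congr EFin; lra.
Qed.

Lemma leb2_II : leb2 (I `*` I) = (4 * M ^+ 2)%:E.
Proof.
rewrite product_measure1E; [|exact: measurable_I..].
transitivity ((2 * M)%:E * (2 * M)%:E)%E; first by congr (_ * _)%E; exact: leb_I.
by rewrite -EFinM; congr EFin; ring.
Qed.

Lemma mrs f : measurable_fun I f -> measurable_fun (I `*` I) (rs f).
Proof.
move=> mf; have mI := @measurable_I R M.
have m1 : measurable_fun (I `*` I) (fun p : measurableTypeR R * measurableTypeR R => p.1).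
  by apply: measurable_funS (@measurable_fst _ _ _ _).
have m2 : measurable_fun (I `*` I) (fun p : measurableTypeR R * measurableTypeR R => p.2).
  by apply: measurable_funS (@measurable_snd _ _ _ _).
apply: measurable_funM.
  apply: measurable_funB.
    by apply: (measurable_comp mI _ mf m1) => x [p [p1 _] <-].
  by apply: (measurable_comp mI _ mf m2) => x [p [_ p2] <-].
apply: (measurable_comp measurableT _ (@measurable_inv_fun R)) => //.
exact: measurable_funB.
Qed.

Lemma rs_lin a f g p : rs (fun t => a * f t + g t) p = a * rs f p + rs g p.
Proof. by rewrite /rs; ring. Qed.

(** The crude constant 2 replaces the triangle inequality for the norm and avoids square roots. *)
Lemma hn2_lin a f g : measurable_fun I f -> measurable_fun I g ->
  (hn2 (fun t => a * f t + g t)%R <= 2%:E * ((a ^+ 2)%:E * hn2 f + hn2 g))%E.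
Proof.
move=> mf mg; have mI := @measurable_I R M; have mII := measurable_II.
have maf : measurable_fun I (fun t => a * f t) by exact: measurable_funM.
have mraf : measurable_fun (I `*` I) (fun p => a * rs f p).
  by apply: measurable_funM => //; exact: mrs.
apply: le_trans.
  apply: leeD; first exact: (isqD_le _ mI maf mg).
  rewrite (_ : rs _ = fun p => a * rs f p + rs g p); last by apply/funext => p; exact: rs_lin.
  exact: (isqD_le _ mII mraf (mrs mg)).
rewrite isqZ// isqZ//; last exact: mrs.
have H (x y x' y' : \bar R) : (0 <= x -> 0 <= y -> 0 <= x' -> 0 <= y' ->
    2%:E * ((a ^+ 2)%:E * x + y) + 2%:E * ((a ^+ 2)%:E * x' + y') =
    2%:E * ((a ^+ 2)%:E * (x + x') + (y + y')))%E.
  move=> x0 y0 x0' y0'; rewrite (ge0_muleDr (a ^+ 2)%:E x0 x0').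
  transitivity (2%:E * (((a ^+ 2)%:E * x + y) + ((a ^+ 2)%:E * x' + y')))%E; last by rewrite addeACA.
  have aa : (0 <= (a ^+ 2)%:E)%E by rewrite lee_fin sqr_ge0.
  have u0 := adde_ge0 (mule_ge0 aa x0) y0; have u0' := adde_ge0 (mule_ge0 aa x0') y0'.
  by rewrite (ge0_muleDr 2%:E u0 u0').
by rewrite H ?isq_ge0.
Qed.

Lemma hin_lin a f g : hin f -> hin g -> hin (fun t => a * f t + g t).
Proof.
move=> [mf f1] [mg g1]; split; first by apply: measurable_funD => //; exact: measurable_funM.
apply: (le_lt_trans (hn2_lin a mf mg)).
apply: lte_mul_pinfty => //; apply: lte_add_pinfty => //.
by apply: lte_mul_pinfty => //; rewrite lee_fin sqr_ge0.
Qed.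

(** Boundedness is expressed through a real upper bound [e] of the squared norm, so that no root of
    an extended real appears. *)
Definition hfun (L : (R -> R) -> R) :=
  (forall a f g, hin f -> hin g -> L (fun t => a * f t + g t) = a * L f + L g) /\
  exists2 C : R, 0 <= C & forall f e, hin f -> 0 <= e -> (hn2 f <= e%:E)%E -> `|L f| <= C * Num.sqrt e.

Lemma lipC_measurable C f : lipC M C f -> measurable_fun I f.
Proof.
move=> [_ hf]; apply: open_continuous_measurable_fun.
  have -> : I = `]- M, M[%classic by apply/seteqP; split => t; rewrite /= in_itv.
  exact: interval_open.
move=> x /set_mem Ix; apply/cvgrPdist_le => e e0.
have C0 : 0 < `|C| + 1 by rewrite ltr_pwDr.
have nI : nbhs x (`]- M, M[%classic : set R).
  by apply: open_nbhs_nbhs; split; [exact: interval_open|rewrite /= in_itv].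
near=> y.
have : `]- M, M[%classic y by near: y; exact: nI.
rewrite /= in_itv/= => Iy.
apply: (le_trans (hf _ _ Ix Iy)).
apply: (@le_trans _ _ ((`|C| + 1) * `|x - y|)).
  by rewrite ler_wpM2r// (le_trans (ler_norm _))// lerDl.
rewrite -ler_pdivlMl//; near: y.
have d0 : 0 < (`|C| + 1)^-1 * e by rewrite mulr_gt0 ?invr_gt0.
by apply: filterS (nbhsx_ballx x _ d0) => y; rewrite /ball/= => h; exact: ltW.
Unshelve. all: by end_near. Qed.

Lemma rs_le C f p : lipC M C f -> 0 <= C -> (I `*` I) p -> `|rs f p| <= C.
Proof.
move=> [_ hf] C0 [p1 p2]; rewrite /rs normrM normfV.
have [->|ne] := eqVneq (p.1 - p.2) 0; first by rewrite normr0 invr0 mulr0.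
by rewrite ler_pdivrMr ?normr_gt0// hf.
Qed.

Lemma lipC_hn2 C f : lipC M C f -> 0 <= C -> (hn2 f <= (C ^+ 2 * (2 * M + 4 * M ^+ 2))%:E)%E.
Proof.
move=> hf C0; have mf := lipC_measurable hf.
have mI := @measurable_I R M; have mII := measurable_II.
rewrite mulrDr EFinD; apply: leeD.
  rewrite EFinM -leb_I -(integral_cst leb mI).
  apply: ge0_le_integral => //; [by move=> x _; rewrite lee_fin sqr_ge0|exact: msq|].
  move=> x Ix; rewrite lee_fin -real_normK ?num_real// lerXn2r ?nnegrE//; exact: hf.1.
rewrite EFinM -leb2_II -(integral_cst leb2 mII).
apply: ge0_le_integral => //; [by move=> x _; rewrite lee_fin sqr_ge0|by apply: msq; exact: mrs|].
by move=> x Ix; rewrite lee_fin -real_normK ?num_real// lerXn2r ?nnegrE// rs_le.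
Qed.

Lemma lipC_ge0 C f : lipC M C f -> 0 <= C.
Proof. by move=> [h _]; apply: le_trans (h 0 _) => //; rewrite oppr_lt0 M_gt0. Qed.

Lemma lipC_hin C f : lipC M C f -> hin f.
Proof.
move=> hf; split; first exact: lipC_measurable hf.
by apply: le_lt_trans (lipC_hn2 hf (lipC_ge0 hf)) _; rewrite ltry.
Qed.

Lemma lip_hin f : lip M f -> hin f.
Proof. by move=> [C]; exact: lipC_hin. Qed.

Lemma hfun_lipfun L : hfun L -> lipfun M L.
Proof.
move=> [linL [B B0 hB]]; split=> [a f g hf hg|C F f hF cF].
  by apply: linL; exact: lip_hin.
have C0 := lipC_ge0 (hF 0%N).
have hf : lipC M C f.
  split=> [t tM|s t sM tM].
    by apply: (cvg_norm_le (cF t tM)) => n; exact: (hF n).1.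
  have cst' : F n s - F n t @[n --> \oo] --> f s - f t by apply: cvgB; exact: cF.
  by apply: (cvg_norm_le cst') => n; exact: (hF n).2.
pose g n t := -1 * f t + F n t.
have lg n : lipC M (`|-1| * C + C) (g n) by apply: lipCD => //; exact: lipCZ.
have g0 t : - M < t < M -> g n t @[n --> \oo] --> (0 : R).
  move=> tM; rewrite -(subrr (f t)) /g.
  under eq_fun do rewrite mulN1r addrC; apply: cvgB; [exact: cF|exact: cvg_cst].
have Lg n : L (F n) = L f + L (g n).
  have hin1 := lipC_hin hf; have hin2 := lipC_hin (hF n).
  by rewrite /g linL//; ring.
apply/cvgrPdist_le => e e0.
(* A squared norm at most [d] gives |L| <= B sqrt d <= e; the + 1 allows B = 0. *)
pose d := (e / (B + 1)) ^+ 2.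
have eB : 0 < e / (B + 1) by rewrite divr_gt0// ltr_wpDl.
have d0 : 0 < d by rewrite exprn_gt0.
have d20 : 0 < d / 2 by rewrite divr_gt0.
have mI := @measurable_I R M; have mII := measurable_II.
have K0 := lipC_ge0 (lg 0%N).
have fI : (leb I < +oo)%E by rewrite leb_I ltry.
have fII : (leb2 (I `*` I) < +oo)%E by rewrite leb2_II ltry.
have e1 := isq_bounded_cvg mI fI (fun n => lipC_measurable (lg n)) (fun n x => (lg n).1 x) g0 d20.
have c2 p : (I `*` I) p -> rs (g n) p @[n --> \oo] --> (0 : R).
  move=> [p1 p2]; rewrite -(mul0r ((p.1 - p.2)^-1)) /rs; apply: cvgMl.
  by rewrite -(subrr 0); apply: cvgB; exact: g0.
have e2 := isq_bounded_cvg mII fII (fun n => mrs (lipC_measurable (lg n))) (fun n p => @rs_le _ _ p (lg n) K0) c2 d20.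
apply: filterS2 e1 e2 => n h1 h2; rewrite Lg opprD addNKr normrN.
have h : (hn2 (g n) <= d%:E)%E.
  by apply: (le_trans (leeD h1 h2)); rewrite -EFinD lee_fin; lra.
apply: (le_trans (hB _ _ (lipC_hin (lg n)) (ltW d0) h)).
rewrite /d sqrtr_sqr gtr0_norm// mulrCA ler_piMr ?(ltW e0)//.
by rewrite ler_pdivrMr ?mul1r ?lerDl// ltr_wpDl.
Qed.

End half_space.

Section duality.
Context {R : realType}.
Variable M : R.
Hypothesis M_gt0 : 0 < M.
Implicit Types (f g : R -> R) (F G : R -> R[i]) (a e : R) (psi : Hmhalf M).

Local Notation leb := (@lebesgue_measure R).
Local Notation I := ([set t : measurableTypeR R | - M < t < M]).
Local Notation leb2 := (leb \x leb)%E.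
Local Notation hinM := (hin M).
Local Notation hn2M := (hn2 M).

Definition chin F := hinM (fun t => cRe (F t)) /\ hinM (fun t => cIm (F t)).
Definition chn2 F := (hn2M (fun t => cRe (F t)) + hn2M (fun t => cIm (F t)))%E.
(** Meaningful for F in [chin]; other functions are replaced by 0. *)
Definition pair psi F : R[i] := psi (insubd 0 F).

Lemma normc_isq d (T : measurableType d) (mu : {measure set T -> \bar R}) (D : set T) (G : T -> R[i]) :
  measurable D -> cmeasurable D G ->
  (\int[mu]_(x in D) (normc (G x) ^+ 2)%:E =
   isq mu D (fun x => cRe (G x)) + isq mu D (fun x => cIm (G x)))%E.
Proof.
move=> mD [mr mi]; rewrite -ge0_integralD//.
- by apply: eq_integral => x _; rewrite sqr_normcE EFinD.
- by move=> x _; rewrite lee_fin sqr_ge0.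
- exact: msq.
- by move=> x _; rewrite lee_fin sqr_ge0.
- exact: msq.
Qed.

Lemma slobodeckijE F p :
  slobodeckij F p = (rs (fun t => cRe (F t)) p +i* rs (fun t => cIm (F t)) p)%C.
Proof.
rewrite /slobodeckij /rs -fmorphV /=; case: (F p.1) => a b; case: (F p.2) => c d /=.
by apply/eqP; rewrite eq_complex /= !(mulr0, mul0r, subr0, addr0, add0r) !eqxx.
Qed.

Lemma cmeasurable_slobodeckij F : cmeasurable I F -> cmeasurable (I `*` I) (slobodeckij F).
Proof.
move=> [mr mi]; split.
  rewrite (_ : (fun _ => _) = rs (fun t => cRe (F t))); first exact: mrs.
  by apply/funext => p; rewrite slobodeckijE.
rewrite (_ : (fun _ => _) = rs (fun t => cIm (F t))); first exact: mrs.
by apply/funext => p; rewrite slobodeckijE.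
Qed.

Lemma chn2E F : cmeasurable I F ->
  (\int[leb]_(t in I) (normc (F t) ^+ 2)%:E +
   \int[leb2]_(p in I `*` I) (normc (slobodeckij F p) ^+ 2)%:E = chn2 F)%E.
Proof.
move=> mF; have mI := @measurable_I R M; have mII := @measurable_II R M.
rewrite !normc_isq//; last exact: cmeasurable_slobodeckij.
rewrite addeACA /chn2 /hn2; have er : (fun p => cRe (slobodeckij F p)) = rs (fun t => cRe (F t)).
  by apply/funext => p; rewrite slobodeckijE.
have ei : (fun p => cIm (slobodeckij F p)) = rs (fun t => cIm (F t)).
  by apply/funext => p; rewrite slobodeckijE.
by rewrite er ei.
Qed.

Lemma adde_lty (x y : \bar R) : (0 <= x -> 0 <= y -> x + y < +oo -> x < +oo /\ y < +oo)%E.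
Proof.
move=> x0 y0 xy; split; apply: le_lt_trans xy; first exact: leeDl.
exact: leeDr.
Qed.

Lemma hn2_ge0 f : (0 <= hn2M f)%E.
Proof. by rewrite adde_ge0 ?isq_ge0. Qed.

Lemma chn2_ge0 F : (0 <= chn2 F)%E.
Proof. by rewrite adde_ge0 ?hn2_ge0. Qed.

Lemma in_HhalfP F : in_Hhalf M F <-> chin F.
Proof.
split=> [[[mF fF] [_ fS]]|[[mr fr] [mi fi]]].
  have : (chn2 F < +oo)%E.
    rewrite -chn2E//; apply: lte_add_pinfty; by rewrite -L2norm_lty.
  move=> /adde_lty[]; [exact: hn2_ge0..|move=> h1 h2].
  by case: mF => m1 m2; split; split.
have mF : cmeasurable I F by split.
have : (chn2 F < +oo)%E by rewrite lte_add_pinfty.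
rewrite -chn2E// => /adde_lty[||h1 h2].
- by apply: integral_ge0 => x _; rewrite lee_fin sqr_ge0.
- by apply: integral_ge0 => x _; rewrite lee_fin sqr_ge0.
by split; split; rewrite ?L2norm_lty//; exact: cmeasurable_slobodeckij.
Qed.

Lemma insubdE F : chin F -> Hhalf_val (insubd (0%R : Hhalf M) F) = F.
Proof. by move=> /in_HhalfP h; apply: insubdK; apply/mem_set. Qed.

Lemma sqre_root (x : \bar R) : (0 <= x)%E -> ((x `^ 2^-1) ^+ 2 = x)%E.
Proof.
case: x => [x| |] //; last by move=> _; rewrite poweRyr ?invr_eq0// expe2 mulyy.
by rewrite lee_fin => x0; rewrite poweR_EFin powR12_sqrt// expe2 -EFinM -expr2 sqr_sqrtr.
Qed.

Lemma Hhalf_normE F : chin F -> Hhalf_norm (insubd (0%R : Hhalf M) F) = (chn2 F `^ 2^-1)%E.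
Proof.
move=> hF; rewrite /Hhalf_norm insubdE// /L2norm !sqre_root; last first.
- by apply: integral_ge0 => x _; rewrite lee_fin sqr_ge0.
- by apply: integral_ge0 => x _; rewrite lee_fin sqr_ge0.
by rewrite chn2E//; case: hF => -[? _] [? _]; split.
Qed.

Lemma Hhalf_norm_le F e : chin F -> 0 <= e -> (chn2 F <= (e ^+ 2)%:E)%E ->
  (Hhalf_norm (insubd (0%R : Hhalf M) F) <= e%:E)%E.
Proof.
move=> hF e0 h; rewrite Hhalf_normE//.
apply: (@le_trans _ _ ((e ^+ 2)%:E `^ 2^-1)%E).
  by apply: gt0_ler_poweR => //; rewrite in_itv/= ?chn2_ge0 ?lee_fin ?sqr_ge0//= ?leey.
by rewrite poweR_EFin lee_fin powR12_sqrt ?sqr_ge0// sqrtr_sqr ger0_norm.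
Qed.

Lemma pairE psi (a : R[i]) F G : chin F -> chin G ->
  pair psi (fun t => a * F t + G t) = a * pair psi F + pair psi G.
Proof.
move=> hF hG; have [linpsi _] := set_mem (valP psi).
rewrite /pair -linpsi; congr (Hmhalf_val psi _); apply: val_inj.
have h : chin (fun t => a * F t + G t).
  apply/in_HhalfP; apply: set_mem.
  have hF' : F \in Hhalf_pred M by apply/mem_set/in_HhalfP.
  have hG' : G \in Hhalf_pred M by apply/mem_set/in_HhalfP.
  exact: (rpredD (rpredZ a hF') hG').
by rewrite linearP /= !insubdE.
Qed.

Lemma Hmhalf_bound psi : exists2 C, 0 <= C & forall F e, chin F -> 0 <= e ->
  (chn2 F <= (e ^+ 2)%:E)%E -> normc (pair psi F) <= C * e.
Proof.
have [_ [C hC]] := set_mem (valP psi).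
exists `|C| => // F e hF e0 hFe; have := hC (insubd 0 F); have := Hhalf_norm_le hF e0 hFe.
rewrite -(fineK (Hhalf_norm_fin_num _)) -EFinM !lee_fin => h1 h2.
apply: (le_trans h2); apply: (@le_trans _ _ (`|C| * fine (Hhalf_norm (insubd (0%R : Hhalf M) F)))).
  by rewrite ler_wpM2r ?ler_norm// fine_ge0// poweR_ge0.
by rewrite ler_wpM2l.
Qed.

Definition cR f : R -> R[i] := fun t => (f t)%:C%C.

Lemma hin0 : hinM (fun=> 0).
Proof. by apply: (lip_hin M_gt0); exact: lip_cst. Qed.

Lemma chin_real f : hinM f -> chin (cR f).
Proof. by move=> hf; split=> //; exact: hin0. Qed.

Lemma hn20 : hn2M (fun=> 0) = 0%E.
Proof.
apply/eqP; rewrite eq_le hn2_ge0 andbT.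
have l0 : lipC M 0 (fun=> 0 : R) by have := @lipC_cst R M 0; rewrite normr0.
by have := lipC_hn2 M_gt0 l0 (lexx 0); rewrite expr0n/= mul0r.
Qed.

Lemma chn2_real f : chn2 (cR f) = hn2M f.
Proof. by rewrite /chn2 /= hn20 adde0. Qed.

(** [P] stands for the real or the imaginary part. *)
Lemma hfun_part psi (P : R[i] -> R) : (forall a z w, P (a%:C%C * z + w) = a * P z + P w) ->
  (forall z, `|P z| <= normc z) -> hfun M (fun f => P (pair psi (cR f))).
Proof.
move=> lP nP; split=> [a f g hf hg|].
  rewrite -lP -pairE; [|exact: chin_real..].
  congr (P (pair psi _)); apply/funext => t; by rewrite /cR rmorphD rmorphM.
have [C C0 hC] := Hmhalf_bound psi; exists C => // f e hf e0 he.
apply: (le_trans (nP _)); apply: hC; rewrite ?sqrtr_ge0//; first exact: chin_real.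
by rewrite chn2_real sqr_sqrtr.
Qed.

Lemma hfun_Re psi : hfun M (fun f => cRe (pair psi (cR f))).
Proof.
apply: hfun_part => [a z w|z]; last exact: normc_Re.
by case: z => x y; case: w => u v; rewrite /= mul0r subr0.
Qed.

Lemma hfun_Im psi : hfun M (fun f => cIm (pair psi (cR f))).
Proof.
apply: hfun_part => [a z w|z]; last exact: normc_Im.
by case: z => x y; case: w => u v; rewrite /= mul0r addr0.
Qed.

Lemma pair_split psi F : chin F ->
  pair psi F = 'i%C * pair psi (cR (fun t => cIm (F t))) + pair psi (cR (fun t => cRe (F t))).
Proof.
move=> [h1 h2]; rewrite -pairE; [|exact: chin_real..].
congr (pair psi _); apply/funext => t; rewrite /cR; case: (F t) => x y /=.
by apply/eqP; rewrite eq_complex /= !(mul0r, mul1r, subr0, addr0, add0r, oppr0) !eqxx.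
Qed.

Lemma Hmhalf_eq0 psi : (forall f, hinM f -> pair psi (cR f) = 0) -> psi = 0.
Proof.
move=> h; apply: val_inj; apply/funext => F.
have hF : chin (Hhalf_val F) by apply/in_HhalfP; exact: (set_mem (valP F)).
have -> : F = insubd 0 (Hhalf_val F) by apply: val_inj; rewrite [RHS]insubdE.
rewrite -[LHS]/(pair psi (Hhalf_val F)) pair_split// !h ?mulr0 ?addr0//; by case: hF.
Qed.

(** The function F / e lies in the unit ball over which [Hmhalf_norm] is a supremum. *)
Lemma pair_le psi F e : chin F -> 0 < e -> (chn2 F <= (e ^+ 2)%:E)%E ->
  ((normc (pair psi F))%:E <= e%:E * Hmhalf_norm psi)%E.
Proof.
move=> hF e0 hFe.
pose F' t := (e^-1)%:C%C * F t + 0.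
have h0 : chin (fun=> 0) by split; exact: hin0.
have Fr t : cRe (F' t) = e^-1 * cRe (F t) by rewrite /F' addr0; case: (F t) => x y; rewrite /= mul0r subr0.
have Fi t : cIm (F' t) = e^-1 * cIm (F t) by rewrite /F' addr0; case: (F t) => x y; rewrite /= mul0r addr0.
have hn2Z f : hinM f -> hn2M (fun t => e^-1 * f t) = ((e^-1 ^+ 2)%:E * hn2M f)%E.
  move=> [mf _]; rewrite /hn2 isqZ//; last exact: measurable_I.
  rewrite (_ : rs _ = fun p => e^-1 * rs f p); last by apply/funext => p; rewrite /rs; ring.
  rewrite (isqZ _ (@measurable_II R M) e^-1 (mrs mf)).
  by apply/esym; apply: ge0_muleDr; exact: isq_ge0.
have hF' : chin F'.
  split.
    rewrite (_ : (fun _ => _) = fun t => e^-1 * cRe (F t) + 0); last by apply/funext => t; rewrite Fr addr0.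
    by apply: (hin_lin _ hF.1) hin0.
  rewrite (_ : (fun _ => _) = fun t => e^-1 * cIm (F t) + 0); last by apply/funext => t; rewrite Fi addr0.
  by apply: (hin_lin _ hF.2) hin0.
have n1 : (Hhalf_norm (insubd (0%R : Hhalf M) F') <= 1)%E.
  apply: Hhalf_norm_le => //; rewrite /chn2 (funext Fr) (funext Fi) !hn2Z; [|by case: hF..].
  rewrite -ge0_muleDr ?hn2_ge0// -/(chn2 F).
  apply: (@le_trans _ _ ((e^-1 ^+ 2)%:E * (e ^+ 2)%:E)%E).
    by rewrite lee_wpmul2l// lee_fin sqr_ge0.
  by rewrite -EFinM -exprMn mulVf ?gt_eqF.
have : ((normc (pair psi F'))%:E <= Hmhalf_norm psi)%E.
  by apply: ereal_sup_ubound; exists (insubd 0 F').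
rewrite /F' pairE//.
have -> : pair psi (fun=> 0) = 0.
  have := pairE psi (-1) h0 h0; under eq_fun do rewrite mulr0 addr0.
  by rewrite mulN1r addNr.
rewrite addr0 normcM normc_real ger0_norm ?invr_ge0 ?(ltW e0)// => h.
have := lee_wpmul2l (ltW e0 : (0 <= e%:E)%E) h.
by rewrite -EFinM mulrA mulfV ?mul1r ?gt_eqF.
Qed.

End duality.

(** * Points have zero capacity *)

Section integral_bounds.
Context {R : realType}.
Variable M : R.
Hypothesis M_gt0 : 0 < M.
Local Notation leb := (@lebesgue_measure R).
Local Notation I := ([set t : measurableTypeR R | - M < t < M]).

(** An explicit primitive of a majorant stands in for computing the integral. *)
Lemma ftc_bound (F P dP : R -> R) : measurable_fun I F -> (forall t, 0 <= F t) ->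
  (forall t : R, der P t (dP t)) -> (forall t : R, cnt dP t) -> (forall t, - M < t < M -> F t <= dP t) ->
  (forall t, 0 <= dP t) ->
  (\int[leb]_(t in I) (F t)%:E <= (P M - P (- M))%:E)%E.
Proof.
move=> mF F0 hP cP FP dP0.
have NM : - M < M by rewrite gtrN.
have mI := @measurable_I R M.
have mdP : measurable_fun [set: R] dP by apply: continuous_measurable_fun => x; exact: cP.
apply: (@le_trans _ _ (\int[leb]_(t in `[(- M)%R, M]) (dP t)%:E)%E).
  apply: (@le_trans _ _ (\int[leb]_(t in I) (dP t)%:E)%E).
    apply: ge0_le_integral; [exact: mI|by move=> t _; rewrite lee_fin|exact/measurable_EFinP| |].
      by apply/measurable_EFinP; exact: measurable_funS mdP.
    by move=> t It; rewrite lee_fin; exact: FP.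
  apply: ge0_subset_integral; [exact: mI|by []| |by move=> t _; rewrite lee_fin|].
    by apply/measurable_EFinP; exact: measurable_funS mdP.
  by move=> t /= /andP[h1 h2]; rewrite in_itv/= !ltW.
rewrite -(rint_der NM hP cP) /rint /Rintegral fineK//.
exact: integrable_fin_num (cont_integrable _ _ cP).
Qed.

Lemma tonelli_bound (K : measurableTypeR R * measurableTypeR R -> R) (phi : R -> R) (c : \bar R) :
  measurable_fun (I `*` I) K -> (forall p, 0 <= K p) -> measurable_fun I phi -> (forall s, 0 <= phi s) ->
  (forall s, - M < s < M -> (\int[leb]_(t in I) (K (s, t))%:E <= (phi s)%:E)%E) ->
  (\int[leb]_(s in I) (phi s)%:E <= c)%E ->
  (\int[(leb \x leb)%E]_(p in I `*` I) (K p)%:E <= c)%E.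
Proof.
move=> mK K0 mphi phi0 hK hc; have mI := @measurable_I R M; have mII := @measurable_II R M.
rewrite integral_mkcond fubini_tonelli1; last 2 first.
- by apply/(measurable_restrictT _ _).1 => //; exact/measurable_EFinP.
- by move=> p; rewrite patchE; case: ifP => // _; rewrite lee_fin.
apply: le_trans hc; rewrite [leRHS]integral_mkcond.
apply: ge0_le_integral => //.
- move=> s _; apply: integral_ge0 => t _; rewrite patchE; case: ifP => // _.
  by rewrite lee_fin.
- apply: measurable_fun_fubini_tonelli_F.
    by apply/(measurable_restrictT _ _).1 => //; exact/measurable_EFinP.
  by move=> p; rewrite patchE; case: ifP => // _; rewrite lee_fin.
- by apply/(measurable_restrictT _ _).1 => //; exact/measurable_EFinP.
move=> s _; rewrite /fubini_F [in leRHS]patchE; case: ifPn => [/set_mem Is|Is].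
  apply: le_trans (hK s Is); rewrite [leRHS]integral_mkcond.
  rewrite le_eqVlt; apply/orP; left; apply/eqP; apply: eq_integral => t _.
  rewrite !patchE; have -> : ((s, t) \in I `*` I) = (t \in I) => //.
  by apply/idP/idP => /set_mem h; apply/mem_set; [case: h|split].
rewrite integral0_eq// => t _; rewrite patchE ifF//.
by apply/negbTE/negP => /set_mem[/= h _]; move/negP: Is; apply; exact/mem_set.
Qed.

End integral_bounds.

(* Logarithmic cut-offs: A = p^4 = sqrt ((t - b)^2 + d^2) regularizes |t - b|. *)
Section log_cutoff.
Context {R : realType}.
Variable M : R.
Hypothesis M_gt0 : 0 < M.
Variables (b d : R).
Hypotheses (d_gt0 : 0 < d) (d_le1 : d <= 1).
Implicit Types s t u v : R.
Local Notation leb := (@lebesgue_measure R).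
Local Notation I := ([set t : measurableTypeR R | - M < t < M]).

Definition logsq t : R := ln ((t - b) ^+ 2 + d ^+ 2).
Let rho t := (t - b) ^+ 2 + d ^+ 2.
Definition cutoff_root t := expR (8^-1 * logsq t).

Local Notation p := cutoff_root.

Let rho_gt0 t : 0 < rho t.
Proof. by rewrite ltr_wpDl ?sqr_ge0// exprn_gt0. Qed.

Let p_gt0 t : 0 < p t. Proof. exact: expR_gt0. Qed.

Let p8 t : p t ^+ 8 = rho t.
Proof. by rewrite /p -expRM_natl mulrA mulfV ?mul1r ?lnK// posrE rho_gt0. Qed.

Let lnp t : logsq t = 8 * ln (p t).
Proof. by rewrite /p expRK mulrA mulfV ?mul1r. Qed.

Let der_logsq t : der logsq t (2 * (t - b) / rho t).
Proof.
rewrite /logsq; eapply der_eq; first by eapply der_ln; [exact: rho_gt0|der_auto].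
by rewrite /= -/(rho t); ring.
Qed.

Let der_p t : der p t ((t - b) / (4 * p t ^+ 7)).
Proof.
rewrite /p; eapply der_eq.
  eapply der_expR; eapply derM; [exact: der_cst|exact: der_logsq].
rewrite /= -/(p t) -p8; have := p_gt0 t => p0; field.
by rewrite gt_eqF.
Qed.

Let p_big t : (t - b) ^+ 2 <= p t ^+ 8.
Proof. by rewrite p8 lerDl sqr_ge0. Qed.

Let A_lip s t : `|p s ^+ 4 - p t ^+ 4| <= `|s - t|.
Proof.
pose dA t := (t - b) / p t ^+ 4.
have hA t' : der (fun t => p t ^+ 4) t' (dA t').
  eapply der_eq; first by eapply derX; exact: der_p.
  by rewrite /= /dA; have := p_gt0 t' => p0; field; rewrite gt_eqF.
rewrite -[leRHS]mul1r; have := @mvt_le _ (fun t => p t ^+ 4) dA 1 t s (fun u _ => hA u); apply => u _.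
rewrite /dA normrM normfV (ger0_norm (exprn_ge0 _ (ltW (p_gt0 u)))) ler_pdivrMr ?exprn_gt0// mul1r.
rewrite -(ler_pXn2r (_ : 0 < 2)%N) ?nnegrE ?exprn_ge0 ?(ltW (p_gt0 u))//.
by rewrite real_normK ?num_real// -exprM.
Qed.

Let ln_diff (x y : R) : 0 < x -> 0 < y -> x <= y -> 0 <= ln y - ln x <= (y - x) / x.
Proof.
move=> x0 y0 xy; rewrite subr_ge0 ler_ln ?posrE// xy /= -ln_div ?posrE//.
have := @expR_ge1Dx R (ln (y / x)); rewrite lnK ?posrE ?divr_gt0// => h.
by rewrite mulrBl mulfV ?gt_eqF//; lra.
Qed.

(** Since [logsq] is 8 ln p, the bound ln y - ln x <= (y - x) / x meets |p_s^4 - p_t^4| <= |s - t|,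
    whose left side factors through y - x: this factor cancels. The majorant is chosen to have
    explicit primitives. *)
Lemma rs_logsq s t : rs logsq (s, t) ^+ 2 <= 64 / p s ^+ 2 * (p t ^+ 2 * (p s ^+ 4 + p t ^+ 4))^-1.
Proof.
have key (x y u : R) : 0 < x -> 0 < y -> x <= y -> y ^+ 4 - x ^+ 4 <= `|u| -> x != y ->
   ((8 * ln y - 8 * ln x) / u) ^+ 2 <= 64 / (x ^+ 2 * y ^+ 2 * (x ^+ 4 + y ^+ 4)).
  move=> x0 y0 xy hu ne; have /andP[l0 l1] := ln_diff x0 y0 xy.
  have yx : 0 < y - x by rewrite subr_gt0 lt_neqAle ne.
  pose w := (y + x) * (y ^+ 2 + x ^+ 2).
  have e4 : y ^+ 4 - x ^+ 4 = (y - x) * w by rewrite /w; ring.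
  have w0 : 0 < w by rewrite mulr_gt0 ?addr_gt0 ?exprn_gt0.
  have u0 : 0 < `|u| by apply: lt_le_trans hu; rewrite e4 mulr_gt0.
  have h1 : `|(8 * ln y - 8 * ln x) / u| <= 8 / (x * w).
    rewrite -mulrBr normrM normfV ger0_norm ?mulr_ge0//.
    have -> : 8 / (x * w) = 8 * ((y - x) / x) * ((y - x) * w)^-1.
      by field; rewrite !gt_eqF.
    apply: ler_pM; rewrite ?invr_ge0 ?mulr_ge0 ?ler_wpM2l//.
    have yw : 0 < (y - x) * w by rewrite mulr_gt0.
    by rewrite lef_pV2 ?posrE// -e4.
  rewrite -real_normK ?num_real//; apply: (@le_trans _ _ ((8 / (x * w)) ^+ 2)).
    by rewrite lerXn2r ?nnegrE// divr_ge0// mulr_ge0// ltW.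
  have -> : (8 / (x * w)) ^+ 2 = 64 / (x * w) ^+ 2 by rewrite expr_div_n; congr (_ / _); ring.
  rewrite ler_wpM2l// lef_pV2 ?posrE ?exprn_gt0 ?mulr_gt0 ?addr_gt0 ?exprn_gt0//.
  rewrite exprMn -mulrA ler_wpM2l ?sqr_ge0// /w exprMn ler_pM ?sqr_ge0 ?addr_ge0 ?exprn_ge0 ?(ltW x0) ?(ltW y0)//.
    by rewrite lerXn2r ?nnegrE ?lerDl ?addr_ge0 ?(ltW x0) ?(ltW y0).
  have -> : (y ^+ 2 + x ^+ 2) ^+ 2 = x ^+ 4 + y ^+ 4 + 2 * (x ^+ 2 * y ^+ 2) by ring.
  by have := sqr_ge0 (x * y); rewrite exprMn => ?; lra.
have r0 : 0 <= 64 / p s ^+ 2 * (p t ^+ 2 * (p s ^+ 4 + p t ^+ 4))^-1.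
  by rewrite !mulr_ge0 ?invr_ge0 ?mulr_ge0 ?addr_ge0 ?exprn_ge0 ?(ltW (p_gt0 _)).
have [e|ne] := eqVneq (p s) (p t).
  by rewrite /rs /= !lnp e subrr mul0r expr0n/=; move: r0; rewrite e.
have eq : 64 / p s ^+ 2 * (p t ^+ 2 * (p s ^+ 4 + p t ^+ 4))^-1 =
    64 / (p s ^+ 2 * p t ^+ 2 * (p s ^+ 4 + p t ^+ 4)).
  by rewrite -mulrA -invfM mulrA.
rewrite eq /rs /= !lnp; have := A_lip s t; have [st|/ltW ts] := leP (p s) (p t).
  have h : p s ^+ 4 <= p t ^+ 4 by rewrite lerXn2r ?nnegrE ?(ltW (p_gt0 _)).
  rewrite distrC ger0_norm ?subr_ge0// => hA.
  have := key _ _ (s - t) (p_gt0 s) (p_gt0 t) st hA ne.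
  by apply: le_trans; rewrite -[leLHS]sqrrN -mulNr opprB.
have h : p t ^+ 4 <= p s ^+ 4 by rewrite lerXn2r ?nnegrE ?(ltW (p_gt0 _)).
rewrite ger0_norm ?subr_ge0// => hA.
have := key _ _ (s - t) (p_gt0 t) (p_gt0 s) ts hA; rewrite eq_sym => /(_ ne).
by rewrite [p t ^+ 2 * _]mulrC [p t ^+ 4 + _]addrC.
Qed.

(** A majorant in t has a multiple of the arctangent of [S] as primitive, and two values of the
    arctangent differ by at most pi. What is left is a multiple of 1 / p_s^4, the inverse of a
    regularized |s - b|. *)
Lemma rs_logsq_inner s :
  (\int[leb]_(t in I) (rs logsq (s, t) ^+ 2)%:E <= (64 * (2 * pi) / p s ^+ 4)%:E)%E.
Proof.
have ps := p_gt0 s.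
pose S t := (t - b) / (p s ^+ 2 * p t ^+ 2).
pose dS t := (2 * p t ^+ 8 - (t - b) ^+ 2) / (2 * p s ^+ 2 * p t ^+ 10).
have hS t : der S t (dS t).
  rewrite /S; eapply der_eq.
    eapply derM; last eapply derV; last (eapply derM; [exact: der_cst|eapply derX; exact: der_p]).
      by eapply derD; [exact: der_id|exact: der_cst].
    by rewrite gt_eqF// mulr_gt0 ?exprn_gt0.
  rewrite /= /dS; have pt := p_gt0 t; field.
  by rewrite !gt_eqF.
pose P t := 64 * (2 / p s ^+ 4) * atan (S t).
pose dP t := 64 * (2 / p s ^+ 4) * (dS t / (1 + S t ^+ 2)).
have S1 t : 1 + S t ^+ 2 != 0 by rewrite gt_eqF// ltr_pwDl ?sqr_ge0.
have hP t : der P t (dP t).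
  rewrite /P; eapply der_eq.
    eapply derM; first exact: der_cst.
    by eapply (@der_comp _ atan); [exact: is_derive1_atan|exact: hS].
  by rewrite /= /dP; field; rewrite S1 gt_eqF.
have cp t : cnt p t by exact: der_continuous (der_p t).
have cI (f : R -> R) t : cnt f t -> f t != 0 -> cnt (fun t => (f t)^-1) t by move=> cf f0; exact: cvgV.
have cP t : cnt dP t.
  rewrite /dP; apply: cntM; first exact: cnt_cst.
  have cS : cnt S t by exact: der_continuous (hS t).
  apply: cntM.
    rewrite /dS; apply: cntM; first by apply: cntD; [apply: cntM; [exact: cnt_cst|exact: cntX]|cnt_auto].
    apply: cI; first by apply: cntM; [exact: cnt_cst|exact: cntX].
    by rewrite gt_eqF// !mulr_gt0 ?exprn_gt0.
  by apply: cI => //; apply: cntD; [exact: cnt_cst|exact: cntX].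
have le t : 64 / p s ^+ 2 * (p t ^+ 2 * (p s ^+ 4 + p t ^+ 4))^-1 <= dP t.
  have pt := p_gt0 t; have hb := p_big t.
  have p4 : 0 < p s ^+ 4 by rewrite exprn_gt0.
  have e1 : dS t / (1 + S t ^+ 2) =
      ((2 * p t ^+ 8 - (t - b) ^+ 2) * p s ^+ 2) / (2 * p t ^+ 6 * (p s ^+ 4 * p t ^+ 4 + (t - b) ^+ 2)).
    have n0 : p s ^+ 4 * p t ^+ 4 + (t - b) ^+ 2 != 0.
      by rewrite gt_eqF// ltr_pwDl ?sqr_ge0// mulr_gt0 ?exprn_gt0.
    rewrite /dS /S; field.
    by rewrite exprMn n0 (gt_eqF pt) (gt_eqF ps).
  rewrite /dP e1 -[64 * (2 / _) * _]mulrA -[64 / _ * _]mulrA ler_wpM2l//.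
  have n1 : 0 < p s ^+ 4 * p t ^+ 4 + (t - b) ^+ 2 by rewrite ltr_pwDl ?sqr_ge0// mulr_gt0 ?exprn_gt0.
  have n2 : p s ^+ 4 * p t ^+ 4 + (t - b) ^+ 2 <= p t ^+ 4 * (p s ^+ 4 + p t ^+ 4).
    by rewrite mulrDr [p t ^+ 4 * p s ^+ 4]mulrC lerD2l -exprD.
  apply: (@le_trans _ _ (2 / p s ^+ 4 * (p t ^+ 8 * p s ^+ 2 / (2 * p t ^+ 6 * (p t ^+ 4 * (p s ^+ 4 + p t ^+ 4)))))).
    rewrite le_eqVlt; apply/orP; left; apply/eqP; field.
    by rewrite !gt_eqF// addr_gt0 ?exprn_gt0.
  rewrite ler_wpM2l ?mulr_ge0 ?invr_ge0 ?(ltW p4)//.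
  apply: ler_pM; rewrite ?invr_ge0 ?mulr_ge0 ?addr_ge0 ?exprn_ge0 ?(ltW ps) ?(ltW pt)//.
    by rewrite ler_wpM2r ?exprn_ge0 ?(ltW ps)//; lra.
  have d1 : 0 < 2 * p t ^+ 6 by rewrite pmulr_rgt0// exprn_gt0.
  have d2 : 0 < p t ^+ 4 * (p s ^+ 4 + p t ^+ 4) by rewrite mulr_gt0 ?addr_gt0 ?exprn_gt0.
  by rewrite lef_pV2 ?posrE ?(mulr_gt0 d1)// ler_wpM2l// ltW.
apply: le_trans.
  apply: (ftc_bound M_gt0 (P := P) (dP := dP)) => //.
  - apply: measurable_funX; rewrite /rs /=; apply: measurable_funM.
      apply: measurable_funB => //; apply: (@measurable_funS _ _ _ _ setT) => //.
      by apply: continuous_measurable_fun => t; exact: der_continuous (der_logsq t).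
    apply: (measurable_comp measurableT _ (@measurable_inv_fun R)) => //.
    by apply: measurable_funB.
  - by move=> t; exact: sqr_ge0.
  - by move=> t _; exact: le_trans (rs_logsq s t) (le t).
  - move=> t; apply: le_trans (le t).
    by rewrite !mulr_ge0 ?invr_ge0 ?mulr_ge0 ?addr_ge0 ?exprn_ge0 ?(ltW (p_gt0 _)).
rewrite lee_fin /P -mulrBr.
have -> : 64 * (2 * pi) / p s ^+ 4 = 64 * (2 / p s ^+ 4) * pi :> R by ring.
rewrite ler_wpM2l ?mulr_ge0 ?invr_ge0 ?exprn_ge0 ?(ltW ps)//.
have := atan_ltpi2 (S M); have := atan_gtNpi2 (S (- M)) => h1 h2.
by rewrite [leRHS]splitr lerD ?(ltW h2)// lerNl ltW.
Qed.

(** The primitive of 1 / p^4 is the logarithm of (t - b) + p^4. What counts is that the bound grows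
    like ln (1 / d), whereas the square of [logsq] at b grows like the square of that. *)
Lemma rs_logsq_total : 
  (isq (leb \x leb)%E (I `*` I) (rs logsq) <=
   (128 * pi * (2 * ln (2 * (M + `|b|) + 1) - 2 * ln d))%:E)%E.
Proof.
have U0 : 0 <= M + `|b| by rewrite addr_ge0// ltW.
pose Q t := 128 * pi * ln ((t - b) + p t ^+ 4).
have pos t : 0 < (t - b) + p t ^+ 4.
  have := p8 t; have := exprn_gt0 4 (p_gt0 t); set A := p t ^+ 4 => A0 eA.
  have {}eA : A ^+ 2 = (t - b) ^+ 2 + d ^+ 2 by rewrite /A -exprM.
  have := exprn_gt0 2 d_gt0; rewrite ltNge => h; apply/negP => l; nra.
have pi0 : 0 <= pi :> R by exact: pi_ge0.
have hQ t : der Q t (64 * (2 * pi) / p t ^+ 4).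
  rewrite /Q; eapply der_eq.
    eapply derM; first exact: der_cst.
    eapply der_ln; first exact: pos.
    by eapply derD; [eapply derD; [exact: der_id|exact: der_cst]|eapply derX; exact: der_p].
  rewrite /=; have pt := p_gt0 t; have n0 := pos t.
  by field; rewrite !gt_eqF.
have cp (t : R) : cnt (fun t => 64 * (2 * pi) / p t ^+ 4) t.
  apply: cntM; first exact: cnt_cst.
  apply: cvgV; first by rewrite gt_eqF// exprn_gt0.
  by apply: cntX; exact: der_continuous (der_p t).
apply: (@tonelli_bound R M (fun q => rs logsq q ^+ 2) (fun s => 64 * (2 * pi) / p s ^+ 4)).
- apply: measurable_funX; apply: mrs; apply: (@measurable_funS _ _ _ _ setT) => //.
  by apply: continuous_measurable_fun => t; exact: der_continuous (der_logsq t).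
- by move=> q; exact: sqr_ge0.
- apply: (@measurable_funS _ _ _ _ setT) => //; apply: continuous_measurable_fun => t.
  exact: cp.
- by move=> s; rewrite !mulr_ge0 ?invr_ge0 ?exprn_ge0 ?(ltW (p_gt0 _)).
- by move=> s _; exact: rs_logsq_inner.
have c0 t : 0 <= 64 * (2 * pi) / p t ^+ 4.
  by rewrite !mulr_ge0 ?invr_ge0 ?exprn_ge0 ?(ltW (p_gt0 _)).
apply: le_trans.
  apply: (ftc_bound M_gt0 (P := Q) (dP := fun t => 64 * (2 * pi) / p t ^+ 4)) => //.
  by apply: (@measurable_funS _ _ _ _ setT) => //; apply: continuous_measurable_fun => t; exact: cp.
rewrite lee_fin /Q -mulrBr ler_wpM2l ?mulr_ge0//.
set K := 2 * (M + `|b|) + 1.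
have K0 : 0 < K by rewrite /K; lra.
(* For the lower bound, d^2 = (A + u) (A - u) with A = p^4 and u = t - b. *)
have bd t : `|t| <= M -> d ^+ 2 / K <= (t - b) + p t ^+ 4 <= K.
  move=> tM; have tb : `|t - b| <= M + `|b| by rewrite (le_trans (ler_normB _ _))// lerD2r.
  have := p8 t; have := pos t; have := exprn_gt0 4 (p_gt0 t); set A := p t ^+ 4 => A0 n0 eA.
  have {}eA : A ^+ 2 = (t - b) ^+ 2 + d ^+ 2 by rewrite /A -exprM.
  have AK : A <= M + `|b| + 1.
    rewrite -(ler_pXn2r (_ : 0 < 2)%N) ?nnegrE ?(ltW A0) ?addr_ge0// ?(ltW M_gt0)// eA.
    have h1 : (t - b) ^+ 2 <= (M + `|b|) ^+ 2.
      by rewrite -(real_normK (num_real (t - b))) lerXn2r ?nnegrE.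
    have h2 : d ^+ 2 <= 1 by rewrite expr_le1// ltW.
    by nra.
  move: tb; rewrite ler_norml => /andP[t1 t2]; apply/andP; split; last by rewrite /K; lra.
  rewrite ler_pdivrMr//; have -> : d ^+ 2 = (t - b + A) * (A - (t - b)) by ring: eA.
  by rewrite ler_wpM2l ?(ltW n0)// /K; lra.
have /andP[_ a1] : d ^+ 2 / K <= (M - b) + p M ^+ 4 <= K by apply: bd; rewrite gtr0_norm.
have /andP[a2 _] : d ^+ 2 / K <= (- M - b) + p (- M) ^+ 4 <= K by apply: bd; rewrite normrN gtr0_norm.
have h1 : ln (M - b + p M ^+ 4) <= ln K by rewrite ler_ln ?posrE ?pos.
have h2 : ln (d ^+ 2 / K) <= ln (- M - b + p (- M) ^+ 4).
  by rewrite ler_ln ?posrE ?pos// divr_gt0// exprn_gt0.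
move: h2; rewrite ln_div ?posrE ?exprn_gt0// lnXn// mulr2n => h2; lra.
Qed.

End log_cutoff.

Section capacity.
Context {R : realType}.
Variable M : R.
Hypothesis M_gt0 : 0 < M.
Local Notation leb := (@lebesgue_measure R).
Local Notation I := ([set t : measurableTypeR R | - M < t < M]).

Lemma inv_ln_cvg : (ln (n.+2%:R : R))^-1 @[n --> \oo] --> (0 : R).
Proof.
apply/cvgr0Pnorm_le => e e0.
exists (Num.truncn (expR e^-1)) => // n /= hn.
have h : expR e^-1 <= n.+2%:R.
  rewrite ltW//; apply: lt_le_trans (truncnS_gt _) _.
  by rewrite ler_nat ltnS (leq_trans hn).
have h2 : e^-1 <= ln n.+2%:R by rewrite -[leLHS]expRK ler_ln ?posrE ?expR_gt0.
have ei : 0 < e^-1 by rewrite invr_gt0.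
have l0 : 0 < ln (n.+2%:R : R) by exact: lt_le_trans h2.
by rewrite ger0_norm ?invr_ge0 ?(ltW l0)// -[leRHS]invrK lef_pV2 ?posrE.
Qed.

Lemma hfun_diffuse L : hfun M L -> diffuse L.
Proof.
move=> [linL [B B0 hB]] b.
pose d n : R := n.+2%:R^-1; pose La n : R := ln n.+2%:R.
have d0 n : 0 < d n by rewrite invr_gt0.
have d1 n : d n <= 1 by rewrite invf_le1// ler1n.
have La0 n : 0 < La n by rewrite ln_gt0// ltr1n.
have lnd n : ln (d n) = - La n by rewrite lnV ?posrE.
(* Normalizes the value at b to 1, as [logsq] equals 2 ln d there; starting from n + 2 keeps [La n]
   positive. *)
pose c n := - (2 * La n)^-1.
pose G n t := c n * logsq b (d n) t.
have rho0 n t : 0 < (t - b) ^+ 2 + d n ^+ 2 by rewrite ltr_wpDl ?sqr_ge0// exprn_gt0.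
have derG n (t : R) : der (G n) t (c n * (2 * (t - b) / ((t - b) ^+ 2 + d n ^+ 2))).
  rewrite /G /logsq; eapply der_eq.
    by eapply derM; [exact: der_cst|eapply der_ln; [exact: rho0|der_auto]].
  by rewrite /=; ring.
have gG n : glip (`|c n| * (d n)^-1) (G n).
  move=> s t; have := @mvt_le _ (G n) _ (`|c n| * (d n)^-1) t s (fun u _ => derG n u); apply => u _.
  rewrite normrM ler_wpM2l// normrM normfV (ger0_norm (ltW (rho0 n u))) ler_pdivrMr//.
  rewrite ler_pdivlMl// normrM ger0_norm// -(real_normK (num_real (u - b))).
  by have := sqr_ge0 (`|u - b| - d n); nra.
have Gb n : G n b = 1.
  rewrite /G /logsq subrr expr0n/= add0r lnXn// lnd /c mulr2n; field.
  by rewrite gt_eqF.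
exists G; split=> //; first by move=> n; exists (`|c n| * (d n)^-1); exact: gG.
have hG n : hin M (G n) by apply: (lip_hin M_gt0); exact: glip_lip M_gt0 (gG n).
have mG n : measurable_fun I (G n) by have [] := hG n.
pose U := M + `|b|.
have U0 : 0 <= U by rewrite addr_ge0// ltW.
(* The factor c^2 is of order 1 / La^2, against a growth of order La in [rs_logsq_total]. *)
have rs_small : forall e : R, 0 < e -> \forall n \near \oo, (isq (leb \x leb)%E (I `*` I) (rs (G n)) <= e%:E)%E.
  move=> e e0; pose K := 128 * pi * (2 * ln (2 * U + 1) / ln 2 + 2) : R.
  have u0 : K * (ln (n.+2%:R : R))^-1 @[n --> \oo] --> (0 : R).
    by rewrite -(mulr0 K); apply: cvgMr; exact: inv_ln_cvg.
  have /cvgr0Pnorm_le/(_ e e0) := u0; apply: filterS => n hn.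
  have ml : measurable_fun I (logsq b (d n)).
    have -> : logsq b (d n) = fun t => (c n)^-1 * G n t; last exact: measurable_funM.
    by apply/funext => t; rewrite /G mulrA mulVf ?mul1r// oppr_eq0 invr_eq0 gt_eqF// mulr_gt0.
  rewrite (_ : rs (G n) = fun p => c n * rs (logsq b (d n)) p); last first.
    by apply/funext => p; rewrite /rs /G; ring.
  rewrite isqZ; [|exact: measurable_II|exact: mrs].
  have h := rs_logsq_total M_gt0 b (d0 n) (d1 n); rewrite lnd -/U in h.
  have c2 : (0 <= (c n ^+ 2)%:E)%E by rewrite lee_fin sqr_ge0.
  apply: (le_trans (lee_wpmul2l c2 h)); rewrite -EFinM lee_fin.
  apply: le_trans hn; apply: le_trans (ler_norm _).
  rewrite -/(La n) /K.
  have l2 : 0 < ln 2 :> R by rewrite ln_gt0// ltr1n.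
  have l2n : ln 2 <= La n by rewrite /La ler_ln ?posrE// ler_nat.
  have lU : 0 <= ln (2 * U + 1) by apply: ln_ge0; rewrite lerDr mulr_ge0.
  have pi0 : 0 <= pi :> R by exact: pi_ge0.
  have -> : c n ^+ 2 * (128 * pi * (2 * ln (2 * U + 1) - 2 * - La n)) =
    128 * pi * ((2 * ln (2 * U + 1) / La n + 2) / (4 * La n)).
    by rewrite /c; field; rewrite gt_eqF.
  rewrite -[leRHS]mulrA ler_wpM2l ?mulr_ge0//.
  apply: ler_pM; rewrite ?invr_ge0 ?mulr_ge0 ?addr_ge0 ?mulr_ge0 ?invr_ge0 ?(ltW (La0 n))//.
    by rewrite lerD2r ler_wpM2l ?mulr_ge0// lef_pV2 ?posrE.
  by rewrite lef_pV2 ?posrE ?mulr_gt0// ler_peMl ?(ltW (La0 n))// ler1n.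
(* Away from b, the functions G n are bounded by K and tend to 0, so dominated convergence
   applies. *)
have sq_small : forall e : R, 0 < e -> \forall n \near \oo, (isq leb I (G n) <= e%:E)%E.
  have mI := @measurable_I R M.
  have mb : measurable ([set b] : set (measurableTypeR R)) by exact: measurable_set1.
  pose D := I `\` [set b].
  have mD : measurable D by exact: measurableD.
  have eI n : isq leb I (G n) = isq leb D (G n).
    rewrite /isq (ge0_negligible_integral mb mI)//; first exact: msq.
      by move=> x _; rewrite lee_fin sqr_ge0.
    exact: lebesgue_measure_set1.
  pose K := 1 + ln (U ^+ 2 + 1) / (2 * ln 2).
  have l2 : 0 < ln 2 :> R by rewrite ln_gt0// ltr1n.
  have lbd n t : - (2 * La n) <= logsq b (d n) t.
    have -> : - (2 * La n) = ln (d n ^+ 2) by rewrite lnXn// lnd; ring.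
    by rewrite ler_ln ?posrE ?exprn_gt0// lerDr sqr_ge0.
  have d21 n : d n ^+ 2 <= 1 by rewrite expr_le1// ltW.
  have pos1 (u : R) : 0 < u ^+ 2 + 1 by rewrite ltr_wpDl ?sqr_ge0.
  have ubd n t : logsq b (d n) t <= ln ((t - b) ^+ 2 + 1).
    by rewrite /logsq ler_ln ?posrE ?pos1// lerD2l.
  have nG n t : `|G n t| = `|logsq b (d n) t| / (2 * La n).
    have L2 : 0 < 2 * La n by rewrite mulr_gt0.
    by rewrite /G normrM /c normrN normfV (gtr0_norm L2) mulrC.
  have GK n t : D t -> `|G n t| <= K.
    move=> [It _]; rewrite nG ler_pdivrMr ?mulr_gt0//.
    have h1 : ln ((t - b) ^+ 2 + 1) <= ln (U ^+ 2 + 1).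
      rewrite ler_ln ?posrE ?pos1// lerD2r -(real_normK (num_real (t - b))).
      rewrite lerXn2r ?nnegrE// (le_trans (ler_normB _ _))// lerD2r ltW// ltr_norml.
      exact: It.
    have lU : 0 <= ln (U ^+ 2 + 1) by apply: ln_ge0; rewrite lerDr sqr_ge0.
    have l2n : ln 2 <= La n by rewrite /La ler_ln ?posrE// ler_nat.
    have h2 : ln (U ^+ 2 + 1) <= ln (U ^+ 2 + 1) / (2 * ln 2) * (2 * La n).
      rewrite -mulrA ler_peMr// mulrC ler_pdivlMr ?mulr_gt0// mul1r.
      by rewrite ler_wpM2l.
    have La1 := La0 n; rewrite ler_norml /K mulrDl mul1r.
    have := lbd n t; have := ubd n t => a1 a2; apply/andP; split; lra.
  have G0 t : D t -> G n t @[n --> \oo] --> (0 : R).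
    move=> [It tb]; apply/cvgr0Pnorm_le => e e0.
    have tb0 : 0 < (t - b) ^+ 2.
      rewrite lt_neqAle sqr_ge0 andbT eq_sym sqrf_eq0 subr_eq0.
      by apply/eqP => tb'; exact: tb.
    pose c0 := `|ln ((t - b) ^+ 2)| + `|ln ((t - b) ^+ 2 + 1)|.
    have u0 : c0 * (ln (n.+2%:R : R))^-1 @[n --> \oo] --> (0 : R).
      by rewrite -(mulr0 c0); apply: cvgMr; exact: inv_ln_cvg.
    have /cvgr0Pnorm_le/(_ e e0) := u0; apply: filterS => n; apply: le_trans.
    apply: le_trans (ler_norm _); rewrite nG.
    have La1 := La0 n; have L2 : 0 < 2 * La n by rewrite mulr_gt0.
    apply: ler_pM => //; [by rewrite invr_ge0 ltW| |]; last first.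
      by rewrite -/(La n) lef_pV2 ?posrE//; lra.
    have h1 : ln ((t - b) ^+ 2) <= logsq b (d n) t.
      by rewrite ler_ln ?posrE// lerDl sqr_ge0.
    have h2 := ubd n t; have h3 := ler_norm (ln ((t - b) ^+ 2 + 1)).
    have h4 := ler_norm (- ln ((t - b) ^+ 2)); rewrite normrN in h4.
    have h5 := normr_ge0 (ln ((t - b) ^+ 2 + 1)); have h6 := normr_ge0 (ln ((t - b) ^+ 2)).
    by rewrite ler_norml /c0; apply/andP; split; lra.
  have fD : (leb D < +oo)%E.
    apply: (@le_lt_trans _ _ (leb I)); last by rewrite leb_I ?ltry.
    by apply: le_measure; rewrite ?inE// => x [].
  move=> e e0; have := isq_bounded_cvg mD fD (fun n => measurable_funS mI (@subDsetl _ _ _) (mG n)) GK G0 e0.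
  by apply: filterS => n; rewrite eI.
apply/cvgr0Pnorm_le => e e0.
pose w := (e / (B + 1)) ^+ 2.
have eB : 0 < e / (B + 1) by rewrite divr_gt0// ltr_wpDl.
have w0 : 0 < w by rewrite exprn_gt0.
have w20 : 0 < w / 2 by rewrite divr_gt0.
apply: filterS2 (sq_small _ w20) (rs_small _ w20) => n h1 h2.
have h : (hn2 M (G n) <= w%:E)%E.
  by apply: (le_trans (leeD h1 h2)); rewrite -EFinD lee_fin; lra.
apply: (le_trans (hB _ _ (hG n) (ltW w0) h)).
rewrite /w sqrtr_sqr gtr0_norm// mulrCA ler_piMr ?(ltW e0)//.
by rewrite ler_pdivrMr ?mul1r ?lerDl// ltr_wpDl.
Qed.

End capacity.

(** * Density of the Lipschitz functions *)

Section affine_change.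
Context {R : realType}.
Local Notation leb := (@lebesgue_measure R).

Lemma measurable_affine (a c : R) : measurable_fun [set: measurableTypeR R] (fun x : measurableTypeR R => a * x + c : measurableTypeR R).
Proof.
apply: (@continuous_measurable_fun R (fun x => a * x + c)) => x.
have : cnt (fun x : R => a * x + c) x by cnt_auto.
exact.
Qed.

(** The right-hand side is a scaled pushforward measure that agrees with Lebesgue measure on
    half-open intervals, hence on all measurable sets. *)
Lemma lebesgue_affine (a c : R) (A : set (measurableTypeR R)) : 0 < a -> measurable A ->
  leb A = (a%:E * leb ((fun x => (a * x + c)%R) @^-1` A))%E.
Proof.
move=> a0 mA; have a0' : 0 <= a by exact: ltW.
pose nu := measure_function_pushforward__canonical__measure_function_Measure leb (measurable_affine a c).
pose m := mscale (NngNum a0') nu.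
have := @lebesgue_measure_unique R m.
move=> /(_ _ _ mA) -> // X [[x y] _ <-] /=.
rewrite /m /mscale /= /nu /pushforward /=.
have -> : (fun x => (a * x + c)%R) @^-1` `]x, y] = `](x - c) / a, (y - c) / a]%classic.
  apply/seteqP; split => t /=; rewrite !in_itv/= => /andP[t1 t2]; apply/andP; split.
  - by rewrite ltr_pdivrMr// ltrBlDr mulrC.
  - by rewrite ler_pdivlMr// lerBrDr mulrC.
  - by move: t1; rewrite ltr_pdivrMr// ltrBlDr mulrC.
  - by move: t2; rewrite ler_pdivlMr// lerBrDr mulrC.
rewrite !lebesgue_measure_itv /= !lte_fin ltr_pM2r ?invr_gt0// ltrD2r.
case: ifP => _; last by rewrite mule0.
by rewrite -!EFinD -EFinM; congr EFin; field; rewrite gt_eqF.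
Qed.

Lemma integral_affine (a c : R) (phi : R -> \bar R) : 0 < a -> measurable_fun [set: measurableTypeR R] phi ->
  (forall x, (0 <= phi x)%E) ->
  (\int[leb]_x phi (a * x + c)%R = (a^-1)%:E * \int[leb]_x phi x)%E.
Proof.
move=> a0 mphi phi0; have a0' : 0 <= a by exact: ltW.
have h := ge0_integral_pushforward (measurable_affine a c) leb measurableT mphi (fun x _ => phi0 x).
rewrite preimage_setT in h.
rewrite -[LHS]/(\int[leb]_x (phi \o (fun x => (a * x + c)%R)) x)%E -h.
pose nu := measure_function_pushforward__canonical__measure_function_Measure leb (measurable_affine a c).
have e : (\int[leb]_x phi x = \int[mscale (NngNum a0') nu]_x phi x)%E.
  apply: eq_measure_integral => A mA _; rewrite /mscale /= /nu /pushforward /=.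
  exact: lebesgue_affine.
rewrite e ge0_integral_mscale// muleA -EFinM mulVf ?gt_eqF// mul1e.
by [].
Qed.

Let integral_affineZ (a c : R) (phi : R -> \bar R) : 0 < a -> measurable_fun [set: measurableTypeR R] phi ->
  (forall x, (0 <= phi x)%E) ->
  (\int[leb]_x ((a^-1)%:E * phi (a * x + c)%R) = (a^-1 ^+ 2)%:E * \int[leb]_x phi x)%E.
Proof.
move=> a0 mphi phi0; have mc := measurableT_comp mphi (@measurable_affine a c).
rewrite (@ge0_integralZl _ _ _ leb _ measurableT _ mc)//; last by rewrite lee_fin invr_ge0 ltW.
rewrite -[X in (_ * X)%E]/(\int[leb]_x phi (a * x + c)%R)%E integral_affine//.
  by rewrite muleA -EFinM expr2.
by move=> x _; exact: phi0.
Qed.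

Lemma integral2_affine (a c : R) (G : measurableTypeR R * measurableTypeR R -> \bar R) : 0 < a ->
  measurable_fun setT G -> (forall p, (0 <= G p)%E) ->
  (\int[(leb \x leb)%E]_p G (a * p.1 + c, a * p.2 + c)%R = (a^-1 ^+ 2)%:E * \int[(leb \x leb)%E]_p G p)%E.
Proof.
move=> a0 mG G0.
have mA := @measurable_affine a c.
have mG2 : measurable_fun setT (fun p : measurableTypeR R * measurableTypeR R =>
    G ((a * p.1 + c)%R : measurableTypeR R, (a * p.2 + c)%R : measurableTypeR R)).
  apply: measurableT_comp => //; apply: measurable_fun_pair.
    exact: (measurableT_comp mA measurable_fst).
  exact: (measurableT_comp mA measurable_snd).
rewrite fubini_tonelli1// fubini_tonelli1//.
have mF := measurable_fun_fubini_tonelli_F (m2 := leb) G mG G0.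
have F0 x : (0 <= fubini_F leb G x)%E by apply: integral_ge0.
transitivity (\int[leb]_x ((a^-1)%:E * fubini_F leb G (a * x + c)%R))%E.
  apply: eq_integral => x _; rewrite /fubini_F /=.
  rewrite (integral_affine c (phi := fun y => G ((a * x + c)%R : measurableTypeR R, y))) //.
  exact: (measurableT_comp mG (measurable_pair1 _)).
exact: integral_affineZ a0 mF F0.
Qed.

End affine_change.

(* No sigma-finite structure is inferred for this product by the library. *)
Definition lebesgue2 {R : realType} : set (measurableTypeR R * measurableTypeR R) -> \bar R :=
  (@lebesgue_measure R \x @lebesgue_measure R)%E.
HB.instance Definition _ (R : realType) := Measure.on (@lebesgue2 R).

Lemma lebesgue2_sigma_finite (R : realType) : sigma_finite setT (@lebesgue2 R).
Proof.
pose J n : set (measurableTypeR R) := `[- n%:R, n%:R]%classic.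
have mJ n : measurable (J n) by exact: measurable_itv.
have fJ n : (lebesgue_measure (`[(- n%:R)%R, n%:R%R]%classic : set R) < +oo)%E.
  by rewrite lebesgue_measure_itv /=; case: ifP => _; rewrite -?EFinD ?ltry.
exists (fun n => J n `*` J n).
  apply/seteqP; split=> // -[x y] _.
  exists (Num.truncn (Num.max `|x| `|y|)).+1 => //.
  have := truncnS_gt (Num.max `|x| `|y|); rewrite gt_max => /andP[x1 y1].
  by split; rewrite /J /= in_itv/= -ler_norml ltW.
move=> n; split; first exact: measurableX.
rewrite /lebesgue2 product_measure1E//; apply: lte_mul_pinfty => //; last exact: fJ.
by rewrite ge0_fin_numE//; exact: fJ.
Qed.

HB.instance Definition _ (R : realType) :=
  Measure_isSigmaFinite.Build _ _ _ (@lebesgue2 R) (lebesgue2_sigma_finite R).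

(* For small h, the average of f over the interval of radius h M around (1 - h) t,
   which lies in ]-M, M[ and contains t, is Lipschitz in t.  By Jensen's inequality
   this averaging does not increase the Gagliardo-Slobodeckij seminorm. *)
Section smoothing.
Context {R : realType}.
Variable M : R.
Hypothesis M_gt0 : 0 < M.
Local Notation leb := (@lebesgue_measure R).
Local Notation leb2 := (leb \x leb)%E.
Local Notation I := ([set t : measurableTypeR R | - M < t < M]).
Local Notation U := (`[-1, 1]%classic : set (measurableTypeR R)).

Variables (f : R -> R) (K : R).
Hypotheses (mf : measurable_fun [set: measurableTypeR R] f) (f_ge0 : forall t, 0 <= f t) (f_leK : forall t, f t <= K).
Implicit Types (h t u : R).

Let f_le t : `|f t| <= K. Proof. by rewrite ger0_norm. Qed.

Let K_ge0 : 0 <= K. Proof. exact: le_trans (f_le 0). Qed.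

Let mI := @measurable_I R M.

Definition smooth h t : R := 2^-1 * \int[leb]_(u in U) f (h * M * u + (1 - h) * t).

Let leb_U : leb U = 2%:E.
Proof.
rewrite lebesgue_measure_itv /= lte_fin ifT; last by lra.
by rewrite -EFinD; congr EFin; lra.
Qed.

Let Rint_cst (c : R) : \int[leb]_(u in U) c = c * 2.
Proof.
have mU : measurable U by [].
by rewrite Rintegral_cst//; congr (_ * _); exact: (congr1 fine leb_U).
Qed.

Let bounded_int (D : set (measurableTypeR R)) (g : R -> R) (C : R) : measurable D -> (leb D < +oo)%E ->
  measurable_fun D g -> (forall t, D t -> `|g t| <= C) -> leb.-integrable D (EFin \o g).
Proof.
move=> mD fD mg hg; apply: measurable_bounded_integrable => //.
exists `|C|; split=> // B CB t Dt /=.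
by rewrite (le_trans (hg t Dt))// (le_trans (ler_norm _))// ltW.
Qed.

Let mfa (a c : R) : measurable_fun [set: measurableTypeR R] (fun u => f (a * u + c)).
Proof. exact: (measurableT_comp mf (@measurable_affine R a c)). Qed.

Let iU (a c : R) : leb.-integrable U (EFin \o (fun u => f (a * u + c))).
Proof.
apply: (@bounded_int _ _ K) => //; first by rewrite leb_U ltry.
by apply: measurable_funS (mfa a c).
Qed.

Lemma smooth_le h t : `|smooth h t| <= K.
Proof.
rewrite /smooth normrM ger0_norm//.
have mU : measurable U by [].
apply: (@le_trans _ _ (2^-1 * \int[leb]_(u in U) (cst K) u)).
  rewrite ler_wpM2l//; apply: le_trans (le_normr_Rintegral mU (iU _ _)) _.
  apply: le_Rintegral => //.
  - apply: (@bounded_int _ _ K) => //; first by rewrite leb_U ltry.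
      by apply: measurableT_comp => //; apply: measurable_funS (mfa _ _).
    by move=> u _; rewrite normr_id.
  - by apply: (@bounded_int _ _ K) => //; [rewrite leb_U ltry|move=> u _; rewrite ger0_norm].
rewrite Rint_cst; lra.
Qed.

(* Jensen's inequality *)
Let mean_sqr (x : R -> R) (C : R) : measurable_fun U x -> (forall u, `|x u| <= C) ->
  (((2^-1 * \int[leb]_(u in U) x u) ^+ 2)%:E <= (2^-1)%:E * \int[leb]_(u in U) ((x u) ^+ 2)%:E)%E.
Proof.
move=> mx xC; have mU : measurable U by [].
have C0 : 0 <= C by exact: le_trans (xC 0).
have fU : (leb U < +oo)%E by rewrite leb_U ltry.
have ix : leb.-integrable U (EFin \o x) by exact: (@bounded_int _ _ C).
have ix2 : leb.-integrable U (EFin \o (fun u => x u ^+ 2)).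
  apply: (@bounded_int _ _ (C ^+ 2)) => //; first exact: measurable_funX.
  by move=> u _; rewrite normrX lerXn2r ?nnegrE.
pose m := 2^-1 * \int[leb]_(u in U) x u.
have ic : leb.-integrable U (EFin \o (fun=> m ^+ 2)).
  by apply: (@bounded_int _ _ (m ^+ 2)) => // u _; rewrite ger0_norm ?sqr_ge0.
have ixm : leb.-integrable U (EFin \o (fun u => - (2 * m) * x u)).
  apply: (@bounded_int _ _ (`|- (2 * m)| * C)) => //; first exact: measurable_funM.
  by move=> u _; rewrite normrM ler_wpM2l.
have i2 : leb.-integrable U (EFin \o (fun u => x u ^+ 2 + - (2 * m) * x u)).
  apply: (@bounded_int _ _ (C ^+ 2 + `|- (2 * m)| * C)) => //.
    by apply: measurable_funD; [exact: measurable_funX|exact: measurable_funM].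
  by move=> u _; rewrite (le_trans (ler_normD _ _))// normrX normrM lerD ?lerXn2r ?nnegrE ?ler_wpM2l.
have key : 0 <= \int[leb]_(u in U) (x u ^+ 2 + - (2 * m) * x u + m ^+ 2).
  apply: Rintegral_ge0 => u _.
  by rewrite (_ : _ + _ = (x u - m) ^+ 2) ?sqr_ge0//; ring.
rewrite RintegralD// RintegralD// RintegralZl// Rint_cst in key.
have e1 : \int[leb]_(u in U) x u = 2 * m by rewrite /m; field.
rewrite e1 in key.
rewrite -/m -(@fineK _ (\int[leb]_(u in U) ((x u) ^+ 2)%:E)%E); last exact: integrable_fin_num ix2.
by rewrite -EFinM lee_fin -/(\int[leb]_(u in U) (x u ^+ 2))%R; lra.
Qed.

Let J h t : set (measurableTypeR R) := `[((1 - h) * t - h * M)%R, ((1 - h) * t + h * M)%R]%classic.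

Let fit (a b : R) : (leb (`[a, b]%classic : set (measurableTypeR R)) < +oo)%E.
Proof. by rewrite lebesgue_measure_itv /=; case: ifP => _; rewrite -?EFinD ?ltry. Qed.

Let iJ (a b : R) : leb.-integrable (`[a, b]%classic : set (measurableTypeR R)) (EFin \o f).
Proof.
have fab := fit a b.
by apply: (@bounded_int _ _ K) => //; exact: measurable_funS mf.
Qed.

Lemma smoothE h t : 0 < h -> smooth h t = (2 * (h * M))^-1 * \int[leb]_(x in J h t) f x.
Proof.
move=> h0; have a0 : 0 < h * M by rewrite mulr_gt0.
have mJ : measurable (J h t) by exact: measurable_itv.
pose phi x := (f x * \1_(J h t) x)%:E.
have mphi : measurable_fun [set: measurableTypeR R] phi.
  by apply/measurable_EFinP; apply: measurable_funM => //; exact: measurable_indic.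
have phi0 x : (0 <= phi x)%E by rewrite lee_fin mulr_ge0// indicE ler0n.
have e1 : (\int[leb]_x phi x = \int[leb]_(x in J h t) (f x)%:E)%E.
  rewrite [RHS]integral_mkcond; apply: eq_integral => x _; rewrite patchE /phi indicE.
  by case: ifP => _; rewrite ?mulr1 ?mulr0.
have e2 : (\int[leb]_x phi (h * M * x + (1 - h) * t)%R = \int[leb]_(u in U) (f (h * M * u + (1 - h) * t)%R)%:E)%E.
  rewrite [RHS]integral_mkcond; apply: eq_integral => u _; rewrite patchE /phi indicE.
  have -> : (h * M * u + (1 - h) * t \in J h t) = (u \in U).
    apply/idP/idP => /set_mem; rewrite /J /= !in_itv/= => /andP[u1 u2]; apply/mem_set; rewrite /= in_itv/=.
      rewrite -(ler_pM2l a0) -(ler_pM2l a0 u); apply/andP; split; lra.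
    have : h * M * -1 <= h * M * u by rewrite ler_pM2l.
    have : h * M * u <= h * M * 1 by rewrite ler_pM2l.
    by move=> ? ?; apply/andP; split; lra.
  by case: ifP => _; rewrite ?mulr1 ?mulr0.
have := integral_affine ((1 - h) * t) a0 mphi phi0; rewrite e1 e2 => e3.
rewrite /smooth /Rintegral e3 fineM//; last first.
  exact: integrable_fin_num (iJ _ _).
by rewrite /=; field; rewrite !gt_eqF.
Qed.

Let Phi (x : R) := \int[leb]_(w in `[(- M)%R, x]) f w.

Let iJo (a b : R) : leb.-integrable (`]a, b]%classic : set (measurableTypeR R)) (EFin \o f).
Proof.
have fab : (leb (`]a, b]%classic : set (measurableTypeR R)) < +oo)%E.
  by rewrite lebesgue_measure_itv /=; case: ifP => _; rewrite -?EFinD ?ltry.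
by apply: (@bounded_int _ _ K) => //; exact: measurable_funS mf.
Qed.

Let PhiB a b : - M <= a -> a <= b -> Phi b - Phi a = \int[leb]_(w in `]a, b]) f w.
Proof.
move=> Ma ab; apply: Rintegral_itvB; [exact: iJ|by rewrite bnd_simp|by rewrite bnd_simp].
Qed.

Let Phi_lip a b : - M <= a -> a <= b -> `|Phi b - Phi a| <= K * (b - a).
Proof.
move=> Ma ab; rewrite PhiB//.
have ia := iJo a b.
have fab : (leb (`]a, b]%classic : set (measurableTypeR R)) < +oo)%E.
  by rewrite lebesgue_measure_itv /=; case: ifP => _; rewrite -?EFinD ?ltry.
apply: le_trans (le_normr_Rintegral _ ia) _ => //.
apply: (@le_trans _ _ (\int[leb]_(w in `]a, b]) (cst K) w)).
  apply: le_Rintegral => //.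
  - apply: (@bounded_int _ _ K) => //; first by apply: measurableT_comp => //; exact: measurable_funS mf.
    by move=> u _; rewrite normr_id.
  - by apply: (@bounded_int _ _ K) => // u _; rewrite ger0_norm.
rewrite Rintegral_cst// ler_wpM2l//.
rewrite (_ : fine _ = fine (lebesgue_measure (`]a, b]%classic : set R)))//.
rewrite lebesgue_measure_itv /= lte_fin; case: ifP => _; last by rewrite subr_ge0.
by rewrite -EFinD.
Qed.

(** The average is a multiple of the difference of two values of the primitive [Phi], whose
    Lipschitz constant is K. *)
Lemma smooth_lipC h : 0 < h < 1 -> lipC M (K + K / (h * M)) (smooth h).
Proof.
move=> /andP[h0 h1]; have a0 : 0 < h * M by rewrite mulr_gt0.
have KK : 0 <= K / (h * M) by rewrite divr_ge0// ltW.
split=> [t _|s t sM tM]; first by apply: le_trans (smooth_le h t) _; rewrite lerDl.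
have bd x : - M < x < M -> - M <= (1 - h) * x - h * M /\ (1 - h) * x - h * M <= (1 - h) * x + h * M.
  by move=> /andP[x1 x2]; split; nra.
have sE x : - M < x < M -> smooth h x = (2 * (h * M))^-1 * (Phi ((1 - h) * x + h * M) - Phi ((1 - h) * x - h * M)).
  move=> xM; have [b1 b2] := bd x xM; rewrite smoothE// PhiB//; congr (_ * _).
  by rewrite /J Rintegral_itv_obnd_cbnd//; exact: iJo.
have PL x y : - M <= x -> - M <= y -> `|Phi x - Phi y| <= K * `|x - y|.
  move=> Mx My; have [xy|/ltW yx] := leP x y.
    by rewrite distrC [`|x - y|]distrC (@ger0_norm _ (y - x)) ?subr_ge0//; exact: Phi_lip.
  by rewrite (@ger0_norm _ (x - y)) ?subr_ge0//; exact: Phi_lip.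
rewrite !sE// -mulrBr normrM ger0_norm; last by rewrite invr_ge0 mulr_ge0// ltW.
have [s1 s2] := bd s sM; have [t1 t2] := bd t tM.
set P1 := Phi _; set P2 := Phi _; set P3 := Phi _; set P4 := Phi _.
have -> : P1 - P2 - (P3 - P4) = (P1 - P3) + - (P2 - P4) by ring.
have h10 : 0 < 1 - h by lra.
have e1 : `|P1 - P3| <= K * `|s - t|.
  apply: le_trans (PL _ _ (le_trans s1 s2) (le_trans t1 t2)) _; rewrite ler_wpM2l//.
  rewrite (_ : _ - _ = (1 - h) * (s - t)); last by ring.
  by rewrite normrM ler_piMl// ger0_norm ?(ltW h10)//; lra.
have e2 : `|P2 - P4| <= K * `|s - t|.
  apply: le_trans (PL _ _ s1 t1) _; rewrite ler_wpM2l//.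
  rewrite (_ : _ - _ = (1 - h) * (s - t)); last by ring.
  by rewrite normrM ler_piMl// ger0_norm ?(ltW h10)//; lra.
apply: (@le_trans _ _ ((2 * (h * M))^-1 * (2 * (K * `|s - t|)))).
  have i0 : 0 <= (2 * (h * M))^-1 by rewrite invr_ge0 mulr_ge0// ltW.
  rewrite ler_wpM2l//.
  by rewrite (le_trans (ler_normD _ _))// normrN; lra.
have -> : (2 * (h * M))^-1 * (2 * (K * `|s - t|)) = K / (h * M) * `|s - t|.
  by field; rewrite !gt_eqF.
by rewrite ler_wpM2r// lerDr.
Qed.

(** In dimension one the seminorm of H^(1/2) is dilation invariant: the factor (1 - h)^2 of the
    squared quotient cancels the Jacobian on pairs of points. Jensen and Tonelli reduce the claim to
    one shift u at a time. *)
Lemma smooth_seminorm h : 0 < h < 1 -> (isq leb2 (I `*` I) (rs (smooth h)) <= isq leb2 (I `*` I) (rs f))%E.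
Proof.
move=> h01; have /andP[h0 h1] := h01; have mII := @measurable_II R M; have mU : measurable U by [].
have h10 : 0 < 1 - h by lra.
pose D : set (measurableTypeR R * measurableTypeR R) := I `*` I.
pose A (t u : R) : R := h * M * u + (1 - h) * t.
pose F (q : (measurableTypeR R * measurableTypeR R) * measurableTypeR R) : R :=
  ((f (A q.1.1 q.2) - f (A q.1.2 q.2)) / (q.1.1 - q.1.2)) ^+ 2.
have mA1 : measurable_fun setT (fun q : (measurableTypeR R * measurableTypeR R) * measurableTypeR R => f (A q.1.1 q.2)).
  apply: (measurableT_comp mf); apply: measurable_funD; apply: measurable_funM => //.
  exact: (measurableT_comp measurable_fst measurable_fst).
have mA2 : measurable_fun setT (fun q : (measurableTypeR R * measurableTypeR R) * measurableTypeR R => f (A q.1.2 q.2)).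
  apply: (measurableT_comp mf); apply: measurable_funD; apply: measurable_funM => //.
  exact: (measurableT_comp measurable_snd measurable_fst).
have mF : measurable_fun setT F.
  apply: measurable_funX; apply: measurable_funM; first exact: measurable_funB.
  apply: (measurableT_comp (@measurable_inv_fun R)); apply: measurable_funB.
    exact: (measurableT_comp measurable_fst measurable_fst).
  exact: (measurableT_comp measurable_snd measurable_fst).
have F0 q : 0 <= F q by exact: sqr_ge0.
pose H q : \bar R := (F q * (\1_D q.1 * \1_U q.2))%:E.
have mH : measurable_fun setT H.
  apply/measurable_EFinP; apply: measurable_funM => //; apply: measurable_funM.
    exact: (measurableT_comp (measurable_indic mII) measurable_fst).
  exact: (measurableT_comp (measurable_indic mU) measurable_snd).
have H0 q : (0 <= H q)%E by rewrite lee_fin; apply: mulr_ge0 => //; apply: mulr_ge0; rewrite indicE ler0n.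
have b1 p : D p -> (((rs (smooth h) p) ^+ 2)%:E <= (2^-1)%:E * \int[leb]_u H (p, u))%E.
  move=> Dp; rewrite (_ : (\int[leb]_u H (p, u))%E = \int[leb]_(u in U) (F (p, u))%:E)%E; last first.
    rewrite [RHS]integral_mkcond; apply: eq_integral => u _; rewrite patchE /H /= !indicE.
    by rewrite (mem_set Dp) mul1r; case: ifP => _; rewrite ?mulr1 ?mulr0.
  pose x u := (f (A p.1 u) - f (A p.2 u)) / (p.1 - p.2).
  have -> : rs (smooth h) p = 2^-1 * \int[leb]_(u in U) x u.
    rewrite /rs /smooth /x -mulrBr -RintegralB//; [|exact: iU..].
    rewrite -mulrA; congr (_ * _); rewrite mulrC -RintegralZl//.
      by apply: eq_Rintegral => u _; rewrite mulrC.
    apply: (@bounded_int _ _ (K + K)) => //.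
      by apply: measurable_funB; apply: measurable_funS (mfa _ _).
    by move=> u _; rewrite (le_trans (ler_normB _ _))// lerD.
  apply: (@mean_sqr x ((K + K) * `|(p.1 - p.2)^-1|)).
    by apply: measurable_funM => //; apply: measurable_funB; apply: measurable_funS (mfa _ _).
  by move=> u; rewrite normrM ler_wpM2r// (le_trans (ler_normB _ _))// lerD.
(* for each shift u, the affine change of variables *)
pose G (p : measurableTypeR R * measurableTypeR R) : \bar R := (rs f p ^+ 2 * \1_D p)%:E.
have mrsf : measurable_fun setT (rs f).
  apply: measurable_funM.
    by apply: measurable_funB; [exact: (measurableT_comp mf measurable_fst)|exact: (measurableT_comp mf measurable_snd)].
  by apply: (measurableT_comp (@measurable_inv_fun R)); exact: measurable_funB.
have mG : measurable_fun setT G.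
  by apply/measurable_EFinP; apply: measurable_funM; [exact: measurable_funX|exact: measurable_indic].
have G0 p : (0 <= G p)%E by rewrite lee_fin; apply: mulr_ge0; [exact: sqr_ge0|rewrite indicE ler0n].
have isqE g : isq leb2 D g = (\int[leb2]_p (g p ^+ 2 * \1_D p)%:E)%E.
  rewrite /isq integral_mkcond; apply: eq_integral => p _; rewrite patchE indicE.
  by case: ifP => _; rewrite ?mulr1 ?mulr0.
have b3 u : (\int[leb2]_p H (p, u) <= (\1_U u)%:E * isq leb2 D (rs f))%E.
  have [Uu|nUu] := boolP (u \in U); last first.
    rewrite indicE (negbTE nUu) mul0e integral0_eq// => p _.
    by rewrite /H /= [\1_U u]indicE (negbTE nUu) !mulr0.
  rewrite indicE Uu mul1e isqE -/G.
  pose c := h * M * u.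
  have Uu' : -1 <= u <= 1 by move: Uu; rewrite inE /= in_itv.
  (* This is why the average is taken around (1 - h) t: every contracted and shifted copy of the
     interval stays inside it. *)
  have stay t : - M < t < M -> - M < (1 - h) * t + c < M.
    move=> /andP[t1 t2]; have : `|c| <= h * M.
      rewrite /c normrM ger0_norm ?mulr_ge0 ?(ltW h0) ?(ltW M_gt0)//.
      by rewrite ler_piMr ?mulr_ge0 ?(ltW h0) ?(ltW M_gt0)// ler_norml.
    rewrite ler_norml => /andP[c1 c2].
    by apply/andP; split; nra.
  apply: (@le_trans _ _ (\int[leb2]_p ((((1 - h) ^+ 2)%:E * G ((1 - h) * p.1 + c, (1 - h) * p.2 + c)%R)))%E).
    apply: ge0_le_integral => //.
    - exact: (measurableT_comp mH (measurable_pair2 _)).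
    - apply: measurable_funeM; apply: (measurableT_comp mG); apply: measurable_fun_pair.
        exact: (measurableT_comp (@measurable_affine R _ _) measurable_fst).
      exact: (measurableT_comp (@measurable_affine R _ _) measurable_snd).
    move=> p _; rewrite /H /G -EFinM lee_fin /= !indicE Uu mulr1.
    have [Dp|_] := boolP (p \in D); last first.
      by rewrite mulr0; apply: mulr_ge0; [|apply: mulr_ge0]; rewrite ?sqr_ge0 ?ler0n.
    have [D1 D2] := set_mem Dp.
    have -> : ((((1 - h) * p.1 + c, (1 - h) * p.2 + c)%R : measurableTypeR R * measurableTypeR R) \in D).
      by apply/mem_set; split; apply: stay.
    rewrite !mulr1 /F /rs /= /A -exprMn le_eqVlt; apply/orP; left; apply/eqP; congr (_ ^+ 2).
    rewrite -/c [c + _]addrC [c + _]addrC; have [->|ne] := eqVneq p.1 p.2.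
      by rewrite !subrr !mul0r mulr0.
    have ne' : p.1 - p.2 != 0 by rewrite subr_eq0.
    have -> : (1 - h) * p.1 + c - ((1 - h) * p.2 + c) = (1 - h) * (p.1 - p.2) by ring.
    by field; rewrite ne' gt_eqF.
  rewrite ge0_integralZl//; last 2 first.
  - apply: (measurableT_comp mG); apply: measurable_fun_pair.
      exact: (measurableT_comp (@measurable_affine R _ _) measurable_fst).
    exact: (measurableT_comp (@measurable_affine R _ _) measurable_snd).
  - by rewrite lee_fin sqr_ge0.
  rewrite (integral2_affine c h10 mG G0) muleA -EFinM -exprMn mulfV ?expr1n ?mul1e// gt_eqF//.
have mS : measurable_fun D (fun p => ((rs (smooth h) p) ^+ 2)%:E).
  by apply: msq; apply: mrs; exact: lipC_measurable (smooth_lipC h01).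
apply: (@le_trans _ _ (\int[leb2]_(p in D) ((2^-1)%:E * \int[leb]_u H (p, u)))%E).
  apply: ge0_le_integral => //.
  - by move=> p _; rewrite lee_fin sqr_ge0.
  - apply: measurable_funeM; apply: measurable_funS (measurable_fun_fubini_tonelli_F H mH H0) => //.
apply: (@le_trans _ _ ((2^-1)%:E * \int[leb2]_p \int[leb]_u H (p, u))%E).
  rewrite -ge0_integralZl//; last 2 first.
  - exact: (measurable_fun_fubini_tonelli_F H mH H0).
  - by move=> p _; apply: integral_ge0.
  apply: ge0_subset_integral => //.
  - by apply: measurable_funeM; exact: (measurable_fun_fubini_tonelli_F H mH H0).
  - by move=> p _; rewrite mule_ge0// integral_ge0.
have eF : (\int[leb2]_p \int[leb]_u H (p, u) = \int[leb]_u \int[lebesgue2]_p H (p, u))%E.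
  exact: (@fubini_tonelli _ _ _ _ R lebesgue2 leb H mH H0).
rewrite eF.
apply: (@le_trans _ _ ((2^-1)%:E * \int[leb]_u ((\1_U u)%:E * isq leb2 D (rs f)))%E).
  apply: lee_wpmul2l => //; apply: ge0_le_integral => //.
  - by move=> u _; apply: integral_ge0.
  - exact: (measurable_fun_fubini_tonelli_G (m1 := lebesgue2) H mH H0).
  - by apply: emeasurable_funM => //; apply/measurable_EFinP; exact: measurable_indic.
under eq_integral do rewrite muleC.
have m1 : measurable_fun [set: measurableTypeR R] (fun u : measurableTypeR R => (\1_U u : R)%:E).
  by apply/measurable_EFinP; exact: measurable_indic.
have p1 u : [set: measurableTypeR R] u -> (0 <= (\1_U u : R)%:E)%E by move=> _; rewrite lee_fin indicE ler0n.
rewrite (ge0_integralZl _ measurableT m1 p1 (isq_ge0 _ _ _)).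
have -> : (\int[leb]_u (\1_U u : R)%:E = 2%:E)%E by rewrite integral_indic// setIT; exact: leb_U.
by rewrite muleC -muleA -EFinM mulfV ?mule1.
Qed.

(** The averaging intervals are not centred at t, but they lie in balls of radius 3 h M around it
    and have measure 2 h M, so they shrink nicely and Lebesgue's differentiation theorem applies.
    The clamp provides such intervals for points off the crack as well. *)
Lemma smooth_cvg : leb.-integrable setT (EFin \o f) ->
  {ae leb, forall t, I t -> smooth (n.+2%:R^-1) t @[n --> \oo] --> f t}.
Proof.
move=> fi; have locf := open_integrable_locally openT fi.
pose h n : R := n.+2%:R^-1.
have h0 n : 0 < h n by rewrite invr_gt0.
have hM n : 0 < h n * M by rewrite mulr_gt0.
pose c x n := x - h n * clamp M x.
pose E (x : R) n : set R := `[c x n - h n * M, c x n + h n * M]%classic.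
have E1 x n : lebesgue_measure (E x n) = (2 * (h n * M))%:E.
  rewrite /E lebesgue_measure_itv /= lte_fin ifT; last by have := hM n; lra.
  by rewrite -EFinD; congr EFin; ring.
have r0 n : 0 < 3 * (h n * M) by rewrite mulr_gt0.
have hE x : nicely_shrinking x (E x).
  split; first by move=> n; exact: measurable_itv.
  exists (3, fun n => PosNum (r0 n)); split => //=.
  - have : (3 * M) * h n @[n --> \oo] --> (0 : R).
      rewrite -(mulr0 (3 * M)); apply: cvgMr.
      by have := @cvg_harmonic R; rewrite -cvg_shiftS; apply.
    by under eq_fun do rewrite mulrAC -mulrA.
  - move=> n y; rewrite /E /ball /= in_itv /= => /andP[y1 y2].
    have := clamp_le x (ltW M_gt0); rewrite ler_norml => /andP[c1 c2].
    have g1 : h n * clamp M x <= h n * M by rewrite ler_wpM2l// ltW.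
    have g2 : h n * - M <= h n * clamp M x by rewrite ler_wpM2l// ltW.
    by have := hM n; rewrite ltr_norml; move: y1 y2; rewrite /c => y1 y2 ?; apply/andP; split; lra.
  - move=> n; rewrite lebesgue_measure_ball ?(ltW (r0 n))// E1 -EFinM lee_fin.
    by have := hM n => ?; lra.
have [N [mN N0 hN]] := lebesgue_differentiation locf.
exists N; split=> // t /= nP; apply: hN => /= ft; apply: nP => It.
have := nice_lebesgue_differentiation hE locf ft.
have -> : (fun n => (lebesgue_measure (E t n))^-1 * \int[lebesgue_measure]_(y in E t n) (f y)%:E)%E =
    (fun n => (smooth (h n) t)%:E).
  apply/funext => n; rewrite E1 inver gt_eqF ?mulr_gt0// smoothE//.
  have -> : E t n = J (h n) t.
    rewrite /E /J /c clamp_id; last by rewrite ltW// ltr_norml.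
    by rewrite mulrBl mul1r.
  by rewrite /Rintegral EFinM fineK//; exact: integrable_fin_num (iJ _ _).
by move=> /fine_cvgP[_].
Qed.

End smoothing.

Lemma lip1_measurable {R : realType} (w : R -> R) :
  (forall x y, `|w x - w y| <= `|x - y|) -> measurable_fun setT w.
Proof.
move=> wl; apply: continuous_measurable_fun => x; apply/cvgrPdist_le => e e0.
apply: filterS (nbhsx_ballx x _ e0) => y; rewrite /ball/= => h.
exact: le_trans (wl _ _) (ltW h).
Qed.

Lemma integrable_supported d (T : measurableType d) (R : realType)
    (mu : {measure set T -> \bar R}) (D : set T) (f : T -> R) : measurable D ->
  mu.-integrable D (EFin \o f) -> (forall t, ~ D t -> f t = 0) -> mu.-integrable setT (EFin \o f).
Proof.
move=> mD /(integrable_mkcond _ mD) + f0; congr (_.-integrable _ _).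
apply/funext => t; rewrite patchE; case: ifPn => // /negP nt /=.
by rewrite f0// => Dt; apply: nt; exact/mem_set.
Qed.

Lemma clampN (R : realType) (N x : R) : 0 <= N -> clamp N (- x) = - clamp N x.
Proof.
move=> N0; rewrite /clamp; case: (leP x N) => hx.
  rewrite oppr_max opprK minC max_r// le_min lerN2 hx andbT.
  by move: N0; lra.
rewrite [Num.min _ _]min_l; last by move: hx N0; lra.
rewrite [Num.max _ (- x)]max_l; last by move: hx N0; lra.
by rewrite max_r//; move: N0; lra.
Qed.

Section density.
Context {R : realType}.
Variable M : R.
Hypothesis M_gt0 : 0 < M.
Local Notation leb := (@lebesgue_measure R).
Local Notation leb2 := (leb \x leb)%E.
Local Notation I := ([set t : measurableTypeR R | - M < t < M]).
Variable L : (R -> R) -> R.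
Hypothesis hL : hfun M L.
Implicit Types f g : R -> R.

Lemma hfun_ext f g : hin M f -> hin M g -> (forall t, - M < t < M -> f t = g t) -> L f = L g.
Proof.
move=> hf hg e; have [linL [B B0 hB]] := hL.
have hd : hin M (fun t => -1 * f t + g t) by exact: hin_lin.
have h0 : (hn2 M (fun t => -1 * f t + g t)%R <= 0%:E)%E.
  rewrite /hn2 /isq !integral0_eq ?adde0//.
    move=> p [p1 p2]; rewrite /rs (e p.1)// (e p.2)//.
    by rewrite !mulN1r !addNr subrr mul0r expr0n.
  by move=> t It; rewrite e// mulN1r addNr expr0n.
have := hB _ _ hd (lexx 0) h0; rewrite sqrtr0 mulr0 normr_le0 linL// mulN1r.
by rewrite addrC subr_eq0 => /eqP.
Qed.

Lemma hfun_approx f (g : nat -> R -> R) : hin M f -> (forall n, hin M (g n)) -> (forall n, L (g n) = 0) ->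
  (forall e : R, 0 < e -> \forall n \near \oo, (isq leb I (fun t => g n t - f t)%R <= e%:E)%E) ->
  (forall e : R, 0 < e -> \forall n \near \oo, (isq leb2 (I `*` I) (fun p => rs (g n) p - rs f p)%R <= e%:E)%E) ->
  L f = 0.
Proof.
move=> hf hg Lg c1 c2; have [linL [B B0 hB]] := hL.
apply/eqP; rewrite -normr_le0; apply/ler_addgt0Pl => e e0; rewrite addr0.
pose w := (e / (B + 1)) ^+ 2.
have eB : 0 < e / (B + 1) by rewrite divr_gt0// ltr_wpDl.
have w0 : 0 < w by rewrite exprn_gt0.
have w20 : 0 < w / 2 by rewrite divr_gt0.
have [n _ /(_ n (leqnn n)) [h1 h2]] : \forall n \near \oo,
    (isq leb I (fun t => g n t - f t)%R <= (w / 2)%:E)%E /\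
    (isq leb2 (I `*` I) (fun p => rs (g n) p - rs f p)%R <= (w / 2)%:E)%E.
  by apply: filterS2 (c1 _ w20) (c2 _ w20) => n.
have hd : hin M (fun t => -1 * f t + g n t) by exact: hin_lin.
have h : (hn2 M (fun t => -1 * f t + g n t)%R <= w%:E)%E.
  rewrite (splitr w) EFinD; apply: leeD.
    by rewrite (_ : (fun t => _) = fun t => g n t - f t)//; apply/funext => t; ring.
  by rewrite (_ : rs _ = fun p => rs (g n) p - rs f p)//; apply/funext => p; rewrite /rs; ring.
have := hB _ _ hd (ltW w0) h; rewrite linL// Lg addr0 mulN1r normrN => hh.
apply: (le_trans hh); rewrite /w sqrtr_sqr gtr0_norm// mulrCA ler_piMr ?(ltW e0)//.
by rewrite ler_pdivrMr ?mul1r ?lerDl// ltr_wpDl.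
Qed.

Hypothesis L_lip : forall f, lip M f -> L f = 0.

(** For the smoothed functions, the L^2 part converges by domination; for the seminorm, convergence
    almost everywhere without increase of the integral is enough, by [isq_cvg]. *)
Lemma hfun_dense_nonneg f (K : R) : hin M f -> (forall t, 0 <= f t) -> (forall t, f t <= K) ->
  (forall t, ~ (- M < t < M) -> f t = 0) -> L f = 0.
Proof.
move=> hf f0 fK fI; have mI := @measurable_I R M; have mII := @measurable_II R M.
have K0 : 0 <= K by exact: le_trans (fK 0).
have fe : f = f \_ I.
  apply/funext => t; rewrite patchE; case: ifPn => // /negP nt; apply: fI => It.
  by apply: nt; exact/mem_set.
have mf : measurable_fun [set: measurableTypeR R] f.
  have h : measurable_fun [set: measurableTypeR R] (f \_ I).
    by apply/(measurable_restrictT _ mI); exact: hf.1.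
  by move: h; rewrite -fe.
have mu_fin : (leb I < +oo)%E by rewrite leb_I ?ltry.
have fi : leb.-integrable setT (EFin \o f).
  have iI : leb.-integrable I (EFin \o f).
    apply: (measurable_bounded_integrable mI mu_fin hf.1).
    exists K; split; first exact: num_real.
    move=> C CK t _ /=; rewrite ger0_norm//.
    exact: le_trans (fK t) (ltW CK).
  exact: integrable_supported mI iI fI.
pose g n := smooth M f n.+2%:R^-1.
have h01 n : 0 < (n.+2%:R^-1 : R) < 1 by rewrite invr_gt0 ltr0n /= invf_lt1// ltr1n.
have lg n : lipC M (K + K / (n.+2%:R^-1 * M)) (g n) by exact: smooth_lipC.
have hg n : hin M (g n) by apply: (lip_hin M_gt0); exists (K + K / (n.+2%:R^-1 * M)); exact: lg.
have ac := smooth_cvg M_gt0 mf f0 fK fi.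
apply: (hfun_approx hf hg).
- by move=> n; apply: L_lip; exists (K + K / (n.+2%:R^-1 * M)).
- move=> e e0; apply: (@isq_bounded_cvg_ae _ _ _ leb I (K + K) (fun n t => g n t - f t) mI mu_fin) => //.
  + by move=> n; apply: measurable_funB; [exact: (hg n).1|exact: hf.1].
  + move=> n t _; rewrite (le_trans (ler_normB _ _))// lerD//; last by rewrite ger0_norm.
    exact: smooth_le.
  + case: (ac) => N [mN N0 hN]; exists N; split=> // t /= nt; apply: hN => /= h; apply: nt => It.
    by rewrite -(subrr (f t)); apply: cvgB; [exact: h|exact: cvg_cst].
move=> e e0; apply: (isq_cvg mII) => //.
- by move=> n; apply: mrs; exact: (hg n).1.
- by apply: mrs; exact: hf.1.
- case: ac => N [mN N0 hN]; exists (N `*` setT `|` setT `*` N); split.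
  + by apply: measurableU; exact: measurableX.
  + apply: null_set_setU; [exact: measurableX|exact: measurableX| |].
      by apply: etrans (product_measure1E _ _ mN measurableT) _; rewrite [X in (X * _)%E](_ : _ = 0%E) ?mul0e//; exact: N0.
    by apply: etrans (product_measure1E _ _ measurableT mN) _; rewrite [X in (_ * X)%E](_ : _ = 0%E) ?mule0//; exact: N0.
  + move=> p; apply: contra_notP => /not_orP[n1 n2] [p1 p2]; rewrite /rs.
    have cx x : I x -> ~ N x -> g n x @[n --> \oo] --> f x.
      by move=> Ix Nx; apply: contrapT => h; apply: Nx; apply: hN => /= /(_ Ix).
    apply: cvgMl; apply: cvgB; apply: cx => // Nx; first by apply: n1.
    by apply: n2.
- by move=> n; exact: smooth_seminorm.
- by have [_ hfin] := hf; exact: (adde_lty (isq_ge0 _ _ _) (isq_ge0 _ _ _) hfin).2.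
Qed.

(** Truncations of the values are normal contractions: they increase neither part of the norm and
    converge pointwise, so [isq_cvg] again gives convergence in norm. *)
Lemma hfun_dense f : hin M f -> L f = 0.
Proof.
move=> hf; have mI := @measurable_I R M; have mII := @measurable_II R M.
have lin := hL.1.
have fin : (isq leb I f < +oo)%E /\ (isq leb2 (I `*` I) (rs f) < +oo)%E.
  by have [_ hfin] := hf; exact: (adde_lty (isq_ge0 _ _ _) (isq_ge0 _ _ _) hfin).
(* a normal contraction of f stays in the space *)
have contr (w : R -> R) : (forall x y, `|w x - w y| <= `|x - y|) -> w 0 = 0 -> measurable_fun setT w ->
    let g := fun t => w (f t) in hin M g /\ (isq leb I g <= isq leb I f)%E /\
      (isq leb2 (I `*` I) (rs g) <= isq leb2 (I `*` I) (rs f))%E.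
  move=> w1 w0 mw g.
  have mg : measurable_fun I g by apply: (measurableT_comp mw); exact: hf.1.
  have l1 : (isq leb I g <= isq leb I f)%E.
    apply: isq_le => //; first exact: hf.1.
    by move=> t _; rewrite /g -[w _]subr0 -w0 (le_trans (w1 _ _))// subr0.
  have l2 : (isq leb2 (I `*` I) (rs g) <= isq leb2 (I `*` I) (rs f))%E.
    apply: isq_le => //; [exact: mrs|by apply: mrs; exact: hf.1|].
    by move=> p _; rewrite /rs !normrM ler_wpM2r// w1.
  split=> //; split=> //; apply: le_lt_trans (leeD l1 l2) _.
  by apply: lte_add_pinfty; case: fin.
pose mt n (x : R) := Num.max (- n%:R) (Num.min x n%:R).
have mt1 n x y : `|mt n x - mt n y| <= `|x - y|.
  wlog xy : x y / x <= y.
    move=> H; have [xy|/ltW yx] := leP x y; first exact: H.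
    by rewrite distrC [leRHS]distrC; exact: H.
  have [h1 h2] := clamp_mono (ler0n R n) xy.
  by rewrite distrC [leRHS]distrC !ger0_norm ?subr_ge0.
have mt0 n : mt n 0 = 0 by rewrite /mt min_l// max_r// oppr_le0.
have cmt n : measurable_fun setT (mt n).
  exact: lip1_measurable (mt1 n).
pose g n t := mt n (f t).
have hg n := contr _ (mt1 n) (mt0 n) (cmt n).
have cv x : mt n x @[n --> \oo] --> x.
  have ev : \forall n \near \oo, mt n x = x.
    exists (Num.truncn `|x|).+1 => // n /= hn; rewrite /mt.
    have : `|x| <= n%:R.
      by apply: (le_trans (ltW (truncnS_gt _))); rewrite ler_nat.
    by rewrite ler_norml => /andP[h1 h2]; rewrite min_l// max_r.
  apply: (@cvg_trans _ ((fun=> x) n @[n --> \oo])); last exact: cvg_cst.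
  by apply: near_eq_cvg; apply: filterS ev => n ->.
have Lg n : L (g n) = 0.
  (* apply the nonnegative case to the positive and negative parts *)
  pose P (s : R) t := if - M < t < M then Num.max 0 (mt n (s * f t)) else 0.
  have part (s : R) : `|s| = 1 -> hin M (P s) /\ L (P s) = 0.
    move=> s1; rewrite /P; pose w x := Num.max 0 (mt n (s * x)).
    have wl x y : `|w x - w y| <= `|x - y|.
      apply: (@le_trans _ _ `|mt n (s * x) - mt n (s * y)|); last first.
        by rewrite (le_trans (mt1 _ _ _))// -mulrBr normrM s1 mul1r.
      rewrite /w; move: (mt n (s * x)) (mt n (s * y)) => u v.
      wlog uv : u v / u <= v.
        move=> H; have [uv|/ltW vu] := leP u v; first exact: H.
        by rewrite distrC [leRHS]distrC; exact: H.
      rewrite distrC [leRHS]distrC !ger0_norm ?subr_ge0//; case: (leP 0 u); case: (leP 0 v); lra.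
    have w0 : w 0 = 0 by rewrite /w mulr0 mt0 maxxx.
    have mw : measurable_fun setT w by exact: lip1_measurable wl.
    have [[mg fg] _] := contr w wl w0 mw.
    have eI t : I t -> (if - M < t < M then w (f t) else 0) = w (f t) by move=> ->.
    have hP : hin M (P s).
      split.
        apply: eq_measurable_fun mg => t /set_mem It.
        by rewrite /P eI.
      rewrite (_ : hn2 _ _ = hn2 M (fun t => w (f t))) //.
      rewrite /hn2; congr (_ + _)%E; rewrite /isq; apply: eq_integral => p /set_mem.
        by move=> Ip; rewrite /P eI.
      by move=> [p1 p2]; rewrite /rs /P !eI.
    split=> //; apply: (@hfun_dense_nonneg _ n%:R) => //.
    - by move=> t; case: ifP => // _; rewrite le_max lexx.
    - move=> t; case: ifP => // _; rewrite ge_max ler0n /= /mt ge_max ge_min lexx orbT andbT.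
      by rewrite (le_trans _ (ler0n _ _))// oppr_le0.
    - by move=> t /negP/negbTE ->.
  have [h1 L1] := part 1 (normr1 _); have [h2 L2] : hin M (P (-1)) /\ L (P (-1)) = 0.
    by apply: part; rewrite normrN1.
  rewrite -[RHS]addr0 -{1}L1 -[X in _ + X](mulr0 (-1)) -[in X in _ + X]L2 addrC -lin//.
  apply: hfun_ext; [exact: (hg n).1|exact: hin_lin|].
  have odd x : mt n (- x) = - mt n x.
    exact: clampN (ler0n R n).
  move=> t It; have eP s : P s t = Num.max 0 (mt n (s * f t)) by rewrite /P It.
  rewrite !eP mul1r [-1 * f t]mulN1r odd /g; move: (mt n (f t)) => y.
  by case: (leP 0 y) => y0; [rewrite max_l ?oppr_le0//|rewrite max_r ?oppr_ge0 ?ltW//]; ring.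
apply: (hfun_approx hf (fun n => (hg n).1) Lg).
- move=> e e0; apply: (isq_cvg mI) => //.
  + by move=> n; exact: (hg n).1.1.
  + exact: hf.1.
  + by apply: aeW => t _; exact: cv.
  + by move=> n; exact: (hg n).2.1.
  + exact: fin.1.
- move=> e e0; apply: (isq_cvg mII) => //.
  + by move=> n; apply: mrs; exact: (hg n).1.1.
  + by apply: mrs; exact: hf.1.
  + by apply: aeW => p _; rewrite /rs; apply: cvgMl; apply: cvgB; exact: cv.
  + by move=> n; exact: (hg n).2.2.
  + exact: fin.2.
Qed.

End density.

(** * Agreement of densities on the modes *)

Section integrals_of_functionals.
Context {R : realType}.
Local Notation leb := (@lebesgue_measure R).

Lemma cnt_seq (f : R -> R) (x : R) : (forall u : R^nat, u @ \oo --> x -> f (u n) @[n --> \oo] --> f x) ->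
  cnt f x.
Proof.
move=> h; apply/continuous_withinNx/cvgr_dnbhsP => u [_ ux]; exact: h.
Qed.

Lemma rintB_itv (f : R -> R) (a b c : R) : a <= b -> b <= c -> (forall x, cnt f x) ->
  rint b c f = rint a c f - rint a b f.
Proof.
move=> ab bc cf; rewrite /rint Rintegral_itvB ?bnd_simp//; last exact: cont_integrable.
rewrite Rintegral_itv_obnd_cbnd//.
apply: (@integrableS _ _ _ leb (`[b, c]%classic : set (measurableTypeR R))) => //; last exact: cont_integrable.
by apply: subset_itvr; rewrite bnd_simp.
Qed.

Lemma rint_ae0 (f : R -> R) (b : R) : 0 < b -> (forall x, cnt f x) ->
  {ae leb, forall s, 0 <= s < b -> f s = 0} -> rint 0 b f = 0.
Proof.
move=> b0 cf h; have i := cont_integrable 0 b cf.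
rewrite /rint -Rintegral_itv_bndo_bndc; last first.
  by apply: integrableS i => //; apply: subset_itvl; rewrite bnd_simp.
rewrite /Rintegral (_ : (\int[_]_(x in _) _)%E = 0%E)//.
have mi : measurable (`[0, b[%classic : set (measurableTypeR R)) by [].
rewrite (@ae_eq_integral _ _ _ leb _ (cst 0%E)) ?integral0//.
  apply/measurable_EFinP; apply: measurable_funTS; apply: continuous_measurable_fun; exact: cf.
case: h => N [mN N0 hN]; exists N; split=> // x /= nx; apply: hN => /= h; apply: nx.
by rewrite in_itv/= => /h ->.
Qed.

Variables (M : R) (L : (R -> R) -> R).
Hypothesis hL : lipfun M L.

Lemma lipfun_cnt (K : R -> R -> R) (C s : R) : (forall s, lipC M C (K s)) ->
  (forall t, - M < t < M -> cnt (K ^~ t) s) -> cnt (fun s => L (K s)) s.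
Proof.
move=> lK cK; apply: cnt_seq => u us; apply: (hL.2 C) => // t It.
exact: (cvg_comp u (K ^~ t) us (cK t It)).
Qed.

(** A Fubini theorem for L: as functions of the upper bound x, both sides have derivative L (K
    x). *)
Lemma lipfun_rint (K : R -> R -> R) (C b : R) : 0 < b -> (forall s, lipC M C (K s)) ->
  (forall s t, - M < t < M -> cnt (K ^~ t) s) ->
  rint 0 b (fun s => L (K s)) = L (fun t => rint 0 b (K ^~ t)).
Proof.
move=> b0 lK cK; have cL s : cnt (fun s => L (K s)) s by exact: lipfun_cnt (cK s).
(* Makes the Lipschitz property below hold for every upper bound, as [der_lipfun] requires. *)
have rneg (f : R -> R) x : x < -1 -> rint (-1) x f = 0.
  by move=> x1; rewrite /rint set_itv_ge ?Rintegral_set0// bnd_simp -ltNge.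
have lF h : lip M (fun t => rint (-1) h (K ^~ t)).
  have [h1|h1] := leP (-1) h; last by exists 0; split=> *; rewrite !rneg// ?subrr normr0 ?mul0r.
  exists (C * (h - -1)); split=> [t It|s t Is It].
    exact: (rint_le h1 (fun x => cK x t It) (fun x _ => (lK x).1 t It)).
  have -> : rint (-1) h (K ^~ s) - rint (-1) h (K ^~ t) = rint (-1) h (fun x => K x s - K x t).
    rewrite -[X in _ - X]mul1r -mulNr -rintZ; last by move=> x; exact: cK.
    rewrite -rintD//; first by apply: eq_rint => x _; rewrite mulN1r.
      by move=> x; exact: cK.
    by move=> x; apply: cvgM; [exact: cvg_cst|exact: cK].
  rewrite mulrAC; apply: (rint_le h1) => [x|x _]; last exact: (lK x).2.
  by apply: cvgB; exact: cK.
(* Starting the integrals at - 1 makes the upper bound 0 an interior point, where both sides can be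
   differentiated. *)
pose Phi x := rint (-1) x (fun s => L (K s)) - L (fun t => rint (-1) x (K ^~ t)).
have dPhi x : 0 <= x <= b -> der Phi x 0.
  move=> /andP[x0 xb]; have x1 : -1 < x by rewrite (lt_le_trans _ x0)// oppr_lt0.
  have d1 : der (fun x => rint (-1) x (fun s => L (K s))) x (L (K x)) by exact: der_rint_bound.
  have d2 : der (fun x => L (fun t => rint (-1) x (K ^~ t))) x (L (K x)).
    have h0 : 0 < (2^-1 : R) by rewrite invr_gt0.
    refine (@der_lipfun _ M L (fun x t => rint (-1) x (K ^~ t)) K x 2^-1 C hL h0 _ (fun h _ => lK h) lF).
    move=> h t hx It; have h1 : -1 < h.
      by move: hx; rewrite ler_distl => /andP[hx _]; apply: lt_le_trans hx; move: x0; lra.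
    by apply: der_rint_bound => // y; exact: cK.
  by have := derD d1 (derN d2); rewrite subrr.
have := cst_of_der0 (ltW b0) dPhi; rewrite /Phi.
have le0 : (-1 : R) <= 0 by rewrite oppr_le0.
rewrite (rintB_itv le0 (ltW b0) cL).
have -> : L (fun t => rint 0 b (K ^~ t)) =
    L (fun t => rint (-1) b (K ^~ t)) - L (fun t => rint (-1) 0 (K ^~ t)).
  rewrite -(lipfunB hL (lF b) (lF 0)); apply/esym/(lipfun_ext hL).
    have := lipD (lF b) (lipZ (-1) (lF 0)); congr (lip M _); apply/funext => t.
    by rewrite mulN1r.
  by move=> t It; rewrite (rintB_itv le0 (ltW b0) (fun x => cK x t It)).
lra.
Qed.

End integrals_of_functionals.

Section transfer.
Context {R : realType}.
Variables (k r M : R).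
Hypotheses (k_gt0 : 0 < k) (r_gt0 : 0 < r) (M_gt0 : 0 < M).
Local Notation leb := (@lebesgue_measure R).
Let T := 2 * pi * r.
Let T_gt0 : 0 < T. Proof. by rewrite !mulr_gt0// pi_gt0. Qed.
Variables (L1 L2 L1' L2' : (R -> R) -> R).
Hypotheses (h1 : lipfun M L1) (h2 : lipfun M L2) (h1' : lipfun M L1') (h2' : lipfun M L2').

(* UJ and VJ stand for kernels built from J_0, UY and VY for those built from Y_0. *)
Variables (UJ UY VJ VY : R -> R -> R) (C : R).
Hypotheses (lUJ : forall s, lipC M C (UJ s)) (lUY : forall s, lipC M C (UY s)).
Hypotheses (lVJ : forall s, lipC M C (VJ s)) (lVY : forall s, lipC M C (VY s)).
Hypotheses (cUJ : forall s t, - M < t < M -> cnt (UJ ^~ t) s).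
Hypotheses (cUY : forall s t, - M < t < M -> cnt (UY ^~ t) s).
Hypotheses (cVJ : forall s t, - M < t < M -> cnt (VJ ^~ t) s).
Hypotheses (cVY : forall s t, - M < t < M -> cnt (VY ^~ t) s).
Hypothesis hae : {ae leb, forall s, 0 <= s < T ->
  L2 (UJ s) + L1 (UY s) = L2' (VJ s) + L1' (VY s) /\
  L1 (UJ s) - L2 (UY s) = L1' (VJ s) - L2' (VY s)}.

(** Graf's formula gives J and Y the same regular modes u and v, with only the amplitudes aJ and aY
    differing. The two real equations become a linear system for L1 u - L1' v and L2 u - L2' v of
    determinant aJ^2 + aY^2, up to sign, which is nonzero by [bessel_tower_neq0]. *)
Lemma mode_transfer (n : nat) (tr : R -> R) (u v : R -> R) :
  (forall s, cnt tr s) -> (forall s, `|tr s| <= 1) -> lip M u -> lip M v ->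
  (forall t, - M < t < M -> rint 0 T (fun s => UJ s t * tr s) = amp k r (besJ k) n r * u t) ->
  (forall t, - M < t < M -> rint 0 T (fun s => UY s t * tr s) = amp k r (besY k) n r * u t) ->
  (forall t, - M < t < M -> rint 0 T (fun s => VJ s t * tr s) = amp k r (besJ k) n r * v t) ->
  (forall t, - M < t < M -> rint 0 T (fun s => VY s t * tr s) = amp k r (besY k) n r * v t) ->
  L1 u = L1' v /\ L2 u = L2' v.
Proof.
move=> ctr tr1 lu lv eUJ eUY eVJ eVY.
set aJ := amp _ _ _ _ _ in eUJ eVJ; set aY := amp _ _ _ _ _ in eUY eVY.
have a0 : 0 < aJ ^+ 2 + aY ^+ 2.
  have r2 : 0 < r ^+ 2 by rewrite exprn_gt0.
  have := bessel_tower_neq0 k_gt0 n r2.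
  have c0 : T * r ^+ n * (- 2 / k) ^+ n != 0.
    have kn0 : - 2 / k != 0 by rewrite mulf_neq0 ?oppr_eq0 ?pnatr_eq0 ?invr_eq0 ?(gt_eqF k_gt0).
    exact: (mulf_neq0 (mulf_neq0 (lt0r_neq0 T_gt0) (expf_neq0 _ (lt0r_neq0 r_gt0))) (expf_neq0 _ kn0)).
  rewrite lt0r paddr_eq0 ?sqr_ge0// addr_ge0 ?sqr_ge0// andbT !expf_eq0/= -negb_and.
  have z F : (amp k r F n r == 0) = (F n (r ^+ 2) == 0) by rewrite /amp mulf_eq0 -/T (negbTE c0).
  by rewrite /aJ /aY !z.
have key (L : (R -> R) -> R) (U : R -> R -> R) (w : R -> R) (a : R) : lipfun M L ->
    (forall s, lipC M C (U s)) -> (forall s t, - M < t < M -> cnt (U ^~ t) s) -> lip M w ->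
    (forall t, - M < t < M -> rint 0 T (fun s => U s t * tr s) = a * w t) ->
    rint 0 T (fun s => L (U s) * tr s) = a * L w /\ (forall s, cnt (fun s => L (U s) * tr s) s).
  move=> hL lU cU lw e.
  have cLU s : cnt (fun s => L (U s)) s by exact: (lipfun_cnt hL) lU (cU s).
  split; last by move=> s; exact: cntM.
  have lU1 s : lip M (U s) by exists C.
  rewrite -(lipfunZ hL)//.
  have -> : L (fun t => a * w t) = L (fun t => rint 0 T (fun s => U s t * tr s)).
    by apply: (lipfun_ext hL) => [|t It]; [exact: lipZ|rewrite e].
  have C0 : 0 <= C by apply: (lipC_ge0 M_gt0 (lU 0)).
  have lK s : lipC M C (fun t => U s t * tr s).
    apply: (@lipC_ext _ _ _ (fun t => tr s * U s t)); first by move=> t _; rewrite mulrC.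
    by apply: lipC_le (lipCZ (tr s) (lU s)); rewrite ler_piMl.
  rewrite -(lipfun_rint hL T_gt0 lK); last by move=> s t It; apply: cntM => //; exact: cU.
  apply: eq_rint => s _; rewrite mulrC -(lipfunZ hL)//; congr L.
  by apply/funext => t; rewrite mulrC.
have [i1 c1] := key _ _ _ _ h2 lUJ cUJ lu eUJ.
have [i2 c2] := key _ _ _ _ h1 lUY cUY lu eUY.
have [i3 c3] := key _ _ _ _ h2' lVJ cVJ lv eVJ.
have [i4 c4] := key _ _ _ _ h1' lVY cVY lv eVY.
have [i5 c5] := key _ _ _ _ h1 lUJ cUJ lu eUJ.
have [i6 c6] := key _ _ _ _ h2 lUY cUY lu eUY.
have [i7 c7] := key _ _ _ _ h1' lVJ cVJ lv eVJ.
have [i8 c8] := key _ _ _ _ h2' lVY cVY lv eVY.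
have comb (x y z w : R -> R) (e : R) : (forall s, cnt x s) -> (forall s, cnt y s) ->
    (forall s, cnt z s) -> (forall s, cnt w s) ->
    {ae leb, forall s, 0 <= s < T -> x s + e * y s - z s - e * w s = 0} ->
    rint 0 T x + e * rint 0 T y - rint 0 T z - e * rint 0 T w = 0.
  move=> cx cy cz cw h; rewrite -[RHS](rint_ae0 T_gt0 _ h); last first.
    by move=> s; cnt_auto; first [exact: cx|exact: cy|exact: cz|exact: cw].
  have cc a (f : R -> R) : (forall s, cnt f s) -> forall s, cnt (fun s => a * f s) s.
    by move=> cf s; apply: cntM => //; exact: cvg_cst.
  have cN (f : R -> R) : (forall s, cnt f s) -> forall s, cnt (fun s => - f s) s.
    by move=> cf s; exact: cntN.
  have rN (f : R -> R) : (forall s, cnt f s) -> - rint 0 T f = rint 0 T (fun s => - f s).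
    by move=> cf; rewrite -mulN1r -rintZ//; apply: eq_rint => s _; rewrite mulN1r.
  rewrite -!rintZ// !rN//; last by exact: cc.
  have cD (f g : R -> R) : (forall s, cnt f s) -> (forall s, cnt g s) -> forall s, cnt (fun s => f s + g s) s.
    by move=> cf cg s; exact: cntD.
  have ey := cc e _ cy; have nz := cN _ cz; have ew := cN _ (cc e _ cw).
  by rewrite (rintD 0 T (cD _ _ (cD _ _ cx ey) nz) ew) (rintD 0 T (cD _ _ cx ey) nz) (rintD 0 T cx ey).
have E1 : aJ * L2 u + aY * L1 u - aJ * L2' v - aY * L1' v = 0.
  rewrite -i1 -i2 -i3 -i4.
  have := comb _ _ _ _ 1 c1 c2 c3 c4; rewrite !mul1r; apply.
  case: hae => N [mN N0 hN]; exists N; split=> // s /= ns; apply: hN => h; apply: ns => /h[e _].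
  have := congr1 (fun x => x * tr s) e; rewrite /=; lra.
have E2 : aJ * L1 u - aY * L2 u - aJ * L1' v + aY * L2' v = 0.
  rewrite -i5 -i6 -i7 -i8.
  have := comb _ _ _ _ (-1) c5 c6 c7 c8; rewrite !mulN1r opprK; apply.
  case: hae => N [mN N0 hN]; exists N; split=> // s /= ns; apply: hN => h; apply: ns => /h[_ e].
  have := congr1 (fun x => x * tr s) e; rewrite /=; lra.
split; apply/eqP; rewrite -subr_eq0; apply/eqP; apply: (mulfI (lt0r_neq0 a0)); rewrite mulr0.
  have -> : (aJ ^+ 2 + aY ^+ 2) * (L1 u - L1' v) = aJ * (aJ * L1 u - aY * L2 u - aJ * L1' v + aY * L2' v)
     + aY * (aJ * L2 u + aY * L1 u - aJ * L2' v - aY * L1' v) by ring.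
  by rewrite E1 E2 !mulr0 addr0.
have -> : (aJ ^+ 2 + aY ^+ 2) * (L2 u - L2' v) = - aY * (aJ * L1 u - aY * L2 u - aJ * L1' v + aY * L2' v)
     + aJ * (aJ * L2 u + aY * L1 u - aJ * L2' v - aY * L1' v) by ring.
by rewrite E1 E2 !mulr0 addr0.
Qed.

End transfer.

(** * From modes to plane waves *)

Section complex_lipschitz.
Context {R : realType}.
Variable M : R.
Implicit Types (F G : R -> R[i]) (C D t : R).

Definition clipC C F := lipC M C (fun t => cRe (F t)) /\ lipC M C (fun t => cIm (F t)).
Definition clip F := exists C, clipC C F.

Lemma clipC_le C D F : C <= D -> clipC C F -> clipC D F.
Proof. by move=> CD [h1 h2]; split; [exact: lipC_le h1|exact: lipC_le h2]. Qed.

Lemma clipC_ext C F G : (forall t, - M < t < M -> F t = G t) -> clipC C F -> clipC C G.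
Proof.
by move=> e [h1 h2]; split; [apply: lipC_ext h1|apply: lipC_ext h2] => t It /=; rewrite e.
Qed.

Lemma clipCD C D F G : clipC C F -> clipC D G -> clipC (C + D) (fun t => F t + G t).
Proof.
move=> [f1 f2] [g1 g2]; split.
  by apply: lipC_ext (lipCD f1 g1) => t _ /=; rewrite ReD.
by apply: lipC_ext (lipCD f2 g2) => t _ /=; rewrite ImD.
Qed.

Lemma clipCM C D F G : clipC C F -> clipC D G -> clipC (4 * C * D) (fun t => F t * G t).
Proof.
move=> [f1 f2] [g1 g2]; have -> : 4 * C * D = 2 * C * D + 2 * C * D by ring.
have lN (f : R -> R) E : lipC M E f -> lipC M E (fun t => - f t).
  move=> h; apply: (@lipC_ext _ _ _ (fun t => -1 * f t)); first by move=> t _; rewrite mulN1r.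
  by have := lipCZ (-1) h; rewrite normrN1 mul1r.
split.
  apply: (@lipC_ext _ _ _ (fun t => cRe (F t) * cRe (G t) + - (cIm (F t) * cIm (G t)))).
    by move=> t _; rewrite ReM.
  by apply: lipCD; [exact: lipCM|apply: lN; exact: lipCM].
apply: (@lipC_ext _ _ _ (fun t => cRe (F t) * cIm (G t) + cIm (F t) * cRe (G t))).
  by move=> t _; rewrite ImM.
by apply: lipCD; exact: lipCM.
Qed.

Lemma clipC_cst (c : R[i]) : clipC (normc c) (fun=> c).
Proof.
split; first by apply: lipC_le (lipC_cst _ _); exact: normc_Re.
by apply: lipC_le (lipC_cst _ _); exact: normc_Im.
Qed.

Lemma clipC_der C F (dF : R -> R[i]) : (forall t, - M < t < M -> cder F t (dF t)) ->
  (forall t, - M < t < M -> normc (F t) <= C) -> (forall t, - M < t < M -> normc (dF t) <= C) ->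
  clipC C F.
Proof.
move=> hd h1 h2; split.
  apply: (lipC_der (df := fun t => cRe (dF t))) => t It; first exact: (hd t It).1.
    exact: le_trans (normc_Re _) (h1 t It).
  exact: le_trans (normc_Re _) (h2 t It).
apply: (lipC_der (df := fun t => cIm (dF t))) => t It; first exact: (hd t It).2.
  exact: le_trans (normc_Im _) (h1 t It).
exact: le_trans (normc_Im _) (h2 t It).
Qed.

Lemma clip_cM (c : R[i]) F : clip F -> clip (fun t => c * F t).
Proof. by case=> C h; exists (4 * normc c * C); apply: clipCM => //; exact: clipC_cst. Qed.

Lemma clipD F G : clip F -> clip G -> clip (fun t => F t + G t).
Proof. by case=> C h [D h']; exists (C + D); exact: clipCD. Qed.

Definition cj (z : R[i]) : R[i] := (cRe z +i* - cIm z)%C.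

Lemma cjM z w : cj (z * w) = cj z * cj w.
Proof. by case: z w => [a b] [c d]; apply: complex_ext; rewrite /= ?ReM ?ImM/=; ring. Qed.

Lemma cjX z n : cj (z ^+ n) = cj z ^+ n.
Proof.
elim: n => [|n ih]; last by rewrite !exprS cjM ih.
by rewrite !expr0; apply: complex_ext => //=; rewrite oppr0.
Qed.

Lemma cj_real (x : R) : cj (x%:C)%C = (x%:C)%C.
Proof. by apply: complex_ext => //=; rewrite oppr0. Qed.

Lemma clip_cj F : clip F -> clip (fun t => cj (F t)).
Proof.
case=> C [h1 h2]; exists C; split=> //.
apply: (@lipC_ext _ _ _ (fun t => -1 * cIm (F t))); first by move=> t _ /=; rewrite mulN1r.
by have := lipCZ (-1) h2; rewrite normrN1 mul1r.
Qed.

Variables L L' : (R -> R) -> R.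
Hypotheses (hL : lipfun M L) (hL' : lipfun M L').

(** The regularity of both functions is included, so that sums, multiples and conjugates need no
    side conditions. *)
Definition agree F G := [/\ clip F, clip G, L (fun t => cRe (F t)) = L' (fun t => cRe (G t)) &
  L (fun t => cIm (F t)) = L' (fun t => cIm (G t))].

Lemma agreeD F F' G G' : agree F G -> agree F' G' ->
  agree (fun t => F t + F' t) (fun t => G t + G' t).
Proof.
have lr H : clip H -> lip M (fun t => cRe (H t)) by case=> C [h _]; exists C.
have li H : clip H -> lip M (fun t => cIm (H t)) by case=> C [_ h]; exists C.
move=> [cF cG e1 e2] [cF' cG' e1' e2']; split; [exact: clipD|exact: clipD| |].
  under eq_fun do rewrite ReD; rewrite (lipfunD hL (lr _ cF) (lr _ cF')) e1 e1'.
  by under [in RHS]eq_fun do rewrite ReD; rewrite (lipfunD hL' (lr _ cG) (lr _ cG')).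
under eq_fun do rewrite ImD; rewrite (lipfunD hL (li _ cF) (li _ cF')) e2 e2'.
by under [in RHS]eq_fun do rewrite ImD; rewrite (lipfunD hL' (li _ cG) (li _ cG')).
Qed.

Lemma agreeZ (c : R[i]) F G : agree F G -> agree (fun t => c * F t) (fun t => c * G t).
Proof.
have lr H : clip H -> lip M (fun t => cRe (H t)) by case=> C [h _]; exists C.
have li H : clip H -> lip M (fun t => cIm (H t)) by case=> C [_ h]; exists C.
move=> [cF cG e1 e2]; split; [exact: clip_cM|exact: clip_cM| |].
  have eR H : (fun t => cRe (c * H t)) = (fun t => cRe c * cRe (H t) + (- cIm c) * cIm (H t)).
    by apply/funext => t; rewrite ReM mulNr.
  rewrite !eR hL.1 ?hL'.1; last 4 first.
  - exact: lr.
  - by apply: lipZ; exact: li.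
  - exact: lr.
  - by apply: lipZ; exact: li.
  by rewrite (lipfunZ hL _ (li _ cF)) (lipfunZ hL' _ (li _ cG)) e1 e2.
have eI H : (fun t => cIm (c * H t)) = (fun t => cRe c * cIm (H t) + cIm c * cRe (H t)).
  by apply/funext => t; rewrite ImM.
rewrite !eI hL.1 ?hL'.1; last 4 first.
- exact: li.
- by apply: lipZ; exact: lr.
- exact: li.
- by apply: lipZ; exact: lr.
by rewrite (lipfunZ hL _ (lr _ cF)) (lipfunZ hL' _ (lr _ cG)) e1 e2.
Qed.

Lemma agree_cj F G : agree F G -> agree (fun t => cj (F t)) (fun t => cj (G t)).
Proof.
have li H : clip H -> lip M (fun t => cIm (H t)) by case=> C [_ h]; exists C.
move=> [cF cG e1 e2]; split; [exact: clip_cj|exact: clip_cj|exact: e1|].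
have eN H : (fun t => cIm (cj (H t))) = (fun t => -1 * cIm (H t)).
  by apply/funext => t; rewrite mulN1r.
by rewrite !eN (lipfunZ hL _ (li _ cF)) (lipfunZ hL' _ (li _ cG)) e2.
Qed.

Lemma agree0 : agree (fun=> 0) (fun=> 0).
Proof.
split; [by exists (normc 0); exact: clipC_cst|by exists (normc 0); exact: clipC_cst| |];
by rewrite /= (lipfun0 hL) (lipfun0 hL').
Qed.

(** The terms of negative order in a wave are multiples of conjugates of those of positive order,
    whence the shape of the sum. *)
Lemma agree_sum (U V : nat -> R -> R[i]) (c d : nat -> R[i]) N : (forall n, agree (U n) (V n)) ->
  agree (fun t => \sum_(n < N) (c n * U n t + d n.+1 * cj (U n.+1 t)))
        (fun t => \sum_(n < N) (c n * V n t + d n.+1 * cj (V n.+1 t))).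
Proof.
move=> h; elim: N => [|N ih].
  rewrite (_ : (fun t => _) = fun=> 0); last by apply/funext => t; rewrite big_ord0.
  rewrite (_ : (fun t => \sum_(n < 0) _) = fun=> 0); last by apply/funext => t; rewrite big_ord0.
  exact: agree0.
under eq_fun do rewrite big_ord_recr.
under [X in agree _ X]eq_fun do rewrite big_ord_recr.
apply: agreeD => //; apply: agreeD; apply: agreeZ => //; exact: agree_cj.
Qed.

Lemma agree_ext F F' G G' : (forall t, - M < t < M -> F t = F' t) ->
  (forall t, - M < t < M -> G t = G' t) -> agree F G -> agree F' G'.
Proof.
have lr H : clip H -> lip M (fun t => cRe (H t)) by case=> C [h _]; exists C.
have li H : clip H -> lip M (fun t => cIm (H t)) by case=> C [_ h]; exists C.
move=> eF eG [cF cG e1 e2]; split.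
- by case: cF => C h; exists C; exact: clipC_ext h.
- by case: cG => C h; exists C; exact: clipC_ext h.
- rewrite -(lipfun_ext hL (f := fun t => cRe (F t))) -?(lipfun_ext hL' (f := fun t => cRe (G t)))//; try exact: lr.
    by move=> t It; rewrite eG.
  by move=> t It; rewrite eF.
- rewrite -(lipfun_ext hL (f := fun t => cIm (F t))) -?(lipfun_ext hL' (f := fun t => cIm (G t)))//; try exact: li.
    by move=> t It; rewrite eG.
  by move=> t It; rewrite eF.
Qed.

Definition ccvg (u : nat -> R[i]) (l : R[i]) :=
  cRe (u n) @[n --> \oo] --> cRe l /\ cIm (u n) @[n --> \oo] --> cIm l.

Lemma agree_lim C (F G : nat -> R -> R[i]) F' G' : (forall n, agree (F n) (G n)) ->
  (forall n, clipC C (F n)) -> (forall n, clipC C (G n)) ->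
  (forall t, - M < t < M -> ccvg (F ^~ t) (F' t)) -> (forall t, - M < t < M -> ccvg (G ^~ t) (G' t)) ->
  L (fun t => cRe (F' t)) = L' (fun t => cRe (G' t)) /\
  L (fun t => cIm (F' t)) = L' (fun t => cIm (G' t)).
Proof.
move=> a lF lG cF cG; split.
  have h1 := hL.2 C _ (fun t => cRe (F' t)) (fun n => (lF n).1) (fun t It => (cF t It).1).
  have h2 := hL'.2 C _ (fun t => cRe (G' t)) (fun n => (lG n).1) (fun t It => (cG t It).1).
  have e : (fun n => L (fun t => cRe (F n t))) = (fun n => L' (fun t => cRe (G n t))).
    by apply/funext => n; case: (a n).
  by rewrite e in h1; exact: (cvg_unique _ h1 h2).
have h1 := hL.2 C _ (fun t => cIm (F' t)) (fun n => (lF n).2) (fun t It => (cF t It).2).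
have h2 := hL'.2 C _ (fun t => cIm (G' t)) (fun n => (lG n).2) (fun t It => (cG t It).2).
have e : (fun n => L (fun t => cIm (F n t))) = (fun n => L' (fun t => cIm (G n t))).
  by apply/funext => n; case: (a n).
by rewrite e in h1; exact: (cvg_unique _ h1 h2).
Qed.

Lemma ccvgD u v l l' : ccvg u l -> ccvg v l' -> ccvg (fun n => u n + v n) (l + l').
Proof.
move=> [u1 u2] [v1 v2]; split.
  by under eq_fun do rewrite ReD; rewrite ReD; exact: cvgD.
by under eq_fun do rewrite ImD; rewrite ImD; exact: cvgD.
Qed.

Lemma ccvgZ c u l : ccvg u l -> ccvg (fun n => c * u n) (c * l).
Proof.
move=> [u1 u2]; split.
  by under eq_fun do rewrite ReM; rewrite ReM; apply: cvgB; exact: cvgMr.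
by under eq_fun do rewrite ImM; rewrite ImM; apply: cvgD; exact: cvgMr.
Qed.

Lemma ccvg0 u : normc (u n) @[n --> \oo] --> 0 -> ccvg u 0.
Proof.
move=> h; split; apply/cvgr0Pnorm_le => e e0; have /cvgr0Pnorm_le/(_ e e0) := h;
  apply: filterS => n; rewrite ger0_norm ?normc_ge0// => ne.
  exact: le_trans (normc_Re _) ne.
exact: le_trans (normc_Im _) ne.
Qed.

End complex_lipschitz.

Section wave_bounds.
Context {R : realType}.
Variable M : R.
Hypothesis M_gt0 : 0 < M.
Variables (a b : R -> R[i]) (X : R -> R) (a1 b1 : R[i]).
Hypotheses (da : forall t, cder a t a1) (db : forall t, cder b t b1).
Hypothesis abX : forall t, a t * b t = ((X t)%:C)%C.

Let X' t := cRe (a1 * b t + a t * b1).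

Lemma dX (t : R) : der X t (X' t).
Proof.
have [d _] := cderM (da t) (db t).
by apply: der_ext d => s; rewrite abX.
Qed.

Lemma X'E (t : R) : ((X' t)%:C)%C = a1 * b t + a t * b1.
Proof.
have [_ d] := cderM (da t) (db t); apply: complex_ext => //=.
have d0 : der (fun s => cIm (a s * b s)) t 0.
  by apply: der_ext (der_cst 0 t) => s; rewrite abX.
by rewrite (der_unique d d0).
Qed.

Lemma affine_bound : exists2 A, 0 <= A & forall t, - M < t < M -> normc (a t) <= A /\ normc (b t) <= A.
Proof.
have cc (f : R -> R) (d : R) : (forall t : R, der f t d) ->
    exists C, forall t, - M <= t <= M -> `|f t| <= C.
  by move=> h; apply: compact_bound => x _; exact: cnt_der (h x).
have nb (f : R -> R[i]) (d : R[i]) : (forall t, cder f t d) ->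
    exists C, forall t, - M < t < M -> normc (f t) <= C.
  move=> h; have [C1 h1] := cc _ _ (fun t => (h t).1); have [C2 h2] := cc _ _ (fun t => (h t).2).
  exists (C1 + C2) => t It.
  have It' : - M <= t <= M by case/andP: It => *; rewrite !ltW.
  apply: (@le_trans _ _ (`|cRe (f t)| + `|cIm (f t)|)); last by rewrite lerD ?h1 ?h2.
  rewrite -[leRHS]ger0_norm ?addr_ge0//.
  rewrite -sqrtr_sqr; case: (f t) => x y /=; rewrite ler_sqrt ?sqr_ge0//.
  rewrite sqrrD !real_normK ?num_real//.
  by have := mulr_ge0 (normr_ge0 x) (normr_ge0 y); lra.
have [A hA] := nb _ _ da; have [B hB] := nb _ _ db.
exists (`|A| + `|B|); first by rewrite addr_ge0.
move=> t It; split; [apply: le_trans (hA t It) _|apply: le_trans (hB t It) _].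
  by apply: le_trans (ler_norm _) _; rewrite lerDl.
by apply: le_trans (ler_norm _) _; rewrite lerDr.
Qed.

(** By [cder_wavsum] the derivative of a partial sum is again made of partial sums and end terms, so
    a single constant serves all N, as continuity of a [lipfun] demands. *)
Lemma wave_bound : exists C, forall N,
  [/\ clipC M C (fun t => wavsum N.+1 (a t) (b t) (X t)), clipC M C (fun t => wav N (a t) (X t)) &
      clipC M C (fun t => wav N (b t) (X t))].
Proof.
have [A A0 hA] := affine_bound.
have XA t : - M < t < M -> `|X t| <= A ^+ 2.
  move=> It; rewrite -normc_real -abX normcM expr2 ler_pM ?normc_ge0//; first exact: (hA t It).1.
  exact: (hA t It).2.
pose W := wavB A; have W0 : 0 <= W by rewrite mulr_ge0 ?expR_ge0.
pose D := normc a1 + normc b1; have D0 : 0 <= D by rewrite addr_ge0 ?normc_ge0.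
pose C := (2 + 4 * D) * W.
have wa n t : - M < t < M -> normc (wav n (a t) (X t)) <= W.
  by move=> It; apply: wav_leB (XA t It); exact: (hA t It).1.
have wb n t : - M < t < M -> normc (wav n (b t) (X t)) <= W.
  by move=> It; apply: wav_leB (XA t It); exact: (hA t It).2.
have two (u v : R[i]) (B : R) : normc u <= B -> normc v <= B -> normc (a1 * u + b1 * v) <= D * B.
  move=> hu hv; apply: le_trans (le_normcD _ _) _; rewrite !normcM mulrDl lerD// ler_wpM2l ?normc_ge0//.
have DWC : D * W <= C by rewrite /C ler_wpM2r//; move: D0; lra.
have WC : 2 * W <= C by rewrite /C ler_wpM2r//; move: D0; lra.
have W1 : W <= C by apply: le_trans WC; rewrite ler_peMl// ler1n.
have X2 t : ((X' t)%:C)%C = b1 * a t + b t * a1.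
  by rewrite X'E addrC [b1 * _]mulrC [b t * _]mulrC.
have ba t : b t * a t = ((X t)%:C)%C by rewrite mulrC abX.
exists C => N; split.
- apply: clipC_der => [t It|t It|t It].
  + exact: (cder_wavsum N (da t) (db t) (dX t) (X'E t) (abX t)).
  + apply: le_trans WC; apply: wavsum_le (XA t It); [exact: (hA t It).1|exact: (hA t It).2].
  + cbv beta; set s := wavsum _ _ _ _.
    have hs : normc s <= 2 * W by apply: wavsum_le (XA t It); [exact: (hA t It).1|exact: (hA t It).2].
    have sub u v : normc u <= W -> normc v <= W -> normc (u - v) <= 2 * W.
      move=> hu hv; apply: le_trans (le_normcD _ _) _.
      by rewrite normcN mulrDl !mul1r lerD.
    rewrite -addrA; apply: le_trans (le_normcD _ _) _.
    have -> : C = 2 * W + D * (2 * W) + D * (2 * W) by rewrite /C; ring.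
    rewrite lerD//.
      rewrite normcM; apply: (@le_trans _ _ (D * (2 * W))); last by rewrite lerDr mulr_ge0.
      by rewrite ler_pM ?normc_ge0// le_normcD.
    by apply: two => //; apply: sub; [exact: wb|exact: wa|exact: wa|exact: wb].
- case: N => [|N].
    apply: clipC_der => [t It|t It|t It]; [exact: (@cder_wav0 R a b X t a1 b1 (X' t) (dX t) (X'E t))|exact: le_trans (wa _ t It) W1|].
    apply: le_trans DWC; apply: two; [exact: wb|exact: wa].
  apply: clipC_der => [t It|t It|t It]; [exact: (@cder_wavS R N a b X t a1 b1 (X' t) (da t) (dX t) (X'E t) (abX t))|exact: le_trans (wa _ t It) W1|].
  by apply: le_trans DWC; apply: two; exact: wa.
- have two' (u v : R[i]) (B : R) : normc u <= B -> normc v <= B -> normc (b1 * u + a1 * v) <= D * B.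
    by move=> hu hv; rewrite addrC; apply: two.
  case: N => [|N].
    apply: clipC_der => [t It|t It|t It]; [exact: (@cder_wav0 R b a X t b1 a1 (X' t) (dX t) (X2 t))|exact: le_trans (wb _ t It) W1|].
    by apply: le_trans DWC; apply: two'; [exact: wa|exact: wb].
  apply: clipC_der => [t It|t It|t It]; [exact: (@cder_wavS R N b a X t b1 a1 (X' t) (db t) (dX t) (X2 t) (ba t))|exact: le_trans (wb _ t It) W1|].
  by apply: le_trans DWC; apply: two'; exact: wb.
Qed.

End wave_bounds.

Section complex_modes.
Context {R : realType}.
Variable k : R.
Implicit Types (z w l m : R[i]) (n N : nat).

Let kc : R[i] := ((k / 2)%:C)%C.

(** J_n(k |z|) e^(i n arg z), written without polar coordinates. *)
Definition cmode n z : R[i] := wav n (kc * z) (- ((k / 2) ^+ 2 * (cRe z ^+ 2 + cIm z ^+ 2))).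

Lemma cmodeE n z : cmode n z = (modec k n (cRe z) (cIm z) +i* modes k n (cRe z) (cIm z))%C.
Proof.
case: z => x y; rewrite /cmode /wav /kc exprMn -rmorphXn/= /modec /modes /zre /zim.
by case: ((x +i* y)%C ^+ n) => p q; apply: complex_ext => /=; ring.
Qed.

(** The Laplacian of exp (alpha z + beta conj z) is 4 alpha beta times it, so l m = - 1 is exactly
    Helmholtz' equation for the exponential of this phase. *)
Definition wphase l m z : R[i] := l * (kc * z) + m * (kc * cj z).

Lemma wave_prod l m z : l * m = -1 ->
  l * (kc * z) * (m * (kc * cj z)) = (- ((k / 2) ^+ 2 * (cRe z ^+ 2 + cIm z ^+ 2)))%:C%C.
Proof.
move=> lm; have -> : l * (kc * z) * (m * (kc * cj z)) = (l * m) * (kc * kc * (z * cj z)) by ring.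
by rewrite lm mulN1r; case: z => x y; apply: complex_ext => /=; ring.
Qed.

Lemma wavsumE l m z N :
  wavsum N (l * (kc * z)) (m * (kc * cj z)) (- ((k / 2) ^+ 2 * (cRe z ^+ 2 + cIm z ^+ 2))) =
  \sum_(n < N) (l ^+ n * cmode n z + m ^+ n.+1 * cj (cmode n.+1 z)).
Proof.
apply: eq_bigr => n _; rewrite /cmode /wav [in LHS]exprMn [(m * _) ^+ _]exprMn -!mulrA.
by rewrite cjM cjX cjM !cj_real.
Qed.

Lemma cder_cj (f : R -> R[i]) h z : cder f h z -> cder (fun y => cj (f y)) h (cj z).
Proof. by move=> [d1 d2]; split; [exact: d1|exact: derN]. Qed.

Lemma cder_unique (f : R -> R[i]) h z w : cder f h z -> cder f h w -> z = w.
Proof. by move=> [a b] [c d]; apply: complex_ext; [exact: der_unique a c|exact: der_unique b d]. Qed.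

Lemma cderZ (f : R -> R[i]) h c z : cder f h z -> cder (fun y => c * f y) h (c * z).
Proof. by move=> d; apply: cder_eq (cderM (cder_cst c h) d) _; rewrite mul0r add0r. Qed.

Lemma real_product_der (a b : R -> R[i]) (X : R -> R) h a' b' : cder a h a' -> cder b h b' ->
  (forall s, a s * b s = ((X s)%:C)%C) ->
  der X h (cRe (a' * b h + a h * b')) /\ (cRe (a' * b h + a h * b'))%:C%C = a' * b h + a h * b'.
Proof.
move=> da db abX; have [d1 d2] := cderM da db; split.
  by apply: der_ext d1 => s; rewrite abX.
have d0 : der (fun s => cIm (a s * b s)) h 0 by apply: der_ext (der_cst 0 h) => s; rewrite abX.
by apply: complex_ext => //=; rewrite (der_unique d2 d0).
Qed.

End complex_modes.

Section agreement_of_waves.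
Context {R : realType}.
Variables (k M : R) (L L' : (R -> R) -> R).
Hypotheses (M_gt0 : 0 < M) (hL : lipfun M L) (hL' : lipfun M L').
Variables (l m : R[i]).
Hypothesis lm : l * m = -1.
Implicit Types (z : R -> R[i]).

Let kc : R[i] := ((k / 2)%:C)%C.
Let av z t := l * (kc * z t).
Let bv z t := m * (kc * cj (z t)).
Let Xv z t : R := - ((k / 2) ^+ 2 * (cRe (z t) ^+ 2 + cIm (z t) ^+ 2)).

Lemma wave_clip z (d : R[i]) : (forall t, cder z t d) -> exists C, forall N,
  [/\ clipC M C (fun t => wavsum N.+1 (av z t) (bv z t) (Xv z t)), clipC M C (fun t => wav N (av z t) (Xv z t)) &
      clipC M C (fun t => wav N (bv z t) (Xv z t))].
Proof.
move=> dz; apply: (@wave_bound _ _ (av z) (bv z) (Xv z) (l * (kc * d)) (m * (kc * cj d))).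
- by move=> t; do 2 apply: cderZ.
- by move=> t; do 2 apply: cderZ; exact: cder_cj.
- by move=> t; exact: wave_prod.
Qed.

Lemma clip_wave z (d : R[i]) : (forall t, cder z t d) -> forall n, clip M (fun t => cmode k n (z t)).
Proof.
move=> dz n.
have da t : cder (fun t => 1 * (kc * z t)) t (1 * (kc * d)) by do 2 apply: cderZ.
have db t : cder (fun t => -1 * (kc * cj (z t))) t (-1 * (kc * cj d)).
  by do 2 apply: cderZ; exact: cder_cj.
have ab t : 1 * (kc * z t) * (-1 * (kc * cj (z t))) = (Xv z t)%:C%C.
  by apply: wave_prod; rewrite mul1r.
have [C h] := wave_bound M da db ab.
by exists C; have [_ h1 _] := h n; apply: clipC_ext h1 => t _; rewrite mul1r.
Qed.

Lemma wave_ccvg z t : ccvg (fun N => wavsum N.+1 (av z t) (bv z t) (Xv z t)) (cexp (wphase k l m (z t))).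
Proof. exact: (wavsum_cvg (wave_prod k (z t) lm)). Qed.

Lemma waves_agree z z' (d d' : R[i]) : (forall t, cder z t d) -> (forall t, cder z' t d') ->
  (forall n, agree M L L' (fun t => cmode k n (z t)) (fun t => cmode k n (z' t))) ->
  L (fun t => cRe (cexp (wphase k l m (z t)))) = L' (fun t => cRe (cexp (wphase k l m (z' t)))) /\
  L (fun t => cIm (cexp (wphase k l m (z t)))) = L' (fun t => cIm (cexp (wphase k l m (z' t)))).
Proof.
move=> dz dz' h; have [C hC] := wave_clip dz; have [C' hC'] := wave_clip dz'.
have le1 : C <= Num.max C C' by rewrite le_max lexx.
have le2 : C' <= Num.max C C' by rewrite le_max lexx orbT.
apply: (@agree_lim _ M L L' hL hL' (Num.max C C') (fun N t => wavsum N.+1 (av z t) (bv z t) (Xv z t))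
  (fun N t => wavsum N.+1 (av z' t) (bv z' t) (Xv z' t))).
- move=> N; apply: (agree_ext hL hL' _ _ (agree_sum hL hL' (fun n => l ^+ n) (fun n => m ^+ n) N.+1 h)).
    by move=> t _; rewrite /av /bv /Xv wavsumE.
  by move=> t _; rewrite /av /bv /Xv wavsumE.
- by move=> N; have [h1 _ _] := hC N; exact: clipC_le h1.
- by move=> N; have [h1 _ _] := hC' N; exact: clipC_le h1.
- by move=> t _; exact: wave_ccvg.
- by move=> t _; exact: wave_ccvg.
Qed.

(** Here [U n] is the rate of change of the n-th mode along the motion z. The derivative of a
    partial sum is given by [cder_wavsum], and its end terms tend to 0 with N. *)
Lemma wave_derivatives_agree (z : R -> R -> R[i]) (zh : R -> R[i]) (d d' : R[i]) (U : nat -> R -> R[i]) :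
  (forall t, cder (z 0) t d) -> (forall t, cder zh t d') ->
  (forall t, cder (fun h => z h t) 0 (zh t)) ->
  (forall n t, cder (fun h => cmode k n (z h t)) 0 (U n t)) ->
  (forall n, agree M L L' (U n) (fun t => cmode k n (z 0 t))) ->
  L (fun t => cRe (wphase k l m (zh t) * cexp (wphase k l m (z 0 t)))) =
    L' (fun t => cRe (cexp (wphase k l m (z 0 t)))) /\
  L (fun t => cIm (wphase k l m (zh t) * cexp (wphase k l m (z 0 t)))) =
    L' (fun t => cIm (cexp (wphase k l m (z 0 t)))).
Proof.
move=> dz dzh hz hU h; have [C hC] := wave_clip dz.
have clip_affine (c : R -> R[i]) c1 : (forall t, cder c t c1) -> exists2 B, 0 <= B & clipC M B c.
  move=> dc; have [A A0 hA] := @affine_bound _ M c c c1 c1 dc dc.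
  exists (A + normc c1); first by rewrite addr_ge0 ?normc_ge0.
  apply: (clipC_der (dF := fun=> c1)) => [t _|t It|t _]; first exact: dc.
    by apply: le_trans (hA t It).1 _; rewrite lerDl normc_ge0.
  by rewrite lerDr.
have [A A0 hA] := clip_affine (fun t => av zh t) (l * (kc * d')) (fun t => cderZ l (cderZ kc (dzh t))).
have [B B0 hB] := clip_affine (fun t => bv zh t) (m * (kc * cj d')) (fun t => cderZ m (cderZ kc (cder_cj (dzh t)))).
pose F N t := (av zh t + bv zh t) * wavsum N.+1 (av (z 0) t) (bv (z 0) t) (Xv (z 0) t)
     + av zh t * (wav N.+2 (bv (z 0) t) (Xv (z 0) t) - wav N (av (z 0) t) (Xv (z 0) t))
     + bv zh t * (wav N.+1 (av (z 0) t) (Xv (z 0) t) - wav N.+1 (bv (z 0) t) (Xv (z 0) t)).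
have clipN C0 G : clipC M C0 G -> clipC M C0 (fun t => - G t).
  move=> [h1 h2]; have lN (f : R -> R) E : lipC M E f -> lipC M E (fun t => - f t).
    move=> hf; apply: (@lipC_ext _ _ _ (fun t => -1 * f t)); first by move=> t _; rewrite mulN1r.
    by have := lipCZ (-1) hf; rewrite normrN1 mul1r.
  split; [apply: lipC_ext (lN _ _ h1)|apply: lipC_ext (lN _ _ h2)] => t _ /=.
    by rewrite ReN.
  by rewrite ImN.
pose D := 4 * (A + B) * C + 4 * A * (C + C) + 4 * B * (C + C).
have cF N : clipC M D (F N).
  have [h1 _ _] := hC N; have [_ ha _] := hC N; have [_ _ hb] := hC N.+2.
  have [_ ha1 hb1] := hC N.+1.
  apply: clipCD; first apply: clipCD.
  - by apply: clipCM => //; exact: clipCD.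
  - by apply: clipCM => //; apply: clipCD => //; exact: clipN.
  - by apply: clipCM => //; apply: clipCD => //; exact: clipN.
have lC : C <= Num.max C D by rewrite le_max lexx.
have lD : D <= Num.max C D by rewrite le_max lexx orbT.
apply: (@agree_lim _ M L L' hL hL' (Num.max C D) F (fun N t => wavsum N.+1 (av (z 0) t) (bv (z 0) t) (Xv (z 0) t))).
- move=> N; apply: (agree_ext hL hL' _ _ (agree_sum hL hL' (fun n => l ^+ n) (fun n => m ^+ n) N.+1 h)).
    (* Both sides are the derivative at h = 0 of the same partial sum, computed term by term and by
       [cder_wavsum]. *)
    move=> t _; apply: (@cder_unique _ (fun h => wavsum N.+1 (av (z h) t) (bv (z h) t) (Xv (z h) t)) 0).
      have hsum P : cder (fun h => \sum_(n < P) (l ^+ n * cmode k n (z h t) + m ^+ n.+1 * cj (cmode k n.+1 (z h t)))) 0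
          (\sum_(n < P) (l ^+ n * U n t + m ^+ n.+1 * cj (U n.+1 t))).
        elim: P => [|P ih].
          rewrite big_ord0; apply: cder_ext (cder_cst 0 0) => y; exact: big_ord0.
        have hs := cderD ih (cderD (cderZ (l ^+ P) (hU P t)) (cderZ (m ^+ P.+1) (cder_cj (hU P.+1 t)))).
        by rewrite big_ord_recr; apply: cder_ext hs => y; exact: big_ord_recr.
      by apply: cder_ext (hsum N.+1) => y; rewrite /av /bv /Xv wavsumE.
    have da : cder (fun h => av (z h) t) 0 (av zh t) by do 2 apply: cderZ.
    have db : cder (fun h => bv (z h) t) 0 (bv zh t) by do 2 apply: cderZ; exact: cder_cj.
    have [dX eX] := real_product_der da db (fun h => wave_prod k (z h t) lm).
    exact: (cder_wavsum N da db dX eX (wave_prod k (z 0 t) lm)).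
  by move=> t _; rewrite /av /bv /Xv wavsumE.
- by move=> N; exact: clipC_le (cF N).
- by move=> N; have [h1 _ _] := hC N; exact: clipC_le h1.
- move=> t It; set w := cexp _.
  have -> : wphase k l m (zh t) * w = wphase k l m (zh t) * w + av zh t * (0 + -1 * 0) + bv zh t * (0 + -1 * 0).
    by rewrite mulr0 addr0 !mulr0 !addr0.
  have [E E0 hE] := @affine_bound _ M (av (z 0)) (bv (z 0)) (l * (kc * d)) (m * (kc * cj d))
    (fun t => cderZ l (cderZ kc (dz t))) (fun t => cderZ m (cderZ kc (cder_cj (dz t)))).
  have XE : `|Xv (z 0) t| <= E ^+ 2.
    rewrite -normc_real -(wave_prod k (z 0 t) lm) normcM expr2 ler_pM ?normc_ge0//; first exact: (hE t It).1.
    exact: (hE t It).2.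
  have w0a := wav_cvg0 (hE t It).1 XE; have w0b := wav_cvg0 (hE t It).2 XE.
  have sh (u : nat -> R) (j : nat) : u @ \oo --> 0 -> u (n + j)%N @[n --> \oo] --> 0.
    by move=> hu; rewrite (@cvg_shiftn j R u).
  have ca j : ccvg (fun N => wav (N + j) (av (z 0) t) (Xv (z 0) t)) 0 by apply/ccvg0/(sh _ j w0a).
  have cb j : ccvg (fun N => wav (N + j) (bv (z 0) t) (Xv (z 0) t)) 0 by apply/ccvg0/(sh _ j w0b).
  have eF N : F N t = wphase k l m (zh t) * wavsum N.+1 (av (z 0) t) (bv (z 0) t) (Xv (z 0) t)
     + av zh t * (wav (N + 2) (bv (z 0) t) (Xv (z 0) t) + -1 * wav (N + 0) (av (z 0) t) (Xv (z 0) t))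
     + bv zh t * (wav (N + 1) (av (z 0) t) (Xv (z 0) t) + -1 * wav (N + 1) (bv (z 0) t) (Xv (z 0) t)).
    by rewrite /F !mulN1r addn0 addn1 addn2.
  move/funext: eF => eF; rewrite eF.
  apply: ccvgD; first apply: ccvgD.
  + by apply: ccvgZ; exact: wave_ccvg.
  + by apply: ccvgZ; apply: ccvgD => //; exact: ccvgZ.
  + by apply: ccvgZ; apply: ccvgD => //; exact: ccvgZ.
- by move=> t _; exact: wave_ccvg.
Qed.

End agreement_of_waves.

(** * The kernel along a moving crack *)

Lemma taylor2 (R : realType) (f f1 f2 : R -> R) (C e : R) :
  (forall h : R, `|h| <= e -> der f h (f1 h)) -> (forall h : R, `|h| <= e -> der f1 h (f2 h)) ->
  (forall h, `|h| <= e -> `|f2 h| <= C) ->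
  forall h, `|h| <= e -> `|f h - f 0 - h * f1 0| <= C * h ^+ 2.
Proof.
move=> d1 d2 b h he.
have e0 : 0 <= e by exact: le_trans he.
have C0 : 0 <= C by apply: le_trans (b 0 _); rewrite ?normr0.
have range (y x : R) : Num.min 0 y <= x <= Num.max 0 y -> `|x| <= `|y|.
  move=> /andP[]; rewrite ge_min le_max => h1 h2; rewrite ler_norml.
  by have := ler_norm y; have := ler_norm (- y); rewrite normrN; case/orP: h1; case/orP: h2; lra.
have s1 x : `|x| <= e -> `|f1 x - f1 0| <= C * `|x|.
  move=> xe; rewrite -[x in C * `|x|]subr0; apply: (@mvt_le _ f1 f2) => y /range yx.
    by apply: d2; exact: le_trans yx xe.
  by apply: b; exact: le_trans yx xe.
have -> : f h - f 0 - h * f1 0 = (f h - h * f1 0) - (f 0 - 0 * f1 0) by ring.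
have -> : C * h ^+ 2 = C * `|h| * `|h - 0| by rewrite subr0 -mulrA -normrM -expr2 ger0_norm ?sqr_ge0.
have := @mvt_le _ (fun x => f x - x * f1 0) (fun x => f1 x - f1 0) (C * `|h|) 0 h; apply => y /range yh.
  apply: der_eq (derD (d1 y (le_trans yh he)) (derN (derM (der_id y) (der_cst (f1 0) y)))) _.
  by ring.
by apply: le_trans (s1 y (le_trans yh he)) _; rewrite ler_wpM2l.
Qed.

Section squared_distance.
Context {R : realType}.
Variables (r theta a q1 q2 : R).
Implicit Types (h s t : R).

(* [sq h s t] is the squared distance between the point of angle s / r of the
   circle and the point of parameter t of the crack (theta + h * q1, a + h * q2);
   the suffixes h and t stand for partial derivatives. *)
Definition sq h s t := r ^+ 2 + t ^+ 2 + (a + h * q2) ^+ 2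
  - 2 * r * (t * cos (s / r - (theta + h * q1)) + (a + h * q2) * sin (s / r - (theta + h * q1))).
Definition sqt h s t := 2 * t - 2 * r * cos (s / r - (theta + h * q1)).
Definition sqh h s t := 2 * q2 * (a + h * q2)
  - 2 * r * (- (a + h * q2) * q1 * cos (s / r - (theta + h * q1)) + (t * q1 + q2) * sin (s / r - (theta + h * q1))).
Definition sqhh h s t := 2 * q2 ^+ 2
  - 2 * r * (- (t * q1 ^+ 2 + 2 * q1 * q2) * cos (s / r - (theta + h * q1))
             - (a + h * q2) * q1 ^+ 2 * sin (s / r - (theta + h * q1))).
Definition sqht h s t := - 2 * r * q1 * sin (s / r - (theta + h * q1)).
Definition sqhht h s t := 2 * r * q1 ^+ 2 * cos (s / r - (theta + h * q1)).

Lemma der_sq_t h s t : der (sq h s) t (sqt h s t).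
Proof. by rewrite /sq /sqt; der; ring. Qed.
Lemma der_sq_h h s t : der (fun h => sq h s t) h (sqh h s t).
Proof. by rewrite /sq /sqh; der; ring. Qed.
Lemma der_sqh_h h s t : der (fun h => sqh h s t) h (sqhh h s t).
Proof. by rewrite /sqh /sqhh; der; ring. Qed.
Lemma der_sqh_t h s t : der (sqh h s) t (sqht h s t).
Proof. by rewrite /sqh /sqht; der; ring. Qed.
Lemma der_sqt_h h s t : der (fun h => sqt h s t) h (sqht h s t).
Proof. by rewrite /sqt /sqht; der; ring. Qed.
Lemma der_sqht_h h s t : der (fun h => sqht h s t) h (sqhht h s t).
Proof. by rewrite /sqht /sqhht; der; ring. Qed.
Lemma cnt_sq_s h s t : cnt (fun s => sq h s t) s.
Proof. by rewrite /sq; cnt_auto. Qed.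
Lemma cnt_sqh_s h s t : cnt (fun s => sqh h s t) s.
Proof. by rewrite /sqh; cnt_auto. Qed.

(** The angle depends on the unrestricted s; treating it as a free variable [b] leaves compactness
    to h and t only. *)
Lemma trig_bound (M e : R) (u v w : R -> R -> R) :
  (forall p, cnt (fun p => u p.1 p.2) p) -> (forall p, cnt (fun p => v p.1 p.2) p) ->
  (forall p, cnt (fun p => w p.1 p.2) p) ->
  exists2 C, 0 <= C & forall h b t, `|h| <= e -> - M <= t <= M ->
    `|u h t * cos b + v h t * sin b + w h t| <= C.
Proof.
move=> cu cv cw.
have bd (g : R -> R -> R) : (forall p, cnt (fun p => g p.1 p.2) p) ->
    exists2 C, 0 <= C & forall h t, `|h| <= e -> - M <= t <= M -> `|g h t| <= C.
  move=> cg; have [|C hC] := @compact2_bound _ g (- e) e (- M) M; first by move=> x y _ _; exact: cg.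
  exists `|C| => // h t he It; apply: le_trans (ler_norm C); apply: hC => //.
  by rewrite -ler_norml.
have [A A0 hA] := bd _ cu; have [B B0 hB] := bd _ cv; have [C C0 hC] := bd _ cw.
exists (A + B + C); first by rewrite !addr_ge0.
move=> h b t he It; have hc : `|cos b| <= 1 by rewrite ler_norml cos_geN1 cos_le1.
have hs : `|sin b| <= 1 by rewrite ler_norml sin_geN1 sin_le1.
apply: le_trans (ler_normD _ _) _; apply: lerD; last exact: hC.
apply: le_trans (ler_normD _ _) _; rewrite !normrM; apply: lerD.
  by rewrite -[A]mulr1; apply: ler_pM => //; exact: hA.
by rewrite -[B]mulr1; apply: ler_pM => //; exact: hB.
Qed.

Lemma sq_bounds (M e : R) : exists2 W, 0 <= W & forall h s t, `|h| <= e -> - M <= t <= M ->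
  [/\ `|sq h s t| <= W, `|sqt h s t| <= W, `|sqh h s t| <= W & 
   [/\ `|sqhh h s t| <= W, `|sqht h s t| <= W & `|sqhht h s t| <= W]].
Proof.
have [|||C1 p1 h1] := @trig_bound M e (fun h t => - 2 * r * t) (fun h t => - 2 * r * (a + h * q2))
  (fun h t => r ^+ 2 + t ^+ 2 + (a + h * q2) ^+ 2).
1-3: by move=> p; cnt_auto.
have [|||C2 p2 h2] := @trig_bound M e (fun h t => - 2 * r) (fun h t => 0)
  (fun h t => 2 * t).
1-3: by move=> p; cnt_auto.
have [|||C3 p3 h3] := @trig_bound M e (fun h t => 2 * r * (a + h * q2) * q1) (fun h t => - 2 * r * (t * q1 + q2))
  (fun h t => 2 * q2 * (a + h * q2)).
1-3: by move=> p; cnt_auto.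
have [|||C4 p4 h4] := @trig_bound M e (fun h t => 2 * r * (t * q1 ^+ 2 + 2 * q1 * q2)) (fun h t => 2 * r * (a + h * q2) * q1 ^+ 2)
  (fun h t => 2 * q2 ^+ 2).
1-3: by move=> p; cnt_auto.
have [|||C5 p5 h5] := @trig_bound M e (fun h t => 0) (fun h t => - 2 * r * q1)
  (fun h t => 0).
1-3: by move=> p; cnt_auto.
have [|||C6 p6 h6] := @trig_bound M e (fun h t => 2 * r * q1 ^+ 2) (fun h t => 0)
  (fun h t => 0).
1-3: by move=> p; cnt_auto.
exists (C1 + C2 + C3 + C4 + C5 + C6); first by rewrite !addr_ge0.
move=> h s t he It; pose b := s / r - (theta + h * q1).
have {}h1 := h1 h b t he It; have {}h2 := h2 h b t he It; have {}h3 := h3 h b t he It.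
have {}h4 := h4 h b t he It; have {}h5 := h5 h b t he It; have {}h6 := h6 h b t he It.
have use (x y B : R) : `|y| <= B -> x = y -> B <= C1 + C2 + C3 + C4 + C5 + C6 -> `|x| <= C1 + C2 + C3 + C4 + C5 + C6.
  by move=> hy -> hB; exact: le_trans hB.
split; last split.
- by apply: (use _ _ _ h1); [rewrite /sq -/b; ring|move: p1 p2 p3 p4 p5 p6; lra].
- by apply: (use _ _ _ h2); [rewrite /sqt -/b; ring|move: p1 p2 p3 p4 p5 p6; lra].
- by apply: (use _ _ _ h3); [rewrite /sqh -/b; ring|move: p1 p2 p3 p4 p5 p6; lra].
- by apply: (use _ _ _ h4); [rewrite /sqhh -/b; ring|move: p1 p2 p3 p4 p5 p6; lra].
- by apply: (use _ _ _ h5); [rewrite /sqht -/b; ring|move: p1 p2 p3 p4 p5 p6; lra].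
- by apply: (use _ _ _ h6); [rewrite /sqhht -/b; ring|move: p1 p2 p3 p4 p5 p6; lra].
Qed.

Variables (k M : R) (G : nat -> R -> R) (e d : R).
Hypotheses (hG : bessel_tower k G) (d_gt0 : 0 < d) (e_ge0 : 0 <= e) (M_gt0 : 0 < M).
Hypothesis sq_ge : forall h s t, `|h| <= e -> - M <= t <= M -> d <= sq h s t.

Let Itv (t : R) : - M < t < M -> - M <= t <= M.
Proof. by case/andP=> *; rewrite !ltW. Qed.

(** The third claim is what operator norms need: the Taylor remainder in h is of order h^2 as a
    Lipschitz function of t. It uses Taylor's formula for the kernel and for its derivative in t,
    hence G up to index 3. *)
Lemma kernel_bounds : exists2 C, 0 <= C & [/\
  forall h s, `|h| <= e -> lipC M C (fun t => G 0 (sq h s t)),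
  forall s, lipC M C (fun t => G 1 (sq 0 s t) * sqh 0 s t) &
  forall h s, `|h| <= e -> lipC M (C * h ^+ 2)
    (fun t => G 0 (sq h s t) - G 0 (sq 0 s t) - h * (G 1 (sq 0 s t) * sqh 0 s t))].
Proof.
have [W W0 hW] := sq_bounds M e.
have sq0 h s t : `|h| <= e -> - M <= t <= M -> 0 < sq h s t.
  by move=> he It; apply: lt_le_trans d_gt0 (sq_ge s he It).
have bG n : exists2 C, 0 <= C & forall h s t, `|h| <= e -> - M <= t <= M -> `|G n (sq h s t)| <= C.
  have [|C hC] := @compact_bound _ (G n) d W.
    by move=> x /andP[dx _]; apply: (tower_cnt hG); exact: lt_le_trans dx.
  exists `|C| => // h s t he It; apply: le_trans (ler_norm C); apply: hC.
  by have [h1 _ _ _] := hW h s t he It; rewrite sq_ge//= (le_trans (ler_norm _) h1).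
have [C0 c0 b0] := bG 0%N; have [C1 c1 b1] := bG 1%N; have [C2 c2 b2] := bG 2%N; have [C3 c3 b3] := bG 3%N.
pose D := C0 + C1 + C2 + C3; have D0 : 0 <= D by rewrite !addr_ge0.
have gD n h s t : (n <= 3)%N -> `|h| <= e -> - M <= t <= M -> `|G n (sq h s t)| <= D.
  move=> n3 he It; have := b0 _ s _ he It; have := b1 _ s _ he It; have := b2 _ s _ he It; have := b3 _ s _ he It.
  by rewrite /D; move: n n3 => [|[|[|[|//]]]] _; lra.
(* [D] bounds the functions G and [W] the derivatives of [sq]; every derivative below is dominated
   by the expansion of D (1 + W)^3. *)
pose B := D * (1 + W) ^+ 3.
have WW : 0 <= W * W by exact: mulr_ge0.
have WWW : 0 <= W * W * W by exact: mulr_ge0.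
have DB x : x <= 1 + 3 * W + 3 * (W * W) + W * W * W -> D * x <= B.
  move=> hx; rewrite /B ler_wpM2l//; apply: le_trans hx _; rewrite le_eqVlt; apply/orP; left.
  by apply/eqP; ring.
have m2 (x y X Y : R) : `|x| <= X -> `|y| <= Y -> `|x * y| <= X * Y by move=> *; rewrite normrM ler_pM.
have B0 : 0 <= B by rewrite mulr_ge0// exprn_ge0// addr_ge0.
have dt n h s t : `|h| <= e -> - M <= t <= M -> der (fun t => G n (sq h s t)) t (G n.+1 (sq h s t) * sqt h s t).
  by move=> he It; apply: (tower_der hG); [exact: sq0|exact: der_sq_t].
have dh n h s t : `|h| <= e -> - M <= t <= M -> der (fun h => G n (sq h s t)) h (G n.+1 (sq h s t) * sqh h s t).
  by move=> he It; apply: (@tower_der _ _ _ hG n (fun h => sq h s t)); [exact: sq0|exact: der_sq_h].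
pose Kh h s t := G 1 (sq h s t) * sqh h s t.
pose Kt h s t := G 1 (sq h s t) * sqt h s t.
pose Khh h s t := G 2 (sq h s t) * sqh h s t * sqh h s t + G 1 (sq h s t) * sqhh h s t.
pose Kht h s t := G 2 (sq h s t) * sqh h s t * sqt h s t + G 1 (sq h s t) * sqht h s t.
pose Khht h s t := G 3 (sq h s t) * sqh h s t * sqh h s t * sqt h s t
  + G 2 (sq h s t) * sqhh h s t * sqt h s t
  + G 2 (sq h s t) * sqh h s t * sqht h s t
  + (G 2 (sq h s t) * sqh h s t * sqht h s t + G 1 (sq h s t) * sqhht h s t).
have dKh h s t : `|h| <= e -> - M <= t <= M -> der (fun h => Kh h s t) h (Khh h s t).
  by move=> he It; apply: der_eq (derM (dh 1%N h s t he It) (der_sqh_h h s t)) _; rewrite /Khh; ring.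
have dKht h s t : `|h| <= e -> - M <= t <= M -> der (Kh h s) t (Kht h s t).
  by move=> he It; apply: der_eq (derM (dt 1%N h s t he It) (der_sqh_t h s t)) _; rewrite /Kht; ring.
have dKt h s t : `|h| <= e -> - M <= t <= M -> der (fun h => Kt h s t) h (Kht h s t).
  by move=> he It; apply: der_eq (derM (dh 1%N h s t he It) (der_sqt_h h s t)) _; rewrite /Kht; ring.
have dKhth h s t : `|h| <= e -> - M <= t <= M -> der (fun h => Kht h s t) h (Khht h s t).
  move=> he It; have d2 := derM (derM (dh 2%N h s t he It) (der_sqh_h h s t)) (der_sqt_h h s t).
  have d1 := derM (dh 1%N h s t he It) (der_sqht_h h s t).
  by apply: der_eq (derD d2 d1) _; rewrite /Khht; ring.
have bK h s t : `|h| <= e -> - M <= t <= M ->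
    [/\ `|G 0 (sq h s t)| <= B, `|Kh h s t| <= B, `|Kt h s t| <= B & 
     [/\ `|Khh h s t| <= B, `|Kht h s t| <= B & `|Khht h s t| <= B]].
  move=> he It; have [h1 h2 h3 [h4 h5 h6]] := hW h s t he It.
  have g0 := gD 0%N h s t isT he It; have g1 := gD 1%N h s t isT he It.
  have g2 := gD 2%N h s t isT he It; have g3 := gD 3%N h s t isT he It.
  split; last split.
  - by apply: le_trans g0 _; rewrite -[leLHS]mulr1; apply: DB; move: W0 WW WWW; lra.
  - by apply: le_trans (m2 _ _ _ _ g1 h3) _; apply: DB; move: W0 WW WWW; lra.
  - by apply: le_trans (m2 _ _ _ _ g1 h2) _; apply: DB; move: W0 WW WWW; lra.
  - apply: le_trans (ler_normD _ _) _; apply: le_trans (lerD (m2 _ _ _ _ (m2 _ _ _ _ g2 h3) h3) (m2 _ _ _ _ g1 h4)) _.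
    by rewrite -mulrA -mulrDr; apply: DB; move: W0 WW WWW; lra.
  - apply: le_trans (ler_normD _ _) _; apply: le_trans (lerD (m2 _ _ _ _ (m2 _ _ _ _ g2 h3) h2) (m2 _ _ _ _ g1 h5)) _.
    by rewrite -mulrA -mulrDr; apply: DB; move: W0 WW WWW; lra.
  - have n4 (x y z u X Y Z U : R) : `|x| <= X -> `|y| <= Y -> `|z| <= Z -> `|u| <= U ->
        `|x + y + z + u| <= X + Y + Z + U.
      by move=> *; do 3 (apply: le_trans (ler_normD _ _) _; apply: lerD => //).
    apply: le_trans (n4 _ _ _ _ (D * W * W * W) (D * W * W) (D * W * W) (D * W * W + D * W) _ _ _ _) _.
    + exact: m2 (m2 _ _ _ _ (m2 _ _ _ _ g3 h3) h3) h2.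
    + exact: m2 (m2 _ _ _ _ g2 h4) h2.
    + exact: m2 (m2 _ _ _ _ g2 h3) h5.
    + apply: le_trans (ler_normD _ _) _; apply: lerD; last exact: m2.
      exact: m2 (m2 _ _ _ _ g2 h3) h5.
    + have -> : D * W * W * W + D * W * W + D * W * W + (D * W * W + D * W) =
        D * (W * W * W + W * W + W * W + W * W + W) by ring.
      by apply: DB; move: W0 WW WWW; lra.
have e00 : `|0 : R| <= e by rewrite normr0.
exists B => //; split.
- move=> h s he; apply: lipC_der => t It; first exact: (dt 0%N h s t he (Itv It)).
    by have [] := bK h s t he (Itv It).
  by have [_ _ h1 _] := bK h s t he (Itv It).
- move=> s; apply: lipC_der => t It; first exact: (dKht 0 s t e00 (Itv It)).
    by have [] := bK 0 s t e00 (Itv It).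
  by have [_ _ _ []] := bK 0 s t e00 (Itv It).
- move=> h s he; apply: (lipC_der (df := fun t => Kt h s t - Kt 0 s t - h * Kht 0 s t)) => t It.
  + have It' := Itv It.
    apply: der_eq (derD (derD (dt 0%N h s t he It') (derN (dt 0%N 0 s t e00 It')))
      (derN (derM (der_cst h t) (dKht 0 s t e00 It')))) _.
    by rewrite /Kt; ring.
  + have It' := Itv It.
    apply: (@taylor2 _ (fun h => G 0 (sq h s t)) (fun h => Kh h s t) (fun h => Khh h s t) _ e) => // x xe.
    * exact: (dh 0%N x s t xe It').
    * exact: dKh.
    * by have [_ _ _ []] := bK x s t xe It'.
  + have It' := Itv It.
    apply: (@taylor2 _ (fun h => Kt h s t) (fun h => Kht h s t) (fun h => Khht h s t) _ e) => // x xe.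
    * exact: dKt.
    * exact: dKhth.
    * by have [_ _ _ []] := bK x s t xe It'.
Qed.

Lemma cnt_kernel n h s t : `|h| <= e -> - M <= t <= M -> cnt (fun s => G n (sq h s t)) s.
Proof.
move=> he It; apply: (@cnt_comp _ _ (G n) (fun s => sq h s t)); last exact: cnt_sq_s.
by apply: (tower_cnt hG); apply: lt_le_trans d_gt0 (sq_ge s he It).
Qed.

End squared_distance.

(** * Uniqueness for the single layer *)

Section functional_parts.
Context {R : realType}.
Variable M : R.
Hypothesis M_gt0 : 0 < M.
Variable psi : Hmhalf M.

Definition Lre f : R := cRe (pair psi (cR f)).
Definition Lim f : R := cIm (pair psi (cR f)).

Lemma lipfun_Lre : lipfun M Lre. Proof. exact: (hfun_lipfun M_gt0 (hfun_Re M_gt0 psi)). Qed.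
Lemma lipfun_Lim : lipfun M Lim. Proof. exact: (hfun_lipfun M_gt0 (hfun_Im M_gt0 psi)). Qed.

Lemma pair_ext F G : chin M F -> chin M G -> (forall t, - M < t < M -> F t = G t) ->
  pair psi F = pair psi G.
Proof.
move=> hF hG e.
have sub (P : (R -> R) -> R) (u v : R -> R) : hfun M P -> hin M u -> hin M v ->
    (forall t, - M < t < M -> u t = v t) -> P u = P v.
  by move=> hP hu hv; exact: (hfun_ext hP hu hv).
have e1 : pair psi (cR (fun t => cIm (F t))) = pair psi (cR (fun t => cIm (G t))).
  apply: complex_ext; [apply: (sub _ _ _ (hfun_Re M_gt0 psi) hF.2 hG.2)|apply: (sub _ _ _ (hfun_Im M_gt0 psi) hF.2 hG.2)];
  by move=> t It; rewrite e.
have e2 : pair psi (cR (fun t => cRe (F t))) = pair psi (cR (fun t => cRe (G t))).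
  apply: complex_ext; [apply: (sub _ _ _ (hfun_Re M_gt0 psi) hF.1 hG.1)|apply: (sub _ _ _ (hfun_Im M_gt0 psi) hF.1 hG.1)];
  by move=> t It; rewrite e.
by rewrite (pair_split M_gt0 psi hF) (pair_split M_gt0 psi hG) e1 e2.
Qed.

Lemma chin_lip (u v : R -> R) : lip M u -> lip M v -> chin M (fun t => (u t +i* v t)%C).
Proof. by move=> hu hv; split; exact: lip_hin. Qed.

(* i / 4 * (u + i v) = - v / 4 + i u / 4 *)
Lemma pair_kernel F (u v : R -> R) : lip M u -> lip M v -> chin M F ->
  (forall t, - M < t < M -> F t = (- (4^-1 * v t) +i* (4^-1 * u t))%C) ->
  cRe (pair psi F) = - 4^-1 * (Lim u + Lre v) /\ cIm (pair psi F) = 4^-1 * (Lre u - Lim v).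
Proof.
move=> lu lv hF e.
have lu4 : lip M (fun t => 4^-1 * u t) by exact: lipZ.
have lv4 : lip M (fun t => - 4^-1 * v t) by exact: lipZ.
have -> : pair psi F = pair psi (fun t => (- 4^-1 * v t +i* (4^-1 * u t))%C).
  by apply: pair_ext => // [|t It]; [exact: chin_lip|rewrite e// mulNr].
rewrite (pair_split M_gt0); last exact: chin_lip.
have z1 : pair psi (cR (fun t => 4^-1 * u t)) = (4^-1 * Lre u +i* (4^-1 * Lim u))%C.
  by apply: complex_ext; [exact: (lipfunZ lipfun_Lre)|exact: (lipfunZ lipfun_Lim)].
have z2 : pair psi (cR (fun t => - 4^-1 * v t)) = (- 4^-1 * Lre v +i* (- 4^-1 * Lim v))%C.
  by apply: complex_ext; [exact: (lipfunZ lipfun_Lre)|exact: (lipfunZ lipfun_Lim)].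
set p := 'i%C * _ + _.
have -> : p = 'i%C * pair psi (cR (fun t => 4^-1 * u t)) + pair psi (cR (fun t => - 4^-1 * v t)) by [].
rewrite {}/p {}z1 {}z2; move: (Lre u) (Lim u) (Lre v) (Lim v) => ru iu rv iv.
by clear; split; rewrite /=; ring.
Qed.

Lemma Hmhalf_lip_eq0 : (forall f, lip M f -> Lre f = 0) -> (forall f, lip M f -> Lim f = 0) -> psi = 0.
Proof.
move=> h1 h2; apply: (Hmhalf_eq0 M_gt0) => f hf; apply: complex_ext.
  exact: (hfun_dense M_gt0 (hfun_Re M_gt0 psi) h1 hf).
exact: (hfun_dense M_gt0 (hfun_Im M_gt0 psi) h2 hf).
Qed.

End functional_parts.

(** * Cracks, circle and plane waves in coordinates *)

Section geometry.
Context {R : realType}.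
Implicit Types (k r s t theta a : R) (m y : R * R).

Lemma crackE m t : crack m t = (t * cos m.1 - m.2 * sin m.1, t * sin m.1 + m.2 * cos m.1).
Proof. by rewrite /crack /tau /nvec -mulrN. Qed.

Lemma sqE r theta a q1 q2 h s t : sq r theta a q1 q2 h s t =
  dist2 r r (crack (theta + h * q1, a + h * q2) t).1 (crack (theta + h * q1, a + h * q2) t).2 s.
Proof.
rewrite crackE /= /sq /dist2 /cw cosB sinB.
set c := cos (theta + _); set n := sin (theta + _).
have e : n ^+ 2 = 1 - c ^+ 2 by rewrite /n /c sin2cos2.
set C := cos _; set S := sin _; set b := a + _.
have -> : (t * c - b * n) ^+ 2 + (t * n + b * c) ^+ 2 = (t ^+ 2 + b ^+ 2) * (c ^+ 2 + n ^+ 2) by ring.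
by rewrite e; ring.
Qed.

Lemma enorm2_arc r s y : enorm2 (Defs.arc r s - y) = Num.sqrt (dist2 r r y.1 y.2 s).
Proof.
congr Num.sqrt; rewrite /dist2 /cw /Defs.arc /=.
set C := cos _; set S := sin _.
have e : S ^+ 2 = 1 - C ^+ 2 by rewrite /S /C sin2cos2.
have -> : (r * C - y.1) ^+ 2 + (r * S - y.2) ^+ 2 =
  r ^+ 2 * (C ^+ 2 + S ^+ 2) + (y.1 ^+ 2 + y.2 ^+ 2) - 2 * r * (y.1 * C + y.2 * S) by ring.
by rewrite e; ring.
Qed.

Lemma circle_arc r s : 0 < r -> circle r (Defs.arc r s).
Proof.
move=> r0; rewrite /circle /= /enorm2 /Defs.arc /= !exprMn -mulrDr cos2Dsin2 mulr1 sqrtr_sqr.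
by rewrite gtr0_norm.
Qed.

Lemma PhiE k r s y : 0 < k -> 0 < dist2 r r y.1 y.2 s ->
  Phi k (Defs.arc r s) y = (- (4^-1 * besY k 0 (dist2 r r y.1 y.2 s)) +i* (4^-1 * besJ k 0 (dist2 r r y.1 y.2 s)))%C.
Proof.
move=> k0 d0; rewrite /Phi enorm2_arc hankelE//.
by apply: complex_ext => /=; ring.
Qed.

Definition ccrack m t : R[i] := ((crack m t).1 +i* (crack m t).2)%C.

Lemma cder_ccrack m t : cder (ccrack m) t (cos m.1 +i* sin m.1)%C.
Proof.
split; rewrite /ccrack; first by apply: (der_ext (g := fun t => t * cos m.1 - m.2 * sin m.1)) => [x|]; [rewrite crackE|der; ring].
by apply: (der_ext (g := fun t => t * sin m.1 + m.2 * cos m.1)) => [x|]; [rewrite crackE|der; ring].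
Qed.

Lemma wave_parameter k s : 0 < k -> exists mu : R, [/\ mu != 0, k / 2 * (mu - mu^-1) = s &
  k / 2 * (mu + mu^-1) = Num.sqrt (s ^+ 2 + k ^+ 2)].
Proof.
move=> k0; set n := Num.sqrt _.
have n2 : n ^+ 2 = s ^+ 2 + k ^+ 2 by rewrite sqr_sqrtr// addr_ge0 ?sqr_ge0.
have sn : 0 < s + n.
  have : `|s| < n.
    rewrite -sqrtr_sqr ltr_sqrt ?ltrDl ?exprn_gt0//.
    by rewrite ltr_pwDr ?exprn_gt0 ?sqr_ge0.
  by have := ler_norm (- s); rewrite normrN; lra.
have kn : k != 0 by rewrite gt_eqF.
have snn : s + n != 0 by rewrite gt_eqF.
(* The positive root of mu^2 - (2 s / k) mu - 1. *)
exists ((s + n) / k); split; first by rewrite mulf_neq0 ?invr_eq0.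
  have -> : k / 2 * ((s + n) / k - ((s + n) / k)^-1) = ((s + n) ^+ 2 - k ^+ 2) / (2 * (s + n)).
    by field; rewrite kn snn.
  have -> : (s + n) ^+ 2 - k ^+ 2 = s * (2 * (s + n)) by rewrite sqrrD n2; ring.
  by rewrite mulfK// mulf_neq0 ?pnatr_eq0.
have -> : k / 2 * ((s + n) / k + ((s + n) / k)^-1) = ((s + n) ^+ 2 + k ^+ 2) / (2 * (s + n)).
  by field; rewrite kn snn.
have -> : (s + n) ^+ 2 + k ^+ 2 = n * (2 * (s + n)).
  by apply: (@eq_trans _ _ (s ^+ 2 + k ^+ 2 + n ^+ 2 + 2 * s * n)); [ring|rewrite -n2; ring].
by rewrite mulfK// mulf_neq0 ?pnatr_eq0.
Qed.

(** With lambda = mu e^(- i th), these are lambda and - 1 / lambda; the angle turns the plane wave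
    into the frame of direction th. *)
Definition rotl (mu th : R) : R[i] := ((mu * cos th) +i* (- (mu * sin th)))%C.
Definition rotm (mu th : R) : R[i] := ((- (mu^-1 * cos th)) +i* (- (mu^-1 * sin th)))%C.

Lemma rot_prod mu th : mu != 0 -> rotl mu th * rotm mu th = -1.
Proof.
move=> mu0; have e : sin th ^+ 2 = 1 - cos th ^+ 2 by rewrite sin2cos2.
apply: complex_ext; rewrite /rotl /rotm /=.
  have -> : mu * cos th * - (mu^-1 * cos th) - - (mu * sin th) * - (mu^-1 * sin th) =
    - ((mu * mu^-1) * (cos th ^+ 2 + sin th ^+ 2)) by ring.
  by rewrite e mulfV//; ring.
by ring.
Qed.

Lemma wphase_rot k mu th z : wphase k (rotl mu th) (rotm mu th) z =
  ((k / 2 * (mu - mu^-1) * (cRe z * cos th + cIm z * sin th)) +i*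
   (k / 2 * (mu + mu^-1) * (cIm z * cos th - cRe z * sin th)))%C.
Proof.
by case: z => x y; rewrite /wphase /rotl /rotm /cj; apply: complex_ext => /=; ring.
Qed.

Lemma rot_crack th m t :
  cRe (ccrack m t) * cos th + cIm (ccrack m t) * sin th = t * cos (m.1 - th) - m.2 * sin (m.1 - th) /\
  cIm (ccrack m t) * cos th - cRe (ccrack m t) * sin th = t * sin (m.1 - th) + m.2 * cos (m.1 - th).
Proof. by rewrite /ccrack crackE /= cosB sinB; split; ring. Qed.

End geometry.

Section circle_data.
Context {R : realType}.
Variables (k r M amax eps : R).
Hypotheses (k_gt0 : 0 < k) (r_gt0 : 0 < r) (M_gt0 : 0 < M) (amax_gt0 : 0 < amax) (eps_gt0 : 0 < eps).
Hypothesis far : exists2 delta : R, 0 < delta &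
       forall (m : R * R) (t : R) (x : R * R),
         Bprime amax eps m -> - M <= t <= M -> circle r x ->
         delta <= enorm2 (x - crack m t).
Local Notation leb := (@lebesgue_measure R).

(** If a crack point were on or outside the circle, scaling its parameter and its offset by c = r /
    |y| <= 1 would stay within the admissible ranges and put a crack point exactly on the circle,
    against [far]. *)
Lemma crack_inside m t : Bprime amax eps m -> - M <= t <= M ->
  (crack m t).1 ^+ 2 + (crack m t).2 ^+ 2 < r ^+ 2.
Proof.
have [delta d0 hd] := far.
move=> Bm It; rewrite ltNge; apply/negP => hr.
set N := _ + _ in hr; have r2 : 0 < r ^+ 2 by rewrite exprn_gt0.
have N0 : 0 < N by exact: lt_le_trans hr.
pose c := r / Num.sqrt N.
have sN : 0 < Num.sqrt N by rewrite sqrtr_gt0.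
have c0 : 0 < c by rewrite divr_gt0.
have c1 : c <= 1.
  by rewrite ler_pdivrMr// mul1r -[leLHS](gtr0_norm r_gt0) -sqrtr_sqr ler_wsqrtr.
have shrink x y z : x < 0 -> 0 < z -> x < y < z -> x < c * y < z.
  move=> x0 z0 /andP[xy yz]; have [y0|y0] := leP 0 y.
    rewrite (lt_le_trans x0 (mulr_ge0 (ltW c0) y0))/=.
    by apply: le_lt_trans yz; rewrite ler_piMl.
  have cy0 : c * y < 0 by rewrite pmulr_rlt0.
  rewrite (lt_trans cy0 z0) andbT.
  by apply: lt_le_trans xy _; rewrite -lerN2 -mulrN ler_piMl// oppr_ge0 ltW.
have Bm' : Bprime amax eps (m.1, c * m.2).
  by case: Bm => B1 B2; split=> //=; apply: shrink => //; move: amax_gt0 eps_gt0; lra.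
have Ict : - M <= c * t <= M.
  by move: It; rewrite -!ler_norml normrM (gtr0_norm c0) => h; apply: le_trans h; rewrite ler_piMl.
have e : crack (m.1, c * m.2) (c * t) = (c * (crack m t).1, c * (crack m t).2).
  by rewrite !crackE /=; congr (_, _); ring.
have cir : circle r (crack (m.1, c * m.2) (c * t)).
  have -> : circle r (crack (m.1, c * m.2) (c * t)) = (Num.sqrt (c ^+ 2 * N) = r).
    by rewrite e /circle /= /enorm2 /= !exprMn -mulrDr.
  rewrite sqrtrM ?sqr_ge0// sqrtr_sqr gtr0_norm//.
  by rewrite /c divfK// gt_eqF.
have := hd _ _ _ Bm' Ict cir; rewrite subrr /enorm2 /= expr0n addr0 sqrtr0.
by rewrite leNgt d0.
Qed.

Lemma dist2_far : exists2 d, 0 < d & forall m s t, Bprime amax eps m -> - M <= t <= M ->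
  d <= dist2 r r (crack m t).1 (crack m t).2 s.
Proof.
have [delta d0 hd] := far; exists (delta ^+ 2); first by rewrite exprn_gt0.
move=> m s t Bm It; have := hd m t _ Bm It (circle_arc s r_gt0).
rewrite enorm2_arc => h; rewrite -[leRHS]sqr_sqrtr.
  by rewrite ler_sqr ?nnegrE ?sqrtr_ge0 ?(ltW d0).
by apply: ltW; apply: dist2_gt0; exact: crack_inside.
Qed.

Definition kern (G : nat -> R -> R) m s t := G 0%N (dist2 r r (crack m t).1 (crack m t).2 s).

(** A fixed crack is a moving one of zero velocity, so [kernel_bounds] applies with q1 = q2 = 0. *)
Lemma kern_facts G m : bessel_tower k G -> Bprime amax eps m ->
  (exists2 C, 0 <= C & forall s, lipC M C (kern G m s)) /\
  forall s t, - M < t < M -> cnt (fun s => kern G m s t) s.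
Proof.
move=> hG Bm; have [d d0 hd] := dist2_far.
have sqk h s t : sq r m.1 m.2 0 0 h s t = dist2 r r (crack m t).1 (crack m t).2 s.
  by rewrite sqE !mulr0 !addr0 -surjective_pairing.
have ge h s t : `|h| <= 0 -> - M <= t <= M -> d <= sq r m.1 m.2 0 0 h s t.
  by move=> _ It; rewrite sqk; exact: hd.
have n0 : `|0 : R| <= 0 by rewrite normr0.
split.
  have [C C0 [hC _ _]] := kernel_bounds hG d0 (lexx 0) ge; exists C => // s.
  by apply: lipC_ext (hC 0 s n0) => t _; rewrite sqk.
move=> s t It; have It' : - M <= t <= M by case/andP: It => *; rewrite !ltW.
have : cnt (fun s => G 0%N (sq r m.1 m.2 0 0 0 s t)) s by apply: (cnt_kernel hG d0 ge n0 It').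
by rewrite (_ : (fun s => _) = fun s => kern G m s t)//; apply/funext => x; rewrite sqk.
Qed.

Lemma kern_mode G m n t : bessel_tower k G -> Bprime amax eps m -> - M < t < M ->
  rint 0 (2 * pi * r) (fun s => kern G m s t * cos (n%:R * (s / r))) = amp k r G n r * cRe (cmode k n (ccrack m t)) /\
  rint 0 (2 * pi * r) (fun s => kern G m s t * sin (n%:R * (s / r))) = amp k r G n r * cIm (cmode k n (ccrack m t)).
Proof.
move=> hG Bm It; have It' : - M <= t <= M by case/andP: It => *; rewrite !ltW.
rewrite cmodeE; exact: (emode_mode k_gt0 r_gt0 hG n r_gt0 (crack_inside Bm It')).
Qed.

Lemma single_layer_arc m (psi : Hmhalf M) s : Bprime amax eps m ->
  cRe (single_layer k m psi (Defs.arc r s)) = - 4^-1 * (Lim psi (kern (besJ k) m s) + Lre psi (kern (besY k) m s)) /\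
  cIm (single_layer k m psi (Defs.arc r s)) = 4^-1 * (Lre psi (kern (besJ k) m s) - Lim psi (kern (besY k) m s)).
Proof.
move=> Bm.
have [[CJ _ hJ] _] := kern_facts (besJ_tower k) Bm.
have [[CY _ hY] _] := kern_facts (besY_tower k) Bm.
have lJ : lip M (kern (besJ k) m s) by exists CJ.
have lY : lip M (kern (besY k) m s) by exists CY.
have e t : - M < t < M -> Phi k (Defs.arc r s) (crack m t) =
    (- (4^-1 * kern (besY k) m s t) +i* (4^-1 * kern (besJ k) m s t))%C.
  move=> It; rewrite PhiE//; apply: dist2_gt0; apply: crack_inside => //.
  by case/andP: It => *; rewrite !ltW.
apply: (pair_kernel M_gt0) => //; split; apply: (lip_hin M_gt0).
  have [C h] := lipZ (- 4^-1) lY; exists C; apply: lipC_ext h => t It.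
  by rewrite e//= mulNr.
have [C h] := lipZ 4^-1 lJ; exists C; apply: lipC_ext h => t It.
by rewrite e.
Qed.

Lemma cnt_cos_arc (n s : R) : cnt (fun s : R => cos (n * (s / r))) s.
Proof. by cnt_auto. Qed.
Lemma cnt_sin_arc (n s : R) : cnt (fun s : R => sin (n * (s / r))) s.
Proof. by cnt_auto. Qed.
Lemma cos_le1' (x : R) : `|cos x| <= 1. Proof. by rewrite ler_norml cos_geN1 cos_le1. Qed.
Lemma sin_le1' (x : R) : `|sin x| <= 1. Proof. by rewrite ler_norml sin_geN1 sin_le1. Qed.

Lemma clip_cmode m n : clip M (fun t => cmode k n (ccrack m t)).
Proof. exact: (clip_wave k M (fun t => cder_ccrack m t)). Qed.

Lemma agree_modes m m' (psi phi : Hmhalf M) : Bprime amax eps m -> Bprime amax eps m' ->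
  circle_eqL2 r (single_layer k m psi) (single_layer k m' phi) ->
  forall n, agree M (Lre psi) (Lre phi) (fun t => cmode k n (ccrack m t)) (fun t => cmode k n (ccrack m' t)) /\
            agree M (Lim psi) (Lim phi) (fun t => cmode k n (ccrack m t)) (fun t => cmode k n (ccrack m' t)).
Proof.
move=> Bm Bm' h n.
have tJ := besJ_tower k; have tY := besY_tower k.
have [[C1 p1 h1] c1] := kern_facts tJ Bm; have [[C2 p2 h2] c2] := kern_facts tY Bm.
have [[C3 p3 h3] c3] := kern_facts tJ Bm'; have [[C4 p4 h4] c4] := kern_facts tY Bm'.
pose C := C1 + C2 + C3 + C4.
have l1 s : lipC M C (kern (besJ k) m s) by apply: lipC_le (h1 s); rewrite /C; lra.
have l2 s : lipC M C (kern (besY k) m s) by apply: lipC_le (h2 s); rewrite /C; lra.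
have l3 s : lipC M C (kern (besJ k) m' s) by apply: lipC_le (h3 s); rewrite /C; lra.
have l4 s : lipC M C (kern (besY k) m' s) by apply: lipC_le (h4 s); rewrite /C; lra.
have hae : {ae leb, forall s, 0 <= s < 2 * pi * r ->
    Lim psi (kern (besJ k) m s) + Lre psi (kern (besY k) m s) = Lim phi (kern (besJ k) m' s) + Lre phi (kern (besY k) m' s) /\
    Lre psi (kern (besJ k) m s) - Lim psi (kern (besY k) m s) = Lre phi (kern (besJ k) m' s) - Lim phi (kern (besY k) m' s)}.
  case: h => N [mN N0 hN]; exists N; split=> // s /= ns; apply: hN => /= hs; apply: ns => Js.
  have {}hs := hs Js.
  have [a1 a2] := single_layer_arc psi s Bm; have [b1 b2] := single_layer_arc phi s Bm'.
  have q4 : 4^-1 != 0 :> R by rewrite invr_eq0 pnatr_eq0.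
  have nq4 : - 4^-1 != 0 :> R by rewrite oppr_eq0.
  split; [apply: (mulfI nq4)|apply: (mulfI q4)].
    by rewrite -a1 -b1; congr cRe.
  by rewrite -a2 -b2; congr cIm.
have [cp [Cc [lc1 lc2]]] := (clip_cmode m n, clip_cmode m n).
have [[Dp [e1 e2]] [Dp' [e1' e2']]] := (clip_cmode m n, clip_cmode m' n).
have re : Lre psi (fun t => cRe (cmode k n (ccrack m t))) = Lre phi (fun t => cRe (cmode k n (ccrack m' t))) /\
    Lim psi (fun t => cRe (cmode k n (ccrack m t))) = Lim phi (fun t => cRe (cmode k n (ccrack m' t))).
  apply: (mode_transfer k_gt0 r_gt0 M_gt0 (lipfun_Lre M_gt0 psi) (lipfun_Lim M_gt0 psi) (lipfun_Lre M_gt0 phi) (lipfun_Lim M_gt0 phi)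
    l1 l2 l3 l4 c1 c2 c3 c4 hae (n := n) (tr := fun s => cos (n%:R * (s / r)))).
  - exact: cnt_cos_arc.
  - by move=> s; exact: cos_le1'.
  - by exists Dp.
  - by exists Dp'.
  - by move=> t It; have [-> _] := kern_mode n tJ Bm It.
  - by move=> t It; have [-> _] := kern_mode n tY Bm It.
  - by move=> t It; have [-> _] := kern_mode n tJ Bm' It.
  - by move=> t It; have [-> _] := kern_mode n tY Bm' It.
have im : Lre psi (fun t => cIm (cmode k n (ccrack m t))) = Lre phi (fun t => cIm (cmode k n (ccrack m' t))) /\
    Lim psi (fun t => cIm (cmode k n (ccrack m t))) = Lim phi (fun t => cIm (cmode k n (ccrack m' t))).
  apply: (mode_transfer k_gt0 r_gt0 M_gt0 (lipfun_Lre M_gt0 psi) (lipfun_Lim M_gt0 psi) (lipfun_Lre M_gt0 phi) (lipfun_Lim M_gt0 phi)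
    l1 l2 l3 l4 c1 c2 c3 c4 hae (n := n) (tr := fun s => sin (n%:R * (s / r)))).
  - exact: cnt_sin_arc.
  - by move=> s; exact: sin_le1'.
  - by exists Dp.
  - by exists Dp'.
  - by move=> t It; have [_ ->] := kern_mode n tJ Bm It.
  - by move=> t It; have [_ ->] := kern_mode n tY Bm It.
  - by move=> t It; have [_ ->] := kern_mode n tJ Bm' It.
  - by move=> t It; have [_ ->] := kern_mode n tY Bm' It.
by split; split; [exact: clip_cmode|exact: clip_cmode|apply re|apply im|exact: clip_cmode|exact: clip_cmode|apply re|apply im].
Qed.

(* [x m t] and [y m t] are the coordinates of [crack m t] rotated by - th; since
   eta^2 = s^2 + k^2, e^(s x) cos (eta y) and e^(s x) sin (eta y) solve Helmholtz' equation. *)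
Lemma agree_plane_waves L L' m m' : lipfun M L -> lipfun M L' ->
  (forall n, agree M L L' (fun t => cmode k n (ccrack m t)) (fun t => cmode k n (ccrack m' t))) ->
  forall s th, let eta := Num.sqrt (s ^+ 2 + k ^+ 2) in
  let x m t := t * cos (m.1 - th) - m.2 * sin (m.1 - th) in
  let y m t := t * sin (m.1 - th) + m.2 * cos (m.1 - th) in
  L (fun t => expR (s * x m t) * cos (eta * y m t)) = L' (fun t => expR (s * x m' t) * cos (eta * y m' t)) /\
  L (fun t => expR (s * x m t) * sin (eta * y m t)) = L' (fun t => expR (s * x m' t) * sin (eta * y m' t)).
Proof.
move=> hL hL' h s th eta x y; have [mu [mu0 es ee]] := wave_parameter s k_gt0.
have ew m0 t : cexp (wphase k (rotl mu th) (rotm mu th) (ccrack m0 t)) =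
    ((expR (s * x m0 t) * cos (eta * y m0 t)) +i* (expR (s * x m0 t) * sin (eta * y m0 t)))%C.
  by rewrite wphase_rot es ee; have [-> ->] := rot_crack th m0 t.
have eR m0 : (fun t => cRe (cexp (wphase k (rotl mu th) (rotm mu th) (ccrack m0 t)))) =
  fun t => expR (s * x m0 t) * cos (eta * y m0 t) by apply/funext => t; rewrite ew.
have eI m0 : (fun t => cIm (cexp (wphase k (rotl mu th) (rotm mu th) (ccrack m0 t)))) =
  fun t => expR (s * x m0 t) * sin (eta * y m0 t) by apply/funext => t; rewrite ew.
have [h1 h2] := waves_agree hL hL' (rot_prod th mu0) (cder_ccrack m) (cder_ccrack m') h; split.
  exact: (etrans (congr1 L (esym (eR m))) (etrans h1 (congr1 L' (eR m')))).
exact: (etrans (congr1 L (esym (eI m))) (etrans h2 (congr1 L' (eI m')))).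
Qed.

End circle_data.

Lemma lip_smooth (R : realType) (M : R) (f df : R -> R) :
  (forall t : R, der f t (df t)) -> (forall t, cnt df t) -> lip M f.
Proof.
move=> d c; have [|A hA] := @compact_bound _ f (- M) M; first by move=> x _; exact: cnt_der (d x).
have [|B hB] := @compact_bound _ df (- M) M; first by move=> x _; exact: c.
exists (`|A| + `|B|); apply: (@lipC_der _ _ _ _ df (fun t _ => d t)) => t It.
  apply: (@le_trans _ _ A); last by rewrite (le_trans (ler_norm _))// lerDl.
  by apply: hA; case/andP: It => *; rewrite !ltW.
apply: (@le_trans _ _ B); last by rewrite (le_trans (ler_norm _))// lerDr.
by apply: hB; case/andP: It => *; rewrite !ltW.
Qed.

(** * Crossing, parallel and coinciding cracks *)

Section two_agreeing_functionals.
Context {R : realType}.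
Variables (k M : R).
Hypotheses (k_gt0 : 0 < k) (M_gt0 : 0 < M).
Implicit Types (m : R * R) (L : (R -> R) -> R).

Lemma lip_cosw s p q : lip M (fun t => expR (s * t) * cos (p * t + q)).
Proof.
apply: (@lip_smooth _ _ _ (fun t => s * expR (s * t) * cos (p * t + q) - p * expR (s * t) * sin (p * t + q))) => t.
  by der; ring.
by cnt_auto.
Qed.

Lemma lip_sinw s p q : lip M (fun t => expR (s * t) * sin (p * t + q)).
Proof.
apply: (@lip_smooth _ _ _ (fun t => s * expR (s * t) * sin (p * t + q) + p * expR (s * t) * cos (p * t + q))) => t.
  by der; ring.
by cnt_auto.
Qed.

Definition agree_at L L' m m' := forall n,
  agree M L L' (fun t => cmode k n (ccrack m t)) (fun t => cmode k n (ccrack m' t)).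

Lemma agree_at_sym L L' m m' : agree_at L L' m m' -> agree_at L' L m' m.
Proof. by move=> h n; have [a b c d] := h n; split. Qed.

Lemma agree_at_exp L L' m m' s : lipfun M L -> lipfun M L' -> agree_at L L' m m' ->
  m.1 = m'.1 -> let eta := Num.sqrt (s ^+ 2 + k ^+ 2) in
  cos (eta * m.2) * L (fun t => expR (s * t)) = cos (eta * m'.2) * L' (fun t => expR (s * t)) /\
  sin (eta * m.2) * L (fun t => expR (s * t)) = sin (eta * m'.2) * L' (fun t => expR (s * t)).
Proof.
move=> hL hL' h e eta; have := agree_plane_waves k_gt0 hL hL' h s m.1.
rewrite /= -e subrr cos0 sin0 -/eta.
have le : lip M (fun t => expR (s * t)).
  by apply: (@lip_smooth _ _ _ (fun t => s * expR (s * t))) => t; [der; ring|cnt_auto].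
have fc (a : R) (trg : R -> R) : (fun t => expR (s * (t * 1 - a * 0)) * trg (eta * (t * 0 + a * 1))) =
    fun t => trg (eta * a) * expR (s * t).
  by apply/funext => t; rewrite !mulr1 !mulr0 subr0 add0r mulrC.
by rewrite !(fc _ cos) !(fc _ sin) !(lipfunZ hL) ?(lipfunZ hL').
Qed.

(** The equations on b and b' say that the parameters b and b' of the two lines give the same point,
    in the frame of the first crack. Mixing the cosine and the sine wave with weights cos (eta m.2)
    and sin (eta m.2) moves the phase of the second wave to that point. *)
Lemma agree_at_cross L L' m m' b b' s : lipfun M L -> lipfun M L' -> agree_at L L' m m' ->
  let c := cos (m'.1 - m.1) in let n := sin (m'.1 - m.1) in
  b' * n + m'.2 * c = m.2 -> b' * c - m'.2 * n = b ->
  L (fun t => expR (s * (t - b))) =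
  L' (fun t => expR (s * (c * (t - b'))) * cos (Num.sqrt (s ^+ 2 + k ^+ 2) * (n * (t - b')))).
Proof.
move=> hL hL' h c n ey ex; have := agree_plane_waves k_gt0 hL hL' h s m.1.
rewrite /= subrr cos0 sin0 -/c -/n; set eta := Num.sqrt _.
have -> : (fun t => expR (s * (t * 1 - m.2 * 0)) * cos (eta * (t * 0 + m.2 * 1))) =
    fun t => cos (eta * m.2) * expR (s * t).
  by apply/funext => t; rewrite !mulr1 !mulr0 subr0 add0r mulrC.
have -> : (fun t => expR (s * (t * 1 - m.2 * 0)) * sin (eta * (t * 0 + m.2 * 1))) =
    fun t => sin (eta * m.2) * expR (s * t).
  by apply/funext => t; rewrite !mulr1 !mulr0 subr0 add0r mulrC.
have le : lip M (fun t => expR (s * t)).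
  by apply: (@lip_smooth _ _ _ (fun t => s * expR (s * t))) => t; [der; ring|cnt_auto].
rewrite !(lipfunZ hL)//; set E := L _ => -[e1 e2].
pose fc t := expR (s * (t * c - m'.2 * n)) * cos (eta * (t * n + m'.2 * c)).
pose fs t := expR (s * (t * c - m'.2 * n)) * sin (eta * (t * n + m'.2 * c)).
have lc : lip M fc.
  have := lipZ (expR (- s * (m'.2 * n))) (lip_cosw (s * c) (eta * n) (eta * (m'.2 * c))).
  congr (lip M _); apply/funext => t; rewrite mulrA -expRD /fc.
  by congr (expR _ * cos _); ring.
have ls : lip M fs.
  have := lipZ (expR (- s * (m'.2 * n))) (lip_sinw (s * c) (eta * n) (eta * (m'.2 * c))).
  congr (lip M _); apply/funext => t; rewrite mulrA -expRD /fs.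
  by congr (expR _ * sin _); ring.
have key : E = L' (fun t => cos (eta * m.2) * fc t + sin (eta * m.2) * fs t).
  rewrite hL'.1//; last exact: lipZ.
  rewrite (lipfunZ hL')// -[L' fc]e1 -[L' fs]e2.
  have := cos2Dsin2 (eta * m.2) => cs; rewrite !mulrA -mulrDl -!expr2 cs mul1r.
  by [].
have eL : L (fun t => expR (s * (t - b))) = expR (- (s * b)) * E.
  rewrite -(lipfunZ hL)//; congr L; apply/funext => t.
  by rewrite -expRD; congr expR; ring.
rewrite eL key -(lipfunZ hL'); last first.
  by apply: lipD; exact: lipZ.
congr L'; apply/funext => t.
have -> : cos (eta * m.2) * fc t + sin (eta * m.2) * fs t =
    expR (s * (t * c - m'.2 * n)) * cos (eta * (t * n + m'.2 * c) - eta * m.2).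
  by rewrite cosB /fc /fs; ring.
rewrite mulrA -expRD; congr (expR _ * cos _); first by rewrite -ex; ring.
by rewrite -ey; ring.
Qed.

Lemma agree_at_crossing L L' m m' : hfun M L -> hfun M L' -> agree_at L L' m m' ->
  sin (m'.1 - m.1) != 0 -> forall f, lip M f -> L f = 0.
Proof.
move=> fL fL' h n0.
have hL := hfun_lipfun M_gt0 fL; have hL' := hfun_lipfun M_gt0 fL'.
set c := cos (m'.1 - m.1); set n := sin (m'.1 - m.1) in n0.
have cs : c ^+ 2 + n ^+ 2 = 1 by exact: cos2Dsin2.
have n2 : n ^+ 2 = 1 - c ^+ 2 by rewrite -cs; ring.
(* The parameters of the crossing point on the second and on the first line. *)
pose b' := (m.2 - m'.2 * c) / n; pose b := b' * c - m'.2 * n.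
have eb' : b' * n = m.2 - m'.2 * c by rewrite /b' divfK.
have ey : b' * n + m'.2 * c = m.2 by rewrite eb'; ring.
have c' : cos (m.1 - m'.1) = c by rewrite -opprB cosN.
have n' : sin (m.1 - m'.1) = - n by rewrite -opprB sinN.
have ey' : b * sin (m.1 - m'.1) + m.2 * cos (m.1 - m'.1) = m'.2.
  rewrite c' n'; have -> : b * - n + m.2 * c = - (b' * n) * c + m'.2 * n ^+ 2 + m.2 * c by rewrite /b; ring.
  by rewrite eb' n2; ring.
have ex' : b * cos (m.1 - m'.1) - m.2 * sin (m.1 - m'.1) = b'.
  rewrite c' n'; have -> : b * c - m.2 * - n = b' * c ^+ 2 + (m.2 - m'.2 * c) * n by rewrite /b; ring.
  by rewrite -eb' -mulrA -expr2 n2; ring.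
have H1 := fun s => agree_at_cross s hL hL' h ey (erefl b).
have H2 s : L' (fun t => expR (s * (t - b'))) =
    L (fun t => expR (s * (c * (t - b))) * cos (Num.sqrt (s ^+ 2 + k ^+ 2) * (n * (t - b)))).
  rewrite (agree_at_cross s hL' hL (agree_at_sym h) ey' ex') c' n'; congr L; apply/funext => t.
  by rewrite -[in RHS]cosN; congr (_ * cos _); ring.
apply: (diffuse_kills M_gt0 hL (hfun_diffuse M_gt0 fL) (b := b)) => e e0.
move=> K f; exact: (two_cracks M_gt0 hL hL' cs n0 (ltW k_gt0) H1 H2 e0).
Qed.

Lemma agree_at_parallel L L' m m' : lipfun M L -> lipfun M L' -> agree_at L L' m m' ->
  m.1 = m'.1 -> m.2 != m'.2 -> forall f, lip M f -> L f = 0.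
Proof.
move=> hL hL' h e1 e2; apply: (parallel_kills M_gt0 (k := k) hL hL' e2) => s.
  exact: (agree_at_exp s hL hL' h e1).1.
exact: (agree_at_exp s hL hL' h e1).2.
Qed.

(** The cosine and sine identities carry the same weights on both sides, and the squares of the
    weights sum to 1. *)
Lemma agree_at_same L L' m : lipfun M L -> lipfun M L' -> agree_at L L' m m ->
  forall f, lip M f -> L f = L' f.
Proof.
move=> hL hL' h f lf; apply/eqP; rewrite -subr_eq0; apply/eqP.
apply: (exp_kills M_gt0 (lipfunB_fun hL hL') _ lf) => s _.
have /= [e1 e2] := agree_at_exp s hL hL' h erefl.
set eta := Num.sqrt _ in e1 e2; have cs := cos2Dsin2 (eta * m.2).
apply/eqP; rewrite subr_eq0; apply/eqP; rewrite -[LHS]mul1r -[RHS]mul1r -cs !mulrDl !expr2 -!mulrA.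
by rewrite e1 e2.
Qed.

End two_agreeing_functionals.

Lemma pairB (R : realType) (M : R) (psi phi : Hmhalf M) F : pair (psi - phi) F = pair psi F - pair phi F.
Proof. by []. Qed.

Lemma LreB (R : realType) (M : R) (psi phi : Hmhalf M) f : Lre (psi - phi) f = Lre psi f - Lre phi f.
Proof. by rewrite /Lre pairB; case: (pair psi _) (pair phi _) => [? ?] [? ?]. Qed.

Lemma LimB (R : realType) (M : R) (psi phi : Hmhalf M) f : Lim (psi - phi) f = Lim psi f - Lim phi f.
Proof. by rewrite /Lim pairB; case: (pair psi _) (pair phi _) => [? ?] [? ?]. Qed.

Section uniqueness.
Context {R : realType}.
Variables (k r M amax eps : R).
Hypotheses (k_gt0 : 0 < k) (r_gt0 : 0 < r) (M_gt0 : 0 < M) (amax_gt0 : 0 < amax) (eps_gt0 : 0 < eps).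
Hypothesis theta_range : eps - (- (pi / 2) - eps) < pi.
Hypothesis far : exists2 delta : R, 0 < delta &
       forall (m : R * R) (t : R) (x : R * R),
         Bprime amax eps m -> - M <= t <= M -> circle r x ->
         delta <= enorm2 (x - crack m t).

Lemma single_layer_uniqueness (psi phi : Hmhalf M) m m' : Bprime amax eps m -> Bprime amax eps m' ->
  psi <> 0 -> circle_eqL2 r (single_layer k m psi) (single_layer k m' phi) -> m = m' /\ psi = phi.
Proof.
move=> Bm Bm' psi0 h.
have a n := agree_modes k_gt0 r_gt0 M_gt0 amax_gt0 eps_gt0 far Bm Bm' h n.
have aR : agree_at k M (Lre psi) (Lre phi) m m' by move=> n; exact: (a n).1.
have aI : agree_at k M (Lim psi) (Lim phi) m m' by move=> n; exact: (a n).2.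
have hR (u : Hmhalf M) : hfun M (Lre u) := hfun_Re M_gt0 u.
have hI (u : Hmhalf M) : hfun M (Lim u) := hfun_Im M_gt0 u.
have lR (u : Hmhalf M) : lipfun M (Lre u) := lipfun_Lre M_gt0 u.
have lI (u : Hmhalf M) : lipfun M (Lim u) := lipfun_Lim M_gt0 u.
(* The angles range over less than pi, so distinct ones are never opposite directions. *)
have sin0 : m.1 != m'.1 -> sin (m'.1 - m.1) != 0.
  move=> ne; case: Bm => [/andP[l1 u1] _]; case: Bm' => [/andP[l2 u2] _].
  have pos (x : R) : 0 < x -> x < pi -> sin x != 0.
    by move=> x0 xpi; rewrite gt_eqF// sin_gt0_pi// x0.
  case: (ltgtP m.1 m'.1) ne => // [lt _|gt _].
    by apply: pos; [rewrite subr_gt0|move: theta_range; lra].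
  rewrite -opprB sinN oppr_eq0; apply: pos; first by rewrite subr_gt0.
  by move: theta_range; lra.
have e1 : m.1 = m'.1.
  apply/eqP; apply: contra_notT psi0 => ne; apply: (Hmhalf_lip_eq0 M_gt0).
    exact: (agree_at_crossing k_gt0 M_gt0 (hR _) (hR _) aR (sin0 ne)).
  exact: (agree_at_crossing k_gt0 M_gt0 (hI _) (hI _) aI (sin0 ne)).
have e2 : m.2 = m'.2.
  apply/eqP; apply: contra_notT psi0 => ne; apply: (Hmhalf_lip_eq0 M_gt0).
    exact: (agree_at_parallel k_gt0 M_gt0 (lR _) (lR _) aR e1 ne).
  exact: (agree_at_parallel k_gt0 M_gt0 (lI _) (lI _) aI e1 ne).
have em : m = m' by rewrite [m]surjective_pairing e1 e2 -surjective_pairing.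
split=> //; rewrite -em in aR aI.
apply/eqP; rewrite -subr_eq0; apply/eqP; apply: (Hmhalf_lip_eq0 M_gt0) => f lf.
  by rewrite LreB (agree_at_same k_gt0 M_gt0 (lR _) (lR _) aR lf) subrr.
by rewrite LimB (agree_at_same k_gt0 M_gt0 (lI _) (lI _) aI lf) subrr.
Qed.

End uniqueness.

Lemma clipM_prod (R : realType) (M : R) (F G : R -> R[i]) : clip M F -> clip M G -> clip M (fun t => F t * G t).
Proof. by case=> C h [D h']; exists (4 * C * D); exact: clipCM. Qed.

(** * The derivative of the single layer *)

Section moving_crack.
Context {R : realType}.
Variables (k r M amax eps : R).
Hypotheses (k_gt0 : 0 < k) (r_gt0 : 0 < r) (M_gt0 : 0 < M) (amax_gt0 : 0 < amax) (eps_gt0 : 0 < eps).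
Hypothesis far : exists2 delta : R, 0 < delta &
       forall (m : R * R) (t : R) (x : R * R),
         Bprime amax eps m -> - M <= t <= M -> circle r x ->
         delta <= enorm2 (x - crack m t).
Variables m q : R * R.
Hypothesis Bm : Bprime amax eps m.
Local Notation leb := (@lebesgue_measure R).
Let T := 2 * pi * r.
Let kc : R[i] := ((k / 2)%:C)%C.

Lemma Bprime_near : exists2 e, 0 < e & forall h, `|h| <= e -> Bprime amax eps (m.1 + h * q.1, m.2 + h * q.2).
Proof.
have [/andP[a1 a2] /andP[b1 b2]] := Bm.
pose Q := 1 + `|q.1| + `|q.2|.
have Q1 : `|q.1| <= Q by rewrite /Q; have := normr_ge0 q.2; lra.
have Q2 : `|q.2| <= Q by rewrite /Q; have := normr_ge0 q.1; lra.
have Q0 : 0 < Q by rewrite /Q; have := normr_ge0 q.1; have := normr_ge0 q.2; lra.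
pose g := Num.min (Num.min (m.1 - (- (pi / 2) - eps)) (eps - m.1)) (Num.min (m.2 - (- amax - eps)) (amax + eps - m.2)).
have g0 : 0 < g by rewrite !lt_min; apply/andP; split; apply/andP; split; lra.
exists (g / 2 / Q); first by rewrite !divr_gt0.
move=> h he.
have small (x : R) : `|x| <= Q -> `|h * x| <= g / 2.
  move=> xQ; rewrite normrM; apply: (@le_trans _ _ (g / 2 / Q * Q)); first by rewrite ler_pM.
  by rewrite divfK// gt_eqF.
have g1 : g <= m.1 - (- (pi / 2) - eps) by rewrite /g !ge_min lexx.
have g2 : g <= eps - m.1 by rewrite /g !ge_min lexx orbT.
have g3 : g <= m.2 - (- amax - eps) by rewrite /g !ge_min lexx !orbT.
have g4 : g <= amax + eps - m.2 by rewrite /g !ge_min lexx !orbT.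
have := small _ Q1; have := small _ Q2; rewrite !ler_norml => /andP[s1 s2] /andP[s3 s4].
by split=> /=; apply/andP; split; lra.
Qed.

Let S := sq r m.1 m.2 q.1 q.2.
Let Sh := sqh r m.1 m.2 q.1 q.2.

Lemma S_dist h s t : S h s t = dist2 r r (crack (m.1 + h * q.1, m.2 + h * q.2) t).1
  (crack (m.1 + h * q.1, m.2 + h * q.2) t).2 s.
Proof. exact: sqE. Qed.

Lemma S_far : exists2 e, 0 < e & (forall h, `|h| <= e -> Bprime amax eps (m.1 + h * q.1, m.2 + h * q.2)) /\
  exists2 d, 0 < d & forall h s t, `|h| <= e -> - M <= t <= M -> d <= S h s t.
Proof.
have [e e0 he] := Bprime_near; have [d d0 hd] := dist2_far r_gt0 amax_gt0 eps_gt0 far.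
by exists e => //; split=> //; exists d => // h s t h1 It; rewrite S_dist; apply: hd => //; exact: he.
Qed.

Definition dkern (G : nat -> R -> R) s t := G 1%N (sq r m.1 m.2 q.1 q.2 0 s t) * sqh r m.1 m.2 q.1 q.2 0 s t.

Lemma dkern_facts G : bessel_tower k G ->
  (exists2 C, 0 <= C & forall s, lipC M C (dkern G s)) /\
  forall s t, - M < t < M -> cnt (fun s => dkern G s t) s.
Proof.
move=> hG; have [e e0 [_ [d d0 ge]]] := S_far; have n0 : `|0 : R| <= e by rewrite normr0 ltW.
split; first by have [C C0 [_ h _]] := kernel_bounds hG d0 (ltW e0) ge; exists C.
move=> s t It; have It' : - M <= t <= M by case/andP: It => *; rewrite !ltW.
apply: cntM; last exact: cnt_sqh_s.
by apply: (cnt_kernel hG d0 ge n0 It').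
Qed.

Let z h t := ccrack (m.1 + h * q.1, m.2 + h * q.2) t.
(** The velocity at h = 0 of the crack point of parameter t. *)
Let zh t : R[i] := ((- (t * sin m.1 * q.1) - q.2 * sin m.1 - m.2 * cos m.1 * q.1) +i*
  (t * cos m.1 * q.1 + q.2 * cos m.1 - m.2 * sin m.1 * q.1))%C.

Lemma cder_zh t : cder (fun h => z h t) 0 (zh t).
Proof.
split; rewrite /z /ccrack /=.
  apply: (der_ext (g := fun h => t * cos (m.1 + h * q.1) - (m.2 + h * q.2) * sin (m.1 + h * q.1))) => [h|].
    by rewrite -mulrN.
  by der; rewrite !mul0r !addr0; ring.
apply: (der_ext (g := fun h => t * sin (m.1 + h * q.1) + (m.2 + h * q.2) * cos (m.1 + h * q.1))) => [h|].
  by [].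
by der; rewrite !mul0r !addr0; ring.
Qed.

Lemma cder_zh_t t : cder zh t ((- (sin m.1 * q.1)) +i* (cos m.1 * q.1))%C.
Proof. by split; rewrite /zh /=; der; ring. Qed.

Lemma z0E : z 0 = ccrack m.
Proof. by apply/funext => t; rewrite /z !mul0r !addr0 -surjective_pairing. Qed.

Lemma cder_z0 t : cder (z 0) t (cos m.1 +i* sin m.1)%C.
Proof. by rewrite z0E; exact: cder_ccrack. Qed.

(** The outcome of [cder_wav0] and [cder_wavS] for l = 1 and m = - 1, kept explicit so that its
    regularity in t can be seen. *)
Definition mode_rate n t : R[i] :=
  let X := - ((k / 2) ^+ 2 * (cRe (z 0 t) ^+ 2 + cIm (z 0 t) ^+ 2)) in
  if n is n'.+1 then 1 * (kc * zh t) * wav n' (1 * (kc * z 0 t)) X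
     + -1 * (kc * cj (zh t)) * wav n'.+2 (1 * (kc * z 0 t)) X
  else 1 * (kc * zh t) * wav 1 (-1 * (kc * cj (z 0 t))) X
     + -1 * (kc * cj (zh t)) * wav 1 (1 * (kc * z 0 t)) X.

Lemma cder_mode n t : cder (fun h => cmode k n (z h t)) 0 (mode_rate n t).
Proof.
have da : cder (fun h => 1 * (kc * z h t)) 0 (1 * (kc * zh t)).
  by do 2 apply: cderZ; exact: cder_zh.
have db : cder (fun h => -1 * (kc * cj (z h t))) 0 (-1 * (kc * cj (zh t))).
  by do 2 apply: cderZ; apply: cder_cj; exact: cder_zh.
have lm : 1 * -1 = -1 :> R[i] by rewrite mul1r.
have [dX eX] := real_product_der da db (fun h => wave_prod k (z h t) lm).
have ew j h : cmode k j (z h t) = wav j (1 * (kc * z h t)) (- ((k / 2) ^+ 2 * (cRe (z h t) ^+ 2 + cIm (z h t) ^+ 2))).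
  by rewrite /cmode mul1r.
apply: (cder_ext (ew n)); case: n => [|n].
  exact: (@cder_wav0 R _ (fun h => -1 * (kc * cj (z h t))) _ 0 _ _ _ dX eX).
exact: (@cder_wavS R n _ (fun h => -1 * (kc * cj (z h t))) _ 0 _ _ _ da dX eX (wave_prod k (z 0 t) lm)).
Qed.

Lemma clip_affine (c : R -> R[i]) c1 : (forall t, cder c t c1) -> clip M c.
Proof.
move=> dc; have lr (f : R -> R) f1 : (forall t : R, der f t f1) -> lip M f.
  by move=> h; apply: (@lip_smooth _ _ _ (fun=> f1)) => // t; exact: cnt_cst.
have [C h1] := lr _ _ (fun t => (dc t).1); have [D h2] := lr _ _ (fun t => (dc t).2).
have C0 := lipC_ge0 M_gt0 h1; have D0 := lipC_ge0 M_gt0 h2.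
by exists (C + D); split; [apply: lipC_le h1; rewrite lerDl|apply: lipC_le h2; rewrite lerDr].
Qed.

Lemma clip_mode_rate n : clip M (mode_rate n).
Proof.
have lm : 1 * -1 = -1 :> R[i] by rewrite mul1r.
have [C hC] := wave_clip k M lm cder_z0.
have cza : clip M (fun t => 1 * (kc * zh t)) by apply: clip_affine => t; do 2 apply: cderZ; exact: cder_zh_t.
have czb : clip M (fun t => -1 * (kc * cj (zh t))).
  by apply: clip_affine => t; do 2 apply: cderZ; apply: cder_cj; exact: cder_zh_t.
have wa j : clip M (fun t => wav j (1 * (kc * z 0 t)) (- ((k / 2) ^+ 2 * (cRe (z 0 t) ^+ 2 + cIm (z 0 t) ^+ 2)))).
  by exists C; have [_ h _] := hC j.
have wb j : clip M (fun t => wav j (-1 * (kc * cj (z 0 t))) (- ((k / 2) ^+ 2 * (cRe (z 0 t) ^+ 2 + cIm (z 0 t) ^+ 2)))).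
  by exists C; have [_ _ h] := hC j.
case: n => [|n]; apply: clipD; apply: clipM_prod => //; first [exact: wa|exact: wb].
Qed.

(** Graf's formula differentiated at h = 0: the amplitude depends on the circle alone, so only the
    mode moves. *)
Lemma dkern_mode (G : nat -> R -> R) n t : bessel_tower k G -> - M < t < M ->
  rint 0 T (fun s => dkern G s t * cos (n%:R * (s / r))) = amp k r G n r * cRe (mode_rate n t) /\
  rint 0 T (fun s => dkern G s t * sin (n%:R * (s / r))) = amp k r G n r * cIm (mode_rate n t).
Proof.
move=> hG It; have It' : - M <= t <= M by case/andP: It => *; rewrite !ltW.
have [e e0 [he [d d0 ge]]] := S_far.
have Spos h s : `|h| <= e -> 0 < S h s t by move=> h1; apply: lt_le_trans d0 (ge h s t h1 It').
have jn j h s : `|h - 0| <= e -> cnt (fun p : R * R => G j (S p.1 p.2 t)) (h, s).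
  rewrite subr0 => h1; apply: (@cnt_comp _ _ (G j) (fun p : R * R => S p.1 p.2 t)).
    by apply: (tower_cnt hG); exact: Spos.
  by rewrite /S /sq; cnt_auto.
have key (tr : R -> R) (P : R[i] -> R) : (forall s, cnt tr s) ->
    (forall h, `|h| <= e -> rint 0 T (fun s => G 0%N (S h s t) * tr s) = amp k r G n r * P (cmode k n (z h t))) ->
    (forall (f : R -> R[i]) l, cder f 0 l -> der (fun h : R => P (f h)) (0 : R) (P l)) ->
    rint 0 T (fun s => dkern G s t * tr s) = amp k r G n r * P (mode_rate n t).
  move=> ctr hm dP.
  have d1 : der (fun h : R => rint 0 T (fun s => G 0%N (S h s t) * tr s)) (0 : R)
      (rint 0 T (fun s => G 1%N (S 0 s t) * Sh 0 s t * tr s)).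
    refine (@der_rint_joint R (fun h s => G 0%N (S h s t) * tr s) (fun h s => G 1%N (S h s t) * Sh h s t * tr s) 0 T 0 e e0 _ _ _).
    - move=> h s h1; apply: cntM; first exact: jn.
      by apply: (@cnt_comp _ _ tr (fun p : R * R => p.2)) => //; exact: cnt_snd.
    - move=> h s h1; apply: cntM; last by apply: (@cnt_comp _ _ tr (fun p : R * R => p.2)) => //; exact: cnt_snd.
      by apply: cntM; [exact: jn|rewrite /Sh /sqh; cnt_auto].
    - move=> h s; rewrite subr0 => h1.
      have dS := @tower_der _ _ _ hG 0%N (fun h => S h s t) h _ (Spos h s h1) (der_sq_h _ _ _ _ _ h s t).
      by apply: der_eq (derM dS (der_cst (tr s) h)) _; rewrite mulr0 addr0.
  have d2 : der (fun h : R => amp k r G n r * P (cmode k n (z h t))) (0 : R) (amp k r G n r * P (mode_rate n t)).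
    by apply: der_eq (derM (der_cst _ 0) (dP _ _ (cder_mode n t))) _; rewrite mul0r add0r.
  apply: (der_unique d1); apply: der_near d2.
  apply: filterS (nbhsx_ballx (0 : R) _ e0) => h; rewrite /ball /= sub0r normrN => /ltW h1.
  by rewrite hm.
have em h : `|h| <= e ->
    rint 0 T (fun s => G 0%N (S h s t) * cos (n%:R * (s / r))) = amp k r G n r * cRe (cmode k n (z h t)) /\
    rint 0 T (fun s => G 0%N (S h s t) * sin (n%:R * (s / r))) = amp k r G n r * cIm (cmode k n (z h t)).
  move=> h1.
  have eS (tr : R -> R) : (fun s => G 0%N (S h s t) * tr s) =
      fun s => kern r G (m.1 + h * q.1, m.2 + h * q.2) s t * tr s.
    by apply/funext => s; rewrite S_dist.
  rewrite !eS; exact: (kern_mode k_gt0 r_gt0 amax_gt0 eps_gt0 far n hG (he h h1) It).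
split; apply: key.
- by move=> s; cnt_auto.
- by move=> h h1; exact: (em h h1).1.
- by move=> f l [d1 _].
- by move=> s; cnt_auto.
- by move=> h h1; exact: (em h h1).2.
- by move=> f l [_ d1].
Qed.

Lemma agree_rates (psi phi : Hmhalf M) :
  {ae leb, forall s, 0 <= s < T ->
    Lim psi (dkern (besJ k) s) + Lre psi (dkern (besY k) s) = Lim phi (kern r (besJ k) m s) + Lre phi (kern r (besY k) m s) /\
    Lre psi (dkern (besJ k) s) - Lim psi (dkern (besY k) s) = Lre phi (kern r (besJ k) m s) - Lim phi (kern r (besY k) m s)} ->
  forall n, agree M (Lre psi) (Lre phi) (mode_rate n) (fun t => cmode k n (ccrack m t)) /\
            agree M (Lim psi) (Lim phi) (mode_rate n) (fun t => cmode k n (ccrack m t)).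
Proof.
move=> hae n.
have tJ := besJ_tower k; have tY := besY_tower k.
have [[C1 p1 h1] c1] := dkern_facts tJ; have [[C2 p2 h2] c2] := dkern_facts tY.
have [[C3 p3 h3] c3] := kern_facts r_gt0 amax_gt0 eps_gt0 far tJ Bm.
have [[C4 p4 h4] c4] := kern_facts r_gt0 amax_gt0 eps_gt0 far tY Bm.
pose C := C1 + C2 + C3 + C4.
have l1 s : lipC M C (dkern (besJ k) s) by apply: lipC_le (h1 s); rewrite /C; lra.
have l2 s : lipC M C (dkern (besY k) s) by apply: lipC_le (h2 s); rewrite /C; lra.
have l3 s : lipC M C (kern r (besJ k) m s) by apply: lipC_le (h3 s); rewrite /C; lra.
have l4 s : lipC M C (kern r (besY k) m s) by apply: lipC_le (h4 s); rewrite /C; lra.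
have [Dp [e1 e2]] := clip_mode_rate n; have [Dp' [e1' e2']] := clip_cmode k M m n.
have re : Lre psi (fun t => cRe (mode_rate n t)) = Lre phi (fun t => cRe (cmode k n (ccrack m t))) /\
    Lim psi (fun t => cRe (mode_rate n t)) = Lim phi (fun t => cRe (cmode k n (ccrack m t))).
  apply: (mode_transfer k_gt0 r_gt0 M_gt0 (lipfun_Lre M_gt0 psi) (lipfun_Lim M_gt0 psi) (lipfun_Lre M_gt0 phi) (lipfun_Lim M_gt0 phi)
    l1 l2 l3 l4 c1 c2 c3 c4 hae (n := n) (tr := fun s => cos (n%:R * (s / r)))).
  - exact: cnt_cos_arc.
  - by move=> s; exact: cos_le1'.
  - by exists Dp.
  - by exists Dp'.
  - by move=> t It; exact: (dkern_mode n tJ It).1.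
  - by move=> t It; exact: (dkern_mode n tY It).1.
  - by move=> t It; exact: (kern_mode k_gt0 r_gt0 amax_gt0 eps_gt0 far n tJ Bm It).1.
  - by move=> t It; exact: (kern_mode k_gt0 r_gt0 amax_gt0 eps_gt0 far n tY Bm It).1.
have im : Lre psi (fun t => cIm (mode_rate n t)) = Lre phi (fun t => cIm (cmode k n (ccrack m t))) /\
    Lim psi (fun t => cIm (mode_rate n t)) = Lim phi (fun t => cIm (cmode k n (ccrack m t))).
  apply: (mode_transfer k_gt0 r_gt0 M_gt0 (lipfun_Lre M_gt0 psi) (lipfun_Lim M_gt0 psi) (lipfun_Lre M_gt0 phi) (lipfun_Lim M_gt0 phi)
    l1 l2 l3 l4 c1 c2 c3 c4 hae (n := n) (tr := fun s => sin (n%:R * (s / r)))).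
  - exact: cnt_sin_arc.
  - by move=> s; exact: sin_le1'.
  - by exists Dp.
  - by exists Dp'.
  - by move=> t It; exact: (dkern_mode n tJ It).2.
  - by move=> t It; exact: (dkern_mode n tY It).2.
  - by move=> t It; exact: (kern_mode k_gt0 r_gt0 amax_gt0 eps_gt0 far n tJ Bm It).2.
  - by move=> t It; exact: (kern_mode k_gt0 r_gt0 amax_gt0 eps_gt0 far n tY Bm It).2.
have cr := clip_mode_rate n; have cc := clip_cmode k M m n.
by split; split => //; [exact: re.1|exact: im.1|exact: re.2|exact: im.2].
Qed.

(** In the frame of the crack the phase of the wave changes at the rate - s m.2 q.1 + i eta (q.1 t +
    q.2). Rotating by the angle eta m.2 separates the two parts: the imaginary one gives L ((q.1 t +
    q.2) e^(s t)) = 0, the real one expresses L' on e^(s t) through L. *)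
Lemma rates_kill (L L' : (R -> R) -> R) : hfun M L -> hfun M L' -> enorm2 q = 1 ->
  (forall n, agree M L L' (mode_rate n) (fun t => cmode k n (ccrack m t))) ->
  (forall f, lip M f -> L f = 0) /\ (forall f, lip M f -> L' f = 0).
Proof.
move=> fL fL' q1 h; have hL := hfun_lipfun M_gt0 fL; have hL' := hfun_lipfun M_gt0 fL'.
have cs := cos2Dsin2 m.1.
have main s : L (fun t => (q.1 * t + q.2) * expR (s * t)) = 0 /\
    - (s * m.2 * q.1) * L (fun t => expR (s * t)) = L' (fun t => expR (s * t)).
  have [mu [mu0 es ee]] := wave_parameter s k_gt0; set eta := Num.sqrt _ in ee.
  have eta0 : 0 < eta by rewrite sqrtr_gt0 ltr_pwDr ?exprn_gt0// sqr_ge0.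
  have h' n : agree M L L' (mode_rate n) (fun t => cmode k n (z 0 t)) by rewrite z0E; exact: h.
  have [E1 E2] := wave_derivatives_agree hL hL' (rot_prod m.1 mu0) cder_z0 cder_zh_t cder_zh cder_mode h'.
  have ew t : cexp (wphase k (rotl mu m.1) (rotm mu m.1) (z 0 t)) =
      ((expR (s * t) * cos (eta * m.2)) +i* (expR (s * t) * sin (eta * m.2)))%C.
    rewrite wphase_rot es ee z0E; have [-> ->] := rot_crack m.1 m t.
    by rewrite subrr cos0 sin0 !mulr1 !mulr0 subr0 add0r.
  have ez t : wphase k (rotl mu m.1) (rotm mu m.1) (zh t) =
      ((- (s * m.2 * q.1)) +i* (eta * (q.1 * t + q.2)))%C.
    rewrite wphase_rot es ee /zh /=; set c := cos _ in cs *; set n := sin _ in cs *.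
    have n2 : n ^+ 2 = 1 - c ^+ 2 by rewrite -cs; ring.
    congr (_ +i* _)%C.
      have -> : s * ((- (t * n * q.1) - q.2 * n - m.2 * c * q.1) * c + (t * c * q.1 + q.2 * c - m.2 * n * q.1) * n) =
        - (s * m.2 * q.1) * (c ^+ 2 + n ^+ 2) by ring.
      by rewrite cs mulr1.
    have -> : eta * ((t * c * q.1 + q.2 * c - m.2 * n * q.1) * c - (- (t * n * q.1) - q.2 * n - m.2 * c * q.1) * n) =
        eta * (q.1 * t + q.2) * (c ^+ 2 + n ^+ 2) by ring.
    by rewrite cs mulr1.
  set C := cos (eta * m.2) in ew; set N := sin (eta * m.2) in ew.
  have CN : C ^+ 2 + N ^+ 2 = 1 by exact: cos2Dsin2.
  have lP : lip M (fun t => expR (s * t)).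
    by apply: (@lip_smooth _ _ _ (fun t => s * expR (s * t))) => t; [der; ring|cnt_auto].
  have lQ : lip M (fun t => (q.1 * t + q.2) * expR (s * t)).
    apply: (@lip_smooth _ _ _ (fun t => q.1 * expR (s * t) + (q.1 * t + q.2) * (s * expR (s * t)))) => t.
      by der; ring.
    by cnt_auto.
  have {}E1 : - (s * m.2 * q.1) * C * L (fun t => expR (s * t)) + - (eta * N) * L (fun t => (q.1 * t + q.2) * expR (s * t))
      = C * L' (fun t => expR (s * t)).
    rewrite -(lipfunZ hL')// -(lipfunZ hL (- (eta * N)))// -hL.1//; last exact: lipZ.
    apply: (etrans _ (etrans E1 _)); [congr L|congr L']; apply/funext => t; rewrite ew ?ez /=; ring.
  have {}E2 : - (s * m.2 * q.1) * N * L (fun t => expR (s * t)) + (eta * C) * L (fun t => (q.1 * t + q.2) * expR (s * t))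
      = N * L' (fun t => expR (s * t)).
    rewrite -(lipfunZ hL')// -(lipfunZ hL (eta * C))// -hL.1//; last exact: lipZ.
    apply: (etrans _ (etrans E2 _)); [congr L|congr L']; apply/funext => t; rewrite ew ?ez /=; ring.
  move: (L (fun t => expR (s * t))) (L (fun t => _ * _)) (L' _) E1 E2 => x y w E1 E2.
  split.
    apply: (mulfI (lt0r_neq0 eta0)); rewrite mulr0.
    have -> : eta * y = eta * y * (C ^+ 2 + N ^+ 2) by rewrite CN mulr1.
    have -> : eta * y * (C ^+ 2 + N ^+ 2) = C * (- (s * m.2 * q.1) * N * x + eta * C * y)
       - N * (- (s * m.2 * q.1) * C * x + - (eta * N) * y) by ring.
    by rewrite E1 E2; ring.
  have -> : - (s * m.2 * q.1) * x = - (s * m.2 * q.1) * x * (C ^+ 2 + N ^+ 2) by rewrite CN mulr1.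
  have -> : - (s * m.2 * q.1) * x * (C ^+ 2 + N ^+ 2) = C * (- (s * m.2 * q.1) * C * x + - (eta * N) * y)
     + N * (- (s * m.2 * q.1) * N * x + eta * C * y) by ring.
  by rewrite E1 E2 !mulrA -mulrDl -!expr2 CN mul1r.
have q0 : (q.1 != 0) || (q.2 != 0).
  rewrite -negb_and; apply/negP => /andP[/eqP z1 /eqP z2]; move: q1.
  by rewrite /enorm2 z1 z2 expr0n addr0 sqrtr0 => /eqP; rewrite eq_sym oner_eq0.
have kL : forall f, lip M f -> L f = 0.
  by apply: (affine_exp_kills M_gt0 hL (hfun_diffuse M_gt0 fL) q0) => s _; exact: (main s).1.
split=> //; apply: (exp_kills M_gt0 hL') => s _.
rewrite -(main s).2 kL ?mulr0//.
by apply: (@lip_smooth _ _ _ (fun t => s * expR (s * t))) => t; [der; ring|cnt_auto].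
Qed.

End moving_crack.

(** * Differentiability of the single layer in operator norm *)

Section pair_bounds.
Context {R : realType}.
Variable M : R.
Hypothesis M_gt0 : 0 < M.
Variable psi : Hmhalf M.

Lemma Hmhalf_norm_fin : exists2 n : R, 0 <= n & Hmhalf_norm psi = n%:E.
Proof.
have [C C0 hC] : exists2 C : R, 0 <= C & (Hmhalf_norm psi <= C%:E)%E.
  have [_ [C hC]] := set_mem (valP psi); exists `|C| => //.
  apply: ge_ereal_sup => _ [f f1 <-]; apply: le_trans (hC f) _.
  apply: (@le_trans _ _ (`|C|%:E * Hhalf_norm f)%E).
    by rewrite lee_wpmul2r ?poweR_ge0// lee_fin ler_norm.
  by rewrite -[leRHS]mule1 lee_wpmul2l// lee_fin.
have n0 : (0 <= Hmhalf_norm psi)%E.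
  have h0 : hin M (fun=> 0 : R) by apply: (lip_hin M_gt0); exact: lip_cst.
  have c0 : chin M (cR (fun=> 0 : R)) by apply: (chin_real M_gt0).
  have z0 : (chn2 M (cR (fun=> 0%R)) <= (1 ^+ 2)%:E)%E by rewrite (chn2_real M_gt0) (hn20 M_gt0) lee_fin expr1n.
  apply: (@le_trans _ _ (normc (pair psi (cR (fun=> 0))))%:E); first by rewrite lee_fin normc_ge0.
  apply: ereal_sup_ubound; exists (insubd 0 (cR (fun=> 0))) => //.
  exact: (Hhalf_norm_le c0 ler01 z0).
exists (fine (Hmhalf_norm psi)); first by rewrite fine_ge0.
by rewrite fineK// ge0_fin_numE//; exact: le_lt_trans hC (ltry _).
Qed.

(** i / 4 times u + i v, with u built from J_0 and v from Y_0. *)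
Definition kf (u v : R -> R -> R) s t : R[i] := (- (4^-1 * v s t) +i* (4^-1 * u s t))%C.

Variables (u v : R -> R -> R) (C : R).
Hypotheses (C_gt0 : 0 < C) (lu : forall s, lipC M C (u s)) (lv : forall s, lipC M C (v s)).

Let half (c : R) (f : R -> R) : `|c| = 4^-1 -> lipC M C f -> lipC M (C / 2) (fun t => c * f t).
Proof.
move=> c4 lf; apply: lipC_le (lipCZ c lf); rewrite c4 mulrC ler_wpM2l ?(ltW C_gt0)//.
by rewrite lef_pV2 ?posrE// ler_nat.
Qed.

Let lIm s : lipC M (C / 2) (fun t => cIm (kf u v s t)).
Proof. by apply: (half (c := 4^-1)) (lu s); rewrite ger0_norm// invr_ge0. Qed.

Let lRe s : lipC M (C / 2) (fun t => cRe (kf u v s t)).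
Proof.
apply: (@lipC_ext _ _ _ (fun t => - 4^-1 * v s t)); first by move=> t _; rewrite mulNr.
by apply: (half (c := - 4^-1)) (lv s); rewrite normrN ger0_norm// invr_ge0.
Qed.

Lemma chin_kf s : chin M (kf u v s).
Proof. by split; apply: (lip_hin M_gt0); exists (C / 2). Qed.

Lemma pair_kf_le s (n : R) : Hmhalf_norm psi = n%:E ->
  normc (pair psi (kf u v s)) <= C * Num.sqrt (2 * M + 4 * M ^+ 2) * n.
Proof.
(* [K] is the length of the crack interval plus the area of its square, the two volumes in
   [lipC_hn2]. *)
move=> en; set K := 2 * M + _; have K0 : 0 < K by rewrite addr_gt0 ?mulr_gt0 ?exprn_gt0.
have C2 : 0 <= C / 2 by rewrite divr_ge0 ?(ltW C_gt0).
have sK : 0 < C * Num.sqrt K by rewrite mulr_gt0 ?sqrtr_gt0.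
have h : (chn2 M (kf u v s) <= ((C * Num.sqrt K) ^+ 2)%:E)%E.
  apply: le_trans (leeD (lipC_hn2 M_gt0 (lRe s) C2) (lipC_hn2 M_gt0 (lIm s) C2)) _.
  have -> : (C * Num.sqrt K) ^+ 2 = C ^+ 2 * K by rewrite exprMn sqr_sqrtr ?(ltW K0).
  rewrite -EFinD lee_fin -/K.
  have : 0 <= C ^+ 2 * K by rewrite mulr_ge0 ?sqr_ge0 ?(ltW K0).
  rewrite expr_div_n; move: (C ^+ 2) => c ck; have -> : c / 2 ^+ 2 * K + c / 2 ^+ 2 * K = c * K / 2 by field.
  by move: (c * K) ck => x; lra.
by have := pair_le M_gt0 psi (chin_kf s) sK h; rewrite en -EFinM lee_fin.
Qed.

Hypotheses (cu : forall s t, - M < t < M -> cnt (u ^~ t) s) (cv : forall s t, - M < t < M -> cnt (v ^~ t) s).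

Lemma cmeasurable_kf (D : set (measurableTypeR R)) : cmeasurable D (fun s => pair psi (kf u v s)).
Proof.
have e s : cRe (pair psi (kf u v s)) = - 4^-1 * (Lim psi (u s) + Lre psi (v s)) /\
    cIm (pair psi (kf u v s)) = 4^-1 * (Lre psi (u s) - Lim psi (v s)).
  by apply: (pair_kernel M_gt0) => //; [exists C|exists C|exact: chin_kf].
have cm (f : R -> R) : (forall s, cnt f s) -> measurable_fun D f.
  by move=> cf; apply: measurable_funTS; apply: continuous_measurable_fun; exact: cf.
have c1 s : cnt (fun s => Lim psi (u s)) s by apply: (lipfun_cnt (lipfun_Lim M_gt0 psi) lu) => t It; exact: cu.
have c2 s : cnt (fun s => Lre psi (v s)) s by apply: (lipfun_cnt (lipfun_Lre M_gt0 psi) lv) => t It; exact: cv.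
have c3 s : cnt (fun s => Lre psi (u s)) s by apply: (lipfun_cnt (lipfun_Lre M_gt0 psi) lu) => t It; exact: cu.
have c4 s : cnt (fun s => Lim psi (v s)) s by apply: (lipfun_cnt (lipfun_Lim M_gt0 psi) lv) => t It; exact: cv.
split.
  rewrite (_ : (fun x => _) = fun s => - 4^-1 * (Lim psi (u s) + Lre psi (v s))).
    by apply: cm => s; apply: cntM; [exact: cnt_cst|exact: cntD].
  by apply/funext => s; rewrite (e s).1.
rewrite (_ : (fun x => _) = fun s => 4^-1 * (Lre psi (u s) + - Lim psi (v s))).
  by apply: cm => s; apply: cntM; [exact: cnt_cst|apply: cntD => //; exact: cntN].
by apply/funext => s; rewrite (e s).2.
Qed.

End pair_bounds.

Section circle_norms.
Context {R : realType}.
Variable r : R.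
Hypothesis r_gt0 : 0 < r.
Local Notation leb := (@lebesgue_measure R).
Local Notation J := ([set s : measurableTypeR R | 0 <= s < 2 * pi * r]).
Let T := 2 * pi * r.
Let T_gt0 : 0 < T. Proof. by rewrite !mulr_gt0// pi_gt0. Qed.
Implicit Types g f : R -> R[i].

Lemma J_itv : J = `[0, T[%classic.
Proof. by apply/seteqP; split => s; rewrite /= in_itv. Qed.

Lemma measurable_J : measurable J.
Proof. by rewrite J_itv; exact: measurable_itv. Qed.

Lemma leb_J : leb J = T%:E.
Proof.
rewrite J_itv; have := @lebesgue_measure_itv R `[0, T[; rewrite /= lte_fin T_gt0 oppr0 adde0.
exact.
Qed.

Lemma circle_norm_le g c : cmeasurable J g -> 0 <= c -> (forall s, J s -> normc (g s) <= c) ->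
  (L2norm leb J g <= (c * Num.sqrt T)%:E)%E.
Proof.
move=> mg c0 h.
have h1 : (\int[leb]_(s in J) (normc (g s) ^+ 2)%:E <= (c ^+ 2 * T)%:E)%E.
  rewrite EFinM -leb_J -(integral_cst leb measurable_J).
  apply: ge0_le_integral => //; first exact: measurable_J.
  - by move=> x _; rewrite lee_fin sqr_ge0.
  - by apply/measurable_EFinP; exact: (measurable_sqr_normc mg).
  - by move=> x Jx; rewrite lee_fin ler_sqr ?nnegrE ?normc_ge0// h.
rewrite /L2norm; apply: (@le_trans _ _ ((c ^+ 2 * T)%:E `^ 2^-1)%E).
  have i0 : (0 <= \int[leb]_(s in J) (normc (g s) ^+ 2)%:E)%E.
    by apply: integral_ge0 => x _; rewrite lee_fin sqr_ge0.
  have cT : 0 <= c ^+ 2 * T by exact: (mulr_ge0 (sqr_ge0 _) (ltW T_gt0)).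
  by apply: gt0_ler_poweR => //; rewrite in_itv/= leey andbT.
rewrite poweR_EFin lee_fin powR12_sqrt; last exact: (mulr_ge0 (sqr_ge0 _) (ltW T_gt0)).
by rewrite sqrtrM ?sqr_ge0// sqrtr_sqr ger0_norm.
Qed.

Lemma measurable_normc g : cmeasurable J g -> measurable_fun J (fun s => normc (g s)).
Proof.
move=> /measurable_sqr_normc mg.
have -> : (fun s => normc (g s)) = (fun x => Num.sqrt x) \o (fun s => normc (g s) ^+ 2).
  by apply/funext => s /=; rewrite sqrtr_sqr ger0_norm ?normc_ge0.
apply: measurableT_comp mg; apply: continuous_measurable_fun; exact: sqrt_continuous.
Qed.

Lemma isq_normc_le g c : 0 <= c -> (L2norm leb J g <= c%:E)%E ->
  (isq leb J (fun s => normc (g s)) <= (c ^+ 2)%:E)%E.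
Proof.
move=> c0 h; have i0 : (0 <= isq leb J (fun s => normc (g s)))%E by exact: isq_ge0.
rewrite -(sqre_root i0) expr2 EFinM -[X in (X <= _)%E]/(_ * _)%E.
by apply: lee_pmul => //; exact: poweR_ge0.
Qed.

(** For every e a single small h brings d h close to both f and g. The number [n], later the norm of
    the density, is allowed to be 0. *)
Lemma circle_limit_unique (n : R) (f g : R -> R[i]) (d : R -> R -> R[i]) : 0 <= n ->
  cmeasurable J f -> cmeasurable J g -> (\forall h \near 0^', cmeasurable J (d h)) ->
  (forall e, 0 < e -> \forall h \near 0^', (L2norm leb J (fun s => d h s - f s)%R <= (e * n)%:E)%E) ->
  (forall e, 0 < e -> \forall h \near 0^', (L2norm leb J (fun s => d h s - g s)%R <= (e * n)%:E)%E) ->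
  {ae leb, forall s, J s -> f s = g s}.
Proof.
move=> n0 mf mg md lf lg; have mJ := measurable_J.
have csub (a b : R -> R[i]) : cmeasurable J a -> cmeasurable J b -> cmeasurable J (fun s => a s - b s).
  move=> ma mb; have := cmeasurable_lin (-1) mb ma.
  by congr cmeasurable; apply/funext => s; rewrite mulN1r addrC.
have key (e : R) : 0 < e -> (isq leb J (fun s => normc (f s - g s)%R) <= (4 * (e * n) ^+ 2)%:E)%E.
  move=> e0.
  have : \forall h \near (0 : R)^', [/\ cmeasurable J (d h),
      (L2norm leb J (fun s => d h s - f s)%R <= (e * n)%:E)%E & (L2norm leb J (fun s => d h s - g s)%R <= (e * n)%:E)%E].
    by apply: filterS3 md (lf e e0) (lg e e0) => h; split.
  move=> H; have [h hh] := @filter_ex _ _ (Proper_dnbhs_numFieldType (0 : R)) _ H.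
  case: hh => mh h1 h2.
  have en0 : 0 <= e * n by rewrite mulr_ge0 ?(ltW e0).
  have m1 := measurable_normc (csub _ _ mh mf); have m2 := measurable_normc (csub _ _ mh mg).
  have m3 := measurable_normc (csub _ _ mf mg).
  apply: (@le_trans _ _ (isq leb J (fun s => normc (d h s - f s) + normc (d h s - g s))%R)).
    apply: isq_le => //; first exact: measurable_funD.
    move=> s _; rewrite !ger0_norm ?addr_ge0 ?normc_ge0//.
    have -> : f s - g s = - (d h s - f s) + (d h s - g s) by ring.
    by rewrite -[X in _ <= X + _]normcN; exact: le_normcD.
  apply: (@le_trans _ _ (2%:E * (isq leb J (fun s => normc (d h s - f s)%R) + isq leb J (fun s => normc (d h s - g s)%R)))%E).
    by apply: isqD_le.
  have i1 := isq_normc_le en0 h1; have i2 := isq_normc_le en0 h2.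
  have -> : (4 * (e * n) ^+ 2)%:E = (2%:E * ((e * n) ^+ 2 + (e * n) ^+ 2)%:E)%E.
    by rewrite -EFinM; congr EFin; ring.
  by rewrite lee_wpmul2l// EFinD; exact: leeD.
have z : isq leb J (fun s => normc (f s - g s)) = 0%E.
  apply/eqP; rewrite eq_le isq_ge0 andbT; apply/lee_addgt0Pr => w w0; rewrite add0e.
  have n1 : 0 < 2 * (n + 1) by rewrite mulr_gt0// ltr_wpDl.
  (* With this choice of e, 4 (e n)^2 is at most w. *)
  have e0 : 0 < Num.sqrt w / (2 * (n + 1)) by rewrite divr_gt0 ?sqrtr_gt0.
  apply: le_trans (key _ e0) _; rewrite lee_fin.
  have -> : 4 * (Num.sqrt w / (2 * (n + 1)) * n) ^+ 2 = (Num.sqrt w ^+ 2) * (n / (n + 1)) ^+ 2.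
    by field; rewrite gt_eqF// ltr_wpDl.
  rewrite sqr_sqrtr ?(ltW w0)// ler_piMr ?(ltW w0)// expr_le1 ?divr_ge0 ?addr_ge0//.
  by rewrite ler_pdivrMr ?mul1r ?lerDl// ltr_wpDl.
have mfg := measurable_sqr_normc (csub _ _ mf mg).
have [N [mN N0 hN]] : ae_eq leb J (fun s => (normc (f s - g s) ^+ 2)%:E) (cst 0%E).
  apply/ae_eq_integral_abs => //; first by apply/measurable_EFinP.
  rewrite -[RHS]z; apply: eq_integral => s _.
  by rewrite gee0_abs// lee_fin sqr_ge0.
exists N; split=> // s /= ns; apply: hN => /= h; apply: ns => Js.
have := h Js => -[]; rewrite sqr_normcE => /eqP.
rewrite paddr_eq0 ?sqr_ge0// !sqrf_eq0 => /andP[/eqP z1 /eqP z2].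
by apply/eqP; rewrite -subr_eq0; apply/eqP; exact: complex_ext.
Qed.

End circle_norms.

Section derivative_of_single_layer.
Context {R : realType}.
Variables (k r M amax eps : R).
Hypotheses (k_gt0 : 0 < k) (r_gt0 : 0 < r) (M_gt0 : 0 < M) (amax_gt0 : 0 < amax) (eps_gt0 : 0 < eps).
Hypothesis far : exists2 delta : R, 0 < delta &
       forall (m : R * R) (t : R) (x : R * R),
         Bprime amax eps m -> - M <= t <= M -> circle r x ->
         delta <= enorm2 (x - crack m t).
Variables m q : R * R.
Hypothesis Bm : Bprime amax eps m.
Local Notation leb := (@lebesgue_measure R).
Local Notation J := ([set s : measurableTypeR R | 0 <= s < 2 * pi * r]).
Let T := 2 * pi * r.
Let mh h := (m.1 + h * q.1, m.2 + h * q.2).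
Let tJ := besJ_tower k.
Let tY := besY_tower k.
Let S := sq r m.1 m.2 q.1 q.2.

Lemma kernE G h s : kern r G (mh h) s = fun t => G 0%N (S h s t).
Proof. by apply/funext => t; rewrite /S sqE. Qed.

Lemma mh0 : mh 0 = m.
Proof. by rewrite /mh !mul0r !addr0 -surjective_pairing. Qed.

Lemma single_layer_kf m' (psi : Hmhalf M) s : Bprime amax eps m' ->
  single_layer k m' psi (Defs.arc r s) = pair psi (kf (kern r (besJ k) m') (kern r (besY k) m') s).
Proof.
move=> Bm'.
have [[CJ _ hJ] _] := kern_facts r_gt0 amax_gt0 eps_gt0 far tJ Bm'.
have [[CY _ hY] _] := kern_facts r_gt0 amax_gt0 eps_gt0 far tY Bm'.
have [a1 a2] := single_layer_arc k_gt0 r_gt0 M_gt0 amax_gt0 eps_gt0 far psi s Bm'.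
have lJ : lip M (kern r (besJ k) m' s) by exists CJ.
have lY : lip M (kern r (besY k) m' s) by exists CY.
have ch : chin M (kf (kern r (besJ k) m') (kern r (besY k) m') s).
  split; apply: (lip_hin M_gt0); last exact: (lipZ 4^-1 lJ).
  have := lipZ (- 4^-1) lY; congr (lip M _); apply/funext => t; exact: mulNr.
have [b1 b2] := pair_kernel M_gt0 psi lJ lY ch (fun t _ => erefl).
by apply: complex_ext; rewrite ?a1 ?a2 ?b1 ?b2.
Qed.

Definition dsl (psi : Hmhalf M) s : R[i] := pair psi (kf (dkern r m q (besJ k)) (dkern r m q (besY k)) s).

Let rem G h s t := h^-1 * (G 0%N (S h s t) - G 0%N (S 0 s t) - h * dkern r m q G s t).

(** One e and one C serve both kernels. The remainder [rem] is already divided by h, so its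
    Lipschitz constant is of order |h|. *)
Lemma derivative_data : exists2 e, 0 < e & exists2 C, 0 < C & [/\
  forall h, `|h| <= e -> Bprime amax eps (mh h),
  forall G, G = besJ k \/ G = besY k ->
    [/\ forall h s, `|h| <= e -> lipC M C (fun t => G 0%N (S h s t)), forall s, lipC M C (dkern r m q G s) &
      forall h s, `|h| <= e -> h != 0 -> lipC M (C * `|h|) (rem G h s)],
  forall G, G = besJ k \/ G = besY k -> forall s t, - M < t < M -> cnt (fun s => dkern r m q G s t) s &
  forall G, G = besJ k \/ G = besY k -> forall h s t, `|h| <= e -> - M < t < M -> cnt (fun s => rem G h s t) s].
Proof.
have [e e0 [he [d d0 ge]]] := S_far r_gt0 amax_gt0 eps_gt0 far q Bm.
have [CJ J0 [J1 J2 J3]] := kernel_bounds tJ d0 (ltW e0) ge.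
have [CY Y0 [Y1 Y2 Y3]] := kernel_bounds tY d0 (ltW e0) ge.
exists e => //; exists (CJ + CY + 1); first by rewrite ltr_wpDl ?addr_ge0.
have remlip G C : C <= CJ + CY + 1 ->
    (forall h s, `|h| <= e -> lipC M (C * h ^+ 2) (fun t => G 0%N (S h s t) - G 0%N (S 0 s t) - h * dkern r m q G s t)) ->
    forall h s, `|h| <= e -> h != 0 -> lipC M ((CJ + CY + 1) * `|h|) (rem G h s).
  move=> hC hG h s h1 h0; apply: lipC_le (lipCZ h^-1 (hG h s h1)).
  have n0 : `|h| != 0 by rewrite normr_eq0.
  have -> : `|h^-1| * (C * h ^+ 2) = C * `|h| by rewrite normfV -real_normK ?num_real//; field.
  by rewrite ler_wpM2r.
split.
- exact: he.
- move=> G [->|->]; split.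
  + by move=> h s h1; apply: lipC_le (J1 h s h1); move: J0 Y0; lra.
  + by move=> s; apply: lipC_le (J2 s); move: J0 Y0; lra.
  + by apply: (remlip _ CJ) J3; move: J0 Y0; lra.
  + by move=> h s h1; apply: lipC_le (Y1 h s h1); move: J0 Y0; lra.
  + by move=> s; apply: lipC_le (Y2 s); move: J0 Y0; lra.
  + by apply: (remlip _ CY) Y3; move: J0 Y0; lra.
- by move=> G [->|->] s t It; [have [_] := dkern_facts r_gt0 amax_gt0 eps_gt0 far q Bm tJ|
    have [_] := dkern_facts r_gt0 amax_gt0 eps_gt0 far q Bm tY]; exact.
- move=> G hG h s t h1 It; have It' : - M <= t <= M by case/andP: It => *; rewrite !ltW.
  have n0 : `|0 : R| <= e by rewrite normr0 ltW.
  have tG : bessel_tower k G by case: hG => ->.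
  have [_ cd] := dkern_facts r_gt0 amax_gt0 eps_gt0 far q Bm tG.
  have c1 : cnt (fun s => G 0%N (S h s t)) s by apply: (cnt_kernel tG d0 ge h1 It').
  have c2 : cnt (fun s => G 0%N (S 0 s t)) s by apply: (cnt_kernel tG d0 ge n0 It').
  apply: cntM; first exact: cnt_cst.
  apply: cntD; first by apply: cntD => //; exact: cntN.
  by apply: cntN; apply: cntM; [exact: cnt_cst|exact: cd].
Qed.

Lemma dkern_arc G s s' : Defs.arc r s = Defs.arc r s' -> dkern r m q G s = dkern r m q G s'.
Proof.
have r0 : r != 0 by rewrite gt_eqF.
case=> /(mulfI r0) ec /(mulfI r0) es.
by apply/funext => t; rewrite /dkern /sq /sqh !cosB !sinB ec es.
Qed.

(** The parametrization [arc] is not injective, so an angle is chosen for each point of the circle;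
    by [dkern_arc] the choice does not matter. *)
Definition dsl_plane (psi : Hmhalf M) (x : R * R) : R[i] := dsl psi (xget 0 [set s | Defs.arc r s = x]).

Lemma dsl_planeE psi s : dsl_plane psi (Defs.arc r s) = dsl psi s.
Proof.
rewrite /dsl_plane; have := @xgetPex _ (0 : R) [set s' | Defs.arc r s' = Defs.arc r s].
move=> /(_ (ex_intro _ s erefl)) /= e.
by rewrite /dsl /kf (dkern_arc (besJ k) e) (dkern_arc (besY k) e).
Qed.

Lemma diff_quotient_kf (psi : Hmhalf M) h s : h != 0 ->
  (forall h', h' = h \/ h' = 0 -> Bprime amax eps (mh h')) ->
  chin M (kf (rem (besJ k) h) (rem (besY k) h) s) ->
  chin M (kf (dkern r m q (besJ k)) (dkern r m q (besY k)) s) ->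
  chin M (kf (kern r (besJ k) m) (kern r (besY k) m) s) ->
  diff_quotient (single_layer k) m q h psi (Defs.arc r s) - dsl psi s =
  pair psi (kf (rem (besJ k) h) (rem (besY k) h) s).
Proof.
move=> h0 hB c1 c2 c3; rewrite /diff_quotient.
have -> : m + h *: q = mh h by [].
have B0 : Bprime amax eps m by have := hB 0 (or_intror erefl); rewrite mh0.
rewrite (single_layer_kf psi s (hB h (or_introl erefl))) (single_layer_kf psi s B0).
have c4 : chin M (fun t => (h%:C)%C * kf (dkern r m q (besJ k)) (dkern r m q (besY k)) s t
    + kf (kern r (besJ k) m) (kern r (besY k) m) s t).
  split.
    have := hin_lin h c2.1 c3.1; congr (hin M _); apply/funext => t /=; ring.
  have := hin_lin h c2.2 c3.2; congr (hin M _); apply/funext => t /=; ring.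
have -> : kf (kern r (besJ k) (mh h)) (kern r (besY k) (mh h)) s =
    fun t => (h%:C)%C * kf (rem (besJ k) h) (rem (besY k) h) s t +
      ((h%:C)%C * kf (dkern r m q (besJ k)) (dkern r m q (besY k)) s t
    + kf (kern r (besJ k) m) (kern r (besY k) m) s t).
  have km G : kern r G m s = fun t => G 0%N (S 0 s t) by rewrite -kernE mh0.
  apply/funext => t; rewrite /kf !kernE !km /rem.
  move: (besJ k 0%N (S h s t)) (besJ k 0%N (S 0 s t)) (besY k 0%N (S h s t)) (besY k 0%N (S 0 s t)) => a b c d.
  move: (dkern r m q (besJ k) s t) (dkern r m q (besY k) s t) => x y.
  by apply: complex_ext => /=; field.
rewrite (pairE psi _ c1 c4) (pairE psi _ c2 c3) -/(dsl psi s).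
set P := pair psi _; set Q := pair psi _.
have hh : (h^-1)%:C%C * (h%:C)%C = 1 :> R[i] by rewrite -realCM mulVf.
have -> : (h^-1)%:C%C * (h%:C%C * P + (h%:C%C * dsl psi s + Q) - Q) - dsl psi s =
  ((h^-1)%:C%C * h%:C%C) * P + ((h^-1)%:C%C * h%:C%C) * dsl psi s - dsl psi s by ring.
by rewrite hh !mul1r addrK.
Qed.

(** The error of the difference quotient is psi paired with a kernel of Lipschitz constant C |h|,
    hence O(|h|) times the norm of psi, uniformly on the circle. *)
Lemma dsl_is_derivative : is_dir_derivative r (single_layer k) m q dsl_plane /\
  forall psi, cmeasurable J (dsl psi) /\ \forall h \near 0^', cmeasurable J
    (fun s => diff_quotient (single_layer k) m q h psi (Defs.arc r s)).
Proof.
have [e e0 [C C0 [hB hG cD cR]]] := derivative_data.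
have oJ : besJ k = besJ k \/ besJ k = besY k by left.
have oY : besY k = besJ k \/ besY k = besY k by right.
have [J1 J2 J3] := hG _ oJ; have [Y1 Y2 Y3] := hG _ oY.
have n0 : `|0 : R| <= e by rewrite normr0 ltW.
have md (psi : Hmhalf M) : cmeasurable J (dsl psi).
  by apply: (cmeasurable_kf M_gt0 psi C0 J2 Y2); [exact: cD|exact: cD].
have cd s : chin M (kf (dkern r m q (besJ k)) (dkern r m q (besY k)) s) by exact: (chin_kf M_gt0 C0 J2 Y2).
have ck s : chin M (kf (kern r (besJ k) m) (kern r (besY k) m) s).
  apply: (chin_kf M_gt0 C0) => s'; rewrite -mh0 kernE; [exact: J1|exact: Y1].
have Ch (h : R) : h != 0 -> 0 < C * `|h| by move=> h0; apply: mulr_gt0 => //; rewrite normr_gt0.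
have dq (psi : Hmhalf M) h s : h != 0 -> `|h| <= e ->
    diff_quotient (single_layer k) m q h psi (Defs.arc r s) - dsl psi s =
    pair psi (kf (rem (besJ k) h) (rem (besY k) h) s).
  move=> h0 h1; apply: diff_quotient_kf => //; last first.
    by apply: (chin_kf M_gt0 (Ch h h0)) => s'; [exact: J3|exact: Y3].
  by move=> h' [->|->]; apply: hB.
have mr (psi : Hmhalf M) h : h != 0 -> `|h| <= e ->
    cmeasurable J (fun s => pair psi (kf (rem (besJ k) h) (rem (besY k) h) s)).
  move=> h0 h1; apply: (cmeasurable_kf M_gt0 psi (Ch h h0)).
  - by move=> s; exact: J3.
  - by move=> s; exact: Y3.
  - by move=> s t; exact: cR.
  - by move=> s t; exact: cR.
have near0 (w : R) : 0 < w -> \forall h \near (0 : R)^', h != 0 /\ `|h| <= w.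
  move=> w0; have h1 : \forall h \near (0 : R)^', h != 0 by exact: nbhs_dnbhs_neq.
  have h2 : \forall h \near (0 : R)^', `|h| <= w by exact: dnbhs0_le.
  by apply: filterS (filterI h1 h2) => h [].
set K := Num.sqrt (2 * M + 4 * M ^+ 2).
have K0 : 0 <= K by exact: sqrtr_ge0.
split; last first.
  move=> psi; split; first exact: md.
  apply: filterS (near0 e e0) => h [h0 h1].
  have := cmeasurable_lin 1 (mr psi h h0 h1) (md psi); congr (cmeasurable J _).
  by apply/funext => s; rewrite mul1r -dq// subrK.
split.
  move=> psi; have [n N0 en] := Hmhalf_norm_fin M_gt0 psi.
  have eB : dsl_plane psi \o Defs.arc r = dsl psi by apply/funext => s /=; exact: dsl_planeE.
  rewrite /circle_inL2 eB; split; first exact: md.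
  apply: (@le_lt_trans _ _ (C * K * n * Num.sqrt T)%:E); last exact: ltry.
  apply: (circle_norm_le r_gt0 (md psi)); first by rewrite !mulr_ge0 ?(ltW C0).
  by move=> s _; exact: (pair_kf_le M_gt0 C0 J2 Y2 s en).
move=> w w0.
(* For |h| <= d the error bound is at most w times the norm of psi; the summands 1 keep the
   denominator positive. *)
pose d := w / (C * (K + 1) * (Num.sqrt T + 1)).
have d0 : 0 < d.
  by rewrite divr_gt0// !mulr_gt0// ltr_wpDl// sqrtr_ge0.
have de : 0 < Num.min d e by rewrite lt_min d0.
apply: filterS (near0 _ de) => h [h0]; rewrite le_min => /andP[hd h1] psi.
have [n N0 en] := Hmhalf_norm_fin M_gt0 psi.
have eB : (diff_quotient (single_layer k) m q h psi \- dsl_plane psi)%R \o Defs.arc r =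
    fun s => pair psi (kf (rem (besJ k) h) (rem (besY k) h) s).
  by apply/funext => s /=; rewrite dsl_planeE dq.
rewrite /circle_L2norm eB en -EFinM.
apply: (@le_trans _ _ (C * `|h| * K * n * Num.sqrt T)%:E).
  apply: (circle_norm_le r_gt0 (mr psi h h0 h1)); first by rewrite !mulr_ge0 ?(ltW C0).
  by move=> s _; apply: (pair_kf_le M_gt0 (Ch h h0)) => // s'; [exact: J3|exact: Y3].
rewrite lee_fin.
have -> : C * `|h| * K * n * Num.sqrt T = `|h| * (C * K * Num.sqrt T) * n by ring.
rewrite ler_wpM2r//; apply: (@le_trans _ _ (d * (C * (K + 1) * (Num.sqrt T + 1)))).
  apply: ler_pM => //; first by rewrite !mulr_ge0 ?(ltW C0) ?sqrtr_ge0.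
  rewrite -!mulrA ler_wpM2l ?(ltW C0)//; by apply: ler_pM; rewrite ?lerDl ?sqrtr_ge0.
rewrite /d divfK// gt_eqF// !mulr_gt0// ltr_wpDl// sqrtr_ge0.
Qed.

(** Existence turns the choice in [dir_derivative] into a true derivative, and uniqueness of L^2
    limits identifies it almost everywhere with the explicit one. *)
Lemma dir_derivative_ae (psi : Hmhalf M) :
  {ae leb, forall s, J s -> dir_derivative r (single_layer k) m q psi (Defs.arc r s) = dsl psi s}.
Proof.
have [hd ms] := dsl_is_derivative; have [md mq] := ms psi.
have hD : is_dir_derivative r (single_layer k) m q (dir_derivative r (@single_layer R k M) m q).
  exact: (@xgetPex _ (fun _ _ => 0) [set B | is_dir_derivative r (@single_layer R k M) m q B] (ex_intro _ _ hd)).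
have [n N0 en] := Hmhalf_norm_fin M_gt0 psi.
apply: (@circle_limit_unique _ r n _ _ (fun h s => diff_quotient (single_layer k) m q h psi (Defs.arc r s)) N0).
- exact: (hD.1 psi).1.
- exact: md.
- exact: mq.
- move=> e e0; apply: filterS (hD.2 e e0) => h /(_ psi).
  by rewrite en -EFinM.
- move=> e e0; apply: filterS (hd.2 e e0) => h /(_ psi); rewrite en -EFinM.
  have eB : (diff_quotient (single_layer k) m q h psi \- dsl_plane psi)%R \o Defs.arc r =
      fun s => diff_quotient (single_layer k) m q h psi (Defs.arc r s) - dsl psi s.
    by apply/funext => s /=; rewrite dsl_planeE.
  by rewrite /circle_L2norm eB.
Qed.

Lemma derivative_uniqueness (psi phi : Hmhalf M) : enorm2 q = 1 ->
  circle_eqL2 r (dir_derivative r (single_layer k) m q psi) (single_layer k m phi) ->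
  psi = 0 /\ phi = 0.
Proof.
move=> q1 h.
have [e e0 [C C0 [hB hG cD cR]]] := derivative_data.
have oJ : besJ k = besJ k \/ besJ k = besY k by left.
have oY : besY k = besJ k \/ besY k = besY k by right.
have [J1 J2 J3] := hG _ oJ; have [Y1 Y2 Y3] := hG _ oY.
have hae : {ae leb, forall s, 0 <= s < 2 * pi * r ->
    Lim psi (dkern r m q (besJ k) s) + Lre psi (dkern r m q (besY k) s) = Lim phi (kern r (besJ k) m s) + Lre phi (kern r (besY k) m s) /\
    Lre psi (dkern r m q (besJ k) s) - Lim psi (dkern r m q (besY k) s) = Lre phi (kern r (besJ k) m s) - Lim phi (kern r (besY k) m s)}.
  have [N1 [mN1 N10 h1]] := h; have [N2 [mN2 N20 h2]] := dir_derivative_ae psi.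
  exists (N1 `|` N2); split; [exact: measurableU|exact: null_set_setU|].
  move=> s /= ns; apply: contrapT => /not_orP[n1 n2]; apply: ns => Js.
  have e1 : dir_derivative r (single_layer k) m q psi (Defs.arc r s) = single_layer k m phi (Defs.arc r s).
    by apply: contrapT => c; apply: n1; apply: h1 => /= /(_ Js).
  have e2 : dir_derivative r (single_layer k) m q psi (Defs.arc r s) = dsl psi s.
    by apply: contrapT => c; apply: n2; apply: h2 => /= /(_ Js).
  have [a1 a2] := single_layer_arc k_gt0 r_gt0 M_gt0 amax_gt0 eps_gt0 far phi s Bm.
  have lJ : lip M (dkern r m q (besJ k) s) by exists C.
  have lY : lip M (dkern r m q (besY k) s) by exists C.
  have [b1 b2] := pair_kernel M_gt0 psi lJ lY (chin_kf M_gt0 C0 J2 Y2 s) (fun t _ => erefl).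
  rewrite -/(dsl psi s) -e2 e1 in b1 b2.
  have q4 : 4^-1 != 0 :> R by rewrite invr_eq0 pnatr_eq0.
  have nq4 : - 4^-1 != 0 :> R by rewrite oppr_eq0.
  by split; [apply: (mulfI nq4)|apply: (mulfI q4)]; rewrite -?a1 -?a2 -?b1 -?b2.
have ag n := agree_rates k_gt0 r_gt0 M_gt0 amax_gt0 eps_gt0 far Bm hae n.
have [R1 R2] := rates_kill k_gt0 M_gt0 (hfun_Re M_gt0 psi) (hfun_Re M_gt0 phi) q1 (fun n => (ag n).1).
have [I1 I2] := rates_kill k_gt0 M_gt0 (hfun_Im M_gt0 psi) (hfun_Im M_gt0 phi) q1 (fun n => (ag n).2).
by split; apply: (Hmhalf_lip_eq0 M_gt0).
Qed.

End derivative_of_single_layer.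

Theorem proposition5 (R : realType) (k r M amax eps : R)
    (k_gt0 : 0 < k) (r_gt0 : 0 < r) (M_gt0 : 0 < M) (amax_gt0 : 0 < amax)
    (eps_gt0 : 0 < eps)
    (theta_range : eps - (- (pi / 2) - eps) < pi)
    (far : exists2 delta : R, 0 < delta &
       forall (m : R * R) (t : R) (x : R * R),
         Bprime amax eps m -> - M <= t <= M -> circle r x ->
         delta <= enorm2 (x - crack m t)) :
  (forall (psi phi : Hmhalf M) (m m' : R * R),
     Bprime amax eps m -> Bprime amax eps m' ->
     psi <> 0 ->
     circle_eqL2 r (single_layer k m psi) (single_layer k m' phi) ->
     m = m' /\ psi = phi)
  /\
  (forall (m q : R * R) (psi phi : Hmhalf M),
     Bprime amax eps m -> enorm2 q = 1 ->
     circle_eqL2 r (dir_derivative r (single_layer k) m q psi)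
                   (single_layer k m phi) ->
     psi = 0 /\ phi = 0).
Proof.
split.
  move=> psi phi m m' Bm Bm'.
  exact: (single_layer_uniqueness k_gt0 r_gt0 M_gt0 amax_gt0 eps_gt0 theta_range far Bm Bm').
move=> m q psi phi Bm.
exact: (derivative_uniqueness k_gt0 r_gt0 M_gt0 amax_gt0 eps_gt0 far Bm).
Qed.
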